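(* Let $0<a\le 5.7$ be the signal-to-noise ratio of the Gaussian channel. Then $E(R,a)=E_0(R,a)$ for all $R_1\le R\le R_{\mathrm{crit}}$.
   Context: Natural logarithms. Codes are finite sets $C$ of points on the unit sphere $S^{n-1}\subset\mathbb R^n$ (suitably scaled to the power constraint), used on the additive white Gaussian noise channel with signal-to-noise ratio $a$ under maximum-likelihood decoding; the rate is $R=\frac1n\ln|C|$ and $P_e(C,a)$ is the average error probability. The reliability function is $E(R,a)=\limsup_{n\to\infty}\frac1n\ln\max_{C:\,R(C)=R}\frac1{P_e(C,a)}$. Define $R_x=\frac12\ln\big(\frac12+\frac12\sqrt{1+a^2/4}\big)$, $\theta_x=\cos^{-1}\sqrt{1-e^{-2R_x}}$, $R_{\mathrm{crit}}=\frac12\ln\big(\frac12+\frac a4+\frac12\sqrt{1+a^2/4}\big)$, $E_0(R,a)=\frac a4(1-\cos\theta_x)+R_x-R$, $\psi(x)=-\frac{1-\sin x}{2\sin x}\ln\frac{1-\sin x}{1+\sin x}-\ln\frac{2\sin x}{1+\sin x}$, and $R_1=\psi(\theta_x)$. *)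

(* Defs.v *)
From HB Require Import structures.
From mathcomp Require Import all_boot all_order all_algebra.
From mathcomp Require Import all_classical all_reals all_analysis.
From mathcomp Require Import normal_distribution.
Set Implicit Arguments. Unset Strict Implicit. Unset Printing Implicit Defensive.
Import Order.TTheory GRing.Theory Num.Theory.
Local Open Scope ring_scope.

Section Gaussian_channel.
Context {R : realType}.

Definition norm2 {n} (v : 'rV[R]_n) : R := \sum_(i < n) v 0 i ^+ 2.

(* Expectation of f(Z) for Z a standard Gaussian vector in R^n
   (i.i.d. N(0,1) coordinates), written as an iterated integral
   against the one-dimensional standard normal law. *)
Fixpoint gauss_expect (n : nat) : ('rV[R]_n -> \bar R) -> \bar R :=
  match n with
  | 0 => fun f => f 0
  | n'.+1 => fun f =>
      (\int[normal_prob (0:R) 1]_x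
         gauss_expect (fun v : 'rV[R]_n' => f (row_mx (\row_(j < 1) x) v)))%E
  end.

Definition is_code {n} (C : seq 'rV[R]_n) : bool :=
  uniq C && all (fun c => norm2 c == 1) C.

(* Transmission of codeword c is the point sqrt(n a) c (power constraint:
   average energy a per coordinate, unit noise variance, SNR = a).
   Under ML (= minimum distance) decoding, an error occurs iff some other
   codeword is at least as close to the received vector y = sqrt(n a) c + Z. *)
Definition err_prob_cw {n} (a : R) (C : seq 'rV[R]_n) (c : 'rV[R]_n) : R :=
  let s := Num.sqrt (n%:R * a) in
  fine (gauss_expect (fun z : 'rV[R]_n =>
     ((has (fun c' => (c' != c) &&
        (norm2 (s *: c + z - s *: c') <= norm2 z)) C)%:R : R)%:E)).

Definition Pe {n} (a : R) (C : seq 'rV[R]_n) : R :=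
  (size C)%:R^-1 * \sum_(c <- C) err_prob_cw a C c.

Definition exponent_of {n} (a : R) (C : seq 'rV[R]_n) : \bar R :=
  if Pe a C == 0 then +oo%E else ((- ln (Pe a C)) / n%:R)%:E.

Definition best_exponent (Rt a : R) (n : nat) : \bar R :=
  ereal_sup [set exponent_of a C | C in
    [set C : seq 'rV[R]_n | is_code C /\ expR (n%:R * Rt) <= (size C)%:R]].

Definition reliability (Rt a : R) : \bar R :=
  limn_esup (best_exponent Rt a).

Definition R_x (a : R) : R :=
  2^-1 * ln (2^-1 + 2^-1 * Num.sqrt (1 + a ^+ 2 / 4)).
Definition theta_x (a : R) : R :=
  acos (Num.sqrt (1 - expR (- (2 * R_x a)))).
Definition R_crit (a : R) : R :=
  2^-1 * ln (2^-1 + a / 4 + 2^-1 * Num.sqrt (1 + a ^+ 2 / 4)).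
Definition E0 (Rt a : R) : R :=
  a / 4 * (1 - cos (theta_x a)) + R_x a - Rt.
Definition psi (x : R) : R :=
  - ((1 - sin x) / (2 * sin x)) * ln ((1 - sin x) / (1 + sin x))
  - ln (2 * sin x / (1 + sin x)).
Definition R_1 (a : R) : R := psi (theta_x a).

End Gaussian_channel.

(* Main.v *)
(** Put b = a/4, s = cos theta_x and p(c, c') = 1 - <c, c'>; then s = b (1 - s^2) and
    e^{-2 R_x} = 1 - s^2, and two codewords are confused with probability e^{-n b p (1 + o(1))}.

    Achievability.  By the union bound it suffices that the sums of e^{n b <c, c'>} over c' are
    at most |C| e^{n (b s - R_x + eps)}.  This exponent is the average over the sphere (a saddle
    point computation for a Gaussian vector conditioned on its norm), so codewords can be chosen
    greedily.

    Converse.  A linear programming bound with the polynomial (t - s') h(t)^2, where h is a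
    combination of consecutive Gegenbauer polynomials of degree about n (1 - sin theta_x) /
    (2 sin theta_x), shows that every subset A of at least e^{n R_1} points satisfies
    sum_{c <> c'} e^{-n b p} >= |A|^2 e^{-n (b (1 - s) + R_x + eps)}.  A halving argument yields
    a subset and an exponent E <= E_0 + eps such that sum_{c'} e^{-n b p(c, c')} <= e^{-n E} for
    every c, with near equality on average, the pairs at a single distance p carrying the average;
    they are the edges of a graph.  Let (c, c') be a random edge and let y be the midpoint of the
    two signals plus noise.  Given c and y, the posterior entropy kappa of c' controls the
    probability that a decoder sees some neighbour nearer than c.  If c' is recovered with
    probability bounded below, the error exponent is at most E.  Otherwise a Kullback-Leibler
    comparison forces a second posterior sample c'' to be at distance at least about p from c',
    and the entropy-mean square error inequality gives E + kappa <= b p + ln (1 - b p) / 2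
    <= E_0 (R_crit), while p > 1 - s contradicts the linear estimation bound on the error. *)
Require Import Defs.
From HB Require Import structures.
From mathcomp Require Import all_boot all_order all_algebra.
From mathcomp Require Import ring lra.
Set Implicit Arguments. Unset Strict Implicit. Unset Printing Implicit Defensive.
Import Order.TTheory GRing.Theory Num.Theory.
Local Open Scope ring_scope.

(** The obstacle in the converse is that the error events of different neighbours of c overlap, so
    their probabilities cannot be added. Each event is therefore multiplied by the posterior weight
    of its neighbour; the weights sum to one at every observation, and what remains is the
    probability that a posterior sample hits the true neighbour. This is why entropy enters. The two
    ends of the rate interval have separate origins. The saddle equation gives b (1 - s) = s / (1 +
    s), so b p + ln (1 - b p) / 2 at p = 1 - s equals b (1 - s) - ln (1 + s) / 2, which is at most
    E_0 (R) exactly when R <= R_crit. R_1 is the growth rate of the dimension of the spherical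
    harmonics of the degree whose Gegenbauer polynomials stop oscillating at s; for smaller sets the
    diagonal terms swallow the linear programming bound. Expectations are real numbers attached to
    functions of exponential growth, a class in which Gaussian vectors can be shifted and rotated
    freely. *)

Module Zonal.
From mathcomp.multinomials Require Import mpoly.

(** * Zonal harmonics and positive definiteness *)

Lemma lap_rad2_ring (A : comNzRingType) (X p p' r p'' : A) :
  (1 *+ 2) * p + (X *+ 2) * p' + ((X *+ 2) * p' + r * p'') = p *+ 2 + X * p' *+ 4 + r * p''.
Proof. by rewrite !mulr2n; ring. Qed.

Lemma eul_ring (A : comNzRingType) (L P1 P0 c r : A) i :
  L * P1 + L * (P1 *+ i.+1) - c * (r *+ 2 * P0 + r * (P0 *+ i)) = (L * P1 - c * (r * P0)) *+ i.+2.
Proof. by rewrite !mulrS !mulr0n mulrnBl !mulrnAr; ring. Qed.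

Lemma d_zon_ring0 (A : comNzRingType) (L c r : A) :
  1 * L + L * 1 - c * (L *+ 2 + r * 0) = (1 + 1 - (c + c)) * L.
Proof. by rewrite mulr2n; ring. Qed.

Lemma d_zon_ring (A : comNzRingType) (L Z0 Z1 Z2 c c1 g g1 r : A) :
  g * c1 = c * g1 + 2%:R * c * c1 -> L * Z1 = Z2 + c1 * (r * Z0) ->
  1 * Z2 + L * (g * Z1) - c * (L *+ 2 * Z1 + r * (g1 * Z0)) = (1 + g - 2%:R * c) * Z2.
Proof.
move=> h1 h2.
have -> : 1 * Z2 + L * (g * Z1) - c * (L *+ 2 * Z1 + r * (g1 * Z0)) = Z2 + (g - 2%:R * c) * (L * Z1) - c * g1 * (r * Z0).
  by rewrite mulr2n; ring.
rewrite h2; have -> : Z2 + (g - 2%:R * c) * (Z2 + c1 * (r * Z0)) - c * g1 * (r * Z0) = (1 + g - 2%:R * c) * Z2 + (g * c1 - (c * g1 + 2%:R * c * c1)) * (r * Z0) by ring.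
by rewrite h1; ring.
Qed.

Section zonal.
Variables (R : realFieldType) (N : nat).
Hypothesis N3 : (2 < N)%N.
Local Notation M := {mpoly R[N]}.
Implicit Types (p q : M) (x y : 'rV[R]_N).

(** With lambda = N/2 - 1 this is i (i + 2 lambda - 1) / (4 (i + lambda) (i + lambda - 1)), the
    coefficient in the three-term recurrence of the monic ultraspherical polynomials. *)
Definition gegc (i : nat) : R :=
  i%:R * (i%:R + N%:R - 3) / ((2 * i%:R + N%:R - 2) * (2 * i%:R + N%:R - 4)).

(* [geg i] is the monic Gegenbauer polynomial of degree i for the sphere of R^N; the pair
   carries degrees i and i - 1, with 0 in degree -1. *)
Fixpoint geg_pair (i : nat) : {poly R} * {poly R} :=
  if i is i'.+1 then let: (P, P') := geg_pair i' in ('X * P - gegc i' *: P', P) else (1, 0).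
Definition geg i := (geg_pair i).1.

Definition lin x : M := \sum_j x 0 j *: 'X_j.
Definition rad2 : M := \sum_j 'X_j ^+ 2.
Definition D x p : M := \sum_j x 0 j *: p^`M(j).
Definition Lap p : M := \sum_j p^`M(j)^`M(j).
Definition Eul p : M := \sum_j 'X_j * p^`M(j).

(* [zon x i] evaluates at w to |w|^i geg_i(<x, w> / |w|): the zonal harmonic with pole x. *)
Fixpoint zon_pair x (i : nat) : M * M :=
  if i is i'.+1 then let: (P, P') := zon_pair x i' in (lin x * P - gegc i' *: (rad2 * P'), P) else (1, 0).
Definition zon x i := (zon_pair x i).1.

Definition ip x y : R := \sum_j x 0 j * y 0 j.

Lemma gegS i : geg i.+2 = 'X * geg i.+1 - gegc i.+1 *: geg i.
Proof. by rewrite /geg /=; case: (geg_pair i). Qed.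

Lemma zonS x i : zon x i.+2 = lin x * zon x i.+1 - gegc i.+1 *: (rad2 * zon x i).
Proof. by rewrite /zon /=; case: (zon_pair x i). Qed.

Lemma geg0 : geg 0 = 1. Proof. by []. Qed.
Lemma geg1 : geg 1 = 'X. Proof. by rewrite /geg /= mulr1 scaler0 subr0. Qed.
Lemma zon0 x : zon x 0 = 1. Proof. by []. Qed.
Lemma zon1 x : zon x 1 = lin x. Proof. by rewrite /zon /= mulr1 mulr0 scaler0 subr0. Qed.

Lemma two_step_ind (P : nat -> Prop) : P 0 -> P 1 -> (forall i, P i -> P i.+1 -> P i.+2) -> forall i, P i.
Proof.
move=> h0 h1 hS i; suff: P i /\ P i.+1 by case.
by elim: i => [|i [ih1 ih2]]; split=> //; exact: hS.
Qed.

Lemma mderivXj i j : ('X_i : M)^`M(j) = (i == j)%:R.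
Proof.
rewrite mderivX mnm1E; case: eqP => [->|_]; last by rewrite scale0r.
rewrite scale1r; suff -> : (U_(j) - U_(j) = 0)%MM by rewrite mpolyX0.
by apply/mnmP => k; rewrite mnmBE subnn mnm0E.
Qed.

Lemma DM x p q : D x (p * q) = D x p * q + p * D x q.
Proof.
rewrite /D mulr_suml mulr_sumr -big_split; apply: eq_bigr => j _ /=.
by rewrite mderivM scalerDr -scalerAl -scalerAr.
Qed.

Lemma DB x p q : D x (p - q) = D x p - D x q.
Proof. by rewrite /D -sumrB; apply: eq_bigr => j _; rewrite mderivB scalerBr. Qed.

Lemma DZ x c p : D x (c *: p) = c *: D x p.
Proof. by rewrite /D scaler_sumr; apply: eq_bigr => j _; rewrite mderivZ !scalerA mulrC. Qed.

Lemma EulM p q : Eul (p * q) = Eul p * q + p * Eul q.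
Proof.
rewrite /Eul mulr_suml mulr_sumr -big_split; apply: eq_bigr => j _ /=.
by rewrite mderivM; ring.
Qed.

Lemma EulB p q : Eul (p - q) = Eul p - Eul q.
Proof. by rewrite /Eul -sumrB; apply: eq_bigr => j _; rewrite mderivB mulrBr. Qed.

Lemma EulZ c p : Eul (c *: p) = c *: Eul p.
Proof. by rewrite /Eul scaler_sumr; apply: eq_bigr => j _; rewrite mderivZ scalerAr. Qed.

Lemma deriv_lin x j : (lin x)^`M(j) = (x 0 j)%:MP.
Proof.
rewrite /lin raddf_sum (bigD1 j)//= mderivZ mderivXj eqxx big1 ?addr0.
  by rewrite -mul_mpolyC mulr1.
by move=> k /negbTE kj; rewrite mderivZ mderivXj kj scaler0.
Qed.

Lemma deriv_rad2 j : rad2^`M(j) = 'X_j *+ 2.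
Proof.
rewrite /rad2 raddf_sum (bigD1 j)//= expr2 mderivM mderivXj eqxx mul1r mulr1 big1 ?addr0//.
by move=> k /negbTE kj; rewrite expr2 mderivM mderivXj kj mul0r mulr0 addr0.
Qed.

Lemma D_lin x y : D x (lin y) = (ip x y)%:MP.
Proof.
rewrite /D /ip raddf_sum; apply: eq_bigr => j _; rewrite deriv_lin -mul_mpolyC -mpolyCM //.
Qed.

Lemma D_rad2 x : D x rad2 = lin x *+ 2.
Proof. by rewrite /D /lin -sumrMnl; apply: eq_bigr => j _; rewrite deriv_rad2 scalerMnr. Qed.

Lemma Eul_lin x : Eul (lin x) = lin x.
Proof. by apply: eq_bigr => j _; rewrite deriv_lin mulrC mul_mpolyC. Qed.

Lemma Eul_rad2 : Eul rad2 = rad2 *+ 2.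
Proof. by rewrite /Eul /rad2 -sumrMnl; apply: eq_bigr => j _; rewrite deriv_rad2 mulrnAr -expr2. Qed.

Lemma Lap_lin x p : Lap (lin x * p) = D x p *+ 2 + lin x * Lap p.
Proof.
rewrite /Lap /D -sumrMnl mulr_sumr -big_split; apply: eq_bigr => j _ /=.
rewrite mderivM deriv_lin mderivD !mderivM deriv_lin mderivC mul0r add0r !mul_mpolyC.
by ring.
Qed.

Lemma Lap_rad2 p : Lap (rad2 * p) = p *+ (2 * N) + Eul p *+ 4 + rad2 * Lap p.
Proof.
have -> : p *+ (2 * N) = \sum_(j < N) p *+ 2.
  by rewrite sumr_const card_ord -mulrnA.
rewrite /Lap /Eul -sumrMnl mulr_sumr -!big_split; apply: eq_bigr => j _ /=.
rewrite mderivM deriv_rad2 mderivD !mderivM deriv_rad2 mderivMn mderivXj eqxx.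
exact: lap_rad2_ring.
Qed.

Lemma LapB p q : Lap (p - q) = Lap p - Lap q.
Proof. by rewrite /Lap -sumrB; apply: eq_bigr => j _; rewrite !mderivB. Qed.

Lemma LapZ c p : Lap (c *: p) = c *: Lap p.
Proof. by rewrite /Lap scaler_sumr; apply: eq_bigr => j _; rewrite !mderivZ. Qed.

Lemma Eul_zon x i : Eul (zon x i) = zon x i *+ i.
Proof.
elim/two_step_ind: i => [||i ih1 ih2].
- by rewrite zon0 mulr0n /Eul big1// => j _; rewrite -mpolyC1 mderivC mulr0.
- by rewrite zon1 Eul_lin.
- rewrite zonS EulB EulZ !EulM Eul_lin Eul_rad2 ih1 ih2 -!mul_mpolyC.
  exact: eul_ring.
Qed.

(** The factor by which differentiation along the pole lowers a zonal harmonic. Its value is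
    dictated by harmonicity: applying [Lap] to the recurrence leaves 2 [D x (zon x i.+1)] minus
    [gegc i.+1] (2 N + 4 i) times [zon x i], which has to vanish. *)
Definition gegg i : R := gegc i * (N%:R + 2 * i%:R - 2).

Lemma gegg1 : gegg 1 = 1.
Proof.
have N2 : (2 : R) < N%:R by rewrite (ltr_nat R 2).
by rewrite /gegg /gegc; field; lra.
Qed.

Lemma geggS i : gegg i.+2 = 1 + gegg i.+1 - 2 * gegc i.+1.
Proof.
have N2 : (2 : R) < N%:R by rewrite (ltr_nat R 2).
have i0 : (0 : R) <= i%:R by rewrite ler0n.
by rewrite /gegg /gegc -!natr1; field; lra.
Qed.

Lemma gegg_comm i : (gegg i.+2 - 2 * gegc i.+2) * gegc i.+1 = gegc i.+2 * gegg i.+1.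
Proof.
have N2 : (2 : R) < N%:R by rewrite (ltr_nat R 2).
have i0 : (0 : R) <= i%:R by rewrite ler0n.
by rewrite /gegg /gegc -!natr1; field; lra.
Qed.

(** Differentiating the recurrence produces a multiple of [lin x * zon x i.+1], which the recurrence
    re-expands; the multiples of [rad2 * zon x i] then cancel by [gegg_comm], and [geggS] collects
    the rest. *)
Lemma D_zon x i : ip x x = 1 -> D x (zon x i.+1) = gegg i.+1 *: zon x i.
Proof.
move=> x1; elim/two_step_ind: i => [||i ih1 ih2].
- by rewrite zon1 zon0 D_lin x1 gegg1 scale1r.
- rewrite zonS zon1 zon0 DB DZ !DM !D_lin x1 mulr1 D_rad2 geggS gegg1 -!mul_mpolyC.
  rewrite -mpolyC1 [D x _]big1 => [|j _]; last by rewrite mderivC scaler0.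
  rewrite mulr_natl mulr2n mpolyCB !mpolyCD !mpolyC1.
  exact: d_zon_ring0.
- rewrite zonS DB DZ !DM D_lin x1 D_rad2 ih1 ih2.
  rewrite (geggS i.+1) -!mul_mpolyC.
  have h : (gegg i.+2)%:MP * (gegc i.+1)%:MP = (gegc i.+2 * gegg i.+1)%:MP + (2 * gegc i.+2 * gegc i.+1)%:MP :> M.
    by rewrite -mpolyCM -mpolyCD -gegg_comm; congr (_ %:MP); ring.
  have hz : lin x * zon x i.+1 = zon x i.+2 + (gegc i.+1)%:MP * (rad2 * zon x i).
    by rewrite zonS mul_mpolyC subrK.
  have e1 (a b : R) : (1 + a - 2 * b)%:MP = 1 + a%:MP - 2%:R * b%:MP :> M.
    by rewrite mpolyCB mpolyCD mpolyCM mpolyC_nat mpolyC1.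
  have e2 (a b c : R) : (a * b + 2 * a * c)%:MP = a%:MP * b%:MP + 2%:R * a%:MP * c%:MP :> M.
    by rewrite mpolyCD !mpolyCM mpolyC_nat.
  move: h; rewrite -mpolyCD e2 => h; rewrite e1.
  exact: (d_zon_ring h hz).
Qed.

Lemma Lap_zon x i : ip x x = 1 -> Lap (zon x i) = 0.
Proof.
move=> x1; elim/two_step_ind: i => [||i ih1 ih2].
- by rewrite zon0 /Lap big1// => j _; rewrite -mpolyC1 !mderivC.
- by rewrite zon1 /Lap big1// => j _; rewrite deriv_lin mderivC.
- rewrite zonS LapB LapZ Lap_lin Lap_rad2 ih1 ih2 !mulr0 !addr0 D_zon// Eul_zon.
  rewrite /gegg -!mulrnA -!scaler_nat -scalerDl !scalerA -scalerBl.
  suff -> : 2 * (gegc i.+1 * (N%:R + 2 * i.+1%:R - 2)) - gegc i.+1 * ((2 * N)%:R + (i * 4)%:R) = 0 by rewrite scale0r.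
  by rewrite -(natr1 i) !natrM; ring.
Qed.

Definition pt x : 'I_N -> R := fun j => x 0 j.

Lemma meval_lin x y : (lin x).@[pt y] = ip x y.
Proof.
rewrite /lin raddf_sum; apply: eq_bigr => j _ /=.
by rewrite mevalZ mevalXU.
Qed.

Lemma meval_rad2 y : rad2.@[pt y] = ip y y.
Proof.
rewrite /rad2 raddf_sum; apply: eq_bigr => j _ /=.
by rewrite expr2 mevalM mevalXU.
Qed.

Lemma meval_zon x y i : ip y y = 1 -> (zon x i).@[pt y] = (geg i).[ip x y].
Proof.
move=> y1; elim/two_step_ind: i => [||i ih1 ih2].
- by rewrite zon0 geg0 hornerE -mpolyC1 mevalC.
- by rewrite zon1 geg1 hornerX meval_lin.
- by rewrite zonS gegS !hornerE mevalB mevalZ !mevalM meval_lin meval_rad2 y1 mul1r ih1 ih2.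
Qed.

(* The apolar product, for which multiplication by 'X_j is adjoint to differentiation. *)
Definition mfac (m : 'X_{1..N}) : R := \prod_j (m j)`!%:R.
Definition ap p q : R := \sum_(m <- msupp p) mfac m * p@_m * q@_m.

Lemma apE s p q : uniq s -> {subset msupp p <= s} -> ap p q = \sum_(m <- s) mfac m * p@_m * q@_m.
Proof.
move=> us ps; rewrite /ap [RHS](bigID (fun m => m \in msupp p)) /= [X in _ + X]big1 ?addr0; last first.
  by move=> m /memN_msupp_eq0 ->; rewrite mulr0 mul0r.
rewrite -[RHS]big_filter; apply: perm_big; apply: uniq_perm; rewrite ?msupp_uniq ?filter_uniq//.
by move=> m; rewrite mem_filter; case: (boolP (m \in msupp p)) => // /ps ->.
Qed.

Lemma apC p q : ap p q = ap q p.
Proof.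
pose s := undup (msupp p ++ msupp q).
rewrite (@apE s p)/s ?undup_uniq//; last by move=> m mp; rewrite mem_undup mem_cat mp.
rewrite (@apE s q)/s ?undup_uniq//; last by move=> m mp; rewrite mem_undup mem_cat mp orbT.
by apply: eq_bigr => m _; rewrite mulrAC.
Qed.

Lemma apDr p q q' : ap p (q + q') = ap p q + ap p q'.
Proof. by rewrite /ap -big_split; apply: eq_bigr => m _; rewrite mcoeffD mulrDr. Qed.
Lemma apZr p c q : ap p (c *: q) = c * ap p q.
Proof. by rewrite /ap mulr_sumr; apply: eq_bigr => m _; rewrite mcoeffZ mulrCA. Qed.
Lemma ap0r p : ap p 0 = 0.
Proof. by rewrite -(scale0r 0) apZr mul0r. Qed.
Lemma ap_sumr p (I : Type) (s : seq I) (P : pred I) (F : I -> M) :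
  ap p (\sum_(i <- s | P i) F i) = \sum_(i <- s | P i) ap p (F i).
Proof. by apply: (big_morph (ap p)) => [q q'|]; [exact: apDr|exact: ap0r]. Qed.
Lemma ap_suml q (I : Type) (s : seq I) (P : pred I) (F : I -> M) :
  ap (\sum_(i <- s | P i) F i) q = \sum_(i <- s | P i) ap (F i) q.
Proof. by rewrite apC ap_sumr; apply: eq_bigr => i _; rewrite apC. Qed.
Lemma apDl p p' q : ap (p + p') q = ap p q + ap p' q.
Proof. by rewrite ![ap _ q]apC apDr. Qed.
Lemma apZl p c q : ap (c *: p) q = c * ap p q.
Proof. by rewrite ![ap _ q]apC apZr. Qed.

Lemma ap_ge0 p : 0 <= ap p p.
Proof.
apply: sumr_ge0 => m _; rewrite -mulrA -expr2 mulr_ge0 ?sqr_ge0//.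
by apply: prodr_ge0 => j _; rewrite ler0n.
Qed.

Lemma ap_X j p q : ap ('X_j * p) q = ap p q^`M(j).
Proof.
rewrite /ap mulrC (perm_big _ (msuppMX p U_(j))) big_map; apply: eq_bigr => m _.
rewrite mcoeffMX mcoeff_deriv addmC.
have -> : mfac (m + U_(j)) = mfac m * (m j).+1%:R.
  rewrite /mfac (bigD1 j)//= [X in _ = X * _](bigD1 j)//= mnmDE mnm1E eqxx addn1 factS natrM.
  rewrite -[LHS]mulrA mulrC; congr (_ * _ * _); apply: eq_bigr => k kj.
  by rewrite mnmDE mnm1E eq_sym (negbTE kj) addn0.
by rewrite -mulr_natl; ring.
Qed.

Lemma ap_lin x p q : ap (lin x * p) q = ap p (D x q).
Proof.
rewrite /lin mulr_suml ap_suml /D ap_sumr; apply: eq_bigr => j _.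
by rewrite -scalerAl apZl apZr ap_X.
Qed.

Lemma ap_rad2 p q : ap (rad2 * p) q = ap p (Lap q).
Proof.
rewrite /rad2 mulr_suml ap_suml /Lap ap_sumr; apply: eq_bigr => j _.
by rewrite expr2 -mulrA !ap_X.
Qed.

Lemma Lap_D x q : Lap (D x q) = D x (Lap q).
Proof.
have D_comm k p : (D x p)^`M(k) = D x p^`M(k).
  by rewrite /D raddf_sum; apply: eq_bigr => j _ /=; rewrite mderivZ mderiv_comm.
rewrite /Lap; under eq_bigr do rewrite !D_comm.
rewrite /D exchange_big; apply: eq_bigr => j _ /=.
by rewrite -scaler_sumr; congr (_ *: _); rewrite [RHS]raddf_sum.
Qed.

(** Against a harmonic q only the leading power of [lin x] in [zon x i] counts, because
    multiplication by [rad2] is adjoint to [Lap]. *)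
Lemma ap_zon x i q : Lap q = 0 -> ap (zon x i) q = ap 1 (iter i (D x) q).
Proof.
elim/two_step_ind: i q => [||i ih1 ih2] q q0.
- by rewrite zon0.
- by rewrite zon1 -[lin x]mulr1 ap_lin.
- rewrite zonS apDl -scaleNr apZl ap_rad2 q0 ap0r mulr0 addr0 ap_lin ih2 ?iterSr//.
  by rewrite Lap_D q0 /D big1// => j _; rewrite mderiv0 scaler0.
Qed.

Lemma ap1 q : ap 1 q = q@_0.
Proof.
rewrite /ap -mpolyX0 msuppX big_seq1 mcoeffX eqxx mulr1 /mfac big1 ?mul1r// => j _.
by rewrite mnm0E.
Qed.

Lemma meval_Eul x q : (Eul q).@[pt x] = (D x q).@[pt x].
Proof.
rewrite /Eul /D !raddf_sum; apply: eq_bigr => j _ /=.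
by rewrite mevalM mevalZ mevalXU.
Qed.

Lemma Eul_sum (F : 'I_N -> M) : Eul (\sum_j F j) = \sum_j Eul (F j).
Proof.
rewrite /Eul exchange_big /=; apply: eq_bigr => k _.
by rewrite -mulr_sumr; congr (_ * _); rewrite raddf_sum.
Qed.

Lemma Eul_deriv q j k : Eul q = q *+ k.+1 -> Eul q^`M(j) = q^`M(j) *+ k.
Proof.
move=> h; have hj := congr1 (fun p => p^`M(j)) h; rewrite /= mderivMn mulrS in hj.
apply: (@addrI _ q^`M(j)); rewrite -hj /Eul raddf_sum.
rewrite -[X in X + _](_ : \sum_l (l == j)%:R * q^`M(l) = _); last first.
  by rewrite (bigD1 j)//= eqxx mul1r big1 ?addr0// => l /negbTE ->; rewrite mul0r.
by rewrite -big_split; apply: eq_bigr => l _ /=; rewrite mderivM mderivXj mderiv_comm.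
Qed.

Lemma Eul_D x q k : Eul q = q *+ k.+1 -> Eul (D x q) = D x q *+ k.
Proof.
move=> h; rewrite /D Eul_sum -sumrMnl; apply: eq_bigr => j _.
by rewrite EulZ (Eul_deriv j h) scalerMnr.
Qed.

Lemma mcoeff_Eul q m : (Eul q)@_m = q@_m *+ mdeg m.
Proof.
rewrite /Eul raddf_sum mdegE -sumrMnr; apply: eq_bigr => j _ /=.
rewrite mulrC; case: (posnP (m j)) => [m0|m0].
  rewrite m0 mulr0n; apply: memN_msupp_eq0; rewrite (perm_mem (msuppMX _ _)).
  apply/mapP => -[m' _ mE]; move: m0; rewrite mE mnmDE mnm1E eqxx //.
have mE : m = (U_(j) + (m - U_(j)))%MM.
  apply/mnmP => k; rewrite mnmDE mnmBE mnm1E; case: eqP => [<-|_]; last by rewrite subn0.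
  by rewrite subnKC.
rewrite {1}mE mcoeffMX mcoeff_deriv addmC -mE mnmBE mnm1E eqxx subn1 prednK//.
Qed.

Lemma Eul0_const x q : Eul q = 0 -> q@_0 = q.@[pt x].
Proof.
move=> h; suff -> : q = (q@_0)%:MP by rewrite mevalC mcoeffC eqxx mulr1.
apply/mpolyP => m; rewrite mcoeffC; have [->|m0] := eqVneq m 0%MM; first by rewrite mulr1.
rewrite mulr0; have := mcoeff_Eul q m; rewrite h mcoeff0 => /esym/eqP.
by rewrite mulrn_eq0 mdeg_eq0 (negbTE m0) => /eqP.
Qed.

(** At the point x the derivative along x coincides with the Euler operator, so a homogeneous q of
    degree i collects the factors i, i - 1, ..., 1. *)
Lemma iter_D_eval x q i : Eul q = q *+ i -> (iter i (D x) q)@_0 = i`!%:R * q.@[pt x].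
Proof.
elim: i q => [|i ih] q h; first by rewrite /= fact0 mul1r (Eul0_const x).
rewrite iterSr ih; last exact: Eul_D.
by rewrite -meval_Eul h mevalMn factS natrM -mulr_natl; ring.
Qed.

Lemma ap_zon_zon x y i : ip x x = 1 -> ip y y = 1 ->
  ap (zon x i) (zon y i) = i`!%:R * (geg i).[ip y x].
Proof.
move=> x1 y1; rewrite ap_zon ?Lap_zon// ap1 iter_D_eval ?Eul_zon//.
by rewrite meval_zon.
Qed.

(** Schoenberg's positive definiteness: up to the factor i! the double sum is the apolar square of
    the sum of the zonal harmonics with poles [x c], by the reproducing property [ap_zon_zon]. *)
Lemma geg_posdef (T : finType) (A : {set T}) (x : T -> 'rV[R]_N) i :
  (forall c, ip (x c) (x c) = 1) ->
  0 <= \sum_(c in A) \sum_(c' in A) (geg i).[ip (x c) (x c')].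
Proof.
move=> x1; have f0 : (0 : R) < i`!%:R by rewrite ltr0n fact_gt0.
rewrite -(pmulr_rge0 _ f0) exchange_big /= mulr_sumr.
under eq_bigr do rewrite mulr_sumr.
have -> : \sum_(c' in A) \sum_(c in A) i`!%:R * (geg i).[ip (x c) (x c')] = 
    ap (\sum_(c in A) zon (x c) i) (\sum_(c in A) zon (x c) i).
  rewrite ap_suml; apply: eq_bigr => c _; rewrite ap_sumr; apply: eq_bigr => c' _.
  by rewrite ap_zon_zon.
exact: ap_ge0.
Qed.

End zonal.

End Zonal.

From mathcomp Require Import all_classical all_reals all_analysis.
From mathcomp Require Import measurable_realfun normal_distribution.
Import numFieldNormedType.Exports.
Local Open Scope classical_set_scope.
Local Open Scope ring_scope.

(** * The one-dimensional normal law *)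

Section density.
Local Open Scope ereal_scope.
Context d (T : measurableType d) (R : realType).
Variables (mu nu : {measure set T -> \bar R}) (g : T -> R).
Hypothesis mg : measurable_fun setT g.
Hypothesis g0 : forall x, (0 <= g x)%R.
Hypothesis nuE : forall A, measurable A -> nu A = \int[mu]_(x in A) (g x)%:E.
Import HBNNSimple.

Lemma integral_density (f : T -> \bar R) :
  measurable_fun setT f -> (forall x, 0 <= f x) ->
  \int[nu]_x f x = \int[mu]_x (f x * (g x)%:E).
Proof.
move=> mf f0.
have mgE : measurable_fun setT (EFin \o g) by apply/measurable_EFinP.
have gE0 x : 0 <= (EFin \o g) x by rewrite lee_fin.
pose f_ := nnsfun_approx measurableT mf.
transitivity (limn (fun n => \int[nu]_x (f_ n x)%:E)).
  rewrite -monotone_convergence//=.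
  - apply: eq_integral => x _; apply/esym/cvg_lim => //=.
    exact: cvg_nnsfun_approx.
  - by move=> n; exact/measurable_EFinP/measurable_funTS.
  - by move=> n ? _; rewrite lee_fin.
  - by move=> ? _ ? ? mn; rewrite lee_fin; exact/lefP/nd_nnsfun_approx.
transitivity (limn (fun n => \int[mu]_x ((f_ n x)%:E * (g x)%:E))); last first.
  rewrite -monotone_convergence//=.
  - apply: eq_integral => x _; apply/cvg_lim => //=.
    apply: cvgeZr => //; exact: cvg_nnsfun_approx.
  - move=> n; apply: emeasurable_funM => //.
    exact/measurable_EFinP/measurable_funTS.
  - by move=> n x _; rewrite mule_ge0// lee_fin.
  - move=> x _ m n mn; rewrite lee_wpmul2r ?lee_fin//.
    exact/lefP/nd_nnsfun_approx.
apply: congr_lim; apply/funext => n /=.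
under [LHS]eq_integral do rewrite fimfunE -fsumEFin//.
rewrite [LHS]ge0_integral_fsum//; last 2 first.
  - by move=> r; exact/measurable_EFinP/measurableT_comp.
  - by move=> m x _; rewrite EFinM nnfun_muleindic_ge0.
under [RHS]eq_integral.
  move=> x xD; rewrite fimfunE -fsumEFin// ge0_mule_fsuml; last first.
    by move=> r; rewrite EFinM; exact: nnfun_muleindic_ge0.
  over.
rewrite [RHS]ge0_integral_fsum//; last 2 first.
  - move=> r; apply: emeasurable_funM => //.
    exact/measurable_EFinP/measurableT_comp.
  - move=> m x _; apply: mule_ge0; last by rewrite lee_fin.
    by rewrite EFinM; exact: nnfun_muleindic_ge0.
apply: eq_fsbigr => r _.
rewrite integralZl_indic_nnsfun//= integral_indic// setIT nuE; last first.
  exact: measurable_sfunP.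
have [r0|r0] := leP 0%R r; last first.
  rewrite preimage_nnfun0// integral_set0 mule0.
  rewrite integral0_eq// => x _; rewrite indicE in_set0 mulr0 mul0e//.
under [RHS]eq_integral do rewrite EFinM -muleA.
rewrite ge0_integralZl//; last 2 first.
- by apply: emeasurable_funM => //; exact/measurable_EFinP/measurable_indic.
- by move=> x _; rewrite mule_ge0// lee_fin.
congr (_ * _); rewrite integral_mkcond/=; apply: eq_integral => x _.
rewrite patchE indicE; case: ifPn => xr; first by rewrite mul1e.
by rewrite mul0e.
Qed.

End density.

Section normal1d.
Context {R : realType}.
Local Open Scope ereal_scope.
Notation mu := (@lebesgue_measure R).
Notation N01 := (normal_prob (0:R) 1).

Lemma integral_normal_prob (f : R -> \bar R) :
  measurable_fun setT f -> (forall x, 0 <= f x) ->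
  \int[N01]_x f x = \int[mu]_x (f x * (normal_pdf 0 1 x)%:E).
Proof.
move=> mf f0; apply: (@integral_density _ _ _ mu N01 (normal_pdf 0 1)) => //.
- exact: measurable_normal_pdf.
- by move=> x; exact: normal_pdf_ge0.
Qed.

Lemma integral_affine (al be : R) (f : R -> \bar R) : (0 < al)%R ->
  measurable_fun setT f -> (forall x, 0 <= f x) ->
  \int[mu]_x f x = al%:E * \int[mu]_x f (al * x + be)%R.
Proof.
move=> al0 mf f0.
pose phi : measurableTypeR R -> measurableTypeR R := fun x => (al * x + be)%R.
have mphi : measurable_fun setT phi.
  by apply: measurable_funD => //; apply: measurable_funM.
have h A : measurable A -> mu A = mscale (NngNum (ltW al0)) (pushforward mu phi) A.
  apply: lebesgue_measure_unique => //= _ [[a b]] _ <-.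
  rewrite /mscale/=.
  have -> : pushforward mu phi `]a, b]%classic = mu `]((a - be) / al)%R, ((b - be) / al)%R]%classic.
    congr (mu _); apply/seteqP; split => x/=; rewrite /phi !in_itv/=.
      by rewrite ltr_pdivrMr// ler_pdivlMr// ltrBlDr lerBrDr (mulrC x).
    by rewrite ltr_pdivrMr// ler_pdivlMr// ltrBlDr lerBrDr (mulrC x).
  rewrite !lebesgue_measure_itv/= !lte_fin ltr_pM2r ?invr_gt0// ltrD2r.
  case: ifPn => ab; last by rewrite mule0.
  rewrite -!EFinD -EFinM -mulrBl mulrCA mulfV ?gt_eqF// mulr1; congr (_%:E).
  by rewrite opprB addrA subrK.
rewrite (@eq_measure_integral _ _ _ _ (mscale (NngNum (ltW al0)) (pushforward mu phi))); last first.
  by move=> A mA _; exact: h.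
rewrite ge0_integral_mscale//=; congr (_ * _).
by rewrite ge0_integral_pushforward//= => x _; exact: f0.
Qed.

Lemma normal_pdf01 (x : R) : normal_pdf 0 1 x = (normal_peak 1 * expR (- x ^+ 2 / 2))%R.
Proof.
by rewrite normal_pdfE ?oner_neq0// /normal_fun subr0 expr1n.
Qed.

Lemma normal_shift (a : R) (f : R -> \bar R) :
  measurable_fun setT f -> (forall x, 0 <= f x) ->
  \int[N01]_x f (x + a)%R = \int[N01]_x (f x * (expR (a * x - a ^+ 2 / 2))%:E).
Proof.
move=> mf f0.
have mfa : measurable_fun setT (fun x : R => f (x + a)%R).
  by apply: measurableT_comp => //; exact: measurable_funD.
have me : measurable_fun setT (fun x : R => (expR (a * x - a ^+ 2 / 2))%:E).
  apply/measurable_EFinP/measurableT_comp => //; apply: measurable_funD => //.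
have mp m s : measurable_fun setT (fun x : R => (normal_pdf m s x)%:E).
  by apply/measurable_EFinP; exact: measurable_normal_pdf.
rewrite integral_normal_prob// integral_normal_prob//; last 2 first.
- exact: emeasurable_funM.
- by move=> x; rewrite mule_ge0// lee_fin expR_ge0.
rewrite [RHS](@integral_affine 1 a)//; last 2 first.
- by do 2 apply: emeasurable_funM => //.
- by move=> x; rewrite !mule_ge0// lee_fin ?expR_ge0 ?normal_pdf_ge0.
rewrite mul1e; apply: eq_integral => x _; rewrite mul1r -muleA -EFinM.
congr (_ * _%:E); rewrite !normal_pdf01 mulrCA -expRD; congr (_ * expR _)%R.
by field.
Qed.

(** Completing the square; scaling by the square root of 1 - v turns the integrand back into a
    normal density. *)
Lemma normal_quad (v h : R) : (v < 1)%R ->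
  \int[N01]_x (expR (h * x + v * x ^+ 2 / 2))%:E = (expR (h ^+ 2 / (2 * (1 - v))) * (Num.sqrt (1 - v))^-1)%:E.
Proof.
move=> v1; pose al := Num.sqrt (1 - v).
have al0 : (0 < al)%R by rewrite sqrtr_gt0 subr_gt0.
have alE : (al ^+ 2 = 1 - v)%R by rewrite sqr_sqrtr// subr_ge0 ltW.
have me : measurable_fun setT (fun x : R => (expR (h * x + v * x ^+ 2 / 2))%:E).
  apply/measurable_EFinP/measurableT_comp => //; apply: measurable_funD; first exact: measurable_funM.
  by apply: measurable_funM => //; apply: measurable_funM => //; exact: measurable_funX.
rewrite integral_normal_prob//.
have i1 := @integral_normal_pdf R 0 1.
rewrite (@integral_affine al (- (h / al))) in i1 => //; last 2 first.
- by apply/measurable_EFinP; exact: measurable_normal_pdf.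
- by move=> x; rewrite lee_fin normal_pdf_ge0.
under eq_integral.
  move=> x _; rewrite -EFinM normal_pdf01 mulrCA -expRD.
  rewrite (_ : (h * x + v * x ^+ 2 / 2 + - x ^+ 2 / 2)%R = h ^+ 2 / (2 * (1 - v)) + - (al * x + - (h / al)) ^+ 2 / 2)%R; last first.
    rewrite -alE sqrrD sqrrN exprMn expr_div_n alE.
    have -> : (al * x * - (h / al) = - (x * h))%R by field; rewrite gt_eqF.
    by rewrite mulr2n; field; rewrite subr_eq0 gt_eqF.
  rewrite expRD mulrCA -normal_pdf01 EFinM; over.
rewrite /= ge0_integralZl//=; last 2 first.
- apply/measurable_EFinP; apply: measurableT_comp; first exact: measurable_normal_pdf.
  by apply: measurable_funD => //; exact: measurable_funM.
- by move=> x _; rewrite lee_fin normal_pdf_ge0.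
move: i1; set I := \int[mu]_x _ => i1.
have I0 : 0 <= I by apply: integral_ge0 => x _; rewrite lee_fin normal_pdf_ge0.
case: I I0 i1 => [r| |] r0 i1 //; last by move: i1; rewrite mulry gtr0_sg// mul1e.
move: i1; rewrite -EFinM => -[i1]; rewrite -EFinM; congr ((_ * _)%R%:E).
by apply: (mulfI (lt0r_neq0 al0)); rewrite i1 mulfV// lt0r_neq0.
Qed.

(** No rotation of the plane is used. Substituting in the inner integral and exchanging the order
    leaves a normal density in the other variable, since x^2 + ((y - be x) / al)^2 is symmetric in x
    and y when al^2 + be^2 = 1. *)
Lemma normal_rot (al be : R) (f : R -> \bar R) : (0 < al)%R -> (al ^+ 2 + be ^+ 2 = 1)%R ->
  measurable_fun setT f -> (forall x, 0 <= f x) ->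
  \int[N01]_x \int[N01]_y f (al * y + be * x)%R = \int[N01]_x f x.
Proof.
move=> al0 ab1 mf f0.
have mp m s : measurable_fun setT (fun x : R => (normal_pdf m s x)%:E).
  by apply/measurable_EFinP; exact: measurable_normal_pdf.
have maff (c d : R) : measurable_fun setT (fun x : R => (c * x + d)%R).
  by apply: measurable_funD => //; apply: measurable_funM.
pose h (z : R * R) : \bar R :=
  f z.2 * (normal_pdf 0 1 z.1 * normal_pdf 0 1 (al^-1 * z.2 + (- be * z.1 / al)) / al)%:E.
have mlin : measurable_fun setT (fun z : R * R =>
   (al^-1 * z.2 + (- be * z.1 / al))%R).
  apply: measurable_funD; first by apply: measurable_funM => //; exact: measurable_snd.
  apply: measurable_funM => //; apply: measurable_funM => //; exact: measurable_fst.
have mh : measurable_fun setT h.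
  apply: emeasurable_funM; first by apply: measurableT_comp => //; exact: measurable_snd.
  apply/measurable_EFinP; apply: measurable_funM => //; apply: measurable_funM.
    apply: measurableT_comp; [exact: measurable_normal_pdf|exact: measurable_fst].
  by apply: measurableT_comp => //; exact: measurable_normal_pdf.
have h0 z : 0 <= h z.
  by rewrite /h mule_ge0// lee_fin divr_ge0 ?mulr_ge0 ?normal_pdf_ge0// ltW.
have mfx (x : R) : measurable_fun setT (fun y : R => f (al * y + be * x)%R).
  by apply: (@measurableT_comp _ _ _ _ _ _ f) => //; exact: maff.
have mF : measurable_fun setT (fun x : R => \int[N01]_y f (al * y + be * x)%R).
  apply: (@measurable_fun_fubini_tonelli_F _ _ _ _ _ N01
    (fun z : R * R => f (al * z.2 + be * z.1)%R)) => //.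
  apply: (@measurableT_comp _ _ _ _ _ _ f) => //.
  apply: measurable_funD; apply: measurable_funM => //.
transitivity (\int[mu]_x \int[mu]_y h (x, y)).
  rewrite integral_normal_prob//; last by move=> x; apply: integral_ge0.
  apply: eq_integral => x _.
  rewrite integral_normal_prob//.
  rewrite [RHS](@integral_affine al (be * x))//; last first.
    by apply: measurableT_comp => //; exact: measurable_pair1.
  have mhx : measurable_fun setT (fun y : R => h (x, (al * y + be * x)%R)).
    apply: (@measurableT_comp _ _ _ _ _ _ h) => //.
    by apply: measurable_fun_pair => //; exact: maff.
  rewrite muleC -[in RHS]ge0_integralZl//; last by rewrite lee_fin ltW.
  rewrite -ge0_integralZl//; last 3 first.
  - by apply: emeasurable_funM; [exact: mfx|exact: mp].
  - by move=> y _; rewrite mule_ge0// lee_fin normal_pdf_ge0.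
  - by rewrite lee_fin normal_pdf_ge0.
  apply: eq_integral => y _; rewrite /h/= muleCA [RHS]muleCA; congr (_ * _).
  rewrite -!EFinM; congr (_%:E).
  rewrite (_ : (al^-1 * (al * y + be * x) + - be * x / al)%R = y); last first.
    by field; rewrite gt_eqF.
  by field; rewrite gt_eqF.
rewrite fubini_tonelli// integral_normal_prob//; apply: eq_integral => y _.
have mlin2 : measurable_fun setT (fun x : R => (normal_pdf 0 1 (al^-1 * y + - be * x / al))%R).
  apply: measurableT_comp; first exact: measurable_normal_pdf.
  apply: measurable_funD => //; apply: measurable_funM => //; exact: measurable_funM.
rewrite /h/= ge0_integralZl//; last 2 first.
- apply/measurable_EFinP; apply: measurable_funM => //; apply: measurable_funM => //.
  exact: measurable_normal_pdf.
- by move=> x _; rewrite lee_fin divr_ge0 ?mulr_ge0 ?normal_pdf_ge0// ltW.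
congr (_ * _).
have hI := @integral_normal_pdf R 0 1.
rewrite (@integral_affine al^-1 (- be * y / al)) in hI => //; last 2 first.
- by rewrite invr_gt0.
- by move=> x; rewrite lee_fin normal_pdf_ge0.
have mlin3 : measurable_fun setT (fun x : R => (normal_pdf 0 1 (al^-1 * x + - be * y / al))%:E).
  apply/measurable_EFinP; apply: measurableT_comp; first exact: measurable_normal_pdf.
  exact: maff.
rewrite -[RHS]mule1 -hI -ge0_integralZl//; last 2 first.
- by move=> x _; rewrite lee_fin normal_pdf_ge0.
- by rewrite lee_fin invr_ge0 ltW.
rewrite -ge0_integralZl//; last 3 first.
- exact: emeasurable_funM.
- by move=> x _; rewrite mule_ge0// lee_fin ?normal_pdf_ge0// invr_ge0 ltW.
- by rewrite lee_fin normal_pdf_ge0.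
apply: eq_integral => x _; rewrite -!EFinM; congr (_%:E).
rewrite !normal_pdf01.
set P := normal_peak 1.
transitivity (P * P / al * expR (- x ^+ 2 / 2 + - (al^-1 * y + - be * x / al) ^+ 2 / 2))%R.
  by rewrite expRD; ring.
transitivity (P * P / al * expR (- y ^+ 2 / 2 + - (al^-1 * x + - be * y / al) ^+ 2 / 2))%R; last first.
  by rewrite expRD; ring.
congr (_ * expR _)%R.
have al2 : (al ^+ 2 != 0)%R by rewrite expf_neq0// gt_eqF.
have b2 : (be ^+ 2 = 1 - al ^+ 2)%R by rewrite -ab1 addrAC subrr add0r.
have e u w : ((al^-1 * u + - be * w / al) ^+ 2 = (u ^+ 2 - 2 * be * u * w + be ^+ 2 * w ^+ 2) / al ^+ 2)%R.
  by field; rewrite gt_eqF.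
rewrite !e b2; field; by rewrite gt_eqF.
Qed.
End normal1d.

(** * Standard Gaussian vectors *)

Section gauss_measure.
Context {R : realType}.
Local Open Scope ereal_scope.
Notation N01 := (normal_prob (0:R) 1).

Definition cons_pair n (z : measurableTypeR R * n.-tuple R) : n.+1.-tuple R := [the n.+1.-tuple R of z.1 :: z.2].

Lemma measurable_cons_pair n : measurable_fun setT (@cons_pair n).
Proof. exact: measurable_cons. Qed.

HB.instance Definition _ n := isMeasurableFun.Build _ _ _ _ (@cons_pair n) (@measurable_cons_pair n).

(** Built coordinate by coordinate, in step with the iterated integral [gauss_expect]; facts about
    Gaussian vectors then follow from the one-dimensional ones by induction on n. *)
Fixpoint gauss_prob n : probability (n.-tuple R) R :=
  match n with
  | 0%N => @dirac _ (0.-tuple R) [tuple] R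
  | n'.+1 => distribution (N01 \x gauss_prob n') (@cons_pair n')
  end.

Definition rv n (t : n.-tuple R) : 'rV[R]_n := \row_j tnth t j.

Lemma rv_cons n (z : measurableTypeR R * n.-tuple R) :
  rv (cons_pair z) = row_mx (\row_(j < 1) z.1) (rv z.2) :> 'rV[R]_n.+1.
Proof.
apply/rowP => j; rewrite !mxE; case: splitP => k jk.
  by rewrite mxE (_ : j = ord0) ?tnth0//; apply/val_inj; rewrite /= jk ord1.
rewrite mxE (_ : j = lift ord0 k) ?tnthS//; apply/val_inj; rewrite /= jk /bump/=.
by rewrite add1n.
Qed.

Definition mfun n (f : 'rV[R]_n -> \bar R) := measurable_fun setT (f \o @rv n).

Lemma integral_gauss_probS n (f : n.+1.-tuple R -> \bar R) :
  measurable_fun setT f -> (forall x, 0 <= f x) ->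
  \int[gauss_prob n.+1]_t f t = \int[N01]_x \int[gauss_prob n]_v f (cons_pair (x, v)).
Proof.
move=> mf f0 /=.
rewrite ge0_integral_distribution//=.
rewrite fubini_tonelli1//=.
by apply: measurableT_comp => //; exact: measurable_cons_pair.
Qed.

Lemma gauss_expectE n (f : 'rV[R]_n -> \bar R) : mfun f -> (forall v, 0 <= f v) ->
  gauss_expect f = \int[gauss_prob n]_t f (rv t).
Proof.
elim: n f => [|n ih] f mf f0 /=.
  rewrite integral_dirac//= diracT mul1e; congr f.
  by apply/rowP => -[].
rewrite -/(gauss_prob n.+1) integral_gauss_probS//.
apply: eq_integral => x _; rewrite ih//; last first.
  rewrite /mfun (_ : _ \o _ = (f \o @rv n.+1) \o (fun v => cons_pair (x, v))).
    apply: measurableT_comp => //; apply: measurableT_comp => //.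
  by apply/funext => v /=; rewrite rv_cons.
by apply: eq_integral => v _; rewrite rv_cons.
Qed.


Definition tv n (v : 'rV[R]_n) : n.-tuple R := [tuple v 0%R j | j < n].

Lemma tvK n : cancel (@tv n) (@rv n).
Proof. by move=> v; apply/rowP => j; rewrite mxE tnth_mktuple. Qed.

Lemma measurable_mfun d (T : measurableType d) n (f : 'rV[R]_n -> \bar R) (phi : T -> 'rV[R]_n) :
  (forall j, measurable_fun setT (fun x => phi x 0%R j)) -> mfun f ->
  measurable_fun setT (fun x => f (phi x)).
Proof.
move=> mphi mf; rewrite (_ : (fun x => _) = (f \o @rv n) \o (@tv n \o phi)); last first.
  by apply/funext => x /=; rewrite tvK.
apply: measurableT_comp => //; apply/measurable_fun_tnthP => i.
by rewrite (_ : _ \o _ = fun x => phi x 0%R i)//; apply/funext => x/=; rewrite tnth_mktuple.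
Qed.

Lemma measurable_rv n j : measurable_fun setT (fun t : n.-tuple R => rv t 0%R j).
Proof.
rewrite (_ : (fun t => _) = (fun t => tnth t j)); first exact: measurable_tnth.
by apply/funext => t; rewrite mxE.
Qed.

Definition dot n (u v : 'rV[R]_n) : R := (\sum_i u 0 i * v 0 i)%R.

Lemma measurable_dot d (T : measurableType d) n (a : 'rV[R]_n) (phi : T -> 'rV[R]_n) :
  (forall j, measurable_fun setT (fun x => phi x 0%R j)) ->
  measurable_fun setT (fun x => dot a (phi x)).
Proof. by move=> h; apply: measurable_sum => i; apply: measurable_funM. Qed.

Lemma measurable_norm2 d (T : measurableType d) n (phi : T -> 'rV[R]_n) :
  (forall j, measurable_fun setT (fun x => phi x 0%R j)) ->
  measurable_fun setT (fun x => norm2 (phi x)).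
Proof. by move=> h; apply: measurable_sum => i; exact: measurable_funX. Qed.

Lemma row_mx0 n (x : R) (v : 'rV[R]_n) : (row_mx (\row_(j < 1) x) v : 'rV[R]_n.+1) 0%R ord0 = x.
Proof. by rewrite mxE; case: splitP => k //; rewrite ?mxE// => /= h; rewrite mxE. Qed.

Lemma row_mxS n (x : R) (v : 'rV[R]_n) j : (row_mx (\row_(j < 1) x) v : 'rV[R]_n.+1) 0%R (lift ord0 j) = v 0%R j.
Proof.
rewrite mxE; case: splitP => k /=; rewrite /bump leq0n add1n; first by case: k => -[].
by rewrite add1n => -[h]; congr (v _ _); apply/val_inj.
Qed.

Definition tl n (a : 'rV[R]_n.+1) : 'rV[R]_n := \row_j a 0%R (lift ord0 j).

Lemma row_split n (a : 'rV[R]_n.+1) : a = row_mx (\row_(j < 1) a 0%R ord0) (tl a) :> 'rV[R]_n.+1.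
Proof.
apply/rowP => j; case: (unliftP ord0 j) => [k ->|->]; rewrite ?row_mxS ?row_mx0//.
by rewrite mxE.
Qed.

Lemma row_eq n (a : 'rV[R]_n.+1) x (v : 'rV[R]_n) : a 0%R ord0 = x -> tl a = v ->
  a = row_mx (\row_(j < 1) x) v :> 'rV[R]_n.+1.
Proof. by move=> <- <-; exact: row_split. Qed.

Lemma dotS n (a : 'rV[R]_n.+1) x (v : 'rV[R]_n) :
  dot a (row_mx (\row_(j < 1) x) v : 'rV[R]_n.+1) = (a 0%R ord0 * x + dot (tl a) v)%R.
Proof.
rewrite /dot big_ord_recl row_mx0; congr (_ + _)%R; apply: eq_bigr => i _.
by rewrite row_mxS mxE.
Qed.

Lemma norm2S n (a : 'rV[R]_n.+1) : norm2 a = (a 0%R ord0 ^+ 2 + norm2 (tl a))%R.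
Proof.
by rewrite /norm2 big_ord_recl; congr (_ + _)%R; apply: eq_bigr => i _; rewrite mxE.
Qed.

Lemma tl_row n x (v : 'rV[R]_n) : tl (row_mx (\row_(j < 1) x) v : 'rV[R]_n.+1) = v.
Proof. by apply/rowP => j; rewrite mxE row_mxS. Qed.

Lemma measurable_rowmx d (T : measurableType d) n (x : T -> R) (phi : T -> 'rV[R]_n) :
  measurable_fun setT x ->
  (forall j, measurable_fun setT (fun z => phi z 0%R j)) ->
  forall j, measurable_fun setT (fun z => (row_mx (\row_(j < 1) x z) (phi z) : 'rV[R]_n.+1) 0%R j).
Proof.
move=> mx mphi j; case: (unliftP ord0 j) => [k ->|->].
  by rewrite (_ : (fun z => _) = fun z => phi z 0%R k)//; apply/funext => z; rewrite row_mxS.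
by rewrite (_ : (fun z => _) = x)//; apply/funext => z; rewrite row_mx0.
Qed.

Lemma integral_gauss_rvS n (f : 'rV[R]_n.+1 -> \bar R) : mfun f -> (forall x, 0 <= f x) ->
  \int[gauss_prob n.+1]_t f (rv t) =
  \int[N01]_x \int[gauss_prob n]_v f (row_mx (\row_(j < 1) x) (rv v)).
Proof.
move=> mf f0; rewrite (@integral_gauss_probS n (f \o @rv _)); [|exact: mf|by move=> t; exact: f0].
by apply: eq_integral => x _; apply: eq_integral => v _ /=; rewrite rv_cons.
Qed.

Lemma measurable_gauss_section n (f : R -> 'rV[R]_n -> \bar R) : (forall x v, 0 <= f x v) ->
  mfun (fun w : 'rV[R]_n.+1 => f (w 0%R ord0) (tl w)) ->
  measurable_fun setT (fun x : R => \int[gauss_prob n]_v f x (rv v)).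
Proof.
move=> f0 mf.
apply: (@measurable_fun_fubini_tonelli_F _ _ _ _ _ (gauss_prob n) (fun z : R * n.-tuple R => f z.1 (rv z.2))) => //=.
have := @measurable_mfun _ (R * n.-tuple R)%type n.+1 _
   (fun z => row_mx (\row_(j < 1) z.1) (rv z.2)) _ mf.
rewrite (_ : (fun x => _) = (fun z : R * n.-tuple R => f z.1 (rv z.2))); last first.
  by apply/funext => z; rewrite row_mx0 tl_row.
apply; apply: measurable_rowmx => // j.
by apply: (measurableT_comp (measurable_rv j)).
Qed.

(** The Cameron-Martin formula, one coordinate at a time. *)
Lemma gauss_shift n (a : 'rV[R]_n) (f : 'rV[R]_n -> \bar R) : mfun f -> (forall v, 0 <= f v) ->
  \int[gauss_prob n]_t f (rv t + a)%R =
  \int[gauss_prob n]_t (f (rv t) * (expR (dot a (rv t) - norm2 a / 2))%:E).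
Proof.
elim: n a f => [|n ih] a f mf f0.
  apply: eq_integral => t _.
  have -> : (rv t + a = rv t)%R by apply/rowP => -[].
  by rewrite /dot /norm2 !big_ord0 mul0r subr0 expR0 mule1.
have mfa : mfun (fun w => f (w + a)%R).
  apply: (@measurable_mfun _ _ _ f (fun t => (rv t + a)%R)) => // j; under eq_fun do rewrite mxE.
  by apply: measurable_funD => //; exact: measurable_rv.
have mfe : mfun (fun w => f w * (expR (dot a w - norm2 a / 2))%:E).
  apply: emeasurable_funM => //; apply/measurable_EFinP; apply: measurableT_comp => //.
  by apply: measurable_funB => //; apply: measurable_dot; exact: measurable_rv.
rewrite (@integral_gauss_rvS n (fun w => f (w + a)%R))//.
rewrite (@integral_gauss_rvS n (fun w => f w * (expR (dot a w - norm2 a / 2))%:E)); last 2 first.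
- exact: mfe.
- by move=> w; rewrite mule_ge0// lee_fin expR_ge0.
pose G x := \int[gauss_prob n]_v (f (row_mx (\row_(j < 1) x) (rv v)) *
     (expR (dot (tl a) (rv v) - norm2 (tl a) / 2))%:E).
transitivity (\int[N01]_x G (x + a 0%R ord0)%R).
  apply: eq_integral => x _; rewrite /G.
  rewrite -(ih (tl a) (fun v => f (row_mx (\row_(j < 1) (x + a 0%R ord0)%R) v)))//; last first.
    apply: (@measurable_mfun _ _ n.+1) => //.
    by apply: measurable_rowmx => // j; exact: measurable_rv.
  apply: eq_integral => v _; congr f; apply: row_eq; first by rewrite mxE row_mx0.
  by apply/rowP => j; rewrite mxE [in LHS]mxE row_mxS [RHS]mxE; congr (_ + _)%R; rewrite mxE.
have G0 x : 0 <= G x by apply: integral_ge0 => v _; rewrite mule_ge0// lee_fin expR_ge0.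
have mG : measurable_fun setT G.
  apply: (@measurable_gauss_section n (fun x w => f (row_mx (\row_(j < 1) x) w) *
     (expR (dot (tl a) w - norm2 (tl a) / 2))%:E)).
    by move=> x v; rewrite mule_ge0// lee_fin expR_ge0.
  apply: emeasurable_funM.
    rewrite (_ : (fun w => _) = f \o @rv n.+1)//.
    by apply/funext => w /=; rewrite -row_split.
  apply/measurable_EFinP; apply: measurableT_comp => //.
  apply: measurable_funB => //; apply: measurable_dot => j.
  by under eq_fun do rewrite mxE; exact: measurable_rv.
apply: (etrans (normal_shift (a 0%R ord0) mG G0)).
apply: eq_integral => x _.
rewrite /G -ge0_integralZr//; last 2 first.
- apply: emeasurable_funM.
    apply: (@measurable_mfun _ _ n.+1) => //.
    by apply: measurable_rowmx => // j; exact: measurable_rv.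
  apply/measurable_EFinP; apply: measurableT_comp => //.
  apply: measurable_funB => //; apply: measurable_dot => j; exact: measurable_rv.
- by move=> v _; rewrite mule_ge0// lee_fin expR_ge0.
apply: eq_integral => v _; rewrite -muleA -EFinM -expRD; congr (_ * (expR _)%:E).
by rewrite dotS norm2S; field.
Qed.

Lemma gauss_quad n (v : R) (h : 'rV[R]_n) : (v < 1)%R ->
  \int[gauss_prob n]_t (expR (dot h (rv t) + v * norm2 (rv t) / 2))%:E =
  (expR (norm2 h / (2 * (1 - v))) * ((Num.sqrt (1 - v))^-1) ^+ n)%:E.
Proof.
move=> v1; elim: n h => [|n ih] h.
  under eq_integral do rewrite /norm2 /dot !big_ord0 mulr0 mul0r addr0 expR0.
  by rewrite integral_cst//= mul1e probability_setT /norm2 big_ord0 mul0r expR0 mulr1.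
have me m (g : 'rV[R]_m) : mfun (fun w : 'rV[R]_m => (expR (dot g w + v * norm2 w / 2))%:E).
  apply/measurable_EFinP; apply: measurableT_comp => //; apply: measurable_funD.
    by apply: measurable_dot; exact: measurable_rv.
  do 2 apply: measurable_funM => //; apply: measurable_norm2; exact: measurable_rv.
rewrite (@integral_gauss_rvS n (fun w => (expR (dot h w + v * norm2 w / 2))%:E))//; last first.
under eq_integral.
  move=> x _; under eq_integral.
    move=> t _; rewrite dotS norm2S row_mx0 tl_row mulrDr mulrDl addrACA expRD EFinM; over.
  rewrite ge0_integralZl//; first by rewrite ih; over.
  exact: me.
rewrite ge0_integralZr//.
- rewrite normal_quad// -EFinM norm2S; congr (_%:E).
  by rewrite [in RHS]mulrDl expRD [(_ ^+ n.+1)%R]exprS; ring.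
- apply/measurable_EFinP; apply: measurableT_comp => //; apply: measurable_funD; first exact: measurable_funM.
  by do 2 apply: measurable_funM => //; exact: measurable_funX.
Qed.

(** Exchanging integrals brings the two first coordinates together, where [normal_rot] applies; the
    remaining coordinates are the induction hypothesis. *)
Lemma gauss_rot n (al be : R) (f : 'rV[R]_n -> \bar R) : (0 < al)%R -> (al ^+ 2 + be ^+ 2 = 1)%R ->
  mfun f -> (forall v, 0 <= f v) ->
  \int[gauss_prob n]_t \int[gauss_prob n]_u f (al *: rv u + be *: rv t)%R =
  \int[gauss_prob n]_t f (rv t).
Proof.
move=> al0 ab1; elim: n f => [|n ih] f mf f0.
  under eq_integral.
    move=> t _; under eq_integral.
      move=> u _; rewrite (_ : (_ + _)%R = rv t); last by apply/rowP => -[].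
      over.
    rewrite integral_cst//= probability_setT mule1; over.
  by [].
pose F (x : R) (t u : 'rV[R]_n) := f (row_mx (\row_(j < 1) x) (al *: u + be *: t)%R).
have F0 x t u : 0 <= F x t u by exact: f0.
have mrow (d : measure_display) (T : measurableType d) (x : T -> R) (t u : T -> 'rV[R]_n) : measurable_fun setT x ->
    (forall j, measurable_fun setT (fun z => t z 0%R j)) ->
    (forall j, measurable_fun setT (fun z => u z 0%R j)) ->
    measurable_fun setT (fun z => F (x z) (t z) (u z)).
  move=> mx mt mu; apply: (@measurable_mfun _ _ n.+1 f) => //; apply: measurable_rowmx => // j.
  by under eq_fun do rewrite !mxE; apply: measurable_funD; apply: measurable_funM.
have mG (d : measure_display) (T : measurableType d) (x : T -> R) (t : T -> 'rV[R]_n) : measurable_fun setT x ->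
    (forall j, measurable_fun setT (fun z => t z 0%R j)) ->
    measurable_fun setT (fun z => \int[gauss_prob n]_u F (x z) (t z) (rv u)).
  move=> mx mt.
  apply: (@measurable_fun_fubini_tonelli_F _ _ _ _ _ (gauss_prob n) (fun z : T * n.-tuple R => F (x z.1) (t z.1) (rv z.2))) => //=.
  apply: mrow => [|j|j].
  - exact: (measurableT_comp mx).
  - exact: (measurableT_comp (mt j)).
  - exact: (measurableT_comp (measurable_rv j)).
have mH (d : measure_display) (T : measurableType d) (x : T -> R) (t : T -> 'rV[R]_n) : measurable_fun setT x ->
    (forall j, measurable_fun setT (fun z => t z 0%R j)) ->
    measurable_fun setT (fun z => \int[N01]_y \int[gauss_prob n]_u F (al * y + be * x z)%R (t z) (rv u)).
  move=> mx mt.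
  apply: (@measurable_fun_fubini_tonelli_F _ _ _ _ _ N01 (fun z : T * measurableTypeR R => \int[gauss_prob n]_u F (al * z.2 + be * x z.1)%R (t z.1) (rv u))) => //=.
    apply: mG => [|j]; last exact: (measurableT_comp (mt j)).
    apply: measurable_funD; apply: measurable_funM => //; exact: (measurableT_comp mx).
  by move=> z; apply: integral_ge0 => u _.
have eqf (t u : 'rV[R]_n.+1) : f (al *: u + be *: t)%R = F (al * u 0%R ord0 + be * t 0%R ord0)%R (tl t) (tl u).
  rewrite /F; congr f; apply: row_eq; first by rewrite !mxE.
  by apply/rowP => j; rewrite !mxE.
transitivity (\int[gauss_prob n.+1]_t \int[N01]_y \int[gauss_prob n]_u F (al * y + be * rv t 0%R ord0)%R (tl (rv t)) (rv u)).
  apply: eq_integral => t _.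
  rewrite (@integral_gauss_rvS n (fun w => f (al *: w + be *: rv t)%R)).
  - by apply: eq_integral => y _; apply: eq_integral => u _; rewrite eqf row_mx0 tl_row.
  - apply: (@measurable_mfun _ _ _ f (fun u => (al *: rv u + be *: rv t)%R)) => // j.
    under eq_fun do rewrite !mxE; apply: measurable_funD => //; apply: measurable_funM => //.
    exact: measurable_tnth.
  - by move=> w; exact: f0.
rewrite (@integral_gauss_rvS n (fun w => \int[N01]_y \int[gauss_prob n]_u F (al * y + be * w 0%R ord0)%R (tl w) (rv u))); last 2 first.
- apply: mH => [|j]; first exact: measurable_rv.
  by under eq_fun do rewrite mxE; exact: measurable_rv.
- by move=> w; apply: integral_ge0 => y _; apply: integral_ge0 => u _.
pose g x := \int[gauss_prob n]_t f (row_mx (\row_(j < 1) x) (rv t)).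
transitivity (\int[N01]_x \int[N01]_y g (al * y + be * x)%R).
  apply: eq_integral => x _.
  under eq_integral do rewrite row_mx0 tl_row.
  rewrite (@fubini_tonelli _ _ _ _ _ (gauss_prob n) N01 (fun z : n.-tuple R * measurableTypeR R => \int[gauss_prob n]_u F (al * z.2 + be * x)%R (rv z.1) (rv u)))/=.
  - apply: eq_integral => y _; rewrite /F /g.
    rewrite -(ih (fun w => f (row_mx (\row_(j < 1) (al * y + be * x)%R) w)))//.
    apply: (@measurable_mfun _ _ n.+1 f) => //.
    by apply: measurable_rowmx => // j; exact: measurable_rv.
  - apply: mG => [|j]; last exact: (measurableT_comp (measurable_rv j)).
    by apply: measurable_funD => //; apply: measurable_funM.
  - by move=> z; apply: integral_ge0.
rewrite normal_rot//; first by rewrite (@integral_gauss_rvS n f).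
- apply: (@measurable_gauss_section n (fun x w => f (row_mx (\row_(j < 1) x) w))) => //.
  rewrite (_ : (fun w => _) = f)//.
  by apply/funext => w /=; rewrite -row_split.
- by move=> x; apply: integral_ge0.
Qed.

Lemma gauss_split n m (f : 'rV[R]_(n + m) -> \bar R) : mfun f -> (forall v, 0 <= f v) ->
  \int[gauss_prob (n + m)]_t f (rv t) =
  \int[gauss_prob n]_t \int[gauss_prob m]_u f (row_mx (rv t) (rv u)).
Proof.
elim: n f => [|n ih] f mf f0.
  rewrite [RHS]integral_dirac//=.
    rewrite diracT mul1e; apply: eq_integral => t _; congr f.
    apply/rowP => j; rewrite !mxE; case: splitP => [[]//|k jk]; rewrite mxE.
    by congr tnth; apply/val_inj.
  apply: (@measurable_fun_fubini_tonelli_F _ _ _ _ _ (gauss_prob m) (fun z : 0.-tuple R * m.-tuple R => f (row_mx (rv z.1) (rv z.2)))) => //=.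
  apply: measurable_mfun => // j; rewrite /=.
  under eq_fun do rewrite mxE; case: splitP => k _.
    exact: (measurableT_comp (measurable_rv k)).
  exact: (measurableT_comp (measurable_rv k)).
have rowA x (v : 'rV[R]_n) (w : 'rV[R]_m) :
   row_mx (row_mx (\row_(j < 1) x) v : 'rV[R]_n.+1) w = row_mx (\row_(j < 1) x) (row_mx v w) :> 'rV[R]_(n.+1 + m).
  apply: (@row_eq (n + m)).
    rewrite mxE; case: splitP => k //= jk.
    by rewrite (_ : k = ord0) ?row_mx0//; apply/val_inj.
  apply/rowP => j; rewrite !mxE; case: splitP => k /=; rewrite /bump/= add1n; case: splitP => l /= ->//.
  - move=> kl; rewrite (_ : k = lift ord0 l) ?row_mxS//; apply/val_inj => /=.
    by rewrite /bump/= add1n.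
  - by move=> h; have := ltn_ord k; rewrite -h ltnS ltnNge leq_addr.
  - by rewrite addSn => -[] h; have := ltn_ord l; rewrite h ltnNge leq_addr.
  - by rewrite addSn => -[] /addnI h; congr (w _ _); apply/val_inj.
rewrite (@integral_gauss_rvS (n + m) f)//.
rewrite (@integral_gauss_rvS n (fun w => \int[gauss_prob m]_u f (row_mx w (rv u)))); last 2 first.
- apply: (@measurable_fun_fubini_tonelli_F _ _ _ _ _ (gauss_prob m) (fun z : n.+1.-tuple R * m.-tuple R => f (row_mx (rv z.1) (rv z.2)))) => //=.
  apply: measurable_mfun => // j; rewrite /=.
  under eq_fun do rewrite mxE; case: splitP => k _.
    exact: (measurableT_comp (measurable_rv k)).
  exact: (measurableT_comp (measurable_rv k)).
- by move=> w; apply: integral_ge0.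
apply: eq_integral => x _.
rewrite (ih (fun w => f (row_mx (\row_(j < 1) x) w))); last 2 first.
- apply: (@measurable_mfun _ _ (n + m).+1 f) => //.
  by apply: measurable_rowmx => // j; exact: measurable_rv.
- by move=> v; exact: f0.
by apply: eq_integral => t _; apply: eq_integral => u _; rewrite rowA.
Qed.

End gauss_measure.

(** * Gaussian expectation of functions of exponential growth *)

Section gauss_real.
Context {R : realType}.
Implicit Types n m : nat.

Definition norm1 n (w : 'rV[R]_n) : R := \sum_i `|w 0 i|.

Lemma norm1_ge0 n (w : 'rV[R]_n) : 0 <= norm1 w.
Proof. exact: sumr_ge0. Qed.

(** A growth class that is closed under sums, products and substitutions of linear growth and is
    integrable for the Gaussian law, so that one predicate settles the integrability and
    measurability conditions. *)
Definition good n (f : 'rV[R]_n -> R) :=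
  measurable_fun setT (f \o @rv R n) /\
  exists2 C, 0 <= C & forall w, `|f w| <= C * expR (C * norm1 w).

Lemma good_meas n (f : 'rV[R]_n -> R) : good f -> measurable_fun setT (f \o @rv R n).
Proof. by case. Qed.

Lemma good_mfun n (f : 'rV[R]_n -> R) : good f -> mfun (fun w => (f w)%:E).
Proof. by case=> mf _; apply/measurable_EFinP. Qed.

Lemma measurable_good d (T : measurableType d) n (f : 'rV[R]_n -> R) (phi : T -> 'rV[R]_n) :
  (forall j, measurable_fun setT (fun x => phi x 0 j)) -> good f ->
  measurable_fun setT (fun x => f (phi x)).
Proof.
move=> mphi gf; have := measurable_mfun mphi (good_mfun gf).
by move/measurable_EFinP.
Qed.

(** The exponent [norm2 w] / 4 stays strictly below the [norm2 w] / 2 of the Gaussian density, so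
    the right-hand side is integrable. *)
Lemma expR_norm1_le n (C : R) (w : 'rV[R]_n) :
  expR (C * norm1 w) <= expR (n%:R * C ^+ 2) * expR (2^-1 * norm2 w / 2).
Proof.
rewrite -expRD ler_expR /norm1 /norm2.
have -> : n%:R * C ^+ 2 = \sum_(i < n) C ^+ 2 by rewrite sumr_const card_ord mulr_natl.
rewrite mulr_sumr mulr_sumr mulr_suml -big_split/=.
apply: ler_sum => i _; rewrite -[w 0 i ^+ 2]real_normK ?num_real//.
by have := sqr_ge0 (C - `|w 0 i| / 2); nra.
Qed.

Lemma integrable_good n (f : 'rV[R]_n -> R) : good f ->
  (gauss_prob n).-integrable setT (fun t => (f (rv t))%:E).
Proof.
move=> [mf [C C0 fC]].
pose g (w : 'rV[R]_n) := C * expR (n%:R * C ^+ 2) * expR (2^-1 * norm2 w / 2).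
have mg : measurable_fun setT (fun t : n.-tuple R => expR (2^-1 * norm2 (rv t) / 2)).
  apply: measurableT_comp => //; do 2 apply: measurable_funM => //.
  by apply: measurable_norm2; exact: measurable_rv.
apply: (@le_integrable _ _ _ _ _ measurableT _ (fun t => (g (rv t))%:E)).
- by apply/measurable_EFinP; exact: mf.
- move=> t _ /=; rewrite lee_fin (le_trans (fC _))// [leRHS]ger0_norm; last first.
    by rewrite /g !mulr_ge0// expR_ge0.
  by rewrite /g -mulrA ler_wpM2l// expR_norm1_le.
- under eq_fun do rewrite /g EFinM; apply: integrableZl => //.
  apply/integrableP; split; first exact/measurable_EFinP.
  under eq_integral do rewrite /= ger0_norm ?expR_ge0//.
  have -> : (fun t : n.-tuple R => (expR (2^-1 * norm2 (rv t) / 2))%:E) =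
      (fun t => (expR (dot 0 (rv t) + 2^-1 * norm2 (rv t) / 2))%:E).
    by apply/funext => t; rewrite /dot big1 ?add0r// => i _; rewrite mxE mul0r.
  by rewrite gauss_quad ?ltry//; lra.
Qed.

Definition Ex n (f : 'rV[R]_n -> R) : R := fine (\int[gauss_prob n]_t (f (rv t))%:E)%E.

Lemma ExE n (f : 'rV[R]_n -> R) : good f ->
  (Ex f)%:E = (\int[gauss_prob n]_t (f (rv t))%:E)%E.
Proof.
move=> gf; rewrite fineK//.
exact: (integrable_fin_num measurableT (integrable_good gf)).
Qed.

Lemma eq_Ex n (f g : 'rV[R]_n -> R) : f =1 g -> Ex f = Ex g.
Proof. by move=> fg; congr Ex; apply/funext. Qed.

Lemma ExD n (f g : 'rV[R]_n -> R) : good f -> good g ->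
  Ex (fun w => f w + g w) = Ex f + Ex g.
Proof.
move=> gf gg; rewrite /Ex; under eq_integral do rewrite EFinD.
rewrite integralD//=; [|exact: integrable_good|exact: integrable_good].
by rewrite -(ExE gf) -(ExE gg).
Qed.

Lemma ExZ n k (f : 'rV[R]_n -> R) : good f -> Ex (fun w => k * f w) = k * Ex f.
Proof.
move=> gf; rewrite /Ex; under eq_integral do rewrite EFinM.
by rewrite integralZl//=; [rewrite -(ExE gf)|exact: integrable_good].
Qed.

Lemma Ex_cst n k : Ex (fun _ : 'rV[R]_n => k) = k.
Proof. by rewrite /Ex integral_cst//= probability_setT mule1. Qed.

Lemma le_Ex n (f g : 'rV[R]_n -> R) : good f -> good g -> (forall w, f w <= g w) ->
  Ex f <= Ex g.
Proof.
move=> gf gg fg; rewrite -lee_fin !ExE//.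
apply: le_integral => //; [exact: integrable_good|exact: integrable_good|].
by move=> t _; rewrite lee_fin.
Qed.

Lemma Ex_ge0 n (f : 'rV[R]_n -> R) : (forall w, 0 <= f w) -> 0 <= Ex f.
Proof. by move=> f0; apply: fine_ge0; apply: integral_ge0 => t _; rewrite lee_fin. Qed.

Lemma good_cst n k : good (fun _ : 'rV[R]_n => k).
Proof.
split; first exact: measurable_cst.
exists `|k| => // w; rewrite ler_peMr// -expR0 ler_expR.
by rewrite mulr_ge0// norm1_ge0.
Qed.

Lemma good_le n (f g : 'rV[R]_n -> R) : measurable_fun setT (f \o @rv R n) -> good g ->
  (forall w, `|f w| <= `|g w|) -> good f.
Proof.
move=> mf [_ [C C0 gC]] fg; split=> //; exists C => // w.
exact: le_trans (fg w) (gC w).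
Qed.

Lemma goodD n (f g : 'rV[R]_n -> R) : good f -> good g -> good (fun w => f w + g w).
Proof.
move=> [mf [C C0 fC]] [mg [D D0 gD]]; split; first exact: measurable_funD.
exists (C + D) => [|w]; first exact: addr_ge0.
rewrite (le_trans (ler_normD _ _))// mulrDl lerD//.
  by rewrite (le_trans (fC w))// ler_wpM2l// ler_expR ler_wpM2r ?norm1_ge0// lerDl.
by rewrite (le_trans (gD w))// ler_wpM2l// ler_expR ler_wpM2r ?norm1_ge0// lerDr.
Qed.

Lemma goodM n (f g : 'rV[R]_n -> R) : good f -> good g -> good (fun w => f w * g w).
Proof.
move=> [mf [C C0 fC]] [mg [D D0 gD]]; split; first exact: measurable_funM.
exists (C * D + (C + D)) => [|w]; first by rewrite !addr_ge0// mulr_ge0.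
rewrite normrM (le_trans (ler_pM _ _ (fC w) (gD w)))// mulrACA -expRD -mulrDl.
apply: ler_pM; rewrite ?mulr_ge0 ?expR_ge0//.
  by rewrite lerDl addr_ge0.
by rewrite ler_expR ler_wpM2r ?norm1_ge0// lerDr mulr_ge0.
Qed.

Lemma goodZ n k (f : 'rV[R]_n -> R) : good f -> good (fun w => k * f w).
Proof. by move=> gf; apply: goodM => //; exact: good_cst. Qed.

Lemma goodN n (f : 'rV[R]_n -> R) : good f -> good (fun w => - f w).
Proof. by move=> gf; under eq_fun do rewrite -mulN1r; exact: goodZ. Qed.

Lemma goodB n (f g : 'rV[R]_n -> R) : good f -> good g -> good (fun w => f w - g w).
Proof. by move=> gf gg; apply: goodD => //; exact: goodN. Qed.

Lemma ExN n (f : 'rV[R]_n -> R) : good f -> Ex (fun w => - f w) = - Ex f.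
Proof. by move=> gf; rewrite -mulN1r -ExZ//; apply: eq_Ex => w; rewrite mulN1r. Qed.

Lemma ExB n (f g : 'rV[R]_n -> R) : good f -> good g ->
  Ex (fun w => f w - g w) = Ex f - Ex g.
Proof. by move=> gf gg; rewrite ExD ?ExN//; exact: goodN. Qed.

Lemma good_sum n (I : Type) (r : seq I) (P : pred I) (f : I -> 'rV[R]_n -> R) :
  (forall i, P i -> good (f i)) -> good (fun w => \sum_(i <- r | P i) f i w).
Proof.
move=> gf; elim: r => [|i r ih].
  by under eq_fun do rewrite big_nil; exact: good_cst.
case: (boolP (P i)) => Pi; last by under eq_fun do rewrite big_cons (negbTE Pi).
under eq_fun do rewrite big_cons Pi.
by apply: goodD => //; exact: gf.
Qed.

Lemma Ex_sum n (I : Type) (r : seq I) (P : pred I) (f : I -> 'rV[R]_n -> R) :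
  (forall i, P i -> good (f i)) ->
  Ex (fun w => \sum_(i <- r | P i) f i w) = \sum_(i <- r | P i) Ex (f i).
Proof.
move=> gf; elim: r => [|i r ih].
  by under eq_Ex do rewrite big_nil; rewrite big_nil Ex_cst.
rewrite big_cons; case: ifPn => Pi; last first.
  by rewrite -ih; apply: eq_Ex => w; rewrite big_cons (negbTE Pi).
under eq_Ex do rewrite big_cons Pi.
by rewrite ExD ?ih//; [exact: gf|exact: good_sum].
Qed.

Lemma dot_norm1 n (a w : 'rV[R]_n) : `|dot a w| <= norm1 a * norm1 w.
Proof.
rewrite (le_trans (ler_norm_sum _ _ _))// /norm1 mulr_sumr; apply: ler_sum => i _.
rewrite normrM ler_wpM2r// (bigD1 i)//= lerDl; exact: sumr_ge0.
Qed.

Lemma meas_dot n (a : 'rV[R]_n) : measurable_fun setT ((fun w => dot a w) \o @rv R n).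
Proof. by apply: measurable_dot; exact: measurable_rv. Qed.

Lemma good_dot n (a : 'rV[R]_n) : good (fun w => dot a w).
Proof.
split; first exact: meas_dot.
exists (1 + norm1 a) => [|w]; first by rewrite addr_ge0// norm1_ge0.
rewrite (le_trans (dot_norm1 _ _))//; have a0 := norm1_ge0 a; have w0 := norm1_ge0 w.
have := expR_ge1Dx ((1 + norm1 a) * norm1 w); nra.
Qed.

Lemma good_norm2 n : good (@norm2 R n).
Proof.
split; first by apply: measurable_norm2; exact: measurable_rv.
exists 2 => // w; have w0 := norm1_ge0 w.
have n0 : 0 <= norm2 w by apply: sumr_ge0 => i _; exact: sqr_ge0.
have : norm2 w <= norm1 w ^+ 2.
  rewrite /norm2 /norm1 expr2 mulr_suml; apply: ler_sum => i _.
  rewrite -real_normK ?num_real// expr2 ler_wpM2l// (bigD1 i)//= lerDl; exact: sumr_ge0.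
rewrite ger0_norm// => h; apply: (le_trans h).
have -> : expR (2 * norm1 w) = expR (norm1 w) ^+ 2 by rewrite -expRM_natl mulrC.
have := expR_ge1Dx (norm1 w); nra.
Qed.

Lemma good_expdot n (a : 'rV[R]_n) : good (fun w => expR (dot a w)).
Proof.
split; first by apply: measurableT_comp => //; exact: meas_dot.
exists (1 + norm1 a) => [|w]; first by rewrite addr_ge0// norm1_ge0.
rewrite ger0_norm ?expR_ge0//; have a0 := norm1_ge0 a.
rewrite -[leLHS]mul1r; apply: ler_pM; rewrite ?expR_ge0 ?lerDl//.
rewrite ler_expR (le_trans (ler_norm _))// (le_trans (dot_norm1 _ _))//.
by rewrite ler_wpM2r ?norm1_ge0// lerDr.
Qed.

Lemma good_comp n m (f : 'rV[R]_n -> R) (phi : 'rV[R]_m -> 'rV[R]_n) K :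
  0 <= K -> (forall j, measurable_fun setT (fun t : m.-tuple R => phi (rv t) 0 j)) ->
  (forall w, norm1 (phi w) <= K * (1 + norm1 w)) ->
  good f -> good (fun w => f (phi w)).
Proof.
move=> K0 mphi phiK gf; split; first exact: measurable_good gf.
case: gf => _ [C C0 fC]; exists (C * expR (C * K) + C * K) => [|w].
  by rewrite addr_ge0 ?mulr_ge0 ?expR_ge0.
rewrite (le_trans (fC _))//.
apply: (@le_trans _ _ (C * (expR (C * K) * expR (C * K * norm1 w)))).
  by rewrite ler_wpM2l// -expRD ler_expR -mulrA -mulrDr ler_wpM2l// -[X in X + _]mulr1 -mulrDr.
rewrite mulrA; apply: ler_pM; rewrite ?mulr_ge0 ?expR_ge0//.
  by rewrite lerDl mulr_ge0.
by rewrite ler_expR ler_wpM2r ?norm1_ge0// lerDr mulr_ge0// expR_ge0.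
Qed.

Lemma norm1D n (u v : 'rV[R]_n) : norm1 (u + v) <= norm1 u + norm1 v.
Proof. by rewrite /norm1 -big_split; apply: ler_sum => i _; rewrite mxE ler_normD. Qed.

Lemma norm1Z n k (v : 'rV[R]_n) : norm1 (k *: v) = `|k| * norm1 v.
Proof. by rewrite /norm1 mulr_sumr; apply: eq_bigr => i _; rewrite mxE normrM. Qed.

Lemma good_shift n (f : 'rV[R]_n -> R) a : good f -> good (fun w => f (w + a)).
Proof.
have a0 := norm1_ge0 a.
apply: (@good_comp _ _ _ _ (1 + norm1 a)) => [|j|w].
- by rewrite addr_ge0.
- by under eq_fun do rewrite mxE; apply: measurable_funD => //; exact: measurable_rv.
- have w0 := norm1_ge0 w; rewrite (le_trans (norm1D _ _))//; nra.
Qed.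

Lemma good_scale n (f : 'rV[R]_n -> R) k : good f -> good (fun w => f (k *: w)).
Proof.
apply: (@good_comp _ _ _ _ `|k|) => [//|j|w].
- by under eq_fun do rewrite mxE; apply: measurable_funM => //; exact: measurable_rv.
- by rewrite norm1Z ler_wpM2l// lerDr.
Qed.

Lemma norm1_split n m (w : 'rV[R]_(n + m)) : norm1 w = norm1 (lsubmx w) + norm1 (rsubmx w).
Proof.
by rewrite /norm1 big_split_ord; congr (_ + _); apply: eq_bigr => i _; rewrite mxE.
Qed.

Lemma good_lin2 n (f : 'rV[R]_n -> R) k l : good f ->
  good (fun w : 'rV[R]_(n + n) => f (k *: rsubmx w + l *: lsubmx w)).
Proof.
apply: (@good_comp _ _ _ _ (`|k| + `|l|)) => [|j|w].
- by rewrite addr_ge0.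
- under eq_fun do rewrite !mxE.
  by apply: measurable_funD; apply: measurable_funM => //; exact: measurable_tnth.
- rewrite (le_trans (norm1D _ _))// !norm1Z norm1_split.
  have := norm1_ge0 (lsubmx w); have := norm1_ge0 (rsubmx w).
  have := normr_ge0 k; have := normr_ge0 l; nra.
Qed.

Lemma good_lsub n m (f : 'rV[R]_n -> R) : good f -> good (fun w : 'rV[R]_(n + m) => f (lsubmx w)).
Proof.
apply: (@good_comp _ _ _ _ 1) => [//|j|w].
- by under eq_fun do rewrite !mxE; exact: measurable_tnth.
- by have := norm1_split w; have := norm1_ge0 (rsubmx w); lra.
Qed.

(** Splitting f into positive and negative parts reduces identities linear in f to nonnegative
    functions, for which integrals may be exchanged freely. *)
Lemma good_ge0_ind n (P : ('rV[R]_n -> R) -> Prop) :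
  (forall f, good f -> (forall w, 0 <= f w) -> P f) ->
  (forall f g, good f -> good g -> P f -> P g -> P (fun w => f w - g w)) ->
  forall f, good f -> P f.
Proof.
move=> P0 PB f gf; pose g w := Num.max 0 (f w); pose h w := Num.max 0 (- f w).
have mx (x : R) : 0 <= Num.max 0 x <= `|x|.
  by rewrite le_max lexx/= ge_max normr_ge0 ler_norm.
have gg : good g.
  apply: (good_le _ gf) => [|w].
    by apply: measurable_maxr => //; exact: good_meas.
  by rewrite ger0_norm; have /andP[] := mx (f w).
have gh : good h.
  apply: (good_le _ gf) => [|w].
    by apply: measurable_maxr => //; apply: measurableT_comp => //; exact: good_meas.
  by rewrite -[leRHS]normrN ger0_norm; have /andP[] := mx (- f w).
have -> : f = fun w => g w - h w.
  by apply/funext => w; rewrite /g /h; case: (leP 0 (f w)) => f0; case: (leP 0 (- f w)) => f1; lra.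
by apply: PB => //; apply: P0 => // w; have /andP[] := mx (f w); have /andP[] := mx (- f w).
Qed.

Lemma Ex_shift n (f : 'rV[R]_n -> R) a : good f ->
  Ex (fun w => f (w + a)) = Ex (fun w => f w * expR (dot a w - norm2 a / 2)).
Proof.
have ge : good (fun w => expR (dot a w - norm2 a / 2)).
  by under eq_fun do rewrite expRD; apply: goodM; [exact: good_expdot|exact: good_cst].
move: f; apply: good_ge0_ind => [f gf f0|f g gf gg Ef Eg].
  rewrite /Ex; congr fine; rewrite (gauss_shift a (good_mfun gf))//.
rewrite ExB ?Ef ?Eg; [|exact: good_shift|exact: good_shift].
rewrite -ExB; [|exact: goodM|exact: goodM].
by apply: eq_Ex => w; rewrite mulrBl.
Qed.

Lemma Ex_rot n (f : 'rV[R]_n -> R) al be : 0 < al -> al ^+ 2 + be ^+ 2 = 1 -> good f ->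
  Ex (fun w : 'rV[R]_(n + n) => f (al *: rsubmx w + be *: lsubmx w)) = Ex f.
Proof.
move=> al0 ab; move: f; apply: good_ge0_ind => [f gf f0|f g gf gg Ef Eg].
  rewrite /Ex; congr fine.
  rewrite (gauss_split (good_mfun (good_lin2 al be gf))); last by move=> v; rewrite lee_fin.
  rewrite -(gauss_rot al0 ab (good_mfun gf)); last by move=> v; rewrite lee_fin.
  apply: eq_integral => t _; apply: eq_integral => u _.
  by rewrite row_mxKl row_mxKr.
by rewrite ExB ?Ef ?Eg ?ExB//; exact: good_lin2.
Qed.

Lemma Ex_lsub n m (f : 'rV[R]_n -> R) : good f ->
  Ex (fun w : 'rV[R]_(n + m) => f (lsubmx w)) = Ex f.
Proof.
move: f; apply: good_ge0_ind => [f gf f0|f g gf gg Ef Eg].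
  rewrite /Ex; congr fine.
  rewrite (gauss_split (good_mfun (good_lsub m gf))); last by move=> v; rewrite lee_fin.
  apply: eq_integral => t _.
  under eq_integral do rewrite row_mxKl.
  by rewrite integral_cst//= probability_setT mule1.
by rewrite ExB ?Ef ?Eg ?ExB//; exact: good_lsub.
Qed.

(** Posterior weights are quotients and their entropies are logarithms; control of the inverse keeps
    both within exponential growth, as |ln f| <= f + 1 / f. *)
Definition pgood n (f : 'rV[R]_n -> R) :=
  [/\ forall w, 0 < f w, good f & good (fun w => (f w)^-1)].

Lemma pgood_gt0 n (f : 'rV[R]_n -> R) w : pgood f -> 0 < f w.
Proof. by case. Qed.

Lemma pgood_good n (f : 'rV[R]_n -> R) : pgood f -> good f.
Proof. by case. Qed.

Lemma pgood_cst n k : 0 < k -> pgood (fun _ : 'rV[R]_n => k).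
Proof. by move=> k0; split=> //; exact: good_cst. Qed.

Lemma dotN n (a w : 'rV[R]_n) : dot (- a) w = - dot a w.
Proof. by rewrite /dot -sumrN; apply: eq_bigr => i _; rewrite mxE mulNr. Qed.

Lemma pgood_expdot n (a : 'rV[R]_n) : pgood (fun w => expR (dot a w)).
Proof.
split=> [w||]; [exact: expR_gt0|exact: good_expdot|].
by under eq_fun do rewrite -expRN -dotN; exact: good_expdot.
Qed.

Lemma pgoodM n (f g : 'rV[R]_n -> R) : pgood f -> pgood g -> pgood (fun w => f w * g w).
Proof.
move=> [f0 gf gf'] [g0 gg gg']; split=> [w||]; [exact: mulr_gt0|exact: goodM|].
by under eq_fun do rewrite invfM; exact: goodM.
Qed.

Lemma pgoodV n (f : 'rV[R]_n -> R) : pgood f -> pgood (fun w => (f w)^-1).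
Proof.
move=> [f0 gf gf']; split=> [w||]; [by rewrite invr_gt0|exact: gf'|].
by under eq_fun do rewrite invrK.
Qed.

Lemma measurable_funV d (T : measurableType d) (f : T -> R) :
  (forall t, 0 < f t) -> measurable_fun setT f -> measurable_fun setT (fun t => (f t)^-1).
Proof.
move=> f0 mf; rewrite (_ : (fun t => _) = fun t => expR (- ln (f t))); last first.
  by apply/funext => t; rewrite expRN lnK// posrE.
apply: measurableT_comp => //; apply: measurableT_comp => //.
exact: (measurableT_comp (@measurable_ln R)).
Qed.

Lemma pgoodD n (f g : 'rV[R]_n -> R) : pgood f -> good g -> (forall w, 0 <= g w) ->
  pgood (fun w => f w + g w).
Proof.
move=> [f0 gf gf'] gg g0.
have fg0 w : 0 < f w + g w by rewrite ltr_pwDl.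
have gfg := goodD gf gg.
split=> //; apply: (good_le _ gf') => [|w].
  apply: (@measurable_funV _ _ (fun t => f (rv t) + g (rv t))) => [t|]; first exact: fg0.
  exact: good_meas gfg.
by rewrite !gtr0_norm ?invr_gt0// lef_pV2 ?posrE// lerDl.
Qed.

Lemma pgood_sum n (I : finType) (P : pred I) (f : I -> 'rV[R]_n -> R) i :
  P i -> (forall i, P i -> pgood (f i)) -> pgood (fun w => \sum_(i | P i) f i w).
Proof.
move=> Pi pf; under eq_fun do rewrite (bigD1 i)//=.
apply: pgoodD; first exact: pf.
  by apply: good_sum => j /andP[/pf[]].
by move=> w; apply: sumr_ge0 => j /andP[/pf[+ _ _] _] => /(_ w)/ltW.
Qed.

Lemma ln_le_id (x : R) : 0 < x -> ln x <= x.
Proof. by move=> x0; have := expR_ge1Dx (ln x); rewrite lnK ?posrE//; lra. Qed.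

Lemma good_ln n (f : 'rV[R]_n -> R) : pgood f -> good (fun w => ln (f w)).
Proof.
move=> [f0 gf gf']; apply: (good_le _ (goodD gf gf')) => [|w].
  exact: (measurableT_comp (@measurable_ln R) (good_meas gf)).
have fi0 : 0 < (f w)^-1 by rewrite invr_gt0.
rewrite [leRHS]gtr0_norm ?addr_gt0//.
have := ln_le_id (f0 w); have := ln_le_id fi0; rewrite lnV ?posrE// => h1 h2.
by rewrite ler_norml; have := f0 w; lra.
Qed.

Lemma good_ind n (P : 'rV[R]_n -> bool) :
  measurable_fun setT (fun t : n.-tuple R => P (rv t)) -> good (fun w => (P w)%:R).
Proof.
move=> mP; apply: (good_le _ (good_cst n 1)) => [|w]; last by case: (P w); rewrite ?normr0 ?normr1 ?ler01 ?lexx.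
rewrite (_ : _ \o _ = fun t : n.-tuple R => if P (rv t) then 1 else 0 : R); last first.
  by apply/funext => t /=; case: (P _).
exact: measurable_fun_ifT.
Qed.

Lemma Ex_expdot n (a : 'rV[R]_n) : Ex (fun w => expR (dot a w)) = expR (norm2 a / 2).
Proof.
have := @Ex_shift n (fun _ => 1) a (good_cst _ _).
rewrite Ex_cst; under [in RHS]eq_Ex do rewrite mul1r addrC expRD.
rewrite ExZ; last exact: good_expdot.
by rewrite expRN => /(congr1 ( *%R (expR (norm2 a / 2)))); rewrite mulr1 mulrA divff ?mul1r// gt_eqF ?expR_gt0.
Qed.

End gauss_real.

(** * Calculus in one variable *)

Section calculus.
Context {R : realType}.
Implicit Types (f g : R -> R) (x a b : R).

Definition der f x l := is_derive x 1 f l.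

Lemma der_eq f x l l' : der f x l -> l = l' -> der f x l'.
Proof. by move=> h <-. Qed.

Lemma der_cst k x : der (fun _ => k) x 0.
Proof. exact: is_derive_cst. Qed.

Lemma der_id x : der (fun y => y) x 1.
Proof. exact: is_derive_id. Qed.

Lemma derD f g x a b : der f x a -> der g x b -> der (fun y => f y + g y) x (a + b).
Proof. exact: is_deriveD. Qed.

Lemma derN f x a : der f x a -> der (fun y => - f y) x (- a).
Proof. exact: is_deriveN. Qed.

Lemma derB f g x a b : der f x a -> der g x b -> der (fun y => f y - g y) x (a - b).
Proof. exact: is_deriveB. Qed.

Lemma derM f g x a b : der f x a -> der g x b -> der (fun y => f y * g y) x (a * g x + f x * b).
Proof. by move=> da db; apply: der_eq (is_deriveM da db) _; rewrite /GRing.scale/=; ring. Qed.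

Lemma derZ k f x a : der f x a -> der (fun y => k * f y) x (k * a).
Proof. by move=> da; apply: der_eq (derM (der_cst k x) da) _; ring. Qed.

Lemma derX n f x a : der f x a -> der (fun y => f y ^+ n) x (n%:R * f x ^+ n.-1 * a).
Proof.
move=> da; have := is_deriveX n da; rewrite /der (_ : f ^+ n = fun y => f y ^+ n) //.
by apply/funext => y; rewrite fctE.
Qed.

Lemma der_exp f x a : der f x a -> der (fun y => expR (f y)) x (expR (f x) * a).
Proof. by move=> da; exact: is_derive1_comp. Qed.

Lemma der_ln f x a : 0 < f x -> der f x a -> der (fun y => ln (f y)) x (a / f x).
Proof.
move=> f0 da; apply: der_eq (is_derive1_comp (is_derive1_ln f0) da) _.
by rewrite mulrC.
Qed.

Lemma derV f x a : f x != 0 -> der f x a -> der (fun y => (f y)^-1) x (- a / f x ^+ 2).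
Proof.
move=> f0 da; have dV : derivable (fun y => (f y)^-1) x 1.
  by apply: derivableV => //; case: da.
split; first exact: dV.
rewrite deriveV; [|exact: f0|by case: da].
by rewrite (@derive_val _ _ _ _ _ _ _ da) /GRing.scale/= mulrC mulrN mulNr.
Qed.

Lemma der_horner (p : {poly R}) x : der (fun y => p.[y]) x p^`().[x].
Proof. exact: is_derive_poly. Qed.

Lemma der_cont f x l : der f x l -> {for x, continuous f}.
Proof.
move=> [d _]; apply: differentiable_continuous; exact/derivable1_diffP.
Qed.

Lemma der_incr f f' a b : a <= b -> (forall x, a <= x <= b -> der f x (f' x)) ->
  (forall x, a <= x <= b -> 0 <= f' x) -> f a <= f b.
Proof.
move=> ab df f0.
have cf : {within `[a, b], continuous f}.
  apply: continuous_in_subspaceT => x; rewrite inE/= in_itv/= => xab.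
  exact: der_cont (df _ xab).
have dfo x : x \in `]a, b[ -> is_derive x 1 f (f' x).
  by rewrite in_itv/= => /andP[/ltW ax /ltW xb]; apply: df; rewrite ax xb.
have [c] := MVT_segment ab dfo cf.
rewrite in_itv/= => cab h; rewrite -subr_ge0 h mulr_ge0 ?subr_ge0//; exact: f0.
Qed.

Lemma der_decr f f' a b : a <= b -> (forall x, a <= x <= b -> der f x (f' x)) ->
  (forall x, a <= x <= b -> f' x <= 0) -> f b <= f a.
Proof.
move=> ab df f0; rewrite -lerN2.
apply: (@der_incr (fun y => - f y) (fun y => - f' y)) => // x xab.
  exact: derN (df _ xab).
by rewrite oppr_ge0 f0.
Qed.

(** The difference of the two sides vanishes at 0 and has derivative y^3 / (1 + y), whose sign is
    that of y. *)
Lemma ln1D_le (t : R) : -1 < t -> ln (1 + t) <= t - t ^+ 2 / 2 + t ^+ 3 / 3.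
Proof.
move=> t1.
pose f (y : R) : R := y - y ^+ 2 / 2 + y ^+ 3 / 3 - ln (1 + y).
have df (y : R) : -1 < y -> der f y (y ^+ 3 / (1 + y)).
  move=> y1; have y0 : 0 < 1 + y by lra.
  apply: der_eq.
    apply: derB.
      apply: derD.
        apply: derB; first exact: der_id.
        under eq_fun do rewrite mulrC.
        by apply: derZ; apply: derX; exact: der_id.
      under eq_fun do rewrite mulrC.
      by apply: derZ; apply: derX; exact: der_id.
    apply: (@der_ln (fun y => 1 + y) y (0 + 1)); first exact: y0.
    exact: derD (der_cst _ _) (der_id _).
  by rewrite /=; field; lra.
have f0 : f 0 = 0 by rewrite /f !expr0n/= !mul0r !addr0 ln1 !subr0.
suff : 0 <= f t by rewrite /f; lra.
rewrite -f0; case: (leP 0 t) => t0.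
  apply: (@der_incr f (fun y => y ^+ 3 / (1 + y))) => [|y /andP[y0 yt]|y /andP[y0 yt]]; [exact: t0|by apply: df; lra|].
  by rewrite divr_ge0 ?exprn_ge0//; lra.
apply: (@der_decr f (fun y => y ^+ 3 / (1 + y))) => [|y /andP[y0 yt]|y /andP[y0 yt]]; [lra|by apply: df; lra|].
by rewrite pmulr_lle0 ?invr_gt0 ?exprn_odd_le0//; lra.
Qed.

Lemma expR_ge2 (y : R) : 0 <= y -> 1 + y + y ^+ 2 / 2 <= expR y.
Proof.
move=> y0; pose f x := expR x - (1 + x + x ^+ 2 / 2).
have df x : der f x (expR x - (1 + x)).
  apply: der_eq.
    apply: derB; first exact: is_derive_expR.
    apply: derD.
      by apply: derD; [exact: der_cst|exact: der_id].
    under eq_fun do rewrite mulrC.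
    by apply: derZ; apply: derX; exact: der_id.
  by rewrite /=; field.
have : f 0 <= f y.
  apply: (@der_incr f (fun x => expR x - (1 + x))) => [|x _|x _]; [exact: y0|exact: df|].
  by rewrite subr_ge0 expR_ge1Dx.
by rewrite /f expR0 expr0n/=; lra.
Qed.

(** Converts a second moment into exponential moments, which are explicit for Gaussian vectors. *)
Lemma sqr_le_cosh (x : R) : x ^+ 2 <= expR x + expR (- x) - 2.
Proof.
wlog x0 : x / 0 <= x.
  move=> h; case: (leP 0 x) => x0; first exact: h.
  have := h (- x); rewrite sqrrN opprK => /(_ _) {}h; have : 0 <= - x by lra.
  by move=> /h; lra.
pose y := x / 2; have -> : x = 2 * y by rewrite /y; field.
have y0 : 0 <= y by rewrite /y; lra.
have e1 := expR_ge2 y0.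
have -> : expR (2 * y) = expR y ^+ 2 by rewrite -expRM_natl mulrC.
have -> : expR (- (2 * y)) = (expR y ^+ 2)^-1 by rewrite expRN -expRM_natl mulrC.
have e0 := expR_gt0 y; set e := expR y in e1 e0 *.
have h : 2 * y * e <= e ^+ 2 - 1 by have := sqr_ge0 (y ^+ 2); nra.
have h1 : 0 <= e ^+ 2 - 1 by have := mulr_ge0 y0 (ltW e0); lra.
have h2 : (2 * y * e) ^+ 2 <= (e ^+ 2 - 1) ^+ 2.
  by rewrite ler_sqr// nnegrE; have := mulr_ge0 y0 (ltW e0); lra.
have e20 : 0 < e ^+ 2 by rewrite exprn_gt0.
rewrite -(ler_pM2r e20).
have -> : (e ^+ 2 + (e ^+ 2)^-1 - 2) * e ^+ 2 = (e ^+ 2 - 1) ^+ 2 by field; lra.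
by move: h2; rewrite exprMn.
Qed.

(* The cubic term of the Taylor expansion is absorbed in the quadratic and quartic ones. *)
Lemma xlnx_le (eta t : R) : 0 < eta <= 1 -> -1 < t ->
  (1 + t) * ln (1 + t) <= t + (1 + eta) / 2 * t ^+ 2 + eta^-1 * t ^+ 4.
Proof.
move=> /andP[e0 e1] t1; have t0 : 0 <= 1 + t by lra.
apply: le_trans (ler_wpM2l t0 (ln1D_le t1)) _.
have ei : 1 <= eta^-1 by rewrite invf_ge1.
have h := sqr_ge0 (eta * t + t ^+ 2 / 3).
have t4 : 0 <= t ^+ 4 by rewrite exprn_even_ge0.
have : - t ^+ 3 / 6 <= eta / 2 * t ^+ 2 + eta^-1 * (t ^+ 4 / 18).
  rewrite -(ler_pM2r e0) mulrDl [eta^-1 * _]mulrC mulfVK; last lra.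
  have : 0 <= (eta * t + t ^+ 2 / 3) ^+ 2 / 2 by rewrite divr_ge0.
  have : (eta * t + t ^+ 2 / 3) ^+ 2 / 2 = eta ^+ 2 * t ^+ 2 / 2 + eta * t ^+ 3 / 3 + t ^+ 4 / 18 by field.
  have : 0 <= (eta * t / 2 + t ^+ 2 / 3) ^+ 2 by exact: sqr_ge0.
  have : (eta * t / 2 + t ^+ 2 / 3) ^+ 2 = eta ^+ 2 * t ^+ 2 / 4 + eta * t ^+ 3 / 3 + t ^+ 4 / 9 by field.
  have : 0 <= eta ^+ 2 * t ^+ 2 by rewrite mulr_ge0 ?sqr_ge0.
  have -> : - t ^+ 3 / 6 * eta = - (eta * t ^+ 3 / 6) by ring.
  have -> : eta / 2 * t ^+ 2 * eta = eta ^+ 2 * t ^+ 2 / 2 by ring.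
  by lra.
have : t ^+ 4 <= eta^-1 * t ^+ 4 by rewrite ler_peMl.
have -> : (1 + t) * (t - t ^+ 2 / 2 + t ^+ 3 / 3) = t + t ^+ 2 / 2 - t ^+ 3 / 6 + t ^+ 4 / 3 by field.
by lra.
Qed.

End calculus.

(** * Gaussian moments *)

Section gauss_moments.
Context {R : realType}.

Lemma dotC n (u v : 'rV[R]_n) : dot u v = dot v u.
Proof. by apply: eq_bigr => i _; rewrite mulrC. Qed.

Lemma dotDl n (u v w : 'rV[R]_n) : dot (u + v) w = dot u w + dot v w.
Proof. by rewrite /dot -big_split; apply: eq_bigr => i _; rewrite mxE mulrDl. Qed.

Lemma dotZl n k (u v : 'rV[R]_n) : dot (k *: u) v = k * dot u v.
Proof. by rewrite /dot mulr_sumr; apply: eq_bigr => i _; rewrite mxE mulrA. Qed.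

Lemma dotDr n (u v w : 'rV[R]_n) : dot w (u + v) = dot w u + dot w v.
Proof. by rewrite !(dotC w) dotDl. Qed.

Lemma dotZr n k (u v : 'rV[R]_n) : dot u (k *: v) = k * dot u v.
Proof. by rewrite !(dotC u) dotZl. Qed.

Lemma dotNr n (u v : 'rV[R]_n) : dot u (- v) = - dot u v.
Proof. by rewrite !(dotC u) dotN. Qed.

Lemma dotBl n (u v w : 'rV[R]_n) : dot (u - v) w = dot u w - dot v w.
Proof. by rewrite dotDl dotN. Qed.

Lemma dotBr n (u v w : 'rV[R]_n) : dot w (u - v) = dot w u - dot w v.
Proof. by rewrite dotDr dotNr. Qed.

Lemma dot0l n (w : 'rV[R]_n) : dot 0 w = 0.
Proof. by rewrite /dot big1// => i _; rewrite mxE mul0r. Qed.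

Lemma dot_suml n (I : Type) (r : seq I) (P : pred I) (u : I -> 'rV[R]_n) (w : 'rV[R]_n) :
  dot (\sum_(i <- r | P i) u i) w = \sum_(i <- r | P i) dot (u i) w.
Proof. by elim/big_rec2: _ => [|i x y _ <-]; rewrite ?dot0l ?dotDl. Qed.

Lemma norm2E n (u : 'rV[R]_n) : norm2 u = dot u u.
Proof. by apply: eq_bigr => i _; rewrite expr2. Qed.

Lemma norm2_ge0 n (u : 'rV[R]_n) : 0 <= norm2 u.
Proof. by apply: sumr_ge0 => i _; exact: sqr_ge0. Qed.

Lemma norm2Z n k (u : 'rV[R]_n) : norm2 (k *: u) = k ^+ 2 * norm2 u.
Proof. by rewrite !norm2E dotZl dotZr mulrA expr2. Qed.

Lemma norm2B n (u v : 'rV[R]_n) : norm2 (u - v) = norm2 u + norm2 v - 2 * dot u v.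
Proof. by rewrite !norm2E !(dotBl, dotBr) (dotC v u); ring. Qed.

Lemma norm2D n (u v : 'rV[R]_n) : norm2 (u + v) = norm2 u + norm2 v + 2 * dot u v.
Proof. by rewrite !norm2E !(dotDl, dotDr) (dotC v u); ring. Qed.

Lemma dot_unit n (u v : 'rV[R]_n) : norm2 u = 1 -> norm2 v = 1 -> `|dot u v| <= 1.
Proof.
move=> u1 v1; have := norm2_ge0 (u - v); have := norm2_ge0 (u + v).
by rewrite norm2B norm2D u1 v1 ler_norml; lra.
Qed.

Lemma good_rsub n m (f : 'rV[R]_m -> R) : good f -> good (fun w : 'rV[R]_(n + m) => f (rsubmx w)).
Proof.
apply: (@good_comp _ _ _ _ _ 1) => [//|j|w].
- by under eq_fun do rewrite !mxE; exact: measurable_tnth.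
- by have := norm1_split w; have := norm1_ge0 (lsubmx w); lra.
Qed.

Lemma Ex_prod n m (f : 'rV[R]_n -> R) (g : 'rV[R]_m -> R) : good f -> good g ->
  Ex (fun w : 'rV[R]_(n + m) => f (lsubmx w) * g (rsubmx w)) = Ex f * Ex g.
Proof.
move=> gf gg.
move: f gf; apply: good_ge0_ind => [f gf f0|f h gf gh Ef Eh]; last first.
  under eq_Ex do rewrite mulrBl.
  rewrite !ExB// ?Ef ?Eh ?mulrBl//; apply: goodM; solve [exact: good_lsub|exact: good_rsub].
move: g gg; apply: good_ge0_ind => [g gg g0|g h gg gh Eg Eh]; last first.
  under eq_Ex do rewrite mulrBr.
  rewrite !ExB// ?Eg ?Eh ?mulrBr//; apply: goodM; solve [exact: good_lsub|exact: good_rsub].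
have gfg : good (fun w : 'rV[R]_(n + m) => f (lsubmx w) * g (rsubmx w)).
  by apply: goodM; [exact: good_lsub|exact: good_rsub].
apply: EFin_inj; rewrite EFinM (ExE gfg).
rewrite (gauss_split (good_mfun gfg)); last by move=> v; rewrite lee_fin mulr_ge0.
under eq_integral.
  move=> t _; under eq_integral do rewrite row_mxKl row_mxKr EFinM.
  rewrite ge0_integralZl//; last 3 first.
  - exact: (good_mfun gg).
  - by move=> u _; rewrite lee_fin.
  - by rewrite lee_fin.
  rewrite -(ExE gg); over.
rewrite ge0_integralZr//; last 3 first.
- exact: (good_mfun gf).
- by move=> u _; rewrite lee_fin.
- by rewrite lee_fin Ex_ge0.
by rewrite -(ExE gf).
Qed.

(** Rotation invariance with the rational pair (3/5, 4/5) shows that the mean m satisfies m = 3/5 m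
    + 4/5 m, hence m = 0. *)
Lemma Ex_dot n (a : 'rV[R]_n) : Ex (fun w => dot a w) = 0.
Proof.
have gd := good_dot a.
have h1 : 0 < 3 / 5 :> R by lra.
have h2 : (3 / 5) ^+ 2 + (4 / 5) ^+ 2 = 1 :> R by field.
have := Ex_rot h1 h2 gd; under eq_Ex do rewrite dotDr !dotZr.
have -> : Ex (fun w : 'rV[R]_(n + n) => 3 / 5 * dot a (rsubmx w) + 4 / 5 * dot a (lsubmx w)) =
   3 / 5 * Ex (fun w => dot a w) + 4 / 5 * Ex (fun w => dot a w).
  rewrite ExD; [|by apply: goodZ; exact: (good_rsub _ gd)|by apply: goodZ; exact: (good_lsub _ gd)].
  rewrite !ExZ; [|exact: (good_lsub _ gd)|exact: (good_rsub _ gd)].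
  rewrite (Ex_lsub _ gd); congr (_ * _ + _).
  have := @Ex_prod n n (fun _ => 1) _ (good_cst _ _) gd.
  by rewrite Ex_cst mul1r => <-; apply: eq_Ex => w; rewrite mul1r.
by lra.
Qed.

Lemma expR_le_inv (y : R) : y < 1 -> expR y <= (1 - y)^-1.
Proof.
move=> y1; rewrite -[expR y]invrK -expRN lef_pV2 ?posrE ?expR_gt0//; last lra.
by have := expR_ge1Dx (- y).
Qed.

(** Bounding x^2 by exponentials at scale sqrt t gives (1 - t [norm2 a] / 2) E <= [norm2 a] for
    every small t > 0; the claim is the limit t -> 0. *)
Lemma Ex_dot_sqr_le n (a : 'rV[R]_n) : Ex (fun w => dot a w ^+ 2) <= norm2 a.
Proof.
have a0 := norm2_ge0 a; set E := Ex _.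
have gd2 : good (fun w => dot a w ^+ 2).
  by under eq_fun do rewrite expr2; apply: goodM; exact: good_dot.
have E0 : 0 <= E by apply: Ex_ge0 => w; exact: sqr_ge0.
have key (t : R) : 0 < t -> t * norm2 a / 2 < 1 -> (1 - t * norm2 a / 2) * E <= norm2 a.
  move=> t0 t1; pose s := Num.sqrt t; have s0 : 0 < s by rewrite sqrtr_gt0.
  have s2 : s ^+ 2 = t by rewrite sqr_sqrtr ?ltW.
  have g1 := good_expdot (s *: a); have g2 := good_expdot (- (s *: a)).
  have : Ex (fun w => t * dot a w ^+ 2) <= Ex (fun w => expR (dot (s *: a) w) + expR (dot (- (s *: a)) w) - 2).
    apply: le_Ex => [||w]; first exact: goodZ.
      by apply: goodB; [exact: goodD|exact: good_cst].
    by have := sqr_le_cosh (s * dot a w); rewrite dotN dotZl exprMn s2.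
  rewrite ExZ// ExB; [|exact: goodD|exact: good_cst].
  rewrite ExD// Ex_cst !Ex_expdot -scaleNr !norm2Z sqrrN s2.
  have := expR_le_inv t1; set y := t * norm2 a / 2 in t1 *.
  have y1 : 0 < 1 - y by lra.
  move=> e1 e2; have : t * E <= 2 * (y / (1 - y)).
    have -> : y / (1 - y) = (1 - y)^-1 - 1 by field; lra.
    by rewrite /E; lra.
  rewrite mulrA ler_pdivlMr// => e3.
  rewrite -(ler_pM2l t0); have -> : t * norm2 a = 2 * y by rewrite /y; field.
  by rewrite mulrCA mulrA mulrC mulrA in e3 *; nra.
case: (ltP (norm2 a) E) => // h; exfalso.
have E1 : 0 < E by apply: le_lt_trans h.
have a2 : 0 < norm2 a + 1 by lra.
(* Small enough that (1 - y) E still exceeds [norm2 a]. The parameter t is then 2 y / ([norm2 a] +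
   1), where the 1 avoids dividing by a zero norm. *)
pose y := Num.min 1 ((E - norm2 a) / E) / 2.
have yE : 0 < (E - norm2 a) / E by apply: divr_gt0 => //; lra.
have y0 : 0 < y by rewrite /y divr_gt0// lt_min yE ltr01.
have y1 : y <= 2^-1 by rewrite /y ler_pdivrMr// mulVf// ge_min lexx.
have y2 : y < (E - norm2 a) / E.
  have : Num.min 1 ((E - norm2 a) / E) <= (E - norm2 a) / E by rewrite ge_min lexx orbT.
  by rewrite /y; lra.
have := key (2 * y / (norm2 a + 1)).
have -> : 2 * y / (norm2 a + 1) * norm2 a / 2 = y * (norm2 a / (norm2 a + 1)) by field; lra.
have r1 : norm2 a / (norm2 a + 1) <= 1 by rewrite ler_pdivrMr//; lra.
have r0 : 0 <= norm2 a / (norm2 a + 1) by rewrite divr_ge0//; lra.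
set r := _ / _ in r1 r0 *.
have yr : y * r <= y by rewrite ler_piMr// ltW.
move=> /(_ _ _)/wrap[]; first by rewrite divr_gt0// mulr_gt0.
  by lra.
apply/negP; rewrite -ltNge.
move: y2; rewrite ltr_pdivlMr//; nra.
Qed.

Lemma Ex_norm2_le n : Ex (@norm2 R n) <= n%:R.
Proof.
have dE i (w : 'rV[R]_n) : dot (delta_mx 0 i) w = w 0 i.
  rewrite /dot (bigD1 i)//= mxE !eqxx/= mul1r big1 ?addr0// => j /negbTE ji.
  by rewrite mxE eqxx/= ji mul0r.
rewrite (_ : Ex _ = Ex (fun w : 'rV[R]_n => \sum_(i < n) dot (delta_mx 0 i) w ^+ 2)); last first.
  by apply: eq_Ex => w; apply: eq_bigr => i _; rewrite dE.
rewrite Ex_sum; last by move=> i _; under eq_fun do rewrite expr2; apply: goodM; exact: good_dot.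
have -> : n%:R = \sum_(i < n) 1 :> R by rewrite sumr_const card_ord.
apply: ler_sum => i _.
apply: le_trans (Ex_dot_sqr_le _) _.
by rewrite norm2E dE mxE !eqxx.
Qed.

End gauss_moments.

(** * Conditional entropy and mean square error in Gaussian noise *)

Section weighted.
Context {R : realType} (I : finType) (D : {set I}).

Lemma wmean_sqr (p y : I -> R) : (forall i, i \in D -> 0 <= p i) -> \sum_(i in D) p i = 1 ->
  (\sum_(i in D) p i * y i) ^+ 2 <= \sum_(i in D) p i * y i ^+ 2.
Proof.
move=> p0 p1; set m := \sum_(i in D) _.
have : 0 <= \sum_(i in D) p i * (y i - m) ^+ 2.
  by apply: sumr_ge0 => i iD; rewrite mulr_ge0 ?sqr_ge0 ?p0.
have -> : \sum_(i in D) p i * (y i - m) ^+ 2 =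
   \sum_(i in D) p i * y i ^+ 2 - 2 * m * m + m ^+ 2 * \sum_(i in D) p i.
  have -> : 2 * m * m = \sum_(i in D) 2 * m * (p i * y i) by rewrite -mulr_sumr.
  by rewrite [m ^+ 2 * _]mulr_sumr -sumrB -big_split; apply: eq_bigr => i _ /=; ring.
by rewrite p1; nra.
Qed.

Lemma wmean_pow4 (p y : I -> R) : (forall i, i \in D -> 0 <= p i) -> \sum_(i in D) p i = 1 ->
  (\sum_(i in D) p i * y i) ^+ 4 <= \sum_(i in D) p i * y i ^+ 4.
Proof.
move=> p0 p1; have h := wmean_sqr (fun i => y i ^+ 2) p0 p1.
have h' := wmean_sqr y p0 p1.
rewrite (exprM _ 2 2); apply: (@le_trans _ _ ((\sum_(i in D) p i * y i ^+ 2) ^+ 2)).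
  by rewrite ler_sqr// nnegrE ?sqr_ge0// sumr_ge0// => i iD; rewrite mulr_ge0 ?sqr_ge0 ?p0.
by under [leRHS]eq_bigr do rewrite (exprM _ 2 2).
Qed.

(** As 1 - <x_i, x_j> is half a squared distance, the left side is the weighted variance of the
    points, and the weighted mean minimizes the right side over y. *)
Lemma wvar_le n (x : I -> 'rV[R]_n) (l : I -> R) (y : 'rV[R]_n) :
  (forall i, i \in D -> norm2 (x i) = 1) ->
  0 < \sum_(i in D) l i ->
  \sum_(i in D) \sum_(j in D) l i * l j / (\sum_(k in D) l k) * (1 - dot (x i) (x j)) <=
  \sum_(i in D) l i * norm2 (x i - y).
Proof.
move=> x1; set La := \sum_(k in D) l k => La0.
pose m := \sum_(i in D) l i *: x i.
have -> : \sum_(i in D) \sum_(j in D) l i * l j / La * (1 - dot (x i) (x j)) = La - norm2 m / La.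
  have e1 i : \sum_(j in D) l i * l j / La * (1 - dot (x i) (x j)) = l i - l i * dot (x i) m / La.
    rewrite dotC /m dot_suml -[X in X - _](@mulfK _ La) ?gt_eqF// {2}/La !mulr_sumr !mulr_suml -sumrB.
    by apply: eq_bigr => j _; rewrite dotZl (dotC (x j)); ring.
  under eq_bigr do rewrite e1.
  by rewrite sumrB norm2E {2}/m dot_suml mulr_suml; congr (_ - _); apply: eq_bigr => i _; rewrite dotZl.
have -> : \sum_(i in D) l i * norm2 (x i - y) = La - 2 * dot m y + La * norm2 y.
  rewrite /La /m dot_suml mulr_sumr mulr_suml -sumrB -big_split; apply: eq_bigr => i iD /=.
  by rewrite norm2B x1// dotZl; ring.
rewrite -subr_ge0.
have -> : La - 2 * dot m y + La * norm2 y - (La - norm2 m / La) = La * norm2 (y - La^-1 *: m).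
  by rewrite norm2B norm2Z dotZr (dotC y); field; rewrite gt_eqF.
by rewrite mulr_ge0 ?norm2_ge0// ltW.
Qed.

End weighted.

(** With g = k d, one step multiplies 1 - g V / m by at least 1 / (1 + d V / m); then ln (1 + u) <=
    u bounds the loss of its logarithm by d V / m. *)
Lemma chain_arith {R : realType} (m d V V' k : R) : 0 < m -> 0 < d -> 0 <= V -> 0 <= k ->
  V' <= m * V / (m + d * V) -> 0 < 1 - k * d * V / m ->
  0 < 1 - (k * d + d) * V' / m /\
  m / 2 * ln (1 - k * d * V / m) - d / 2 * V <= m / 2 * ln (1 - (k * d + d) * V' / m).
Proof.
move=> m0 d0 V0 k0 h2 ih1.
have dV0 : 0 <= d * V by rewrite mulr_ge0// ltW.
have D0 : 0 < m + d * V by lra.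
have D1' : 0 <= d * V / m by rewrite divr_ge0// ltW.
have D1 : 0 < 1 + d * V / m by lra.
have kd0 : 0 <= k * d by rewrite mulr_ge0// ltW.
have key : (1 - k * d * V / m) / (1 + d * V / m) <= 1 - (k * d + d) * V' / m.
  have : (k * d + d) * V' / m <= (k * d + d) * (m * V / (m + d * V)) / m.
    apply: ler_wpM2r; first by rewrite invr_ge0 ltW.
    by apply: ler_wpM2l; [lra|exact: h2].
  have -> : (1 - k * d * V / m) / (1 + d * V / m) =
     1 - (k * d + d) * (m * V / (m + d * V)) / m.
    by field; rewrite !gt_eqF.
  by lra.
set A := 1 - k * d * V / m in ih1 key *; set B := 1 + d * V / m in D1 key *.
set C := 1 - (k * d + d) * V' / m in key *.
have P0 : 0 < A / B by exact: divr_gt0.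
have P1 := lt_le_trans P0 key; split; first exact: P1.
have lnk : ln A - d * V / m <= ln C.
  apply: (@le_trans _ _ (ln (A / B))); last by rewrite ler_ln.
  rewrite ln_div// lerD2l lerN2; apply: le_ln1Dx; lra.
have m2 : 0 <= m / 2 by lra.
have := ler_wpM2l m2 lnk.
have -> : m / 2 * (ln A - d * V / m) = m / 2 * ln A - d / 2 * V by field; rewrite gt_eqF.
by [].
Qed.

Lemma ent_arith {R : realType} (A A' g d eta V : R) : 0 < d -> 0 < eta <= 1 -> 0 <= V ->
  A' <= A + ((1 + eta) / 2 * (d * (1 - V) + 2 * d ^+ 2) + eta^-1 * (84 * d ^+ 2)) ->
  A' - (g + d) / 2 <= A - g / 2 - d / 2 * V + (eta * d / 2 + 86 * d ^+ 2 / eta).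
Proof.
move=> d0 /andP[eta0 eta1] V0.
have e1 : d ^+ 2 <= d ^+ 2 / eta by rewrite ler_peMr ?sqr_ge0// invf_ge1.
have e2 : eta * d ^+ 2 <= d ^+ 2 by rewrite ler_piMl ?sqr_ge0.
have e3 : 0 <= eta * d * V by rewrite mulr_ge0// mulr_ge0// ltW.
have -> : 86 * d ^+ 2 / eta = 86 * (d ^+ 2 / eta) by ring.
have -> : eta^-1 * (84 * d ^+ 2) = 84 * (d ^+ 2 / eta) by ring.
have -> : (1 + eta) / 2 * (d * (1 - V) + 2 * d ^+ 2) =
  d / 2 - d / 2 * V + eta * d / 2 - eta * d * V / 2 + d ^+ 2 + eta * d ^+ 2 by field.
by lra.
Qed.

Lemma ent_arith2 {R : realType} (K K' L v k e A A' : R) :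
  K <= L + A + k * e -> K' <= K - v + e -> A - v <= A' -> K' <= L + A' + (k + 1) * e.
Proof. by rewrite mulrDl mul1r; lra. Qed.

Section channel.
Context {R : realType} (n : nat) (I : finType) (D : {set I}) (x : I -> 'rV[R]_n) (i0 : I).
Implicit Types g d eta : R.
Hypothesis n0 : (0 < n)%N.
Hypothesis x1 : forall i, i \in D -> norm2 (x i) = 1.
Hypothesis i0D : i0 \in D.

(* An index i, uniform in D, is observed through y = sqrt g x_i + W: [lik] is the density of y
   given i relative to the law of W, and [cond_ent] the entropy of i given y. *)
Definition lik (g : R) (i : I) (w : 'rV[R]_n) : R := expR (dot (Num.sqrt g *: x i) w - g / 2).
Definition liks g w := \sum_(i in D) lik g i w.
(** The mean square error of the posterior mean, written as half the mean squared distance of two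
    independent posterior samples; this form can later be compared with distances between
    codewords. *)
Definition mmse g : R := #|D|%:R^-1 * Ex (fun w =>
  \sum_(i in D) \sum_(j in D) lik g i w * lik g j w / liks g w * (1 - dot (x i) (x j))).
Definition cond_ent g : R := #|D|%:R^-1 * Ex (fun w => liks g w * ln (liks g w)) - g / 2.

Lemma cardD_gt0 : 0 < #|D|%:R :> R.
Proof. by rewrite ltr0n; apply/card_gt0P; exists i0. Qed.

Lemma lik_gt0 g i w : 0 < lik g i w. Proof. exact: expR_gt0. Qed.

Lemma pgood_lik g i : pgood (lik g i).
Proof.
rewrite /lik; under eq_fun do rewrite expRD; apply: pgoodM; first exact: pgood_expdot.
by apply: pgood_cst; exact: expR_gt0.
Qed.

Lemma good_lik g i : good (lik g i). Proof. exact: pgood_good (pgood_lik _ _). Qed.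

Lemma pgood_liks g : pgood (liks g).
Proof. by apply: (pgood_sum i0D) => i _; exact: pgood_lik. Qed.

Lemma good_liks g : good (liks g). Proof. exact: pgood_good (pgood_liks _). Qed.

Lemma liks_gt0 g w : 0 < liks g w. Proof. exact: pgood_gt0 (pgood_liks g). Qed.

Lemma good_ratio g i j : good (fun w => lik g i w * lik g j w / liks g w).
Proof.
apply: pgood_good; apply: pgoodM; last exact/pgoodV/pgood_liks.
by apply: pgoodM; exact: pgood_lik.
Qed.

Lemma Ex_likX g i k : 0 <= g -> i \in D ->
  Ex (fun w => lik g i w ^+ k) = expR (g * (k%:R * (k%:R - 1) / 2)).
Proof.
move=> g0 iD.
rewrite (_ : Ex _ = Ex (fun w => expR (- (k%:R * g / 2)) * expR (dot ((k%:R * Num.sqrt g) *: x i) w))).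
  rewrite ExZ; last exact: good_expdot.
  rewrite Ex_expdot -expRD norm2Z x1// exprMn sqr_sqrtr//; by congr expR; field.
apply: eq_Ex => w; rewrite -expRD /lik -expRM_natl; congr expR.
by rewrite !dotZl; field.
Qed.

Lemma Ex_lik g i : 0 <= g -> i \in D -> Ex (lik g i) = 1.
Proof.
move=> g0 iD; have := Ex_likX 1 g0 iD; rewrite subrr mulr0 mul0r mulr0 expR0 => <-.
by apply: eq_Ex => w; rewrite expr1.
Qed.

Lemma Ex_lik2 g i j : 0 <= g -> i \in D -> j \in D ->
  Ex (fun w => lik g i w * lik g j w) = expR (g * dot (x i) (x j)).
Proof.
move=> g0 iD jD.
rewrite (_ : Ex _ = Ex (fun w => expR (- g) * expR (dot (Num.sqrt g *: (x i + x j)) w))).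
  rewrite ExZ; last exact: good_expdot.
  rewrite Ex_expdot -expRD norm2Z norm2D !x1// sqr_sqrtr//; by congr expR; field.
apply: eq_Ex => w; rewrite -!expRD /lik; congr expR.
by rewrite !dotZl dotDl; field.
Qed.

Lemma Ex_liks g : 0 <= g -> Ex (liks g) = #|D|%:R.
Proof.
move=> g0; rewrite Ex_sum; last by move=> i _; exact: good_lik.
by under eq_bigr => i iD do rewrite (Ex_lik g0 iD); rewrite sumr_const.
Qed.

Lemma Ex_lik_shift g i (f : 'rV[R]_n -> R) : 0 <= g -> i \in D -> good f ->
  Ex (fun w => f w * lik g i w) = Ex (fun w => f (w + Num.sqrt g *: x i)).
Proof.
move=> g0 iD gf; rewrite (Ex_shift _ gf); apply: eq_Ex => w.
by rewrite /lik norm2Z x1// sqr_sqrtr// mulr1.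
Qed.

Lemma mmse_dot g : 0 <= g -> mmse g = 1 - #|D|%:R^-1 *
  (\sum_(i in D) \sum_(j in D) Ex (fun w => lik g i w * lik g j w / liks g w) * dot (x i) (x j)).
Proof.
move=> g0; rewrite /mmse.
have -> : Ex (fun w => \sum_(i in D) \sum_(j in D) lik g i w * lik g j w / liks g w * (1 - dot (x i) (x j)))
  = Ex (fun w => liks g w - \sum_(i in D) \sum_(j in D) dot (x i) (x j) * (lik g i w * lik g j w / liks g w)).
  apply: eq_Ex => w; rewrite {2}/liks -sumrB; apply: eq_bigr => i _.
  rewrite -[X in X - _](@mulfK _ (liks g w)) ?gt_eqF ?liks_gt0// {2}/liks mulr_sumr mulr_suml.
  by rewrite -sumrB; apply: eq_bigr => j _; rewrite mulrBr mulr1; congr (_ - _); rewrite mulrC.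
rewrite ExB; [|exact: good_liks|]; last first.
  by apply: good_sum => i _; apply: good_sum => j _; apply: goodZ; exact: good_ratio.
rewrite Ex_liks// mulrBr mulVf ?gt_eqF ?cardD_gt0//; congr (_ - _ * _).
rewrite Ex_sum => [|i _]; last by apply: good_sum => j _; apply: goodZ; exact: good_ratio.
apply: eq_bigr => i _; rewrite Ex_sum => [|j _]; last by apply: goodZ; exact: good_ratio.
by apply: eq_bigr => j _; rewrite ExZ 1?mulrC//; exact: good_ratio.
Qed.

Lemma mmse_ge0 g : 0 <= mmse g.
Proof.
rewrite /mmse mulr_ge0 ?invr_ge0//; apply: Ex_ge0 => w.
apply: sumr_ge0 => i iD; apply: sumr_ge0 => j jD; rewrite mulr_ge0//.
  by rewrite !mulr_ge0 ?invr_ge0 ?(ltW (lik_gt0 _ _ _))// ltW// liks_gt0.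
by have := dot_unit (x1 iD) (x1 jD); rewrite ler_norml => /andP[_]; lra.
Qed.

Lemma good_mmse g : good (fun w =>
  \sum_(i in D) \sum_(j in D) lik g i w * lik g j w / liks g w * (1 - dot (x i) (x j))).
Proof.
apply: good_sum => i _; apply: good_sum => j _; apply: goodM; [exact: good_ratio|exact: good_cst].
Qed.

Lemma mmse_center g B y0 : 0 <= g -> 0 <= B -> (forall i, i \in D -> norm2 (x i - y0) <= B) ->
  mmse g <= B * n%:R / (n%:R + g * B).
Proof.
move=> g0 B0 hB; have N0 := cardD_gt0; have nn0 : 0 < n%:R :> R by rewrite ltr0n.
have den : 0 < n%:R + g * B by rewrite ltr_pwDl// mulr_ge0.
(* The gain of the optimal linear estimator: it minimizes a^2 B + be^2 n, the spread kept around the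
   centre plus the noise let through. *)
pose al := B / (n%:R + g * B); pose a := 1 - al * g; pose be := al * Num.sqrt g.
have bg : be * Num.sqrt g = 1 - a by rewrite /be /a -mulrA -expr2 sqr_sqrtr//; ring.
have gi i : good (fun w => norm2 (x i - (a *: y0 + be *: w))).
  under eq_fun do rewrite norm2B norm2D norm2Z dotDr !dotZr !dotZl.
  apply: goodB; first apply: goodD; first exact: good_cst.
    apply: goodD; first by apply: goodD; [exact: good_cst|apply: good_scale; exact: good_norm2].
    by do 2 apply: goodZ; apply: goodZ; exact: good_dot.
  by apply: goodZ; apply: goodD; [exact: good_cst|apply: goodZ; exact: good_dot].
rewrite /mmse ler_pdivrMl//.
apply: (@le_trans _ _ (Ex (fun w => \sum_(i in D) norm2 (x i - (a *: y0 + be *: w)) * lik g i w))).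
  apply: le_Ex; first exact: good_mmse.
    by apply: good_sum => i _; apply: goodM => //; exact: good_lik.
  move=> w; under [leRHS]eq_bigr do rewrite mulrC.
  by apply: wvar_le => //; exact: liks_gt0.
rewrite Ex_sum; last by move=> i _; apply: goodM => //; exact: good_lik.
have -> : #|D|%:R * (B * n%:R / (n%:R + g * B)) = \sum_(i in D) (B * n%:R / (n%:R + g * B)).
  by rewrite sumr_const mulr_natl.
apply: ler_sum => i iD; rewrite (Ex_lik_shift g0 iD)//.
rewrite (_ : Ex _ = Ex (fun w => a ^+ 2 * norm2 (x i - y0) + be ^+ 2 * norm2 w - 2 * a * be * dot (x i - y0) w)).
  rewrite ExB; [|by apply: goodD; [exact: good_cst|apply: goodZ; exact: good_norm2]|by apply: goodZ; exact: good_dot].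
  rewrite ExD; [|exact: good_cst|by apply: goodZ; exact: good_norm2].
  rewrite (@ExZ _ n _ _ (good_norm2 _)) (@ExZ _ n _ _ (good_dot _)) Ex_cst Ex_dot mulr0 subr0.
  have -> : B * n%:R / (n%:R + g * B) = a ^+ 2 * B + be ^+ 2 * n%:R.
    by rewrite /be exprMn sqr_sqrtr// /a /al; field; rewrite gt_eqF.
  by rewrite lerD// ler_wpM2l ?sqr_ge0 ?hB// Ex_norm2_le.
apply: eq_Ex => w.
have -> : x i - (a *: y0 + be *: (w + Num.sqrt g *: x i)) = a *: (x i - y0) - be *: w.
  rewrite scalerDr scalerA bg; apply/rowP => j; rewrite !mxE; ring.
by rewrite [LHS]norm2B !norm2Z dotZl dotZr; ring.
Qed.

(** Splits an observation of strength g + d into independent ones of strengths g and d: the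
    reference law is preserved ([Ex_comb]) and the likelihoods multiply ([lik_comb]). *)
Let comb g d (w : 'rV[R]_(n + n)) : 'rV[R]_n :=
  (Num.sqrt d / Num.sqrt (g + d)) *: rsubmx w + (Num.sqrt g / Num.sqrt (g + d)) *: lsubmx w.

Lemma lik_comb g d i w : 0 <= g -> 0 < d ->
  lik (g + d) i (comb g d w) = lik g i (lsubmx w) * lik d i (rsubmx w).
Proof.
move=> g0 d0; rewrite /lik -expRD; congr expR.
rewrite /comb dotDr !dotZr !dotZl; field; rewrite gt_eqF// sqrtr_gt0; lra.
Qed.

Lemma Ex_comb g d (f : 'rV[R]_n -> R) : 0 <= g -> 0 < d -> good f ->
  Ex f = Ex (fun w => f (comb g d w)).
Proof.
move=> g0 d0 gf; rewrite /comb Ex_rot//.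
  by rewrite divr_gt0 ?sqrtr_gt0//; lra.
rewrite !expr_div_n !sqr_sqrtr; [|lra|lra|lra]; field; lra.
Qed.

(** The posterior mean of the first observation is corrected linearly by the second one. The gain is
    the optimal one for an error V, which gives the harmonic law n V / (n + d V). *)
Lemma mmse_step g d : 0 <= g -> 0 < d ->
  mmse (g + d) <= n%:R * mmse g / (n%:R + d * mmse g).
Proof.
move=> g0 d0; have N0 := cardD_gt0; have nn0 : 0 < n%:R :> R by rewrite ltr0n.
have d0' := ltW d0.
set V := mmse g; have V0 : 0 <= V by exact: mmse_ge0.
have den : 0 < n%:R + d * V by rewrite ltr_pwDl// mulr_ge0// ltW.
pose al := V / (n%:R + d * V); pose a := 1 - al * d; pose be := al * Num.sqrt d.
have bd : be * Num.sqrt d = 1 - a by rewrite /be /a -mulrA -expr2 sqr_sqrtr ?ltW//; ring.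
pose P i j w := lik g i w * lik g j w / liks g w.
have gP i j : good (P i j) by exact: good_ratio.
have gL i := good_lik d i.
have ge i j : good (fun w => dot (x j) w * lik d i w) by apply: goodM => //; exact: good_dot.
have gn i : good (fun w => norm2 w * lik d i w) by apply: goodM => //; exact: good_norm2.
pose c i j := dot (x i) (x j).
pose m w := \sum_(j in D) (lik g j w / liks g w) *: x j.
have sumP i w : \sum_(j in D) P i j w = lik g i w.
  by rewrite /P -mulr_suml -mulr_sumr mulfK// gt_eqF// liks_gt0.
have mx i w : lik g i w * dot (m w) (x i) = \sum_(j in D) c i j * P i j w.
  rewrite /m dot_suml mulr_sumr; apply: eq_bigr => j _.
  by rewrite dotZl /c /P (dotC (x j)); ring.
have mm w : \sum_(i in D) lik g i w * norm2 (m w) = \sum_(i in D) \sum_(j in D) c i j * P i j w.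
  rewrite -mulr_suml -/(liks g w) norm2E {1}/m dot_suml mulr_sumr; apply: eq_bigr => i _.
  by rewrite dotZl -mx (dotC (x i)); field; rewrite gt_eqF// liks_gt0.
rewrite /mmse (Ex_comb g0 d0 (good_mmse _)) ler_pdivrMl//.
pose A i w := (1 + be ^+ 2 * norm2 w - 2 * be * dot (x i) w) * lik d i w.
pose M i w := lik g i w * norm2 (m w).
pose F (w : 'rV[R]_(n + n)) := \sum_(i in D) (lik g i (lsubmx w) * A i (rsubmx w)
  + a ^+ 2 * (M i (lsubmx w) * lik d i (rsubmx w)) +
  \sum_(j in D) (2 * a * be * (P i j (lsubmx w) * (dot (x j) (rsubmx w) * lik d i (rsubmx w)))
     - 2 * a * c i j * (P i j (lsubmx w) * lik d i (rsubmx w)))).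
have gA i : good (A i).
  apply: goodM => //; apply: goodB; last by apply: goodZ; exact: good_dot.
  by apply: goodD; [exact: good_cst|apply: goodZ; exact: good_norm2].
have gM i : good (M i).
  apply: goodM; first exact: good_lik.
  under eq_fun do rewrite norm2E {1}/m dot_suml.
  apply: good_sum => j _; under eq_fun do rewrite dotZl dotC /m dot_suml.
  have gr k : good (fun w => lik g k w / liks g w).
    by apply: pgood_good; apply: pgoodM; [exact: pgood_lik|exact/pgoodV/pgood_liks].
  apply: goodM => //; apply: good_sum => k _; under eq_fun do rewrite dotZl.
  by apply: goodM => //; exact: good_cst.
have g2 (f h : 'rV[R]_n -> R) : good f -> good h -> good (fun w : 'rV[R]_(n + n) => f (lsubmx w) * h (rsubmx w)).
  by move=> gf gh; apply: goodM; [exact: (good_lsub n gf)|exact: (good_rsub n gh)].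
have gF1 i j : good (fun w : 'rV[R]_(n + n) => 2 * a * be * (P i j (lsubmx w) * (dot (x j) (rsubmx w) * lik d i (rsubmx w)))).
  by apply: goodZ; exact: (g2 _ _ (gP i j) (ge i j)).
have gF2 i j : good (fun w : 'rV[R]_(n + n) => 2 * a * c i j * (P i j (lsubmx w) * lik d i (rsubmx w))).
  by apply: goodZ; exact: (g2 _ _ (gP i j) (gL i)).
have gF3 i : good (fun w : 'rV[R]_(n + n) => lik g i (lsubmx w) * A i (rsubmx w)).
  exact: (g2 _ _ (good_lik g i) (gA i)).
have gF4 i : good (fun w : 'rV[R]_(n + n) => a ^+ 2 * (M i (lsubmx w) * lik d i (rsubmx w))).
  by apply: goodZ; exact: (g2 _ _ (gM i) (gL i)).
have gF5 i : good (fun w => \sum_(j in D) (2 * a * be * (P i j (lsubmx w) * (dot (x j) (rsubmx w) * lik d i (rsubmx w)))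
     - 2 * a * c i j * (P i j (lsubmx w) * lik d i (rsubmx w)))).
  by apply: good_sum => j _; exact: (goodB (gF1 i j) (gF2 i j)).
have gFi i := goodD (goodD (gF3 i) (gF4 i)) (gF5 i).
have gF : good F by apply: good_sum => i _; exact: gFi.
apply: (@le_trans _ _ (Ex F)).
  apply: le_Ex => //; first exact: (good_lin2 _ _ (good_mmse _)).
  move=> w; pose l i := lik (g + d) i (comb g d w).
  pose y := a *: m (lsubmx w) + be *: rsubmx w.
  have := @wvar_le R I D n x l y x1 (liks_gt0 _ _).
  move=> h; apply: (le_trans h); rewrite le_eqVlt; apply/orP; left; apply/eqP.
  apply: eq_bigr => i iD /=; rewrite sumrB.
  have -> : \sum_(j in D) 2 * a * c i j * (P i j (lsubmx w) * lik d i (rsubmx w)) =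
    2 * a * (lik g i (lsubmx w) * dot (m (lsubmx w)) (x i)) * lik d i (rsubmx w).
    by rewrite mx mulr_sumr mulr_suml; apply: eq_bigr => j _; ring.
  have -> : \sum_(j in D) 2 * a * be * (P i j (lsubmx w) * (dot (x j) (rsubmx w) * lik d i (rsubmx w))) =
    2 * a * be * (lik g i (lsubmx w) * dot (m (lsubmx w)) (rsubmx w)) * lik d i (rsubmx w).
    rewrite /m dot_suml !mulr_sumr mulr_suml; apply: eq_bigr => j _.
    by rewrite dotZl /P; ring.
  rewrite /l lik_comb// /y norm2B norm2D !norm2Z dotDr !dotZr dotZl x1// (dotC (x i) (m _)) /A /M; ring.
have EL i : i \in D -> Ex (lik g i) = 1 by exact: Ex_lik.
have El i : i \in D -> Ex (lik d i) = 1 by exact: Ex_lik.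
have Ed i j : i \in D -> Ex (fun w => dot (x j) w * lik d i w) = Num.sqrt d * c i j.
  move=> iD; rewrite (Ex_lik_shift d0' iD (good_dot _)).
  under eq_Ex do rewrite dotDr.
  rewrite (ExD (good_dot _) (good_cst _ _)) Ex_dot Ex_cst add0r dotZr /c (dotC (x j)) //.
have En i : i \in D -> Ex (fun w => norm2 w * lik d i w) <= n%:R + d.
  move=> iD; rewrite (Ex_lik_shift d0' iD (good_norm2 _)).
  under eq_Ex do rewrite norm2D norm2Z x1// sqr_sqrtr// mulr1 dotC.
  rewrite ExD; [|by apply: goodD; [exact: good_norm2|exact: good_cst]|by apply: goodZ; exact: good_dot].
  rewrite (ExD (good_norm2 _) (good_cst _ _)) Ex_cst (ExZ _ (good_dot _)) Ex_dot mulr0 addr0.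
  by rewrite lerD2r Ex_norm2_le.
have EA i : i \in D -> Ex (A i) <= 1 + be ^+ 2 * (n%:R + d) - 2 * be * Num.sqrt d.
  move=> iD; rewrite (_ : Ex _ = Ex (fun w => lik d i w + be ^+ 2 * (norm2 w * lik d i w) - 2 * be * (dot (x i) w * lik d i w))).
    rewrite ExB; [|apply: goodD => //; exact: goodZ|exact: goodZ].
    rewrite ExD; [|by []|exact: goodZ].
    rewrite !ExZ// Ed// El// /c -norm2E x1// mulr1.
    by rewrite lerD2r lerD2l ler_wpM2l ?sqr_ge0 ?En.
  by apply: eq_Ex => w; rewrite /A; ring.
pose X := \sum_(i in D) \sum_(j in D) Ex (P i j) * c i j.
have VX : X = #|D|%:R * (1 - V) by rewrite /V mmse_dot// opprB addrC subrK mulrA divff ?mul1r// gt_eqF.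
have EM : \sum_(i in D) Ex (M i) = X.
  rewrite -Ex_sum => [|i _]; last exact: gM.
  under eq_Ex do rewrite mm.
  rewrite Ex_sum => [|i _]; last by apply: good_sum => j _; exact: goodZ.
  apply: eq_bigr => i _; rewrite Ex_sum => [|j _]; last exact: goodZ.
  by apply: eq_bigr => j _; rewrite ExZ// mulrC.
have -> : Ex F = \sum_(i in D) Ex (A i) + a ^+ 2 * X + (2 * a * be * Num.sqrt d - 2 * a) * X.
  rewrite -{1}EM /X !mulr_sumr -!big_split Ex_sum => [|i _]; last exact: gFi.
  apply: eq_bigr => i iD /=.
  rewrite (ExD (goodD (gF3 i) (gF4 i)) (gF5 i)) (ExD (gF3 i) (gF4 i)).
  rewrite (Ex_prod (good_lik g i) (gA i)) EL// mul1r (ExZ _ (g2 _ _ (gM i) (gL i))).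
  rewrite (Ex_prod (gM i) (gL i)) El// mulr1; congr (_ + _ + _).
  rewrite Ex_sum => [|j _]; last exact: (goodB (gF1 i j) (gF2 i j)).
  rewrite mulr_sumr; apply: eq_bigr => j _.
  rewrite (ExB (gF1 i j) (gF2 i j)) (ExZ _ (g2 _ _ (gP i j) (ge i j))) (ExZ _ (g2 _ _ (gP i j) (gL i))).
  by rewrite (Ex_prod (gP i j) (ge i j)) (Ex_prod (gP i j) (gL i)) El// Ed//; ring.
apply: (@le_trans _ _ (#|D|%:R * (1 + be ^+ 2 * (n%:R + d) - 2 * be * Num.sqrt d) + a ^+ 2 * X + (2 * a * be * Num.sqrt d - 2 * a) * X)).
  by rewrite 2!lerD2r mulr_natl -sumr_const; apply: ler_sum => i iD; exact: EA.
have -> : be ^+ 2 * (n%:R + d) = al ^+ 2 * d * n%:R + (1 - a) ^+ 2.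
  by rewrite -bd /be !exprMn sqr_sqrtr//; ring.
rewrite VX -!(mulrA _ be) bd.
have -> : #|D|%:R * (n%:R * V / (n%:R + d * V)) = #|D|%:R * (a ^+ 2 * V + al ^+ 2 * d * n%:R).
  by congr (_ * _); rewrite /a /al; field; rewrite gt_eqF.
by rewrite le_eqVlt; apply/orP; left; apply/eqP; ring.
Qed.

Lemma expR_quad (z : R) : z <= 2^-1 -> expR z <= 1 + z + 2 * z ^+ 2.
Proof.
move=> z1; have z2 : z < 1 by lra.
apply: le_trans (expR_le_inv z2) _; rewrite -[leLHS]mul1r ler_pdivrMr; last lra.
by have := sqr_ge0 z; nra.
Qed.

(** One step of the relation dH/dg = - mmse / 2, with explicit error. The likelihood sum is
    multiplied by 1 + t, where t is a posterior mean of the increments [lik d i] - 1; the second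
    moment of t yields d (1 - [mmse g]), the fourth is of order d^2, and eta absorbs the cubic
    term. *)
Lemma cond_ent_step g d eta : 0 <= g -> 0 < d <= 12^-1 -> 0 < eta <= 1 ->
  cond_ent (g + d) <= cond_ent g - d / 2 * mmse g + (eta * d / 2 + 86 * d ^+ 2 / eta).
Proof.
move=> g0 /andP[d0 d12] eta01; have N0 := cardD_gt0.
have /andP[eta0 eta1] := eta01.
have d0' := ltW d0; have V0 := mmse_ge0 g.
have d12' : d * 12 <= 1 by move: d12; rewrite -ler_pdivlMr// div1r.
pose P i j w := lik g i w * lik g j w / liks g w.
have gP i j : good (P i j) by exact: good_ratio.
pose c i j := dot (x i) (x j).
pose B i w := lik g i w * ln (liks g w).
pose q i w := lik d i w - 1.
have gL i : good (lik g i) by exact: good_lik.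
have gl i : good (lik d i) by exact: good_lik.
have gB i : good (B i) by apply: goodM => //; apply: good_ln; exact: pgood_liks.
have gq i : good (q i) by apply: goodB => //; exact: good_cst.
have gqq i j : good (fun w => q i w * q j w) by exact: goodM.
have gq4 i : good (fun w => q i w ^+ 4).
  under eq_fun do rewrite (exprM _ 2 2) !expr2; exact: goodM.
have g2 (f h : 'rV[R]_n -> R) : good f -> good h -> good (fun w : 'rV[R]_(n + n) => f (lsubmx w) * h (rsubmx w)).
  by move=> gf gh; apply: goodM; [exact: (good_lsub n gf)|exact: (good_rsub n gh)].
have gF1 i := g2 _ _ (gB i) (gl i).
have gF2 i := g2 _ _ (gL i) (gq i).
have gF3 i j := goodZ ((1 + eta) / 2) (g2 _ _ (gP i j) (gqq i j)).
have gF3' i := @good_sum R (n + n) I (index_enum I) (mem D) _ (fun j _ => gF3 i j).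
have gF4 i := goodZ eta^-1 (g2 _ _ (gL i) (gq4 i)).
have gFi i := goodD (goodD (goodD (gF1 i) (gF2 i)) (gF3' i)) (gF4 i).
pose F (w : 'rV[R]_(n + n)) := \sum_(i in D) (B i (lsubmx w) * lik d i (rsubmx w) +
   lik g i (lsubmx w) * q i (rsubmx w) +
   \sum_(j in D) (1 + eta) / 2 * (P i j (lsubmx w) * (q i (rsubmx w) * q j (rsubmx w))) +
   eta^-1 * (lik g i (lsubmx w) * q i (rsubmx w) ^+ 4)).
have gF : good F by apply: good_sum => i _; exact: gFi.
have gSS h : good (fun w => liks h w * ln (liks h w)).
  by apply: goodM; [exact: good_liks|apply: good_ln; exact: pgood_liks].
have main : Ex (fun w => liks (g + d) w * ln (liks (g + d) w)) <= Ex F.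
  rewrite (Ex_comb g0 d0 (gSS _)); apply: le_Ex => //; first exact: (good_lin2 _ _ (gSS _)).
  move=> w; set S' := liks (g + d) _; set S := liks g (lsubmx w).
  have S0 : 0 < S by exact: liks_gt0.
  have S'0 : 0 < S' by exact: liks_gt0.
  pose p i := lik g i (lsubmx w) / S.
  have p0 i : i \in D -> 0 <= p i by rewrite divr_ge0// ltW ?lik_gt0.
  have p1 : \sum_(i in D) p i = 1 by rewrite -mulr_suml divff// gt_eqF.
  pose t := \sum_(i in D) p i * q i (rsubmx w).
  have S't : S' = S * (1 + t).
    rewrite -p1 -big_split mulr_sumr; apply: eq_bigr => i iD /=; rewrite lik_comb// /p /q.
    have aux (u l k : R) : u != 0 -> l * k = u * (l / u + l / u * (k - 1)) by move=> u0; field.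
    by apply: aux; rewrite gt_eqF.
  have t1 : 0 < 1 + t by move: S'0; rewrite S't pmulr_rgt0.
  have St : S * t = \sum_(i in D) lik g i (lsubmx w) * q i (rsubmx w).
    by rewrite mulr_sumr; apply: eq_bigr => i _; rewrite /p; field; rewrite gt_eqF.
  have St2 : S * t ^+ 2 = \sum_(i in D) \sum_(j in D) P i j (lsubmx w) * (q i (rsubmx w) * q j (rsubmx w)).
    rewrite expr2 {1}/t mulr_suml mulr_sumr; apply: eq_bigr => i _.
    rewrite /t mulr_sumr mulr_sumr; apply: eq_bigr => j _; rewrite /p /P -/S.
    have aux (u a b y z : R) : u != 0 -> u * (a / u * y * (b / u * z)) = a * b / u * (y * z) by move=> u0; field.
    by apply: aux; rewrite gt_eqF.
  have St4 : S * t ^+ 4 <= \sum_(i in D) lik g i (lsubmx w) * q i (rsubmx w) ^+ 4.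
    apply: le_trans (ler_wpM2l (ltW S0) (wmean_pow4 _ p0 p1)) _.
    rewrite mulr_sumr; rewrite le_eqVlt; apply/orP; left; apply/eqP.
    by apply: eq_bigr => i _; rewrite /p; field; rewrite gt_eqF.
  have lnS' : ln S' = ln S + ln (1 + t) by rewrite S't lnM.
  have SB : S' * ln S = \sum_(i in D) B i (lsubmx w) * lik d i (rsubmx w).
    rewrite /S' /liks mulr_suml; apply: eq_bigr => i _; rewrite lik_comb// /B -/S; ring.
  rewrite lnS' mulrDr SB {1}S't -mulrA.
  have tm : -1 < t by lra.
  have := ler_wpM2l (ltW S0) (xlnx_le eta01 tm).
  rewrite /F !big_split/= -mulr_sumr.
  under [X in _ -> _ <= _ + _ + X + _]eq_bigr do rewrite -mulr_sumr.
  rewrite -mulr_sumr -St2 -St.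
  move=> h; rewrite -!addrA lerD2l; apply: (le_trans h).
  have e1 : S * (t + (1 + eta) / 2 * t ^+ 2 + eta^-1 * t ^+ 4) =
     S * t + ((1 + eta) / 2 * (S * t ^+ 2) + eta^-1 * (S * t ^+ 4)) by ring.
  by rewrite e1 2!lerD2l ler_wpM2l// invr_ge0 ltW.
pose X := \sum_(i in D) \sum_(j in D) Ex (P i j) * c i j.
have VX : X = #|D|%:R * (1 - mmse g) by rewrite mmse_dot// opprB addrC subrK mulrA divff ?mul1r// gt_eqF.
have EP : \sum_(i in D) \sum_(j in D) Ex (P i j) = #|D|%:R.
  rewrite -(Ex_liks g0) Ex_sum//; apply: eq_bigr => i _.
  rewrite -Ex_sum//; apply: eq_Ex => w.
  by rewrite /P -mulr_suml -mulr_sumr mulfK// gt_eqF// liks_gt0.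
have Eq i : i \in D -> Ex (q i) = 0.
  by move=> iD; rewrite (ExB (gl i) (good_cst _ _)) Ex_cst Ex_lik// subrr.
have Eqq i j : i \in D -> j \in D -> Ex (fun w => q i w * q j w) <= d * c i j + 2 * d ^+ 2.
  move=> iD jD.
  rewrite (_ : Ex _ = Ex (fun w => lik d i w * lik d j w - lik d i w - q j w)); last first.
    have aux (u v : R) : (u - 1) * (v - 1) = u * v - u - (v - 1) by ring.
    by apply: eq_Ex => w; exact: aux.
  rewrite ExB//; last by apply: goodB => //; exact: goodM.
  rewrite ExB//; last exact: goodM.
  rewrite Ex_lik2// Ex_lik// Eq// subr0.
  have := dot_unit (x1 iD) (x1 jD); rewrite -/(c i j) => c1.
  have /expR_quad : d * c i j <= 2^-1.
    have := ler_norm (c i j); nra.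
  have : (d * c i j) ^+ 2 <= d ^+ 2.
    rewrite exprMn ler_piMr ?sqr_ge0// -real_normK ?num_real// expr_le1//.
  by lra.
have Eq4 i : i \in D -> Ex (fun w => q i w ^+ 4) <= 84 * d ^+ 2.
  move=> iD.
  have gk k : good (fun w => lik d i w ^+ k).
    by elim: k => [|k ih]; [exact: good_cst|under eq_fun do rewrite exprS; exact: goodM].
  rewrite (_ : Ex _ = Ex (fun w => lik d i w ^+ 4 + 6 * lik d i w ^+ 2 + 1 - 4 * lik d i w ^+ 3 - 4 * lik d i w)); last first.
    by apply: eq_Ex => w; rewrite /q; ring.
  rewrite ExB; [|apply: goodB; [apply: goodD; [by apply: goodD => //; exact: goodZ|exact: good_cst]|exact: goodZ]|exact: goodZ].
  rewrite ExB; [|apply: goodD; [by apply: goodD => //; exact: goodZ|exact: good_cst]|exact: goodZ].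
  rewrite ExD; [|by apply: goodD => //; exact: goodZ|exact: good_cst].
  rewrite ExD//; last exact: goodZ.
  rewrite !ExZ// Ex_cst !Ex_likX// Ex_lik//.
  have -> : d * (4 * (4 - 1) / 2) = 6 * d by field.
  have -> : d * (3 * (3 - 1) / 2) = 3 * d by field.
  have -> : d * (2 * (2 - 1) / 2) = d by field.
  have h1 : expR (6 * d) <= 1 + 6 * d + 2 * (6 * d) ^+ 2 by apply: expR_quad; lra.
  have h2 : expR d <= 1 + d + 2 * d ^+ 2 by apply: expR_quad; lra.
  by have := expR_ge1Dx (3 * d); lra.
have EF : Ex F <= Ex (fun w => liks g w * ln (liks g w)) +
    ((1 + eta) / 2 * (d * X + 2 * d ^+ 2 * #|D|%:R) + eta^-1 * (#|D|%:R * (84 * d ^+ 2))).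
  have -> : Ex (fun w => liks g w * ln (liks g w)) = \sum_(i in D) Ex (B i).
    by rewrite -Ex_sum//; apply: eq_Ex => w; rewrite /liks mulr_suml.
  have -> : #|D|%:R * (84 * d ^+ 2) = \sum_(i in D) 84 * d ^+ 2 by rewrite sumr_const mulr_natl.
  rewrite -EP /X !mulr_sumr -!big_split !mulr_sumr -!big_split Ex_sum/=; last by move=> i _; exact: gFi.
  apply: ler_sum => i iD.
  rewrite (ExD (goodD (goodD (gF1 i) (gF2 i)) (gF3' i)) (gF4 i)) (ExD (goodD (gF1 i) (gF2 i)) (gF3' i)) (ExD (gF1 i) (gF2 i)).
  rewrite (Ex_prod (gB i) (gl i)) (Ex_prod (gL i) (gq i)) Eq// mulr0 addr0 Ex_lik// mulr1.
  rewrite -addrA lerD2l; apply: lerD; last first.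
    rewrite (ExZ _ (g2 _ _ (gL i) (gq4 i))) (Ex_prod (gL i) (gq4 i)) Ex_lik// mul1r.
    by rewrite ler_wpM2l ?invr_ge0 ?(ltW eta0)// Eq4.
  rewrite Ex_sum => [|j _]; last exact: gF3.
  rewrite !mulr_sumr -big_split mulr_sumr; apply: ler_sum => j jD /=.
  rewrite (ExZ _ (g2 _ _ (gP i j) (gqq i j))) (Ex_prod (gP i j) (gqq i j)).
  apply: ler_wpM2l; first by rewrite divr_ge0//; lra.
  have EP0 : 0 <= Ex (P i j).
    by apply: Ex_ge0 => w; rewrite /P !mulr_ge0 ?invr_ge0 ?ltW ?lik_gt0 ?liks_gt0.
  apply: le_trans (ler_wpM2l EP0 (Eqq _ _ iD jD)) _.
  by rewrite le_eqVlt; apply/orP; left; apply/eqP; ring.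
rewrite /cond_ent.
have h : #|D|%:R^-1 * Ex (fun w => liks (g + d) w * ln (liks (g + d) w)) <=
   #|D|%:R^-1 * Ex (fun w => liks g w * ln (liks g w)) +
   ((1 + eta) / 2 * (d * (1 - mmse g) + 2 * d ^+ 2) + eta^-1 * (84 * d ^+ 2)).
  rewrite ler_pdivrMl//; apply: (le_trans main); apply: (le_trans EF).
  rewrite VX le_eqVlt; apply/orP; left; apply/eqP; field; rewrite !gt_eqF//.
exact: (ent_arith g d0 eta01 V0 h).
Qed.

Lemma cond_ent0 : cond_ent 0 = ln #|D|%:R.
Proof.
have e w : liks 0 w = #|D|%:R.
  rewrite /liks -sumr_const; apply: eq_bigr => i _.
  by rewrite /lik sqrtr0 scale0r dot0l mul0r subr0 expR0.
rewrite /cond_ent; under eq_Ex do rewrite e.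
by rewrite Ex_cst mul0r subr0 mulKf// gt_eqF// cardD_gt0.
Qed.

Lemma cond_ent_chain eta d k : 0 < d <= 12^-1 -> 0 < eta <= 1 ->
  0 < 1 - k%:R * d * mmse (k%:R * d) / n%:R /\
  cond_ent (k%:R * d) <= ln #|D|%:R + n%:R / 2 * ln (1 - k%:R * d * mmse (k%:R * d) / n%:R) +
    k%:R * (eta * d / 2 + 86 * d ^+ 2 / eta).
Proof.
move=> d12 eta01; have nn0 : 0 < n%:R :> R by rewrite ltr0n.
have /andP[d0 _] := d12.
elim: k => [|k [ih1 ih2]].
  by rewrite !mul0r subr0 ltr01 ln1 mulr0 cond_ent0 !addr0.
have kd0 : 0 <= k%:R * d by rewrite mulr_ge0// ltW.
have -> : k.+1%:R * d = k%:R * d + d by rewrite -natr1 mulrDl mul1r.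
have h1 := cond_ent_step kd0 d12 eta01.
have h2 := mmse_step kd0 d0.
have [P1 P2] := chain_arith nn0 d0 (mmse_ge0 _) (ler0n _ k) h2 ih1.
have kE : k.+1%:R = k%:R + 1 :> R by rewrite -natr1.
split; first exact: P1.
by rewrite kE; exact: (ent_arith2 ih2 h1 P2).
Qed.

Lemma mmse_lt g : 0 < g -> 0 < 1 - g * mmse g / n%:R.
Proof.
move=> g0; pose k := (Num.truncn (12 * g)).+1.
have kg : 12 * g < k%:R by exact: truncnS_gt.
have k0 : 0 < k%:R :> R by rewrite ltr0n.
have d12 : 0 < g / k%:R <= 12^-1.
  by rewrite divr_gt0//= ler_pdivrMr// ler_pdivlMl// ltW.
have [+ _] := @cond_ent_chain 1 (g / k%:R) k d12 ltac:(lra).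
by rewrite [k%:R * _]mulrC divfK// gt_eqF.
Qed.

(** The entropy-mean square error inequality: the information about i is at least that of a Gaussian
    source with the same error. The interval from 0 to g is cut into k equal steps, with k large
    depending on eta. *)
Lemma cond_ent_le g : 0 < g ->
  cond_ent g <= ln #|D|%:R + n%:R / 2 * ln (1 - g * mmse g / n%:R).
Proof.
move=> g0; apply/ler_addgt0Pr => e e0.
pose eta := Num.min 1 (e / g).
have eta01 : 0 < eta <= 1 by rewrite lt_min ltr01 divr_gt0//= ge_min lexx.
have /andP[eta0 eta1] := eta01.
have etae : eta * g <= e by rewrite -ler_pdivlMr// ge_min lexx orbT.
(* The term 12 g keeps the step g / k below 1/12; the other one brings the accumulated error 86 g^2
   / (eta k) below e / 2. *)
pose k := (Num.truncn (12 * g + 172 * g ^+ 2 / (eta * e))).+1.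
have kg : 12 * g + 172 * g ^+ 2 / (eta * e) < k%:R by exact: truncnS_gt.
have k0 : 0 < k%:R :> R by rewrite ltr0n.
have ee0 : 0 < eta * e by rewrite mulr_gt0.
have q0 : 0 <= 172 * g ^+ 2 / (eta * e) by rewrite divr_ge0 ?mulr_ge0 ?sqr_ge0// ltW.
have d12 : 0 < g / k%:R <= 12^-1.
  by rewrite divr_gt0//= ler_pdivrMr// ler_pdivlMl//; lra.
have [_] := @cond_ent_chain eta (g / k%:R) k d12 eta01.
have -> : k%:R * (g / k%:R) = g by rewrite mulrC divfK// gt_eqF.
move=> h; apply: (le_trans h); rewrite lerD2l.
have -> : k%:R * (eta * (g / k%:R) / 2 + 86 * (g / k%:R) ^+ 2 / eta) =
   eta * g / 2 + 86 * g ^+ 2 / eta / k%:R by field; rewrite !gt_eqF.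
have : 86 * g ^+ 2 / eta / k%:R <= e / 2.
  rewrite ler_pdivrMr//.
  have : 172 * g ^+ 2 / (eta * e) <= k%:R by have := mulr_gt0 (ltr0n R 12) g0; lra.
  rewrite ler_pdivrMr// => h2; rewrite ler_pdivrMr//; lra.
by lra.
Qed.

End channel.

(** * Random edges of a graph of code points *)

Lemma kl_arith {R : realType} (X p l1 l2 l3 l4 l5 : R) :
  p * (l1 + l2 - l5 - l4 + l3) <= X - p -> p * (l2 - l4) <= X - p * (1 + l1) - p * (l3 - l5).
Proof. by rewrite !mulrDr mulrN => h; lra. Qed.

(** Balance of shrinking the centre of a close pair: the gain, d1 / 2 times a defect of at least 3
    d1 / 2, exceeds the cost of at most d1^2 / 2 by the required d1^2 / 4. *)
Lemma gain_arith {R : realType} (d d1 p0 p1 p2 p3 : R) : 0 < d1 -> d1 <= 1 -> d <= d1 / 4 ->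
  - d <= p1 - p0 -> - d <= p2 - p0 -> 0 <= p3 -> p3 < p0 - d1 ->
  0 <= d1 / 2 * (p1 + p2 - 2 * p3) - d1 ^+ 2 / 4 * (2 - p3) - d1 ^+ 2 / 4.
Proof.
move=> d10 d11 dd h1 h2 p30 h3.
have : d1 / 2 * (3 / 2 * d1) <= d1 / 2 * (p1 + p2 - 2 * p3) by rewrite ler_wpM2l; lra.
have : 0 <= d1 ^+ 2 / 4 * p3 by rewrite mulr_ge0// divr_ge0// sqr_ge0.
have -> : d1 ^+ 2 / 4 * (2 - p3) = d1 ^+ 2 / 2 - d1 ^+ 2 / 4 * p3 by field.
have -> : d1 / 2 * (3 / 2 * d1) = 3 / 4 * d1 ^+ 2 by field.
by lra.
Qed.

Lemma point_arith1 {R : realType} (L nE mu X Y Z i p0 p1 p2 p3 d g : R) :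
  0 < mu -> i * p3 = 0 -> p2 - p0 <= d ->
  - L + nE - mu ^+ 2 * (p0 + d) - nE * i + g * 0 -
    mu * (`|Y - X| + 2^-1 * `|Y - mu * (2 - p1)| + 2^-1 * `|Z - mu * (2 - p2)|) <=
  - L + (1 - i) * (nE - mu ^+ 2 * p3) + (1 * mu * (Y + Z) - (1 * mu) ^+ 2 / 2 * (4 - 2 * p3)) -
    (mu * (X + Z) - mu ^+ 2 / 2 * (4 - 2 * p2)).
Proof.
move=> m0 ip h2.
have n1 := ler_norm (- (Y - X)); rewrite normrN in n1.
have n2' := normr_ge0 (Y - mu * (2 - p1)); have n3' := normr_ge0 (Z - mu * (2 - p2)).
set N1 := `|Y - X| in n1 *; set N2 := `|_ - _| in n2' *; set N3 := `|_ - _| in n3' *.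
have a1 : 0 <= mu * (N1 + (Y - X)) by apply: mulr_ge0; lra.
have a2 : 0 <= mu ^+ 2 * (p0 + d - p2) by apply: mulr_ge0; [exact: exprn_ge0 (ltW m0)|lra].
have a3 : 0 <= mu * (2^-1 * N2 + 2^-1 * N3) by apply: mulr_ge0; lra.
have a4 : mu ^+ 2 * (i * p3) = 0 by rewrite ip mulr0.
clearbody N1 N2 N3.
rewrite -subr_ge0.
set G := (X in 0 <= X).
suff -> : G = mu * (N1 + (Y - X)) + mu ^+ 2 * (p0 + d - p2) + mu ^+ 2 * (i * p3)
  + mu * (2^-1 * N2 + 2^-1 * N3).
  by rewrite a4; do 3 (apply: addr_ge0 => //).
by rewrite /G; field.
Qed.

Lemma point_arith2 {R : realType} (L nE mu X Y Z i p0 p1 p2 p3 d d1 : R) :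
  0 < mu -> i * p3 = 0 -> 0 < d1 -> d1 <= 1 -> d <= d1 / 4 -> - d <= p1 - p0 -> - d <= p2 - p0 -> p2 - p0 <= d ->
  0 <= p3 -> p3 < p0 - d1 ->
  - L + nE - mu ^+ 2 * (p0 + d) - nE * i + mu ^+ 2 * (d1 ^+ 2 / 4) * 1 -
    mu * (`|Y - X| + 2^-1 * `|Y - mu * (2 - p1)| + 2^-1 * `|Z - mu * (2 - p2)|) <=
  - L + (1 - i) * (nE - mu ^+ 2 * p3) + ((1 - d1 / 2) * mu * (Y + Z) - ((1 - d1 / 2) * mu) ^+ 2 / 2 * (4 - 2 * p3)) -
    (mu * (X + Z) - mu ^+ 2 / 2 * (4 - 2 * p2)).
Proof.
move=> m0 ip d10 d11 dd h1 h2 h3 p30 h4.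
have n1 := ler_norm (- (Y - X)); rewrite normrN in n1.
have n2 := ler_norm (Y - mu * (2 - p1)); have n3 := ler_norm (Z - mu * (2 - p2)).
have n2' := normr_ge0 (Y - mu * (2 - p1)); have n3' := normr_ge0 (Z - mu * (2 - p2)).
set N1 := `|Y - X| in n1 *; set N2 := `|_ - _| in n2 n2' *; set N3 := `|_ - _| in n3 n3' *.
have a1 : 0 <= mu * (N1 + (Y - X)) by apply: mulr_ge0; lra.
have a2 : 0 <= mu ^+ 2 * (p0 + d - p2) by apply: mulr_ge0; [exact: exprn_ge0 (ltW m0)|lra].
have a4 : mu ^+ 2 * (i * p3) = 0 by rewrite ip mulr0.
have a5 : 0 <= mu ^+ 2 * (d1 / 2 * (p1 + p2 - 2 * p3) - d1 ^+ 2 / 4 * (2 - p3) - d1 ^+ 2 / 4).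
  apply: mulr_ge0; first by rewrite exprn_ge0// ltW.
  exact: (gain_arith (d := d) (p0 := p0)).
have a6 : 0 <= d1 / 2 * mu * (mu * (2 - p1) + mu * (2 - p2) + N2 + N3 - (Y + Z)).
  by apply: mulr_ge0; [apply: mulr_ge0; lra|lra].
have a7 : 0 <= (1 - d1) / 2 * mu * (N2 + N3).
  by apply: mulr_ge0; [apply: mulr_ge0; lra|lra].
clearbody N1 N2 N3.
rewrite -subr_ge0.
set G := (X in 0 <= X).
suff -> : G = mu * (N1 + (Y - X)) + mu ^+ 2 * (p0 + d - p2) + mu ^+ 2 * (i * p3)
  + mu ^+ 2 * (d1 / 2 * (p1 + p2 - 2 * p3) - d1 ^+ 2 / 4 * (2 - p3) - d1 ^+ 2 / 4)
  + d1 / 2 * mu * (mu * (2 - p1) + mu * (2 - p2) + N2 + N3 - (Y + Z)) + (1 - d1) / 2 * mu * (N2 + N3).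
  by rewrite a4; do 5 (apply: addr_ge0 => //).
by rewrite /G; field.
Qed.

Lemma close_arith {R : realType} (L nE nbp N mu g Th SC S lnN : R) :
  mu * S <= mu * (N * (15 / 4) + N * (5 / 4)) ->
  (- L + nE - nbp) * N - nE * Th + g * SC - mu * S <= - (N * lnN) ->
  g * SC <= N * (L - nE + nbp - lnN + 5 * mu) + nE * Th.
Proof. by nra. Qed.

Lemma sum_lin5 {R : realType} (I : finType) (P : pred I) (k1 k2 k3 k4 : R) (f1 f2 f3 f4 f5 : I -> R) :
  \sum_(i | P i) (k1 * f1 i - k2 * f2 i + k3 * f3 i - k4 * (f4 i + f5 i)) =
  k1 * \sum_(i | P i) f1 i - k2 * \sum_(i | P i) f2 i + k3 * \sum_(i | P i) f3 i -
  k4 * (\sum_(i | P i) f4 i + \sum_(i | P i) f5 i).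
Proof. by rewrite sumrB big_split sumrB /= -!mulr_sumr big_split. Qed.

Section graph.
Context {R : realType} (n : nat) (T : finType) (x : T -> 'rV[R]_n) (e : rel T) (b : R).
Hypothesis n0 : (0 < n)%N.
Hypothesis b0 : 0 < b.
Hypothesis x1 : forall c, norm2 (x c) = 1.
Hypothesis esym : symmetric e.
Implicit Types c : T.

(** Half the signal amplitude: sqrt (n a) = 2 mu when a = 4 b. *)
Let mu := Num.sqrt (n%:R * b).

Definition pd c c' : R := 1 - dot (x c) (x c').

Lemma pdE c c' : pd c c' = 1 - dot (x c) (x c').
Proof. by []. Qed.
Definition nbh c : {set T} := [set c' | e c c'].
(* [Lz c c'] is the density, relative to the standard Gaussian law, of an observation centred at
   the midpoint mu (x c + x c') of the two signals; in [Pz] a second neighbour c'' is drawn from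
   the posterior given c and the observation. *)
Definition Lz c c' z := expR (dot (mu *: (x c + x c')) z - mu ^+ 2 / 2 * norm2 (x c + x c')).
Definition Sz c z := \sum_(c' | e c c') Lz c c' z.
Definition Pz c c' c'' z := Lz c c' z * Lz c c'' z / Sz c z.
Definition nedges : R := \sum_c \sum_(c' | e c c') 1.

Lemma nb_gt0 : 0 < n%:R * b. Proof. by rewrite mulr_gt0// ltr0n. Qed.

Lemma mu_gt0 : 0 < mu. Proof. by rewrite sqrtr_gt0 nb_gt0. Qed.

Lemma mu2 : mu ^+ 2 = n%:R * b. Proof. by rewrite sqr_sqrtr// ltW// nb_gt0. Qed.

Lemma pdC c c' : pd c c' = pd c' c. Proof. by rewrite /pd dotC. Qed.

Lemma pd_cc c : pd c c = 0. Proof. by rewrite /pd -norm2E x1 subrr. Qed.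

Lemma pd_bound c c' : 0 <= pd c c' <= 2.
Proof. by have := dot_unit (x1 c) (x1 c'); rewrite /pd ler_norml; lra. Qed.

Lemma norm2_sum c c' : norm2 (x c + x c') = 4 - 2 * pd c c'.
Proof. by rewrite norm2D !x1 /pd; ring. Qed.

Lemma norm2_diff c c' : norm2 (x c' - x c) = 2 * pd c c'.
Proof. by rewrite norm2B !x1 /pd dotC; ring. Qed.

Lemma LzC c c' z : Lz c c' z = Lz c' c z. Proof. by rewrite /Lz [x c + _]addrC. Qed.

Lemma Lz_gt0 c c' z : 0 < Lz c c' z. Proof. exact: expR_gt0. Qed.

Lemma pgood_Lz c c' : pgood (Lz c c').
Proof.
rewrite /Lz; under eq_fun do rewrite expRD; apply: pgoodM; first exact: pgood_expdot.
by apply: pgood_cst; exact: expR_gt0.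
Qed.

Lemma good_Lz c c' : good (Lz c c'). Proof. exact: pgood_good (pgood_Lz _ _). Qed.

Lemma pgood_Sz c c' : e c c' -> pgood (Sz c).
Proof. by move=> ecc; apply: (pgood_sum ecc) => i _; exact: pgood_Lz. Qed.

Lemma Sz_gt0 c c' z : e c c' -> 0 < Sz c z.
Proof. by move=> ecc; exact: pgood_gt0 (pgood_Sz ecc). Qed.

Lemma pgood_Pz c c' c'' : e c c' -> pgood (Pz c c' c'').
Proof.
by move=> ecc; apply: pgoodM; [apply: pgoodM; exact: pgood_Lz|exact/pgoodV/(pgood_Sz ecc)].
Qed.

Lemma good_Pz c c' c'' : e c c' -> good (Pz c c' c'').
Proof. by move=> ecc; exact: pgood_good (pgood_Pz _ ecc). Qed.

Lemma sum_Pz c c' z : e c c' -> \sum_(c'' | e c c'') Pz c c' c'' z = Lz c c' z.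
Proof. by move=> ecc; rewrite -mulr_suml -mulr_sumr mulfK// gt_eqF// (Sz_gt0 _ ecc). Qed.

Lemma PzC c c' c'' z : Pz c c' c'' z = Pz c c'' c' z.
Proof. by rewrite /Pz (mulrC (Lz c c' z)). Qed.

Lemma Ex_Lz_shift c c' (f : 'rV[R]_n -> R) : good f ->
  Ex (fun w => f w * Lz c c' w) = Ex (fun w => f (w + mu *: (x c + x c'))).
Proof.
move=> gf; rewrite (Ex_shift _ gf); apply: eq_Ex => w.
by rewrite /Lz norm2Z mulrAC.
Qed.

Lemma Ex_Lz c c' : Ex (Lz c c') = 1.
Proof.
have := Ex_Lz_shift c c' (good_cst n 1); rewrite Ex_cst => <-.
by apply: eq_Ex => w; rewrite mul1r.
Qed.

Lemma Ex_Lz_noise c c' (a : 'rV[R]_n) : norm2 a <= 4 ->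
  Ex (fun w => `|dot a w - dot a (mu *: (x c + x c'))| * Lz c c' w) <= 5 / 2.
Proof.
move=> a4; set k := dot a _.
have gd : good (fun w => dot a w - k) by apply: goodB; [exact: good_dot|exact: good_cst].
have ga : good (fun w => `|dot a w - k|).
  apply: (good_le _ gd) => [|w]; last by rewrite normr_id.
  by apply: measurableT_comp => //; exact: good_meas gd.
rewrite (Ex_Lz_shift _ _ ga).
under eq_Ex do rewrite dotDr addrK.
apply: (@le_trans _ _ (Ex (fun w => 2^-1 + 2^-1 * dot a w ^+ 2))).
  have gd2 : good (fun w => dot a w ^+ 2).
    by under eq_fun do rewrite expr2; apply: goodM; exact: good_dot.
  apply: le_Ex.
  - apply: (good_le _ (good_dot a)) => [|w]; last by rewrite normr_id.
    by apply: measurableT_comp => //; exact: meas_dot.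
  - by apply: goodD; [exact: good_cst|exact: goodZ].
  - by move=> w; rewrite -[dot a w ^+ 2]real_normK ?num_real//; have := sqr_ge0 (`|dot a w| - 1); nra.
have gd2 : good (fun w => dot a w ^+ 2).
  by under eq_fun do rewrite expr2; apply: goodM; exact: good_dot.
rewrite (ExD (good_cst _ _) (goodZ _ gd2)) Ex_cst (ExZ _ gd2).
by have := Ex_dot_sqr_le a; lra.
Qed.

Lemma Ex_center c (f : 'rV[R]_n -> R) : good f ->
  Ex f = Ex (fun w => f (w + mu *: x c) * expR (- dot (mu *: x c) w - mu ^+ 2 / 2)).
Proof.
move=> gf; pose f1 w := f w * expR (- dot (mu *: x c) w + mu ^+ 2 / 2).
have g1 : good f1.
  apply: goodM => //; under eq_fun do rewrite expRD -dotN.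
  by apply: goodM; [exact: good_expdot|exact: good_cst].
have := Ex_shift (mu *: x c) g1.
rewrite (_ : (fun w => f1 w * _) = f); last first.
  apply/funext => w; rewrite /f1 -mulrA -expRD norm2Z x1 mulr1.
  by rewrite (_ : _ + _ = 0) ?expR0 ?mulr1//; ring.
move=> <-; apply: eq_Ex => w; rewrite /f1; congr (_ * expR _).
by rewrite dotDr -norm2E norm2Z x1; field.
Qed.

(** For a fixed c the known part mu x_c can be subtracted; what remains is the channel [lik] at
    strength mu^2 = n b, up to a factor that does not depend on c' and cancels in every
    posterior. *)
Lemma Lz_center c c' w : Lz c c' (w + mu *: x c) =
  lik x (mu ^+ 2) c' w * expR (dot (mu *: x c) w + mu ^+ 2 / 2).
Proof.
rewrite /Lz /lik sqrtr_sqr ger0_norm ?(ltW mu_gt0)// -expRD; congr expR.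
by rewrite norm2_sum /pd !dotZl !(dotDl, dotDr, dotZr) -!norm2E !x1 (dotC (x c') (x c)); field.
Qed.

Lemma Sz_center c w : Sz c (w + mu *: x c) =
  liks (nbh c) x (mu ^+ 2) w * expR (dot (mu *: x c) w + mu ^+ 2 / 2).
Proof.
rewrite /Sz /liks mulr_suml; apply: eq_big => [c'|c' _]; first by rewrite inE.
exact: Lz_center.
Qed.

Lemma Ex_Pz_center c c' c'' : e c c' ->
  Ex (Pz c c' c'') = Ex (fun w => lik x (mu ^+ 2) c' w * lik x (mu ^+ 2) c'' w / liks (nbh c) x (mu ^+ 2) w).
Proof.
move=> ecc; rewrite (Ex_center c (good_Pz _ ecc)); apply: eq_Ex => w.
rewrite /Pz !Lz_center Sz_center.
have -> : - dot (mu *: x c) w - mu ^+ 2 / 2 = - (dot (mu *: x c) w + mu ^+ 2 / 2) by ring.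
rewrite expRN; set q := expR _; have q0 : 0 < q by exact: expR_gt0.
have l0 : 0 < liks (nbh c) x (mu ^+ 2) w.
  have c'N : c' \in nbh c by rewrite inE.
  exact: (liks_gt0 _ c'N).
by field; rewrite !gt_eqF.
Qed.

Lemma mmse_graph c c0 : e c c0 ->
  #|nbh c|%:R * mmse (nbh c) x (mu ^+ 2) =
  \sum_(c' | e c c') \sum_(c'' | e c c'') Ex (Pz c c' c'') * pd c' c''.
Proof.
move=> ecc; have c0N : c0 \in nbh c by rewrite inE.
rewrite /mmse mulrA divff ?mul1r; last by rewrite gt_eqF// (cardD_gt0 c0N).
rewrite Ex_sum => [|c' _]; last first.
  apply: good_sum => c'' _; apply: goodM; last exact: good_cst.
  exact: (good_ratio _ c0N).
rewrite (eq_bigl (e c)); last by move=> c'; rewrite inE.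
apply: eq_bigr => c' ecc'; rewrite Ex_sum => [|c'' _]; last first.
  apply: goodM; last exact: good_cst.
  exact: (good_ratio _ c0N).
rewrite (eq_bigl (e c)); last by move=> c''; rewrite inE.
apply: eq_bigr => c'' _; rewrite (Ex_Pz_center _ ecc') -/(pd c' c'') mulrC -ExZ; last exact: (good_ratio _ c0N).
by apply: eq_Ex => w; rewrite mulrC.
Qed.

Lemma good_lnpi c c' : e c c' -> good (fun z => Lz c c' z * ln (Lz c c' z / Sz c z)).
Proof.
move=> ecc; apply: goodM; first exact: good_Lz.
by apply: good_ln; apply: pgoodM; [exact: pgood_Lz|exact/pgoodV/(pgood_Sz ecc)].
Qed.

Lemma cond_ent_graph c c0 : e c c0 ->
  \sum_(c' | e c c') Ex (fun z => Lz c c' z * ln (Lz c c' z / Sz c z)) =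
  - (#|nbh c|%:R * cond_ent (nbh c) x (mu ^+ 2)).
Proof.
move=> ecc; have c0N : c0 \in nbh c by rewrite inE.
have g0 : 0 <= mu ^+ 2 by exact: sqr_ge0.
have x1' i : i \in nbh c -> norm2 (x i) = 1 by [].
have gl i := good_lik x (mu ^+ 2) i.
have gll i : good (fun w => (dot (mu *: x i) w - mu ^+ 2 / 2) * lik x (mu ^+ 2) i w).
  by apply: goodM => //; apply: goodB; [exact: good_dot|exact: good_cst].
have gls i : good (fun w => lik x (mu ^+ 2) i w * ln (liks (nbh c) x (mu ^+ 2) w)).
  by apply: goodM => //; apply: good_ln; exact: (pgood_liks _ c0N).
have step c' : e c c' -> Ex (fun z => Lz c c' z * ln (Lz c c' z / Sz c z)) =
   mu ^+ 2 / 2 - Ex (fun w => lik x (mu ^+ 2) c' w * ln (liks (nbh c) x (mu ^+ 2) w)).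
  move=> ecc'; have c'N : c' \in nbh c by rewrite inE.
  rewrite (Ex_center c (good_lnpi ecc')).
  have EE : Ex (fun w => (dot (mu *: x c') w - mu ^+ 2 / 2) * lik x (mu ^+ 2) c' w) = mu ^+ 2 / 2.
    have gd : good (fun w => dot (mu *: x c') w - mu ^+ 2 / 2).
      by apply: goodB; [exact: good_dot|exact: good_cst].
    rewrite (Ex_lik_shift x1' g0 c'N gd).
    rewrite sqrtr_sqr ger0_norm ?(ltW mu_gt0)//.
    under eq_Ex do rewrite dotDr -norm2E norm2Z x1 mulr1 -addrA.
    by rewrite (ExD (good_dot _) (good_cst _ _)) Ex_dot Ex_cst; field.
  rewrite -[X in _ = X - _]EE -(ExB (gll _) (gls _)); apply: eq_Ex => w.
  rewrite Lz_center Sz_center.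
  have -> : - dot (mu *: x c) w - mu ^+ 2 / 2 = - (dot (mu *: x c) w + mu ^+ 2 / 2) by ring.
  rewrite expRN; set q := expR _; have q0 : 0 < q by exact: expR_gt0.
  have l0 : 0 < liks (nbh c) x (mu ^+ 2) w by exact: (liks_gt0 _ c'N).
  have -> : lik x (mu ^+ 2) c' w * q / (liks (nbh c) x (mu ^+ 2) w * q) =
     lik x (mu ^+ 2) c' w / liks (nbh c) x (mu ^+ 2) w by field; rewrite !gt_eqF.
  rewrite ln_div ?posrE ?lik_gt0//.
  have -> : ln (lik x (mu ^+ 2) c' w) = dot (mu *: x c') w - mu ^+ 2 / 2.
    by rewrite /lik expRK sqrtr_sqr ger0_norm ?(ltW mu_gt0).
  by field; rewrite gt_eqF.
rewrite (eq_bigr _ step) sumrB.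
rewrite /cond_ent mulrBr mulrA divff ?mul1r; last by rewrite gt_eqF// (cardD_gt0 c0N).
rewrite opprB; congr (_ - _).
  by rewrite sumr_const mulr_natl; congr (_ *+ _); apply: eq_card => c'; rewrite !inE.
rewrite -Ex_sum//; apply: eq_Ex => w; rewrite -mulr_suml; congr (_ * _).
by apply: eq_bigl => c'; rewrite inE.
Qed.

Lemma Ex_edges : \sum_c \sum_(c' | e c c') Ex (Lz c c') = nedges.
Proof. by apply: eq_bigr => c _; apply: eq_bigr => c' _; rewrite Ex_Lz. Qed.

(** Gibbs' inequality for the law of (c, c', c'', z), with (c, c') a random edge and c'' a posterior
    sample, against the law in which (c', c'', z) is drawn from q and c from its posterior given c'
    and z. *)
Lemma kl_core (A : {set T}) (q : T -> T -> 'rV[R]_n -> R) :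
  0 < nedges -> (forall c c', e c c' -> c \in A) ->
  (forall c' c'', pgood (q c' c'')) ->
  \sum_(c' in A) \sum_(c'' in A) Ex (q c' c'') <= 1 ->
  \sum_c \sum_(c' | e c c') \sum_(c'' | e c c'')
     Ex (fun z => Pz c c' c'' z * (ln (q c' c'' z) - ln (Lz c c'' z))) <= - (nedges * ln nedges).
Proof.
move=> E0 eA gq q1; set N := nedges in E0 *.
have gF c c' c'' : e c c' -> good (fun z => Pz c c' c'' z * (ln (q c' c'' z) - ln (Lz c c'' z))).
  move=> ecc; apply: goodM; first exact: good_Pz.
  by apply: goodB; apply: good_ln => //; exact: pgood_Lz.
have gF2 c c' : e c c' -> good (fun z => \sum_(c'' | e c c'') Pz c c' c'' z * (ln (q c' c'' z) - ln (Lz c c'' z))).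
  by move=> ecc; apply: good_sum => c'' _; exact: gF.
have gF1 c : good (fun z => \sum_(c' | e c c') \sum_(c'' | e c c'') Pz c c' c'' z * (ln (q c' c'' z) - ln (Lz c c'' z))).
  by apply: good_sum => c' ecc; exact: gF2.
have gq2 : good (fun z => \sum_(c' in A) \sum_(c'' in A) q c' c'' z).
  by apply: good_sum => c' _; apply: good_sum => c'' _; exact: pgood_good.
have gL : good (fun z => \sum_c \sum_(c' | e c c') Lz c c' z).
  by apply: good_sum => c _; apply: good_sum => c' _; exact: good_Lz.
rewrite (eq_bigr (fun c => Ex (fun z => \sum_(c' | e c c') \sum_(c'' | e c c'') Pz c c' c'' z * (ln (q c' c'' z) - ln (Lz c c'' z))))); last first.
  move=> c _; rewrite Ex_sum; last by move=> c' ecc; exact: gF2.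
  apply: eq_bigr => c' ecc.
  by rewrite Ex_sum// => c'' _; exact: gF.
rewrite -Ex_sum; last by move=> c _; exact: gF1.
apply: (@le_trans _ _ (Ex (fun z => N * (\sum_(c' in A) \sum_(c'' in A) q c' c'' z) -
    (1 + ln N) * (\sum_c \sum_(c' | e c c') Lz c c' z)))); last first.
  rewrite (ExB (goodZ _ gq2) (goodZ _ gL)) (ExZ _ gq2) (ExZ _ gL).
  have -> : Ex (fun z => \sum_c \sum_(c' | e c c') Lz c c' z) = N.
    rewrite /N -Ex_edges Ex_sum => [|c _]; last by apply: good_sum => c' _; exact: good_Lz.
    by apply: eq_bigr => c _; rewrite Ex_sum// => c' _; exact: good_Lz.
  have -> : Ex (fun z => \sum_(c' in A) \sum_(c'' in A) q c' c'' z) = \sum_(c' in A) \sum_(c'' in A) Ex (q c' c'').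
    rewrite Ex_sum => [|c' _]; last by apply: good_sum => c'' _; exact: pgood_good.
    by apply: eq_bigr => c' _; rewrite Ex_sum// => c'' _; exact: pgood_good.
  have := ler_wpM2l (ltW E0) q1; rewrite mulr1 mulrDl mul1r (mulrC (ln N)); lra.
apply: le_Ex; first by apply: good_sum => c _; exact: gF1.
  by apply: goodB; exact: goodZ.
move=> z.
(* The normalizers of the two posteriors cancel on average, because both the edges and [Lz] are
   symmetric in c and c'. *)
have sym0 : \sum_c \sum_(c' | e c c') Lz c c' z * (ln (Sz c z) - ln (Sz c' z)) = 0.
  have -> : \sum_c \sum_(c' | e c c') Lz c c' z * (ln (Sz c z) - ln (Sz c' z)) =
     \sum_c \sum_(c' | e c c') Lz c c' z * ln (Sz c z) - \sum_c \sum_(c' | e c c') Lz c c' z * ln (Sz c' z).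
    by rewrite -sumrB; apply: eq_bigr => c _; rewrite -sumrB; apply: eq_bigr => c' _; rewrite mulrBr.
  apply/eqP; rewrite subr_eq0; apply/eqP.
  rewrite [RHS](exchange_big_dep xpredT)//=; apply: eq_bigr => c _.
  by apply: eq_big => [c'|c' _]; [rewrite esym|rewrite LzC].
have step c c' c'' : e c c' -> e c c'' ->
   Pz c c' c'' z * (ln (q c' c'' z) - ln (Lz c c'' z)) <=
   N * (q c' c'' z * (Lz c c' z / Sz c' z)) - Pz c c' c'' z * (1 + ln N) - Pz c c' c'' z * (ln (Sz c z) - ln (Sz c' z)).
  move=> ecc ecc'; have ec'c : e c' c by rewrite esym.
  have P0 : 0 < Pz c c' c'' z by exact: pgood_gt0 (pgood_Pz _ ecc).
  have S0 := Sz_gt0 z ecc; have S'0 := Sz_gt0 z ec'c.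
  have q0 : 0 < q c' c'' z by exact: pgood_gt0.
  have L0 := Lz_gt0 c c' z; have L''0 := Lz_gt0 c c'' z.
  (* The density of the comparison law relative to the true one; the estimate is ln y <= y - 1,
     weighted by [Pz]. *)
  pose y := N * (q c' c'' z * (Lz c c' z / Sz c' z)) / Pz c c' c'' z.
  have y0 : 0 < y by rewrite !(divr_gt0, mulr_gt0).
  have lny : ln y = ln N + ln (q c' c'' z) - ln (Sz c' z) - ln (Lz c c'' z) + ln (Sz c z).
    rewrite /y /Pz.
    have -> : N * (q c' c'' z * (Lz c c' z / Sz c' z)) / (Lz c c' z * Lz c c'' z / Sz c z) =
       N * q c' c'' z * Sz c z / (Sz c' z * Lz c c'' z) by field; rewrite !gt_eqF.
    rewrite ln_div ?posrE ?mulr_gt0// !lnM ?posrE ?mulr_gt0//.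
    by move: (ln N) (ln (q _ _ _)) (ln (Sz _ _)) (ln (Sz _ _)) (ln (Lz _ _ _)) => *; ring.
  have : ln y <= y - 1 by have := expR_ge1Dx (ln y); rewrite lnK ?posrE//; move: (ln y); clear; move=> *; lra.
  move=> /(ler_wpM2l (ltW P0)).
  have -> : Pz c c' c'' z * (y - 1) = N * (q c' c'' z * (Lz c c' z / Sz c' z)) - Pz c c' c'' z.
    by rewrite /y; field; rewrite !gt_eqF.
  rewrite lny => h; set X := N * (_ * _) in h *; set p := Pz _ _ _ _ in h *.
  exact: kl_arith h.
apply: (@le_trans _ _ (\sum_c \sum_(c' | e c c') (N * ((\sum_(c'' in A) q c' c'' z) * (Lz c c' z / Sz c' z)) - Lz c c' z * (1 + ln N) - Lz c c' z * (ln (Sz c z) - ln (Sz c' z))))).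
  apply: ler_sum => c _; apply: ler_sum => c' ecc.
  have ec'c : e c' c by rewrite esym.
  apply: le_trans (ler_sum _ (fun c'' h => step c c' c'' ecc h)) _.
  have r0 : 0 <= Lz c c' z / Sz c' z by rewrite divr_ge0 ?(ltW (Lz_gt0 _ _ _))// ltW// (Sz_gt0 _ ec'c).
  set r := Lz c c' z / Sz c' z in r0 *; set k := ln (Sz c z) - ln (Sz c' z).
  have -> : \sum_(i | e c i) (N * (q c' i z * r) - Pz c c' i z * (1 + ln N) - Pz c c' i z * k) =
     N * ((\sum_(i | e c i) q c' i z) * r) - Lz c c' z * (1 + ln N) - Lz c c' z * k.
    by rewrite 2!sumrB -[X in X - _ - _]mulr_sumr -[X in _ * X - _ - _]mulr_suml -[X in _ - X - _]mulr_suml -[X in _ - _ - X]mulr_suml sum_Pz.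
  rewrite 2!lerD2r; apply: ler_wpM2l; first exact: ltW.
  apply: ler_wpM2r => //.
  rewrite [leLHS]big_mkcond [leRHS]big_mkcond; apply: ler_sum => c'' _.
  have q0 : 0 < q c' c'' z by exact: pgood_gt0.
  case: ifPn => ecc''; last by case: ifP => // _; exact: ltW.
  by rewrite (eA c'' c) ?lexx// esym.
rewrite (eq_bigr (fun c => \sum_(c' | e c c') N * ((\sum_(c'' in A) q c' c'' z) * (Lz c c' z / Sz c' z)) - (1 + ln N) * \sum_(c' | e c c') Lz c c' z - \sum_(c' | e c c') Lz c c' z * (ln (Sz c z) - ln (Sz c' z)))); last first.
  by move=> c _; rewrite !sumrB -mulr_suml (mulrC _ (1 + ln N)).
rewrite !sumrB sym0 subr0 -mulr_sumr lerD2r.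
under eq_bigr do rewrite -mulr_sumr.
rewrite -mulr_sumr ler_wpM2l ?(ltW E0)//.
rewrite (exchange_big_dep xpredT)//= [leRHS]big_mkcond; apply: ler_sum => c' _.
rewrite -mulr_sumr -mulr_suml.
have -> : \sum_(c | e c c') Lz c c' z = Sz c' z.
  by apply: eq_big => [c|c _]; [rewrite esym|rewrite LzC].
case: (pickP (e c')) => [c ec'c|no]; last first.
  have -> : Sz c' z = 0 by rewrite /Sz big_pred0.
  rewrite invr0 !mulr0; case: ifP => // _; apply: sumr_ge0 => c'' _; exact: ltW (pgood_gt0 _ (gq _ _)).
by rewrite (eA c' c)// divff ?mulr1// gt_eqF// (Sz_gt0 _ ec'c).
Qed.

Definition Lt (t : R) c c' z :=
  expR (dot ((t * mu) *: (x c + x c')) z - (t * mu) ^+ 2 / 2 * norm2 (x c + x c')).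

Lemma pgood_Lt t c c' : pgood (Lt t c c').
Proof.
rewrite /Lt; under eq_fun do rewrite expRD; apply: pgoodM; first exact: pgood_expdot.
by apply: pgood_cst; exact: expR_gt0.
Qed.

Lemma Ex_Lt t c c' : Ex (Lt t c c') = 1.
Proof.
rewrite /Lt; under eq_Ex do rewrite expRD mulrC.
rewrite (ExZ _ (good_expdot _)) Ex_expdot -expRD norm2Z.
by rewrite (_ : _ + _ = 0) ?expR0//; ring.
Qed.

(** Absolute fluctuations of the linear statistics in the exponents compared below. Their means
    under [Lz] are bounded and they come with a factor mu, so they cost only O(sqrt n) per edge. *)
Definition noise c c' z := `|dot (x c' - x c) z| + 2^-1 * `|dot (x c') z - mu * (2 - pd c c')|.
Definition noise2 c c' z := 2^-1 * `|dot (x c') z - mu * (2 - pd c c')|.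

Lemma good_abs_lin (a : 'rV[R]_n) k : good (fun z => `|dot a z - k|).
Proof.
have gd : good (fun w => dot a w - k) by apply: goodB; [exact: good_dot|exact: good_cst].
apply: (good_le _ gd) => [|w]; last by rewrite normr_id.
by apply: measurableT_comp => //; exact: good_meas gd.
Qed.

Lemma good_noise2 c c' : good (noise2 c c').
Proof. by apply: goodZ; exact: good_abs_lin. Qed.

Lemma good_noise c c' : good (noise c c').
Proof.
apply: goodD; last exact: good_noise2.
by have := good_abs_lin (x c' - x c) 0; under eq_fun do rewrite subr0.
Qed.

Lemma Ex_noise2 c c' : Ex (fun z => noise2 c c' z * Lz c c' z) <= 5 / 4.
Proof.
have h : norm2 (x c') <= 4 by rewrite x1; lra.
have := Ex_Lz_noise c c' h.
have gg : good (fun z => `|dot (x c') z - dot (x c') (mu *: (x c + x c'))| * Lz c c' z).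
  by apply: goodM; [exact: good_abs_lin|exact: good_Lz].
have -> : Ex (fun z => noise2 c c' z * Lz c c' z) =
  2^-1 * Ex (fun z => `|dot (x c') z - dot (x c') (mu *: (x c + x c'))| * Lz c c' z).
  rewrite -(ExZ _ gg); apply: eq_Ex => z; rewrite /noise2 -mulrA; congr (_ * (`|_ - _| * _)).
  by rewrite dotZr dotDr -norm2E x1 /pd dotC; ring.
by lra.
Qed.

Lemma Ex_noise c c' : Ex (fun z => noise c c' z * Lz c c' z) <= 15 / 4.
Proof.
have h : norm2 (x c' - x c) <= 4 by rewrite norm2_diff; have := pd_bound c c'; lra.
have h0 : dot (x c' - x c) (mu *: (x c + x c')) = 0.
  by rewrite dotZr dotBl !dotDr -!norm2E !x1 (dotC (x c')); ring.
have := Ex_Lz_noise c c' h; rewrite h0; under eq_Ex do rewrite subr0.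
have g1 : good (fun z => `|dot (x c' - x c) z| * Lz c c' z).
  apply: goodM; last exact: good_Lz.
  by have := good_abs_lin (x c' - x c) 0; under eq_fun do rewrite subr0.
have g2 : good (fun z => noise2 c c' z * Lz c c' z) by apply: goodM; [exact: good_noise2|exact: good_Lz].
have -> : Ex (fun z => noise c c' z * Lz c c' z) =
   Ex (fun z => `|dot (x c' - x c) z| * Lz c c' z) + Ex (fun z => noise2 c c' z * Lz c c' z).
  by rewrite -(ExD g1 g2); apply: eq_Ex => z; rewrite -mulrDl.
by have := Ex_noise2 c c'; lra.
Qed.

(* The comparison density [q] shrinks the centre [mu (c' + c'')] by [1 - d1 / 2] exactly for
   the pairs that are closer than typical; this is where they lose. *)
Lemma close_pairs (A : {set T}) (E p0 d d1 : R) :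
  0 < nedges -> (forall c c', e c c' -> c \in A) ->
  (forall c c', e c c' -> `|pd c c' - p0| <= d) ->
  (forall c, c \in A -> \sum_(c' in A | c' != c) expR (- (n%:R * b * pd c c')) <= expR (- (n%:R * E))) ->
  0 < d1 <= 1 -> d <= d1 / 4 ->
  n%:R * b * (d1 ^+ 2 / 4) * (\sum_c \sum_(c' | e c c') \sum_(c'' | e c c'')
     ((c'' != c') && (pd c' c'' < p0 - d1))%:R * Ex (Pz c c' c'')) <=
  nedges * (ln (2 * #|A|%:R) - n%:R * E + n%:R * b * (p0 + d) - ln nedges + 5 * mu)
  + n%:R * E * \sum_c \sum_(c' | e c c') Ex (Pz c c' c').
Proof.
move=> E0 eA pe om /andP[d10 d11] dd1.
have A0 : 0 < #|A|%:R :> R.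
  rewrite ltr0n; apply/card_gt0P; case: (pickP (mem A)) => [c cA|no]; first by exists c.
  move: E0; rewrite /nedges big1 ?ltxx// => c _; rewrite big_pred0// => c'.
  by apply/negP => /eA cA; have := no c; rewrite /= cA.
have A20 : 0 < 2 * #|A|%:R :> R by rewrite mulr_gt0.
pose close c' c'' := (c'' != c') && (pd c' c'' < p0 - d1).
pose tau c' c'' := if close c' c'' then 1 - d1 / 2 else 1.
(* The hypothesis on the sums bounds the total of the off-diagonal weights at each c' by 1, and the
   diagonal adds 1; hence the normalization by 2 [#|A|]. *)
pose w c' c'' := if c'' == c' then 1 else expR (n%:R * E - n%:R * b * pd c' c'').
pose q c' c'' z := (2 * #|A|%:R)^-1 * w c' c'' * Lt (tau c' c'') c' c'' z.
have w0 c' c'' : 0 < w c' c'' by rewrite /w; case: ifP => // _; exact: expR_gt0.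
have k0 c' c'' : 0 < (2 * #|A|%:R)^-1 * w c' c'' by rewrite mulr_gt0// invr_gt0.
have gq c' c'' : pgood (q c' c'').
  by apply: pgoodM; [exact: pgood_cst|exact: pgood_Lt].
have q1 : \sum_(c' in A) \sum_(c'' in A) Ex (q c' c'') <= 1.
  apply: (@le_trans _ _ (\sum_(c' in A) #|A|%:R^-1)); last first.
    by rewrite sumr_const -[_ *+ _]mulr_natl divff// gt_eqF.
  apply: ler_sum => c' c'A.
  have -> : \sum_(c'' in A) Ex (q c' c'') = (2 * #|A|%:R)^-1 * \sum_(c'' in A) w c' c''.
    rewrite mulr_sumr; apply: eq_bigr => c'' _.
    by rewrite (ExZ _ (pgood_good (pgood_Lt _ _ _))) Ex_Lt mulr1.
  rewrite (bigD1 c')//= {1}/w eqxx.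
  have : \sum_(c'' in A | c'' != c') w c' c'' <= 1.
    rewrite (eq_bigr (fun c'' => expR (n%:R * E) * expR (- (n%:R * b * pd c' c'')))); last first.
      by move=> c'' /andP[_ /negbTE h]; rewrite /w h expRD.
    rewrite -mulr_sumr; apply: le_trans (ler_wpM2l (expR_ge0 _) (om _ c'A)) _.
    by rewrite -expRD subrr expR0.
  move=> h; rewrite invfM mulrAC -[leRHS]mul1r; apply: ler_wpM2r; first by rewrite invr_ge0 ltW.
  by lra.
have := kl_core E0 eA gq q1.
have m0 := mu_gt0; have mm := mu2; have nb0 := nb_gt0.
have lnq c' c'' z : ln (q c' c'' z) = - ln (2 * #|A|%:R) + (c'' != c')%:R * (n%:R * E - n%:R * b * pd c' c'') +
    (tau c' c'' * mu * dot (x c' + x c'') z - (tau c' c'' * mu) ^+ 2 / 2 * (4 - 2 * pd c' c'')).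
  rewrite /q [LHS]lnM ?posrE; [|exact: k0|exact: expR_gt0].
  rewrite [ln (_^-1 * _)]lnM ?posrE; [|by rewrite invr_gt0|exact: w0].
  rewrite lnV ?posrE// /Lt expRK dotZl norm2_sum.
  congr (_ + _ + _); rewrite /w; case: eqP => _ /=; first by rewrite ln1 mul0r.
  by rewrite expRK mul1r.
pose C0 := - ln (2 * #|A|%:R) + n%:R * E - n%:R * b * (p0 + d).
have point c c' c'' z : e c c' -> e c c'' ->
  C0 - n%:R * E * (c'' == c')%:R + n%:R * b * (d1 ^+ 2 / 4) * (close c' c'')%:R
   - mu * (noise c c' z + noise2 c c'' z) <= ln (q c' c'' z) - ln (Lz c c'' z).
  move=> ecc ecc'; have /andP[pd0 pd2] := pd_bound c' c''.
  have := pe _ _ ecc; have := pe _ _ ecc'; rewrite !ler_norml => /andP[h1 h2] /andP[h3 h4].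
  rewrite lnq /Lz expRK dotZl norm2_sum /C0 /noise /noise2 dotBl !dotDl.
  rewrite -mm.
  have cc : (c'' == c')%:R * pd c' c'' = 0.
    by case: eqP => [->|_]; rewrite ?pd_cc ?mulr0 ?mul0r.
  have ind : (c'' != c')%:R = 1 - (c'' == c')%:R :> R by case: eqP; rewrite ?subrr ?subr0.
  rewrite ind /tau; case: ifPn => hc.
    have /andP[_ hp3] := hc; exact: point_arith2.
  rewrite mulr0n; exact: point_arith1.
move=> K1.
have gN1 c c' c'' : e c c' -> good (fun z => noise c c' z * Pz c c' c'' z).
  by move=> ecc; apply: goodM; [exact: good_noise|exact: good_Pz].
have gN2 c c' c'' : e c c' -> good (fun z => noise2 c c'' z * Pz c c' c'' z).
  by move=> ecc; apply: goodM; [exact: good_noise2|exact: good_Pz].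
pose KK c c' c'' := C0 * Ex (Pz c c' c'') - n%:R * E * ((c'' == c')%:R * Ex (Pz c c' c'')) +
  n%:R * b * (d1 ^+ 2 / 4) * ((close c' c'')%:R * Ex (Pz c c' c'')) -
  mu * (Ex (fun z => noise c c' z * Pz c c' c'' z) + Ex (fun z => noise2 c c'' z * Pz c c' c'' z)).
have K2 : \sum_c \sum_(c' | e c c') \sum_(c'' | e c c'') KK c c' c'' <= - (nedges * ln nedges).
  apply: le_trans K1; apply: ler_sum => c _; apply: ler_sum => c' ecc; apply: ler_sum => c'' ecc'.
  have gP := good_Pz c'' ecc.
  set k1 := C0 - n%:R * E * (c'' == c')%:R + n%:R * b * (d1 ^+ 2 / 4) * (close c' c'')%:R.
  have -> : KK c c' c'' = Ex (fun z => k1 * Pz c c' c'' z - mu * (noise c c' z * Pz c c' c'' z + noise2 c c'' z * Pz c c' c'' z)).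
    have gn := goodD (gN1 _ _ c'' ecc) (gN2 _ _ c'' ecc).
    rewrite (ExB (goodZ _ gP) (goodZ _ gn)) (ExZ _ gP) (ExZ _ gn) (ExD (gN1 _ _ c'' ecc) (gN2 _ _ c'' ecc)).
    by rewrite /KK /k1; ring.
  apply: le_Ex.
  - by apply: goodB; apply: goodZ => //; apply: goodD; [exact: gN1|exact: gN2].
  - apply: goodM => //; apply: goodB; apply: good_ln; [exact: gq|exact: pgood_Lz].
  - move=> z; have P0 : 0 < Pz c c' c'' z by exact: pgood_gt0 (pgood_Pz _ ecc).
    rewrite (_ : _ - _ = Pz c c' c'' z * (k1 - mu * (noise c c' z + noise2 c c'' z))); last by ring.
    by rewrite ler_pM2l//; exact: point.
have S1 : \sum_c \sum_(c' | e c c') \sum_(c'' | e c c'') Ex (Pz c c' c'') = nedges.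
  apply: eq_bigr => c _; apply: eq_bigr => c' ecc; rewrite -Ex_sum => [|c'' _]; last exact: good_Pz.
  by rewrite -(Ex_Lz c c'); apply: eq_Ex => z; rewrite sum_Pz.
have S2 : \sum_c \sum_(c' | e c c') \sum_(c'' | e c c'') Ex (fun z => noise c c' z * Pz c c' c'' z) <= nedges * (15 / 4).
  rewrite /nedges mulr_suml; apply: ler_sum => c _; rewrite mulr_suml; apply: ler_sum => c' ecc.
  rewrite -Ex_sum => [|c'' _]; last exact: gN1.
  under eq_Ex do rewrite -mulr_sumr sum_Pz//.
  by rewrite mul1r Ex_noise.
have S3 : \sum_c \sum_(c' | e c c') \sum_(c'' | e c c'') Ex (fun z => noise2 c c'' z * Pz c c' c'' z) <= nedges * (5 / 4).
  rewrite /nedges mulr_suml; apply: ler_sum => c _; rewrite mulr_suml exchange_big/=; apply: ler_sum => c'' ecc.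
  rewrite -Ex_sum => [|c' ecc']; last exact: gN2.
  under eq_Ex do rewrite -mulr_sumr.
  rewrite (_ : Ex _ = Ex (fun z => noise2 c c'' z * Lz c c'' z)); first by rewrite mul1r Ex_noise2.
  by apply: eq_Ex => z; rewrite -(sum_Pz z ecc); congr (_ * _); apply: eq_bigr => c' _; rewrite PzC.
have S4 : \sum_c \sum_(c' | e c c') \sum_(c'' | e c c'') (c'' == c')%:R * Ex (Pz c c' c'') = \sum_c \sum_(c' | e c c') Ex (Pz c c' c').
  apply: eq_bigr => c _; apply: eq_bigr => c' ecc; rewrite (bigD1 c')//= eqxx mul1r big1 ?addr0//.
  by move=> c'' /andP[_ /negbTE ->]; rewrite mul0r.
set SC := \sum_c \sum_(c' | e c c') \sum_(c'' | e c c'') (close c' c'')%:R * Ex (Pz c c' c'').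
have KKE : \sum_c \sum_(c' | e c c') \sum_(c'' | e c c'') KK c c' c'' =
   C0 * (\sum_c \sum_(c' | e c c') \sum_(c'' | e c c'') Ex (Pz c c' c'')) -
   n%:R * E * (\sum_c \sum_(c' | e c c') \sum_(c'' | e c c'') (c'' == c')%:R * Ex (Pz c c' c'')) +
   n%:R * b * (d1 ^+ 2 / 4) * SC -
   mu * (\sum_c \sum_(c' | e c c') \sum_(c'' | e c c'') Ex (fun z => noise c c' z * Pz c c' c'' z) +
         \sum_c \sum_(c' | e c c') \sum_(c'' | e c c'') Ex (fun z => noise2 c c'' z * Pz c c' c'' z)).
  rewrite /SC -sum_lin5; apply: eq_bigr => c _.
  rewrite -sum_lin5; apply: eq_bigr => c' _.
  by rewrite -sum_lin5.
move: K2; rewrite KKE [X in C0 * X]S1 [X in C0 * _ - _ * X]S4.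
have := ler_wpM2l (ltW m0) (lerD S2 S3).
rewrite /C0; set s1 := \sum_c _; set s2 := \sum_c _; set s3 := \sum_c _; clearbody SC s1 s2 s3.
exact: close_arith.
Qed.

End graph.

(** * Error probability seen from the midpoint of an edge *)

Lemma Ex_shift_inv {R : realType} n (a : 'rV[R]_n) (f : 'rV[R]_n -> R) : good f ->
  Ex f = Ex (fun w => f (w + a) * expR (- dot a w - norm2 a / 2)).
Proof.
move=> gf; pose f1 w := f w * expR (- dot a w + norm2 a / 2).
have g1 : good f1.
  apply: goodM => //; under eq_fun do rewrite expRD -dotN.
  by apply: goodM; [exact: good_expdot|exact: good_cst].
have := Ex_shift a g1.
rewrite (_ : (fun w => f1 w * _) = f); last first.
  apply/funext => w; rewrite /f1 -mulrA -expRD.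
  by rewrite (_ : _ + _ = 0) ?expR0 ?mulr1//; ring.
move=> <-; apply: eq_Ex => w; rewrite /f1; congr (_ * expR _).
by rewrite dotDr -norm2E; field.
Qed.

Lemma shift_arith {R : realType} (mu tau p u : R) : 0 < mu -> 0 < tau -> 0 <= p -> p <= 2 ->
  - (2 * tau * p) <= u -> u <= 2 * tau * p ->
  - (mu ^+ 2 * p) - 10 * mu * tau - 6 * tau ^+ 2 <=
  - (2 * mu * tau) + (- (mu * (u + 2 * tau * p)) - mu ^+ 2 * p) + (- (tau * u) - tau ^+ 2 * (2 * p) / 2).
Proof.
move=> m0 t0 p0 p2 u1 u2.
have h1 : mu * (u + 2 * tau * p) <= mu * (8 * tau).
  rewrite ler_pM2l//; have : tau * p <= tau * 2 by rewrite ler_pM2l.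
  by lra.
have h2 : tau * u <= tau * (4 * tau).
  rewrite ler_pM2l//; have : tau * p <= tau * 2 by rewrite ler_pM2l.
  by lra.
have h3 : tau ^+ 2 * p <= tau ^+ 2 * 2 by rewrite ler_wpM2l// sqr_ge0.
by lra.
Qed.

Lemma theta_arith {R : realType} (u v w : R) : u <= v -> 0 <= w -> w <= 1 -> u - v * (1 - w) <= u * w.
Proof. by nra. Qed.

Lemma ln_tangent {R : realType} (u v : R) : 0 < u -> 0 < v -> ln u <= ln v + (u / v - 1).
Proof.
move=> u0 v0; have uv0 : 0 < u / v by exact: divr_gt0.
have := expR_ge1Dx (ln (u / v)); rewrite lnK ?posrE// ln_div ?posrE//; lra.
Qed.

Section graph_error.
Context {R : realType} (n : nat) (T : finType) (x : T -> 'rV[R]_n) (e : rel T) (b : R).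
Hypothesis n0 : (0 < n)%N.
Hypothesis b0 : 0 < b.
Hypothesis x1 : forall c, norm2 (x c) = 1.
Hypothesis esym : symmetric e.
Implicit Types c : T.

Local Notation mu := (Num.sqrt (n%:R * b)).
Local Notation L := (Lz x b).
Local Notation S := (Sz x e b).
Local Notation P := (Pz x e b).
Local Notation pd := (pd x).
Local Notation nedges := (@nedges R T e).

Lemma meas_abs_le (a : 'rV[R]_n) k : measurable_fun setT (fun t : n.-tuple R => `|dot a (rv t)| <= k).
Proof.
apply: measurable_fun_ler => //; apply: measurableT_comp => //; exact: (@meas_dot R n a).
Qed.

Lemma meas_dot_ge0 (a : 'rV[R]_n) : measurable_fun setT (fun t : n.-tuple R => 0 <= dot a (rv t)).
Proof. by apply: measurable_fun_ler => //; exact: (@meas_dot R n a). Qed.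

Definition inside (tau : R) c c' z : R := (`|dot (x c' - x c) z| <= 2 * tau * pd c c')%R%:R.

Lemma good_inside tau c c' : good (inside tau c c').
Proof. by apply: good_ind; exact: meas_abs_le. Qed.

Lemma inside01 tau c c' z : 0 <= inside tau c c' z <= 1.
Proof. by rewrite /inside ler0n lern1 leq_b1. Qed.

Lemma dot_diff_sum c c' : dot (x c' - x c) (x c + x c') = 0.
Proof. by rewrite dotBl !dotDr -!norm2E !x1 (dotC (x c')); ring. Qed.

(** Weighting the event that c' is nearer by the posterior of c' makes the sum over neighbours at
    most 1, hence at most [Phi] wherever some neighbour is nearer. Close to the bisector the law
    centred at the signal of c has density about e^{-n b p} relative to [Lz c c']. *)
Lemma err_lower c tau (Phi : 'rV[R]_n -> R) : 0 < tau -> good Phi -> (forall z, 0 <= Phi z) ->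
  (forall z c', e c c' -> 0 <= dot (x c' - x c) z -> 1 <= Phi z) ->
  \sum_(c' | e c c') expR (- (n%:R * b * pd c c') - 10 * mu * tau - 6 * tau ^+ 2) *
     Ex (fun z => P c c' c' z * inside tau c c' z) <= Ex (fun w => Phi (w + (2 * mu) *: x c)).
Proof.
move=> tau0 gPhi Phi0 PhiP; have m0 := mu_gt0 n0 b0; have mm := mu2 n0 b0.
pose D c' := x c' - x c.
pose W z := expR (dot ((2 * mu) *: x c) z - 2 * mu ^+ 2).
have gW : good W.
  by rewrite /W; under eq_fun do rewrite expRD; apply: goodM; [exact: good_expdot|exact: good_cst].
have -> : Ex (fun w => Phi (w + (2 * mu) *: x c)) = Ex (fun z => Phi z * W z).
  by rewrite (Ex_shift _ gPhi); apply: eq_Ex => z; rewrite /W norm2Z x1; congr (_ * expR (_ - _)); field.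
pose G c' z := L c c' z / S c z * (0 <= dot (D c') z)%R%:R * W z.
have gG c' : e c c' -> good (G c').
  move=> ecc; apply: goodM => //; apply: goodM; last by apply: good_ind; exact: meas_dot_ge0.
  by apply: pgood_good; apply: pgoodM; [exact: pgood_Lz|exact/pgoodV/(pgood_Sz _ _ ecc)].
apply: (@le_trans _ _ (Ex (fun z => \sum_(c' | e c c') G c' z))); last first.
  apply: le_Ex; [by apply: good_sum => c' ecc; exact: gG|exact: goodM|move=> z].
  rewrite -mulr_suml; apply: ler_wpM2r; first exact: expR_ge0.
  case: (pickP (fun c' => e c c' && (0 <= dot (D c') z))) => [c1 /andP[ec1 d1]|no]; last first.
    rewrite big1 ?Phi0// => c' ecc; have := no c'; rewrite ecc/= => ->; by rewrite mulr0.
  apply: le_trans (PhiP _ _ ec1 d1); have S0 := Sz_gt0 x b z ec1.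
  apply: (@le_trans _ _ (\sum_(c' | e c c') L c c' z / S c z)).
    apply: ler_sum => c' ecc; rewrite ler_piMr//; last by rewrite lern1 leq_b1.
    by rewrite divr_ge0 ?(ltW S0)// ltW// Lz_gt0.
  by rewrite -mulr_suml divff// gt_eqF.
rewrite Ex_sum//; apply: ler_sum => c' ecc.
have gI : good (fun z => P c c' c' z * inside tau c c' z).
  by apply: goodM; [exact: good_Pz|exact: good_inside].
(* Moving the variable by tau (x_c' - x_c) carries the strip [inside] to the side of c'; [Lz c c']
   does not change, since the displacement is orthogonal to x_c + x_c'. *)
set k := expR _; rewrite (Ex_shift_inv (tau *: D c') (gG _ ecc)) -(ExZ _ gI).
have gs : good (fun w => expR (- dot (tau *: D c') w - norm2 (tau *: D c') / 2)).
  under eq_fun do rewrite expRD -dotN.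
  by apply: goodM; [exact: good_expdot|exact: good_cst].
apply: le_Ex; [exact: goodZ|apply: goodM => //; exact: good_shift (gG _ ecc)|move=> z].
have /andP[p0 p2] := pd_bound x1 c c'; set p := pd c c' in p0 p2 *.
have W0 (v : 'rV[R]_n) : 0 < W v by exact: expR_gt0.
have S0 v := Sz_gt0 x b v ecc; have L0 v := Lz_gt0 x b c c' v.
have L1 (v : 'rV[R]_n) : L c c' (v + tau *: D c') = L c c' v.
  by rewrite /Lz dotZl dotDr dotZr (dotC (x c + x c') (D c')) dot_diff_sum mulr0 addr0 dotZl.
rewrite /inside; case: (boolP (`|dot (x c' - x c) z| <= 2 * tau * pd c c')%R) => hin; last first.
  rewrite /= !mulr0; apply: mulr_ge0; last exact: expR_ge0.
  rewrite /G; apply: mulr_ge0; last exact: expR_ge0.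
  apply: mulr_ge0; last exact: ler0n.
  by apply: divr_ge0; exact: ltW.
set u := dot (D c') z in hin *.
have hu : dot (D c') (z + tau *: D c') = u + 2 * tau * p.
  by rewrite /u dotDr dotZr -norm2E /D norm2_diff// -/p; ring.
move: hin; rewrite -/(D c') -/u -/p ler_norml => /andP[u1 u2].
have up : 0 <= u + 2 * tau * p by lra.
rewrite /G hu up !mulr1 L1.
have SS : S c (z + tau *: D c') <= expR (2 * mu * tau) * S c z.
  rewrite /Sz mulr_sumr; apply: ler_sum => c'' _; rewrite /Lz -expRD ler_expR.
  rewrite dotZl dotDr dotZr !dotZl.
  have : mu * (tau * dot (x c + x c'') (D c')) <= 2 * mu * tau.
    have : dot (x c + x c'') (D c') <= 2.
      rewrite /D dotBr !dotDl -norm2E x1.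
      have := pd_bound x1 c c'; have := pd_bound x1 c'' c'; have := pd_bound x1 c'' c.
      by rewrite !pdE; lra.
    move=> h; have mt : 0 <= mu * tau by rewrite mulr_ge0 ?ltW.
    have -> : 2 * mu * tau = mu * tau * 2 by ring.
    by rewrite mulrA ler_wpM2l.
  by rewrite mulrDr; lra.
have -> : W (z + tau *: D c') = L c c' z * expR (- (mu * (u + 2 * tau * p)) - mu ^+ 2 * p).
  rewrite -(L1 z) /W /Lz -expRD -hu; congr expR.
  by rewrite norm2_sum// -/p !dotZl dotDl /D dotBl; field.
rewrite dotZl norm2Z /D norm2_diff// -/p -/(D c') -/u.
have S1 : 0 < expR (2 * mu * tau) * S c z by rewrite mulr_gt0// expR_gt0.
apply: (@le_trans _ _ (L c c' z / (expR (2 * mu * tau) * S c z) *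
  (L c c' z * expR (- (mu * (u + 2 * tau * p)) - mu ^+ 2 * p)) * expR (- (tau * u) - tau ^+ 2 * (2 * p) / 2))); last first.
  apply: ler_wpM2r; first exact: expR_ge0.
  apply: ler_wpM2r; first by rewrite mulr_ge0 ?expR_ge0// ltW.
  by apply: ler_wpM2l; [exact: ltW|rewrite lef_pV2 ?posrE; [exact: SS|exact: S1|exact: S0]].
have -> : L c c' z / (expR (2 * mu * tau) * S c z) *
  (L c c' z * expR (- (mu * (u + 2 * tau * p)) - mu ^+ 2 * p)) * expR (- (tau * u) - tau ^+ 2 * (2 * p) / 2) =
  (expR (- (2 * mu * tau)) * expR (- (mu * (u + 2 * tau * p)) - mu ^+ 2 * p) * expR (- (tau * u) - tau ^+ 2 * (2 * p) / 2)) * P c c' c' z.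
  rewrite /Pz expRN; field; rewrite !gt_eqF ?expR_gt0//.
apply: ler_wpM2r; first by rewrite ltW// (pgood_gt0 _ (pgood_Pz x b _ ecc)).
rewrite /k -!expRD ler_expR mm -/p; have := shift_arith m0 tau0 p0 p2 u1 u2.
by rewrite mm.
Qed.

Lemma Ex_outside tau c c' : 0 < tau -> 0 < pd c c' ->
  Ex (fun z => L c c' z * (1 - inside tau c c' z)) <= (2 * tau ^+ 2 * pd c c')^-1.
Proof.
move=> tau0 p0; set p := pd c c' in p0 *; pose a := x c' - x c.
have gL := good_Lz x b c c'.
have gd2 : good (fun z => dot a z ^+ 2).
  by under eq_fun do rewrite expr2; apply: goodM; exact: good_dot.
have tp : 0 < 2 * tau * p by rewrite !mulr_gt0.
apply: (@le_trans _ _ (Ex (fun z => (2 * tau * p) ^- 2 * (dot a z ^+ 2 * L c c' z)))).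
  apply: le_Ex.
  - by apply: goodM => //; apply: goodB; [exact: good_cst|exact: good_inside].
  - by apply: goodZ; exact: goodM.
  - move=> z; rewrite mulrA [leRHS]mulrC ler_pM2l ?Lz_gt0// /inside -/a -/p.
    case: (lerP `|dot a z| (2 * tau * p)) => h.
      by rewrite subrr mulr_ge0 ?sqr_ge0// invr_ge0 exprn_ge0// ltW.
    rewrite subr0 ler_pdivlMl ?exprn_gt0// mulr1 -[leRHS]real_normK ?num_real//.
    by rewrite ler_sqr ?nnegrE ?ltW// (lt_trans tp).
rewrite (ExZ _ (goodM gd2 gL)) (Ex_Lz_shift x b c c' gd2).
under eq_Ex do rewrite dotDr dotZr dot_diff_sum mulr0 addr0.
have := Ex_dot_sqr_le a; rewrite norm2_diff// -/p => h.
apply: le_trans (ler_wpM2l _ h) _; first by rewrite invr_ge0 exprn_ge0// ltW.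
by rewrite le_eqVlt; apply/orP; left; apply/eqP; field; rewrite !gt_eqF.
Qed.

Lemma edge_sum_theta tau pm : 0 < tau -> 0 < pm -> (forall c c', e c c' -> pm <= pd c c') ->
  \sum_c \sum_(c' | e c c') Ex (P c c' c') - nedges * (2 * tau ^+ 2 * pm)^-1 <=
  \sum_c \sum_(c' | e c c') Ex (fun z => P c c' c' z * inside tau c c' z).
Proof.
move=> tau0 pm0 hp.
rewrite /nedges mulr_suml -sumrB; apply: ler_sum => c _.
rewrite mulr_suml -sumrB; apply: ler_sum => c' ecc; rewrite mul1r.
have p0 : 0 < pd c c' by exact: lt_le_trans (hp _ _ ecc).
have gP := good_Pz x b c' ecc; have gI := good_inside tau c c'.
have gO : good (fun z => L c c' z * (1 - inside tau c c' z)).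
  by apply: goodM; [exact: good_Lz|apply: goodB => //; exact: good_cst].
have h1 := Ex_outside tau0 p0.
have h2 : (2 * tau ^+ 2 * pd c c')^-1 <= (2 * tau ^+ 2 * pm)^-1.
  by rewrite lef_pV2 ?posrE ?mulr_gt0 ?exprn_gt0// ler_pM2l ?mulr_gt0 ?exprn_gt0// hp.
apply: (@le_trans _ _ (Ex (P c c' c') - Ex (fun z => L c c' z * (1 - inside tau c c' z)))).
  by rewrite lerD2l lerN2 (le_trans h1).
rewrite -(ExB gP gO); apply: le_Ex; [exact: goodB|exact: goodM|move=> z].
have /andP[i0 i1] := inside01 tau c c' z.
have PL : P c c' c' z <= L c c' z.
  rewrite -(sum_Pz x b z ecc) (bigD1 c')//= lerDl; apply: sumr_ge0 => c'' /andP[_ _].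
  exact: ltW (pgood_gt0 _ (pgood_Pz x b _ ecc)).
move: PL i0 i1; set u := P _ _ _ _; set v := L _ _ _; set w := inside _ _ _ _; exact: theta_arith.
Qed.

Definition kappa : R := - \sum_c \sum_(c' | e c c') Ex (fun z => L c c' z * ln (L c c' z / S c z)).

(** By the tangent of the exponential at - lam, a posterior weight r is at least e^{-lam} (1 + lam +
    ln r); so its mean is controlled by the mean of ln r, which is minus the entropy. *)
Lemma edge_sum_kappa tau pm lam : 0 < tau -> 0 < pm -> (forall c c', e c c' -> pm <= pd c c') -> 0 <= lam ->
  expR (- lam) * ((1 + lam) * (1 - (2 * tau ^+ 2 * pm)^-1) * nedges - kappa) <=
  \sum_c \sum_(c' | e c c') Ex (fun z => P c c' c' z * inside tau c c' z).
Proof.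
move=> tau0 pm0 hp lam0; rewrite /kappa opprK.
have lam1 : 0 <= 1 + lam by lra.
rewrite /nedges [X in X + _]mulr_sumr -big_split mulr_sumr; apply: ler_sum => c _ /=.
rewrite [X in X + _]mulr_sumr -big_split mulr_sumr; apply: ler_sum => c' ecc /=; rewrite mulr1.
have p0 : 0 < pd c c' by exact: lt_le_trans (hp _ _ ecc).
have gP := good_Pz x b c' ecc; have gI := good_inside tau c c'.
have gl := good_lnpi x b ecc.
have gO : good (fun z => L c c' z * (1 - inside tau c c' z)).
  by apply: goodM; [exact: good_Lz|apply: goodB => //; exact: good_cst].
have h1 := Ex_outside tau0 p0.
have h2 : (2 * tau ^+ 2 * pd c c')^-1 <= (2 * tau ^+ 2 * pm)^-1.
  by rewrite lef_pV2 ?posrE ?mulr_gt0 ?exprn_gt0// ler_pM2l ?mulr_gt0 ?exprn_gt0// hp.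
have gL := good_Lz x b c c'.
apply: (@le_trans _ _ (Ex (fun z => expR (- lam) * ((1 + lam) * (L c c' z - L c c' z * (1 - inside tau c c' z)) +
    L c c' z * ln (L c c' z / S c z))))).
  have g1 := goodB gL gO; have g2 := goodD (goodZ (1 + lam) g1) gl.
  rewrite (ExZ _ g2) (ExD (goodZ (1 + lam) g1) gl) (ExZ _ g1) (ExB gL gO) Ex_Lz.
  rewrite ler_wpM2l ?expR_ge0// lerD2r ler_wpM2l// lerD2l lerN2 (le_trans h1)//.
apply: le_Ex.
- by apply: goodZ; apply: goodD => //; apply: goodZ; exact: goodB.
- exact: goodM.
move=> z; have /andP[i0 i1] := inside01 tau c c' z.
have L0 := Lz_gt0 x b c c' z; have S0 := Sz_gt0 x b z ecc.
have LS : L c c' z <= S c z.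
  rewrite /Sz (bigD1 c')//= lerDl; apply: sumr_ge0 => c'' _; exact: ltW (Lz_gt0 _ _ _ _ _).
pose r := L c c' z / S c z.
have r0 : 0 < r by exact: divr_gt0.
have r1 : r <= 1 by rewrite ler_pdivrMr// mul1r.
have lnr : ln r <= 0 by rewrite ln_le0.
have key : expR (- lam) * (1 + lam + ln r) <= r.
  have := expR_ge1Dx (ln r + lam); rewrite expRD lnK ?posrE// => h.
  have := ler_wpM2l (expR_ge0 (- lam)) h.
  rewrite mulrCA -expRD addNr expR0 mulr1; congr (_ <= _); congr (_ * _); ring.
have -> : P c c' c' z = L c c' z * r by rewrite /Pz /r mulrA.
rewrite -/r.
have e0 := expR_gt0 (- lam).
rewrite /inside in i0 i1 *; case: (`|_| <= _) i0 i1 => /= _ _.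
  rewrite mulr1 [leLHS](_ : _ = L c c' z * (expR (- lam) * (1 + lam + ln r))); last by ring.
  by rewrite ler_pM2l.
by rewrite subr0 mulr1 subrr !mulr0 add0r pmulr_rle0// pmulr_rle0.
Qed.

(** The logarithm in the entropy bound is replaced by its tangent at t0, so that the bounds for
    different c, whose errors differ, can be added. *)
Lemma kappa_le t0 Nmax : 0 < Nmax -> (forall c, #|nbh e c|%:R <= Nmax :> R) -> 0 < 1 - b * t0 ->
  kappa <= nedges * (ln Nmax + n%:R / 2 * (ln (1 - b * t0) + b * t0 / (1 - b * t0)))
   - n%:R / 2 * (b / (1 - b * t0)) * \sum_c \sum_(c' | e c c') \sum_(c'' | e c c'') Ex (P c c' c'') * pd c' c''.
Proof.
move=> Nm0 hN t0b.
have nn0 : 0 < n%:R :> R by rewrite ltr0n.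
have m0 := mu_gt0 n0 b0; have mm := mu2 n0 b0; have nb0 := nb_gt0 n0 b0.
rewrite /kappa /nedges -sumrN mulr_suml mulr_sumr -sumrB; apply: ler_sum => c _.
case: (pickP (e c)) => [c0 ecc|no]; last by rewrite !big_pred0// oppr0 mul0r mulr0 subrr.
have c0N : c0 \in nbh e c by rewrite inE.
have x1' i : i \in nbh e c -> norm2 (x i) = 1 by [].
rewrite (cond_ent_graph n0 b0 x1 ecc) opprK -(mmse_graph n0 b0 x1 ecc).
have m20 : 0 < mu ^+ 2 by rewrite mm.
have := cond_ent_le n0 x1' c0N m20; have := mmse_lt n0 x1' c0N m20.
rewrite mm; set V := mmse _ _ _; set K := cond_ent _ _ _.
have -> : n%:R * b * V / n%:R = b * V by field; rewrite gt_eqF.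
set N := #|nbh e c|%:R; have N0 : 0 < N by exact: (cardD_gt0 c0N).
have -> : \sum_(c' | e c c') 1 = N.
  by rewrite sumr_const /N; congr (_%:R); apply: eq_card => c'; rewrite !inE.
move=> V1 KV.
have lnN : ln N <= ln Nmax by rewrite ler_ln ?posrE ?hN.
have tang : ln (1 - b * V) <= ln (1 - b * t0) + b * t0 / (1 - b * t0) - b / (1 - b * t0) * V.
  have := ln_tangent V1 t0b.
  congr (_ <= _); rewrite -!addrA; congr (_ + _).
  by field; rewrite gt_eqF.
have n2 : 0 <= n%:R / 2 :> R by rewrite divr_ge0.
have := ler_wpM2l n2 tang => tang2.
have KK : K <= ln Nmax + n%:R / 2 * (ln (1 - b * t0) + b * t0 / (1 - b * t0) - b / (1 - b * t0) * V) by lra.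
have := ler_wpM2l (ltW N0) KK; congr (_ <= _); ring.
Qed.

(** The neighbours of c lie near a sphere around (1 - p0) x_c of squared radius p0 (2 - p0); linear
    estimation from that centre gives the bound. *)
Lemma dist_upper p0 d : 0 <= p0 <= 2 -> 0 <= d -> (forall c c', e c c' -> `|pd c c' - p0| <= d) ->
  \sum_c \sum_(c' | e c c') \sum_(c'' | e c c'') Ex (P c c' c'') * pd c' c'' <=
  nedges * ((p0 * (2 - p0) + 2 * d) / (1 + b * (p0 * (2 - p0) + 2 * d))).
Proof.
move=> /andP[p00 p02] d0 pe; set B := p0 * (2 - p0) + 2 * d.
have B0 : 0 <= B by rewrite /B addr_ge0 ?mulr_ge0//; lra.
have nn0 : 0 < n%:R :> R by rewrite ltr0n.
have m0 := mu_gt0 n0 b0; have mm := mu2 n0 b0; have nb0 := nb_gt0 n0 b0.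
rewrite /nedges mulr_suml; apply: ler_sum => c _.
case: (pickP (e c)) => [c0 ecc|no]; last by rewrite !big_pred0// mul0r.
have c0N : c0 \in nbh e c by rewrite inE.
have x1' i : i \in nbh e c -> norm2 (x i) = 1 by [].
rewrite -(mmse_graph n0 b0 x1 ecc).
have -> : \sum_(c' | e c c') 1 = #|nbh e c|%:R :> R.
  by rewrite sumr_const; congr (_%:R); apply: eq_card => c'; rewrite !inE.
rewrite ler_pM2l ?(cardD_gt0 c0N)//.
have m20 : 0 <= mu ^+ 2 by rewrite mm ltW.
have := @mmse_center _ _ _ _ _ _ n0 x1' c0N _ B ((1 - p0) *: x c) m20 B0.
have -> : B * n%:R / (n%:R + mu ^+ 2 * B) = B / (1 + b * B).
  have bB : 0 <= b * B by rewrite mulr_ge0// ltW.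
  have b1 : 0 < 1 + b * B by lra.
  have b2 : 0 < n%:R + n%:R * b * B by rewrite -mulrA ltr_pwDl// mulr_ge0// ltW.
  by rewrite mm; field; rewrite !gt_eqF.
apply=> c'; rewrite inE => ecc'; have := pe _ _ ecc'; rewrite ler_norml !pdE => /andP[h1 h2].
rewrite norm2B norm2Z !x1 dotZr (dotC (x c')) /B; set t := dot (x c) (x c') in h1 h2 *.
have : (1 - p0) * (1 - p0 - t) <= d.
  case: (lerP 0 (1 - p0)) => hp; first by apply: (@le_trans _ _ ((1 - p0) * d)); [apply: ler_wpM2l; lra|rewrite ler_piMl//; lra].
  by apply: (@le_trans _ _ ((1 - p0) * (- d))); [apply: ler_wnM2l; lra|nra].
have -> : 1 + (1 - p0) ^+ 2 * 1 - 2 * ((1 - p0) * t) = p0 * (2 - p0) + 2 * ((1 - p0) * (1 - p0 - t)) by ring.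
by lra.
Qed.

Lemma dist_lower p0 d1 : 0 <= p0 - d1 ->
  (p0 - d1) * (nedges - \sum_c \sum_(c' | e c c') Ex (P c c' c') -
   \sum_c \sum_(c' | e c c') \sum_(c'' | e c c'') ((c'' != c') && (pd c' c'' < p0 - d1)%R)%:R * Ex (P c c' c'')) <=
  \sum_c \sum_(c' | e c c') \sum_(c'' | e c c'') Ex (P c c' c'') * pd c' c''.
Proof.
move=> pd0; rewrite /nedges -!sumrB mulr_sumr; apply: ler_sum => c _.
rewrite -!sumrB mulr_sumr; apply: ler_sum => c' ecc.
have S1 : 1 = \sum_(c'' | e c c'') Ex (P c c' c'').
  rewrite -Ex_sum => [|c'' _]; last exact: good_Pz.
  by rewrite -(Ex_Lz x b c c'); apply: eq_Ex => z; rewrite sum_Pz.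
have S4 : Ex (P c c' c') = \sum_(c'' | e c c'') (c'' == c')%:R * Ex (P c c' c'').
  rewrite (bigD1 c')//= eqxx mul1r big1 ?addr0//.
  by move=> c'' /andP[_ /negbTE ->]; rewrite mul0r.
rewrite S4 [X in X - _ - _]S1 -!sumrB mulr_sumr; apply: ler_sum => c'' ecc'.
have P0 : 0 <= Ex (P c c' c'').
  by apply: Ex_ge0 => z; exact: ltW (pgood_gt0 _ (pgood_Pz x b _ ecc)).
have /andP[q0 q2] := pd_bound x1 c' c''.
set X := Ex _ in P0 *; set q := pd c' c'' in q0 *.
case: (c'' == c') => /=; first by rewrite mul1r mul0r subrr subr0 mulr0 mulr_ge0.
rewrite mul0r subr0; case: ltP => h /=; first by rewrite mul1r subrr mulr0 mulr_ge0.
by rewrite mul0r subr0 mulrC ler_wpM2l.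
Qed.

End graph_error.

(** For p > 0 the estimation bound p (2 - p) / (1 + b p (2 - p)) equals p exactly when 1 - p = b p
    (2 - p), which at p = 1 - s is the saddle equation; beyond 1 - s it falls below p by a margin
    proportional to p - (1 - s). *)
Lemma sat_gap {R : realType} (b s p d B : R) : 0 < b -> 0 < s -> s < 1 -> s = b * (1 - s ^+ 2) ->
  0 <= p <= 2 -> 0 <= d -> B = p * (2 - p) + 2 * d ->
  B / (1 + b * B) <= p - p * (p - (1 - s)) / (2 * (1 + b)) + 2 * d \/ p <= 1 - s.
Proof.
move=> b0 s0 s1 sE /andP[p0 p2] d0 ->.
case: (lerP p (1 - s)) => hp; [by right|left].
set B0 := p * (2 - p).
have B00 : 0 <= B0 by rewrite /B0 mulr_ge0//; lra.
have B01 : B0 <= 1 by rewrite /B0; have := sqr_ge0 (p - 1); nra.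
have D0 : 0 < 1 + b * B0 by have := mulr_ge0 (ltW b0) B00; lra.
have D1 : 0 < 1 + b * (B0 + 2 * d) by rewrite mulrDr; have := mulr_ge0 (ltW b0) B00; have := mulr_ge0 (ltW b0) d0; nra.
have h1 : (B0 + 2 * d) / (1 + b * (B0 + 2 * d)) <= B0 / (1 + b * B0) + 2 * d.
  rewrite -subr_ge0.
  have -> : B0 / (1 + b * B0) + 2 * d - (B0 + 2 * d) / (1 + b * (B0 + 2 * d)) =
     2 * d * ((1 + b * B0) * (1 + b * (B0 + 2 * d)) - 1) / ((1 + b * B0) * (1 + b * (B0 + 2 * d))).
    by field; rewrite !gt_eqF.
  apply: divr_ge0; last by rewrite mulr_ge0// ltW.
  apply: mulr_ge0; first lra.
  have u0 : 0 <= b * B0 by rewrite mulr_ge0// ltW.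
  have v0 : 0 <= b * (B0 + 2 * d) by rewrite mulr_ge0 ?(ltW b0)//; lra.
  have := mulr_ge0 u0 v0; lra.
have h2 : B0 / (1 + b * B0) <= p - p * (p - (1 - s)) / (2 * (1 + b)).
  have -> : B0 / (1 + b * B0) = p - p * ((p - (1 - s)) / (1 + s) + b * (2 - p) * (p - (1 - s))) / (1 + b * B0).
    have sE' : b = s / (1 - s ^+ 2) by rewrite {1}sE mulfK// gt_eqF//; nra.
    have s2 : 1 - s ^+ 2 != 0 by rewrite gt_eqF//; nra.
    rewrite /B0 in D0 *.
    have : B0 = p * (1 + b * B0) - p * ((p - (1 - s)) / (1 + s) + b * (2 - p) * (p - (1 - s))).
      rewrite /B0 sE'; field; rewrite s2 gt_eqF//; lra.
    rewrite /B0 => h; rewrite {1}h mulrBl mulfK ?gt_eqF//.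
  rewrite lerD2l lerN2.
  have q0 : 0 <= p - (1 - s) by lra.
  have b1 : 0 < 2 * (1 + b) by lra.
  rewrite ler_pdivrMr// mulrAC ler_pdivlMr// -!mulrA ler_wpM2l//.
  have : (p - (1 - s)) / 2 <= (p - (1 - s)) / (1 + s) by rewrite ler_wpM2l// lef_pV2 ?posrE; lra.
  have : 0 <= b * (2 - p) * (p - (1 - s)) by rewrite !mulr_ge0//; lra.
  have : (p - (1 - s)) * (1 + b * B0) <= (p - (1 - s)) * (1 + b) by rewrite ler_wpM2l// lerD2l ler_piMr// ltW.
  set u := p - (1 - s) in q0 *; set v := u / (1 + s); set w := b * (2 - p) * u => a1 a2 a3.
  apply: (le_trans a1).
  have -> : (v + b * ((2 - p) * u)) * (2 * (1 + b)) = 2 * (v + w) * (1 + b) by rewrite /w; ring.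
  by apply: ler_wpM2r; lra.
by lra.
Qed.

Lemma gb_arith1 {R : realType} (m b p0 d E M ep lam X Y l : R) :
  X + Y - l <= m * d -> m * E + lam <= m * (M + ep - d * (b + 2)) ->
  - (m * (M + ep)) <= - (m * b * (p0 + d)) - X - Y + m * (b * p0 - E - d) + l - lam.
Proof. by nra. Qed.

Lemma gb_arith2 {R : realType} (m N b q E p0 d d1 d2 e1 sg Eb ep M K U : R) :
  0 < m -> 0 < N -> 0 < b -> 0 < b * q -> b * q <= 2^-1 ->
  K <= N * (m * (b * (p0 + d) - E) + m / 2 * (ln (1 - b * q) + b * q / (1 - b * q))) -
     m / 2 * (b / (1 - b * q)) * U ->
  K <= N * (m * (b * (p0 + d) - E) + m / 2 * (ln (1 - b * 0) + b * 0 / (1 - b * 0))) -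
     m / 2 * (b / (1 - b * 0)) * U ->
  (p0 - (d1 + 2 * (2 * e1 + sg))) * N <= U -> 0 <= U -> p0 <= q + d2 ->
  d * (2 * b + 3) + b * d2 + b * (d1 + 2 * (2 * e1 + sg)) + 2 * e1 * (3 * b + Eb) <= ep ->
  b * q + ln (1 - b * q) / 2 <= M -> 0 <= p0 <= 2 -> - Eb <= E -> 0 < e1 -> e1 <= 4^-1 ->
  0 < d -> d <= d1 / 4 -> d1 <= 1 -> 0 < d2 -> 0 < sg -> 0 <= K ->
  m * E + K / N / (1 - e1) <= m * (M + ep - d * (b + 2)).
Proof.
move=> m0 N0 b0 bq0 bq1 k1 k2 UN U0 p0q hep FM /andP[p00 p02] E2 e10 e14 d0 dd1 d11 d20 sg0 K0.
set lq := ln (1 - b * q) in k1 FM.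
have D0 : 0 < 1 - b * q by move: bq1; clear; lra.
pose k := K / N; have KN : K = N * k by rewrite /k mulrC divfK// gt_eqF.
have kk0 : 0 <= k by rewrite divr_ge0// ltW.
pose v := U / N; have UV : U = N * v by rewrite /v mulrC divfK// gt_eqF.
have v0 : 0 <= v by rewrite divr_ge0// ltW.
set eta := d1 + 2 * (2 * e1 + sg) in UN hep.
have eta0 : 0 <= eta by rewrite /eta; move: d0 dd1 e10 sg0; clear; lra.
have v1 : p0 - eta <= v by move: UN; rewrite UV mulrC ler_pM2l.
pose be := b / (2 * (1 - b * q)).
have be0 : 0 <= be by apply: divr_ge0; [exact: ltW|apply: mulr_ge0 => //; exact: ltW].
have beb : be <= b.
  rewrite /be ler_pdivrMr; last by move: D0; clear; lra.
  by rewrite ler_peMr; [|exact: ltW|move: bq1; clear; lra].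
have k1' : k <= m * (b * (p0 + d) - E + lq / 2 - be * (v - q)).
  move: k1; rewrite KN UV.
  have -> : N * (m * (b * (p0 + d) - E) + m / 2 * (lq + b * q / (1 - b * q))) - m / 2 * (b / (1 - b * q)) * (N * v) =
    N * (m * (b * (p0 + d) - E + lq / 2 - be * (v - q))) by rewrite /be; field; rewrite gt_eqF.
  by rewrite ler_pM2l.
have k2' : k <= m * (3 * b + Eb).
  move: k2; rewrite KN UV mulr0 subr0 ln1 mul0r addr0 mulr0 addr0 divr1.
  have : 0 <= m / 2 * b * (N * v).
    by apply: mulr_ge0; apply: mulr_ge0 => //; [apply: divr_ge0 => //; exact: ltW|exact: ltW|exact: ltW].
  move=> h1 h2; have : N * k <= N * (m * (b * (p0 + d) - E)) by move: h1 h2; clear; lra.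
  rewrite ler_pM2l// => h3; apply: (le_trans h3); rewrite ler_pM2l//.
  have : b * (p0 + d) <= b * 3 by rewrite ler_pM2l//; move: p02 dd1 d11; clear; lra.
  by move: E2; clear; lra.
have lam : k / (1 - e1) <= k + 2 * e1 * k.
  rewrite ler_pdivrMr; last by move: e14; clear; lra.
  have : 0 <= k * e1 * (1 - 2 * e1).
    by apply: mulr_ge0; [apply: mulr_ge0 => //; exact: ltW|move: e14; clear; lra].
  by clear; nra.
rewrite -/k.
have h1 : 2 * e1 * k <= m * (2 * e1 * (3 * b + Eb)).
  by have := ler_wpM2l (ltW e10) k2'; clear; nra.
have h2 : be * (p0 - eta - q) <= be * (v - q) by apply: ler_wpM2l => //; move: v1; clear; lra.
have h3 : (b - be) * (p0 - q) <= b * d2.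
  apply: (@le_trans _ _ ((b - be) * d2)).
    by apply: ler_wpM2l; [move: beb; clear; lra|move: p0q; clear; lra].
  by rewrite ler_pM2r//; move: be0; clear; lra.
have h4 : be * eta <= b * eta by rewrite ler_wpM2r.
have h5 : b * (p0 + d) - E + lq / 2 - be * (v - q) <= M - E + b * d + b * d2 + b * eta.
  have e5 : b * (p0 + d) - be * (p0 - eta - q) = (b - be) * (p0 - q) + be * eta + b * q + b * d by ring.
  by move: e5 h2 h3 h4 FM; clear; lra.
have h6 := ler_wpM2l (ltW m0) h5.
have h7 := ler_wpM2l (ltW m0) hep.
have : m * E + (k + 2 * e1 * k) <= m * (M + ep - d * (b + 2)).
  have : 0 <= m * (d * 1) by rewrite !mulr_ge0 ?ltW.
  by move: h6 h7 h1 k1'; clear; nra.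
by move: lam; clear; lra.
Qed.

(** * The error bound of a graph for fixed tolerances *)

Section graph_bound.
Context {R : realType} (n : nat) (T : finType) (x : T -> 'rV[R]_n) (e : rel T) (b s : R).
Hypothesis n0 : (0 < n)%N.
Hypothesis b0 : 0 < b.
Hypothesis s0 : 0 < s.
Hypothesis s1 : s < 1.
Hypothesis sE : s = b * (1 - s ^+ 2).
Hypothesis x1 : forall c, norm2 (x c) = 1.
Hypothesis esym : symmetric e.
Implicit Types c : T.

Local Notation mu := (Num.sqrt (n%:R * b)).
Local Notation L := (Lz x b).
Local Notation S := (Sz x e b).
Local Notation P := (Pz x e b).
Local Notation pd := (pd x).
Local Notation nedges := (@nedges R T e).

Variables (A : {set T}) (E p0 pm Eb d d1 d2 e1 tau sg : R) (Phi : T -> 'rV[R]_n -> R).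
Hypothesis eA : forall c c', e c c' -> c \in A.
Hypothesis pe : forall c c', e c c' -> `|pd c c' - p0| <= d.
Hypothesis pem : forall c c', e c c' -> pm <= pd c c'.
Hypothesis om : forall c, c \in A ->
  \sum_(c' in A | c' != c) expR (- (n%:R * b * pd c c')) <= expR (- (n%:R * E)).
Hypothesis A0 : (0 < #|A|)%N.
Hypothesis NA : #|A|%:R * expR (n%:R * (b * p0 - E - d)) <= nedges.
Hypothesis p002 : 0 <= p0 <= 2.
Hypothesis EEb : `|E| <= Eb.
Hypothesis PhiG : forall c, good (Phi c).
Hypothesis Phi0 : forall c z, 0 <= Phi c z.
Hypothesis PhiP : forall c c' z, e c c' -> 0 <= dot (x c' - x c) z -> 1 <= Phi c z.
Hypothesis pm0 : 0 < pm.
Hypothesis d0 : 0 < d.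
Hypothesis dd1 : d <= d1 / 4.
Hypothesis d11 : d1 <= 1.
Hypothesis d1p : d1 <= pm / 4.
Hypothesis d20 : 0 < d2.
Hypothesis e10 : 0 < e1.
Hypothesis e14 : e1 <= 4^-1.
Hypothesis tau0 : 0 < tau.
Hypothesis tau1 : (2 * tau ^+ 2 * pm)^-1 <= e1.
Hypothesis sg0 : 0 < sg.
Hypothesis h3 : ln 2 + 5 * mu <= n%:R * d.
Hypothesis h4 : 4 * (d * (b + 2) + 2 * Eb * e1) <= b * d1 ^+ 2 * sg.
Hypothesis h6 : d1 + 2 * (2 * e1 + sg) + 2 * d < pm * d2 / (4 * (1 + b)).
Hypothesis h7 : 10 * mu * tau + 6 * tau ^+ 2 - ln e1 <= n%:R * d.

(** Up to the factor N these are averages over edges: [Th] is the probability that a posterior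
    sample repeats the true neighbour, [SC] that it differs from it but comes too close, [U] the
    mean distance of the two. *)
Let N := nedges.
Let Th := \sum_c \sum_(c' | e c c') Ex (P c c' c').
Let SC := \sum_c \sum_(c' | e c c') \sum_(c'' | e c c'') ((c'' != c') && (pd c' c'' < p0 - d1)%R)%:R * Ex (P c c' c'').
Let U := \sum_c \sum_(c' | e c c') \sum_(c'' | e c c'') Ex (P c c' c'') * pd c' c''.
Let Tot := \sum_(c in A) Ex (fun w => Phi c (w + (2 * mu) *: x c)).
Let In := \sum_c \sum_(c' | e c c') Ex (fun z => P c c' c' z * inside x tau c c' z).

Lemma gb_A0 : 0 < #|A|%:R :> R. Proof. by rewrite ltr0n. Qed.

Lemma gb_N0 : 0 < N.
Proof. by apply: lt_le_trans NA; rewrite mulr_gt0 ?gb_A0 ?expR_gt0. Qed.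

Lemma gb_lnN : ln #|A|%:R + n%:R * (b * p0 - E - d) <= ln N.
Proof.
have := NA; rewrite -ler_ln ?posrE ?gb_N0//; last by rewrite mulr_gt0 ?gb_A0 ?expR_gt0.
by rewrite lnM ?posrE ?gb_A0 ?expR_gt0// expRK.
Qed.

Lemma gb_tot : expR (- (n%:R * b * (p0 + d)) - 10 * mu * tau - 6 * tau ^+ 2) * In <= Tot.
Proof.
have -> : In = \sum_(c in A) \sum_(c' | e c c') Ex (fun z => P c c' c' z * inside x tau c c' z).
  rewrite /In [RHS]big_mkcond; apply: eq_bigr => c _; case: ifPn => // cA.
  by rewrite big_pred0// => c'; apply/negP => /eA; rewrite (negbTE cA).
rewrite mulr_sumr; apply: ler_sum => c cA; rewrite mulr_sumr.
have := err_lower n0 b0 x1 tau0 (PhiG c) (Phi0 c) (fun z c' => @PhiP c c' z).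
apply: le_trans; apply: ler_sum => c' ecc; apply: ler_wpM2r.
  apply: Ex_ge0 => z; apply: mulr_ge0; first exact: ltW (pgood_gt0 _ (pgood_Pz x b _ ecc)).
  by have /andP[] := inside01 x tau c c' z.
rewrite ler_expR !lerD2r lerN2; apply: ler_wpM2l; first by rewrite ltW// nb_gt0.
by have := pe ecc; rewrite ler_norml; lra.
Qed.

(** When repetitions are rare, the near equality [NA] leaves almost no room in the Kullback-Leibler
    balance of [close_pairs], so close pairs are rare too. *)
Lemma gb_SC : Th <= 2 * e1 * N -> SC <= sg * N.
Proof.
move=> ThN; have N0 := gb_N0.
have d10 : 0 < d1 by have := d0; have := dd1; lra.
have d1b : 0 < d1 <= 1 by rewrite d10.
have := close_pairs n0 b0 x1 esym gb_N0 eA pe om d1b dd1.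
rewrite -/N -/Th -/SC lnM ?posrE ?gb_A0//; have := gb_lnN.
have Th0 : 0 <= Th.
  apply: sumr_ge0 => c _; apply: sumr_ge0 => c' ecc; apply: Ex_ge0 => z.
  exact: ltW (pgood_gt0 _ (pgood_Pz x b _ ecc)).
have nn0 : 0 < n%:R :> R by rewrite ltr0n.
have Eb0 : 0 <= Eb by exact: le_trans (normr_ge0 _) EEb.
have E1 : E <= Eb by apply: le_trans (ler_norm _) EEb.
have ETh : n%:R * E * Th <= n%:R * (2 * Eb * e1) * N.
  rewrite -!mulrA ler_pM2l//; apply: (@le_trans _ _ (Eb * Th)); first by rewrite ler_wpM2r.
  have := ler_wpM2l Eb0 ThN; congr (_ <= _); ring.
move=> lnN hC.
have hC2 : n%:R * b * (d1 ^+ 2 / 4) * SC <= N * (n%:R * (d * (b + 2))) + n%:R * (2 * Eb * e1) * N.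
  apply: (le_trans hC); apply: lerD => //; rewrite ler_pM2l//.
  have -> : n%:R * (d * (b + 2)) = n%:R * d + n%:R * b * d + n%:R * d by ring.
  have : n%:R * (b * p0 - E - d) = n%:R * b * p0 - n%:R * E - n%:R * d by ring.
  have : n%:R * b * (p0 + d) = n%:R * b * p0 + n%:R * b * d by ring.
  by have := h3; lra.
have k0 : 0 < n%:R * b * (d1 ^+ 2 / 4) by rewrite !mulr_gt0// exprn_gt0.
rewrite -(ler_pM2l k0); apply: (le_trans hC2).
have := ler_wpM2l (ltW (mulr_gt0 nn0 N0)) h4.
have -> : n%:R * N * (4 * (d * (b + 2) + 2 * Eb * e1)) =
  4 * (N * (n%:R * (d * (b + 2))) + n%:R * (2 * Eb * e1) * N) by ring.
have -> : n%:R * N * (b * d1 ^+ 2 * sg) = 4 * (n%:R * b * (d1 ^+ 2 / 4) * (sg * N)) by field.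
by rewrite ler_pM2l.
Qed.

Lemma gb_U : Th <= 2 * e1 * N -> (p0 - (d1 + 2 * (2 * e1 + sg))) * N <= U.
Proof.
move=> ThN; have SCN := gb_SC ThN; have N0 := gb_N0.
have p0pm : pm - d <= p0.
  case: (pickP (fun cc : T * T => e cc.1 cc.2)) => [[c c'] /= ecc|no].
    by have := pe ecc; have := pem ecc; have := d0; have := dd1; have := d1p; have := pm0; rewrite ler_norml; lra.
  move: gb_N0; rewrite /N /nedges big1 ?ltxx// => c _; rewrite big_pred0// => c'.
  exact: (no (c, c')).
have pd1 : 0 <= p0 - d1 by have := d0; have := dd1; have := d1p; have := pm0; lra.
apply: le_trans (dist_lower e b x1 pd1); rewrite -/N -/Th -/SC.
have := ler_wpM2l pd1 (lerD ThN SCN).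
have : (p0 - d1) * ((2 * e1 + sg) * N) <= 2 * ((2 * e1 + sg) * N).
  by apply: ler_wpM2r; [apply: mulr_ge0; [have := e10; have := sg0; lra|exact: ltW]|have := p002; have := d0; have := dd1; lra].
have -> : (p0 - d1) * (2 * e1 * N + sg * N) = (p0 - d1) * ((2 * e1 + sg) * N) by ring.
have -> : (p0 - d1) * (N - Th - SC) = (p0 - d1) * N - (p0 - d1) * (Th + SC) by ring.
have -> : (p0 - (d1 + 2 * (2 * e1 + sg))) * N = (p0 - d1) * N - 2 * ((2 * e1 + sg) * N) by ring.
by lra.
Qed.

(** By [gb_U] two samples are nearly p0 apart on average, while linear estimation keeps them closer
    by the margin of [sat_gap]; [h6] makes the tolerances smaller than this margin at 1 - s + d2. *)
Lemma gb_p0 : Th <= 2 * e1 * N -> p0 <= 1 - s + d2.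
Proof.
move=> ThN; have UN := gb_U ThN; have N0 := gb_N0.
have d0' := ltW d0.
have U2 := dist_upper n0 b0 x1 p002 d0' pe; rewrite -/N -/U in U2.
have [h|h] := sat_gap b0 s0 s1 sE p002 d0' erefl; last by have := d20; lra.
case: (lerP p0 (1 - s + d2)) => // hp.
have : (p0 - (d1 + 2 * (2 * e1 + sg))) * N <= N * (p0 - p0 * (p0 - (1 - s)) / (2 * (1 + b)) + 2 * d).
  by apply: (le_trans UN); apply: (le_trans U2); rewrite ler_pM2l.
rewrite mulrC ler_pM2l// => h8.
have p0pm : pm / 2 <= p0.
  case: (pickP (fun cc : T * T => e cc.1 cc.2)) => [[c c'] /= ecc|no].
    by have := pe ecc; have := pem ecc; have := d0; have := dd1; have := d1p; have := pm0; rewrite ler_norml; lra.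
  move: gb_N0; rewrite /N /nedges big1 ?ltxx// => c _; rewrite big_pred0// => c'.
  exact: (no (c, c')).
have : pm * d2 / (4 * (1 + b)) <= p0 * (p0 - (1 - s)) / (2 * (1 + b)).
  have -> : pm * d2 / (4 * (1 + b)) = pm / 2 * d2 / (2 * (1 + b)) by have := b0; move=> ?; field; rewrite gt_eqF//; lra.
  have := b0; have := pm0; have := d20 => ? ? ?; rewrite ler_pM2r ?invr_gt0; last lra.
  by apply: ler_pM; lra.
by have := h6; lra.
Qed.

Lemma gb_bq : b * (1 - s) = s / (1 + s) /\ 0 < b * (1 - s) /\ b * (1 - s) <= 2^-1.
Proof.
have := s0; have := s1; have := b0 => ? ? ?.
have bqe : b * (1 - s) = s / (1 + s).
  by rewrite {2}sE; field; rewrite gt_eqF//; lra.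
split=> //; rewrite bqe divr_gt0//; last lra.
by split=> //; rewrite ler_pdivrMr; lra.
Qed.

Lemma gb_Nmax c : #|nbh e c|%:R <= expR (n%:R * (b * (p0 + d) - E)).
Proof.
case: (pickP (e c)) => [c0 ecc|no]; last first.
  have -> : nbh e c = finset.set0 by apply/setP => c'; rewrite !inE no.
  by rewrite cards0 expR_ge0.
have cA := eA ecc.
apply: (@le_trans _ _ (\sum_(c' in A | c' != c) expR (- (n%:R * b * pd c c')) * expR (n%:R * b * (p0 + d)))).
  rewrite -sum1_card natr_sum.
  rewrite [leLHS]big_mkcond [leRHS]big_mkcond; apply: ler_sum => c' _; rewrite inE.
  case: ifPn => ecc'; last by case: ifP => // _; rewrite mulr_ge0 ?expR_ge0.
  have -> : c' \in A by apply: (eA (c' := c)); rewrite esym.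
  have -> : c' != c.
    apply/eqP => h; have := pem ecc'; rewrite h (pd_cc x1); have := pm0; lra.
  rewrite /= -expRD -[leLHS]expR0 ler_expR addrC -mulrBr mulr_ge0 ?(ltW (nb_gt0 n0 b0))//.
  by have := pe ecc'; rewrite ler_norml; lra.
rewrite -mulr_suml; apply: le_trans (ler_wpM2r (expR_ge0 _) (om cA)) _.
rewrite -expRD ler_expR le_eqVlt; apply/orP; left; apply/eqP; ring.
Qed.

Lemma graph_bound ep :
  d * (2 * b + 3) + b * d2 + b * (d1 + 2 * (2 * e1 + sg)) + 2 * e1 * (3 * b + Eb) <= ep ->
  #|A|%:R * expR (- (n%:R * (Num.max E (b * (1 - s) + ln (1 - b * (1 - s)) / 2) + ep))) <= Tot.
Proof.
move=> hep; have N0 := gb_N0; have nn0 : 0 < n%:R :> R by rewrite ltr0n.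
set M := Num.max _ _.
have EM : E <= M by rewrite le_max lexx.
have FM : b * (1 - s) + ln (1 - b * (1 - s)) / 2 <= M by rewrite le_max lexx orbT.
have Eb0 : 0 <= Eb by exact: le_trans (normr_ge0 _) EEb.
have d10 : 0 < d1 by have := d0; have := dd1; lra.
have e1N : N * (2 * tau ^+ 2 * pm)^-1 <= N * e1 by rewrite ler_pM2l.
(* It remains to recover the true neighbour with probability at least e1 e^{-lam}, at a cost lam
   that fits into the exponent. *)
suff [lam [lamI lamE]] : exists lam, N * e1 * expR (- lam) <= In /\ n%:R * E + lam <= n%:R * (M + ep - d * (b + 2)).
  apply: le_trans gb_tot.
  apply: le_trans (ler_wpM2l (expR_ge0 _) lamI).
  have NA' := NA; rewrite -/N in NA'.
  apply: (@le_trans _ _ (expR (- (n%:R * b * (p0 + d)) - 10 * mu * tau - 6 * tau ^+ 2) *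
     (#|A|%:R * expR (n%:R * (b * p0 - E - d)) * e1 * expR (- lam)))); last first.
    apply: ler_wpM2l; first exact: expR_ge0.
    apply: ler_wpM2r; first exact: expR_ge0.
    by apply: ler_wpM2r => //; exact: ltW.
  have -> : expR (- (n%:R * b * (p0 + d)) - 10 * mu * tau - 6 * tau ^+ 2) *
     (#|A|%:R * expR (n%:R * (b * p0 - E - d)) * e1 * expR (- lam)) =
     #|A|%:R * expR (- (n%:R * b * (p0 + d)) - 10 * mu * tau - 6 * tau ^+ 2 + n%:R * (b * p0 - E - d) + ln e1 - lam).
    by rewrite !expRD lnK ?posrE//; ring.
  rewrite ler_wpM2l// ler_expR; exact: (gb_arith1 p0 h7 lamE).
(* If repetition has probability above 2 e1 there is no entropy cost: lam = 0 and the exponent is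
   that of E. *)
case: (lerP Th (2 * e1 * N)) => ThN; last first.
  exists 0; rewrite oppr0 expR0 mulr1; split.
    have := edge_sum_theta b x1 tau0 pm0 pem; rewrite -/N -/Th -/In.
    move: e1N ThN; set u := N * _^-1; clearbody u; lra.
  rewrite addr0 ler_pM2l//.
  have := b0; have := d0; have := d20; have := e10; have := sg0 => q1 q2 q3 q4 q5.
  have : 0 <= b * d by rewrite mulr_ge0 ?ltW.
  have : 0 <= b * d2 by rewrite mulr_ge0 ?ltW.
  have : 0 <= b * (d1 + 2 * (2 * e1 + sg)) by apply: mulr_ge0; [exact: ltW|lra].
  have : 0 <= 2 * e1 * (3 * b + Eb) by apply: mulr_ge0; lra.
  by lra.
have UN := gb_U ThN; have p0q := gb_p0 ThN.
have [bqE [bq0 bq1]] := gb_bq.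
have t0b : 0 < 1 - b * (1 - s) by lra.
have Nm := expR_gt0 (n%:R * (b * (p0 + d) - E)).
(* The tangent at 1 - s gives the exponent that is needed; the tangent at 0 only serves as a crude
   bound of order n on kappa per edge. *)
have k1 := kappa_le n0 b0 x1 Nm gb_Nmax t0b.
have t00 : 0 < 1 - b * 0 by rewrite mulr0 subr0.
have k2 := kappa_le n0 b0 x1 Nm gb_Nmax t00.
rewrite -/N -/U !expRK in k1 k2.
have U0 : 0 <= U.
  apply: sumr_ge0 => c _; apply: sumr_ge0 => c' ecc; apply: sumr_ge0 => c'' _.
  apply: mulr_ge0; last by have /andP[] := pd_bound x1 c' c''.
  by apply: Ex_ge0 => z; exact: ltW (pgood_gt0 _ (pgood_Pz x b _ ecc)).
have kap0 : 0 <= kappa x e b.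
  rewrite /kappa oppr_ge0; apply: sumr_le0 => c _; apply: sumr_le0 => c' ecc.
  rewrite -oppr_ge0 -(ExN (good_lnpi x b ecc)); apply: Ex_ge0 => z.
  rewrite oppr_ge0 pmulr_rle0 ?Lz_gt0// ln_le0// ler_pdivrMr ?(Sz_gt0 _ _ _ ecc)// mul1r.
  rewrite /Sz (bigD1 c')//= lerDl; apply: sumr_ge0 => c'' _; exact: ltW (Lz_gt0 _ _ _ _ _).
set K := kappa x e b in k1 k2 kap0.
(* The mean entropy per edge, enlarged so that (1 + lam) (1 - e1) N - K = (1 - e1) N, which is at
   least e1 N. *)
exists (K / N / (1 - e1)).
have e1' : 0 < 1 - e1 by have := e14; lra.
have lam0 : 0 <= K / N / (1 - e1) by rewrite !divr_ge0// ltW.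
split.
  have := edge_sum_kappa b x1 tau0 pm0 pem lam0; rewrite -/N -/In -/K; apply: le_trans.
  rewrite mulrC; apply: ler_wpM2l; first exact: expR_ge0.
  have h1 : (1 + K / N / (1 - e1)) * (1 - e1) * N = (1 - e1) * N + K by field; rewrite !gt_eqF.
  have h2 : (1 + K / N / (1 - e1)) * (1 - e1) * N <= (1 + K / N / (1 - e1)) * (1 - (2 * tau ^+ 2 * pm)^-1) * N.
    rewrite ler_wpM2r ?(ltW N0)// ler_wpM2l//; first lra.
    by rewrite lerD2l lerN2.
  have h5 : N * e1 <= (1 - e1) * N by rewrite mulrC ler_pM2r//; have := e14; lra.
  by lra.
have E2 : - Eb <= E by have := EEb; rewrite ler_norml => /andP[].
exact: (gb_arith2 nn0 N0 b0 bq0 bq1 k1 k2 UN U0 p0q hep FM p002 E2 e10 e14 d0 dd1 d11 d20 sg0 kap0).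
Qed.

End graph_bound.

(** * Choice of the tolerances, single pairs, regular subsets *)

Section asymptotics.
Context {R : realType}.

Lemma archi_nat (K : R) : exists n1 : nat, forall n, (n1 <= n)%N -> K <= n%:R.
Proof.
exists (Num.truncn K).+1 => n hn; apply: le_trans (ltW (truncnS_gt K)) _.
by rewrite ler_nat.
Qed.

Lemma sqrt_small (b C K d : R) : 0 <= b -> 0 <= C -> 0 < d -> exists n1 : nat, forall n, (n1 <= n)%N ->
  K + C * Num.sqrt (n%:R * b) <= n%:R * d.
Proof.
move=> b0 C0 d0.
have [n1 hn1] := archi_nat (2 * K / d); have [n2 hn2] := archi_nat (4 * C ^+ 2 * b / d ^+ 2).
exists (maxn n1 n2) => n; rewrite geq_max => /andP[/hn1 h1 /hn2 h2].
have {h1} : K <= n%:R * d / 2.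
  by move: h1; rewrite ler_pdivrMr// => h1; rewrite ler_pdivlMr//; lra.
suff : C * Num.sqrt (n%:R * b) <= n%:R * d / 2 by lra.
have nd0 : 0 <= n%:R * d / 2 by rewrite divr_ge0// mulr_ge0// ltW.
rewrite -ler_sqr ?nnegrE//; last by rewrite mulr_ge0// sqrtr_ge0.
rewrite exprMn sqr_sqrtr ?mulr_ge0//.
move: h2; rewrite ler_pdivrMr ?exprn_gt0// => h2.
have n0 : 0 <= n%:R :> R by [].
have := ler_wpM2l n0 h2.
have -> : (n%:R * d / 2) ^+ 2 = n%:R * (n%:R * d ^+ 2) / 4 by field.
by lra.
Qed.

Lemma small_lin (K d : R) : 0 < d -> exists n1 : nat, forall n, (n1 <= n)%N -> K <= n%:R * d.
Proof.
move=> d0; have [n1 h] := @sqrt_small 0 0 K d (lexx _) (lexx _) d0.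
by exists n1 => n /h; rewrite mul0r addr0.
Qed.

(** The tolerances d2, d1, sg, e1, d are fixed in this order, each small against the earlier ones.
    The width tau is large but depends on e1 and pm only, so mu tau is of order sqrt n and
    disappears against n d. *)
Lemma graph_theorem (b s Eb pm ep : R) : 0 < b -> 0 < s -> s < 1 -> s = b * (1 - s ^+ 2) ->
  0 <= Eb -> 0 < pm -> 0 < ep ->
  exists2 d, 0 < d <= 1 & exists n1 : nat, forall n, (n1 <= n)%N ->
  forall (T : finType) (x : T -> 'rV[R]_n) (e : rel T) (A : {set T}) (E p0 : R) (Phi : T -> 'rV[R]_n -> R),
  (forall c, norm2 (x c) = 1) -> symmetric e ->
  (forall c c', e c c' -> c \in A) ->
  (forall c c', e c c' -> `|pd x c c' - p0| <= d) ->
  (forall c c', e c c' -> pm <= pd x c c') ->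
  (forall c, c \in A -> \sum_(c' in A | c' != c) expR (- (n%:R * b * pd x c c')) <= expR (- (n%:R * E))) ->
  (0 < #|A|)%N -> #|A|%:R * expR (n%:R * (b * p0 - E - d)) <= @nedges R T e ->
  0 <= p0 <= 2 -> `|E| <= Eb ->
  (forall c, good (Phi c)) -> (forall c z, 0 <= Phi c z) ->
  (forall c c' z, e c c' -> 0 <= dot (x c' - x c) z -> 1 <= Phi c z) ->
  #|A|%:R * expR (- (n%:R * (Num.max E (b * (1 - s) + ln (1 - b * (1 - s)) / 2) + ep))) <=
  \sum_(c in A) Ex (fun w => Phi c (w + (2 * Num.sqrt (n%:R * b)) *: x c)).
Proof.
move=> b0 s0 s1 sE Eb0 pm0 ep0.
have [f1 f2 f3 f4] : [/\ 0 < b + 1, 0 < 1 + b, 0 < Eb + 1 & 0 < 3 * b + Eb + 1] by split; lra.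
have [f5 f6] : 0 < b + 2 /\ 0 < 2 * b + 3 by split; lra.
pose d2 := ep / (8 * (b + 1)).
have d20 : 0 < d2 by rewrite divr_gt0//; lra.
have d2e : d2 * (8 * (b + 1)) = ep by rewrite /d2 mulfVK// gt_eqF//; lra.
clearbody d2.
pose d1 := Num.min (Num.min 1 (pm / 4)) (Num.min (pm * d2 / (16 * (1 + b))) (ep / (32 * (b + 1)))).
have d10 : 0 < d1 by rewrite !lt_min; do ![apply/andP; split | apply: divr_gt0 | apply: mulr_gt0 | apply: exprn_gt0] => //.
have d11 : d1 <= 1 by rewrite !ge_min lexx.
have d1p : d1 <= pm / 4 by rewrite !ge_min lexx orbT.
have d1q : d1 <= pm * d2 / (16 * (1 + b)) by rewrite !ge_min lexx !orbT.
have d1e : d1 <= ep / (32 * (b + 1)) by rewrite !ge_min lexx !orbT.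
clearbody d1.
pose sg := d1 / 8; have sgE : sg = d1 / 8 by [].
have sg0 : 0 < sg by rewrite divr_gt0.
have bds : 0 < b * d1 ^+ 2 * sg by rewrite !mulr_gt0// exprn_gt0.
clearbody sg.
pose e1 := Num.min (Num.min 4^-1 (d1 / 8)) (Num.min (b * d1 ^+ 2 * sg / (32 * (Eb + 1))) (ep / (32 * (3 * b + Eb + 1)))).
have e10 : 0 < e1 by rewrite !lt_min; do ![apply/andP; split | apply: divr_gt0 | apply: mulr_gt0 | apply: exprn_gt0] => //; lra.
have e14 : e1 <= 4^-1 by rewrite !ge_min lexx.
have e1d : e1 <= d1 / 8 by rewrite !ge_min lexx orbT.
have e1s : e1 <= b * d1 ^+ 2 * sg / (32 * (Eb + 1)) by rewrite !ge_min lexx !orbT.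
have e1e : e1 <= ep / (32 * (3 * b + Eb + 1)) by rewrite !ge_min lexx !orbT.
clearbody e1.
pose d := Num.min (d1 / 16) (Num.min (b * d1 ^+ 2 * sg / (16 * (b + 2))) (ep / (16 * (2 * b + 3)))).
have d0 : 0 < d by rewrite !lt_min; do ![apply/andP; split | apply: divr_gt0 | apply: mulr_gt0 | apply: exprn_gt0] => //.
have dd1 : d <= d1 / 16 by rewrite !ge_min lexx.
have ds : d <= b * d1 ^+ 2 * sg / (16 * (b + 2)) by rewrite !ge_min lexx !orbT.
have de : d <= ep / (16 * (2 * b + 3)) by rewrite !ge_min lexx !orbT.
clearbody d.
pose tau := Num.sqrt ((2 * e1 * pm)^-1).
have tau0 : 0 < tau by rewrite sqrtr_gt0 invr_gt0 !mulr_gt0.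
have tau1 : (2 * tau ^+ 2 * pm)^-1 <= e1.
  have i0 : 0 <= (2 * e1 * pm)^-1 by rewrite invr_ge0 ltW// !mulr_gt0.
  rewrite sqr_sqrtr//.
  by rewrite le_eqVlt; apply/orP; left; apply/eqP; field; rewrite !gt_eqF.
clearbody tau.
have [n1 hn1] := @sqrt_small b 5 (ln 2) d (ltW b0) (ler0n _ 5) d0.
have tau10 : 0 <= 10 * tau by apply: mulr_ge0 => //; exact: ltW.
have [n2 hn2] := @sqrt_small b (10 * tau) (6 * tau ^+ 2 - ln e1) d (ltW b0) tau10 d0.
exists d; first by rewrite d0; move: dd1 d11; clear; lra.
exists (maxn (maxn n1 n2) 1) => n; rewrite !geq_max => /andP[/andP[/hn1 h3 /hn2 h7'] nn0].
have h7 : 10 * Num.sqrt (n%:R * b) * tau + 6 * tau ^+ 2 - ln e1 <= n%:R * d.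
  by move: h7'; set m := Num.sqrt _; rewrite -!mulrA (mulrC tau); clear; lra.
have h4 : 4 * (d * (b + 2) + 2 * Eb * e1) <= b * d1 ^+ 2 * sg.
  move: ds e1s; rewrite !ler_pdivlMr; [|by apply: mulr_gt0 => //; apply: ltr_wpDl|by apply: mulr_gt0 => //; apply: addr_gt0].
  set X := b * d1 ^+ 2 * sg => u1 u2.
  have : Eb * e1 <= X / 32 by rewrite ler_pdivlMr//; move: u2 e10; clear; nra.
  by move: u1 bds; rewrite -/X; clear; nra.
have h6 : d1 + 2 * (2 * e1 + sg) + 2 * d < pm * d2 / (4 * (1 + b)).
  have -> : pm * d2 / (4 * (1 + b)) = 4 * (pm * d2 / (16 * (1 + b))) by field; rewrite gt_eqF//; move: b0; clear; lra.
  by move: d1q e1d sgE dd1 d10; clear; lra.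
have hep : d * (2 * b + 3) + b * d2 + b * (d1 + 2 * (2 * e1 + sg)) + 2 * e1 * (3 * b + Eb) <= ep.
  have u1 : d * (2 * b + 3) <= ep / 16.
    by move: de; rewrite ler_pdivlMr; [clear; lra|move: b0; clear; lra].
  have u2 : b * d2 <= ep / 8.
    by move: d2e d20; clear; lra.
  have u3 : b * (d1 + 2 * (2 * e1 + sg)) <= b * (2 * d1) by rewrite ler_pM2l//; move: e1d sgE d10; clear; lra.
  have u4 : b * d1 <= ep / 32.
    by move: d1e; rewrite ler_pdivlMr; [move: d10; clear; lra|move: b0; clear; lra].
  have u5 : e1 * (3 * b + Eb) <= ep / 32.
    by move: e1e; rewrite ler_pdivlMr; [move: e10; clear; lra|move: b0 Eb0; clear; lra].
  by move: u1 u2 u3 u4 u5 ep0; clear; lra.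
move=> T x e A E p0 Phi x1 esym eA pe pem om A0 NA p002 EEb PhiG Phi0 PhiP.
have dd4 : d <= d1 / 4 by move: dd1 d10; clear; lra.
exact: (graph_bound nn0 b0 s0 s1 sE x1 esym eA pe pem om A0 NA p002 EEb PhiG Phi0 PhiP pm0 d0 dd4 d11 d1p d20 e10 e14 tau0 tau1 sg0 h3 h4 h6 h7 hep).
Qed.

(** A single competitor already causes an error of exponent b p, so codewords of small error keep a
    distance bounded below; this supplies the lower bound [pm] for the edges. *)
Lemma pair_err n (b : R) (x y : 'rV[R]_n) (Phi : 'rV[R]_n -> R) : (0 < n)%N -> 0 < b ->
  norm2 x = 1 -> norm2 y = 1 -> dot x y < 1 ->
  good Phi -> (forall z, 0 <= Phi z) -> (forall z, 0 <= dot (y - x) z -> 1 <= Phi z) ->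
  2^-1 * expR (- (n%:R * b * (1 - dot x y)) - 8 * Num.sqrt (n%:R * b) - 3) <=
  Ex (fun w => Phi (w + (2 * Num.sqrt (n%:R * b)) *: x)).
Proof.
move=> n0 b0 x1 y1 xy1 gPhi Phi0 PhiP; set mu := Num.sqrt _.
have m0 : 0 < mu by exact: mu_gt0.
have mm : mu ^+ 2 = n%:R * b by exact: mu2.
pose p := 1 - dot x y; have p0 : 0 < p by rewrite /p; lra.
have p2 : p <= 2 by have := dot_unit x1 y1; rewrite ler_norml /p; lra.
pose D := y - x.
have D2 : norm2 D = 2 * p by rewrite /D norm2B x1 y1 dotC /p; ring.
pose r := Num.sqrt p; have r0 : 0 < r by rewrite sqrtr_gt0.
have r2 : r ^+ 2 = p by rewrite sqr_sqrtr// ltW.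
(* The displacement carries <D, z> beyond the bisector by 2 tau p = 2 sqrt p, comparable with its
   standard deviation even when p is small. *)
pose tau := r^-1; have tau0 : 0 < tau by rewrite invr_gt0.
have tr : tau * p = r by rewrite /tau -r2 expr2 mulKf// gt_eqF.
pose t := mu + tau.
have gs : good (fun w => Phi (w + (2 * mu) *: x)) by exact: good_shift.
rewrite (Ex_shift_inv (t *: D) gs).
pose ins z : R := (`|dot D z| <= 2 * r)%R%:R.
have gins : good ins by apply: good_ind; exact: meas_abs_le.
have gd2 : good (fun z => dot D z ^+ 2) by under eq_fun do rewrite expr2; apply: goodM; exact: good_dot.
have Pins : 2^-1 <= Ex ins.
  apply: (@le_trans _ _ (Ex (fun z => 1 - (4 * p)^-1 * dot D z ^+ 2))); last first.
    apply: le_Ex => //; first by apply: goodB; [exact: good_cst|exact: goodZ].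
    move=> z; rewrite /ins; case: (lerP `|dot D z| (2 * r)) => h /=.
      by rewrite gerBl mulr_ge0 ?sqr_ge0// invr_ge0; lra.
    rewrite subr_le0 ler_pdivlMl ?mulr1; last lra.
    rewrite -[dot D z ^+ 2]real_normK ?num_real//.
    have -> : 4 * p = (2 * r) ^+ 2 by rewrite exprMn r2; ring.
    by rewrite ler_sqr ?nnegrE//; lra.
  rewrite (ExB (good_cst _ _) (goodZ _ gd2)) Ex_cst (ExZ _ gd2).
  have := Ex_dot_sqr_le D; rewrite D2 => h.
  have : (4 * p)^-1 * Ex (fun z => dot D z ^+ 2) <= (4 * p)^-1 * (2 * p).
    by rewrite ler_wpM2l// invr_ge0; lra.
  have -> : (4 * p)^-1 * (2 * p) = 2^-1 by field; rewrite gt_eqF.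
  by lra.
set k := expR _.
have k0 : 0 < k by exact: expR_gt0.
apply: (@le_trans _ _ (Ex (fun z => k * ins z))); first by rewrite (ExZ _ gins) mulrC ler_pM2l.
apply: le_Ex; first exact: goodZ.
  apply: goodM; first exact: (good_shift (t *: D) gs).
  under eq_fun do rewrite expRD -dotN.
  by apply: goodM; [exact: good_expdot|exact: good_cst].
move=> z; rewrite /ins; case: (boolP (`|dot D z| <= 2 * r)%R) => /=; last first.
  by move=> _; rewrite mulr0 mulr_ge0 ?expR_ge0.
rewrite mulr1 ler_norml => /andP[z1 z2].
apply: (@le_trans _ _ (1 * expR (- dot (t *: D) z - norm2 (t *: D) / 2))); last first.
  apply: ler_wpM2r; first exact: expR_ge0.
  apply: PhiP; rewrite -/D !dotDr !dotZr -norm2E D2.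
  have -> : dot D x = - p by rewrite /D dotBl -norm2E x1 dotC /p; ring.
  have -> : dot D z + t * (2 * p) + 2 * mu * - p = dot D z + 2 * (tau * p) by rewrite /t; ring.
  by rewrite tr; lra.
rewrite mul1r /k ler_expR dotZl norm2Z D2 -mm.
have -> : t ^+ 2 * (2 * p) / 2 = t ^+ 2 * p by field.
have t0 : 0 < t by rewrite /t; lra.
have h1 : t * dot D z <= t * (2 * r) by rewrite ler_pM2l.
have rt : r * tau = 1 by rewrite /tau divff// gt_eqF.
have h2 : t ^+ 2 * p = mu ^+ 2 * p + 2 * mu * r + 1.
  have -> : t ^+ 2 * p = mu ^+ 2 * p + 2 * mu * (tau * p) + (tau * p) * tau by rewrite /t; ring.
  by rewrite tr rt.
have e3 : t * (2 * r) = 2 * mu * r + 2 * (r * tau) by rewrite /t; ring.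
have h3 : t * (2 * r) = 2 * mu * r + 2 by rewrite e3 rt mulr1.
have r1 : mu * r <= mu * 2.
  rewrite ler_pM2l// -ler_sqr ?nnegrE ?ltW// r2; lra.
rewrite -/p; lra.
Qed.

(** At least half of the points have a sum of at most twice the mean W. If the mean over that half
    falls below W / g, the half is halved again; as means stay above w0 and start below w0 g^j, this
    happens at most j times. *)
Lemma regularize (T : finType) (f : T -> T -> R) (X w0 g : R) :
  (forall c c', 0 <= f c c') -> 0 < X -> 0 < w0 -> 1 <= g ->
  (forall A : {set T}, X <= #|A|%:R -> #|A|%:R * w0 <= \sum_(c in A) \sum_(c' in A | c' != c) f c c') ->
  forall (j : nat) (A : {set T}), 2 ^+ j.+1 * X <= #|A|%:R ->
  \sum_(c in A) \sum_(c' in A | c' != c) f c c' <= #|A|%:R * w0 * g ^+ j ->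
  exists (A' : {set T}) (W : R), [/\ A' \subset A, X <= #|A'|%:R, w0 <= W <= w0 * g ^+ j,
    (forall c, c \in A' -> \sum_(c' in A' | c' != c) f c c' <= 2 * W) &
    #|A'|%:R * W / g <= \sum_(c in A') \sum_(c' in A' | c' != c) f c c'].
Proof.
move=> f0 X0 w00 g1 hLP; have g0 : 0 < g by lra.
elim=> [|j ih] A hA totA.
all: have A0 : 0 < #|A|%:R :> R by apply: lt_le_trans hA; rewrite mulr_gt0// exprn_gt0.
all: pose om (B : {set T}) c := \sum_(c' in B | c' != c) f c c'.
all: pose W := #|A|%:R^-1 * \sum_(c in A) om A c.
all: have WA : \sum_(c in A) om A c = #|A|%:R * W by rewrite /W mulVKf// gt_eqF.
all: have XA : X <= #|A|%:R by apply: le_trans hA; rewrite ler_peMl ?(ltW X0)// exprn_ege1// ler1n.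
all: have w0W : w0 <= W by rewrite -(ler_pM2l A0) -WA; exact: hLP.
all: have W0 : 0 < W by exact: lt_le_trans w0W.
all: pose A1 := [set c in A | om A c <= 2 * W].
all: have A1A : A1 \subset A by apply/fintype.subsetP => c; rewrite inE => /andP[].
all: have omA1 c : om A1 c <= om A c.
  1,3: rewrite /om [leLHS]big_mkcond [leRHS]big_mkcond; apply: ler_sum => c' _.
  1,2: case: (boolP (c' \in A1)) => h /=; first by rewrite (fintype.subsetP A1A _ h).
  1,2: by case: ifP.
all: have cardA1 : #|A|%:R / 2 <= #|A1|%:R :> R.
  1,3: have : #|A :\: A1|%:R * (2 * W) <= #|A|%:R * W.
  1,3: rewrite -WA -sum1_card natr_sum mulr_suml; apply: (@le_trans _ _ (\sum_(c in A :\: A1) om A c)).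
  1,3: by apply: ler_sum => c; rewrite !inE mul1r => /andP[+ cA]; rewrite cA/= -ltNge => /ltW.
  1,2: rewrite [leRHS](big_setID A1)/= lerDr; apply: sumr_ge0 => c _; exact: sumr_ge0.
  1,2: rewrite mulrA ler_pM2r// => h; have := cardsID A1 A; rewrite (finset.setIidPr A1A) => /(congr1 (fun k => k%:R : R)).
  1,2: by rewrite natrD; lra.
all: have A1om c : c \in A1 -> om A1 c <= 2 * W by move=> cA1; apply: (le_trans (omA1 c)); move: cA1; rewrite inE => /andP[].
- exists A1, W; have XA1 : X <= #|A1|%:R by apply: le_trans cardA1; rewrite ler_pdivlMr// mulrC; rewrite expr1 in hA.
  have Ww : W <= w0 by rewrite -(ler_pM2l A0) -WA; move: totA; rewrite expr0 mulr1.
  split=> //; first by rewrite expr0 mulr1 w0W.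
  apply: le_trans (hLP _ XA1); rewrite -mulrA ler_wpM2l// ler_pdivrMr//.
  by apply: (le_trans Ww); rewrite ler_peMr// ltW.
- have hA1 : 2 ^+ j.+1 * X <= #|A1|%:R.
    by apply: le_trans cardA1; rewrite ler_pdivlMr// mulrAC -exprSr.
  have Wg : W <= w0 * g ^+ j.+1.
    by rewrite -(ler_pM2l A0) -WA mulrA.
  case: (lerP (#|A1|%:R * W / g) (\sum_(c in A1) om A1 c)) => h.
    exists A1, W; split=> //; last by rewrite w0W.
    apply: le_trans hA1; by rewrite ler_peMl ?(ltW X0)// exprn_ege1// ler1n.
  have [|A' [W' [A'A1 XA' /andP[w0W' W'g] omA' totA']]] := ih A1 hA1.
    apply: (le_trans (ltW h)).
    have hW : W / g <= w0 * g ^+ j by rewrite ler_pdivrMr// -[leRHS]mulrA -exprSr.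
    by have := ler_wpM2l (ler0n R #|A1|) hW; rewrite !mulrA.
  exists A', W'; split=> //; first exact: fintype.subset_trans A'A1 A1A.
  rewrite w0W'/=; by apply: (le_trans W'g); rewrite ler_pM2l// ler_weXn2l// leqnSn.
Qed.

End asymptotics.

(** * The converse bound *)

Section converse_arith.
Context {R : realType}.
Implicit Types (m E ep J L W : R).

Lemma conv_arith1 m E ep J L W : J * L <= m * ep -> - (m * (E + ep)) - (J + 1) * L <= W ->
  - (L + W) <= m * (E + 2 * ep).
Proof. by rewrite !mulrDr mulrDl mul1r mulrCA; lra. Qed.

Lemma conv_arith2 m t Q q ep x y : 0 < m -> m * x <= m * (q + ep + 1 + y) -> - Q <= q -> y <= 1 ->
  m * (t + 1) + (- (m * (Q + ep)) + m * x) <= m * (t + 2 * q + 3).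
Proof.
move=> m0; rewrite ler_pM2l// => h1 h2 h3.
by rewrite -mulrN -!mulrDr ler_pM2l//; lra.
Qed.

Lemma conv_arith3 (E E0 Rt Q nu : R) : nu <= 1 -> E <= E0 + 2 * (nu / 8) ->
  - (`|Rt| + 2 * `|Q| + 3) <= E -> `|E| <= `|E0| + `|Rt| + 2 * `|Q| + 10.
Proof.
move=> h1 h2 h3; have := normr_ge0 Rt; have := normr_ge0 E0; have := normr_ge0 Q; have := ler_norm E0.
by rewrite ler_norml; lra.
Qed.

Lemma conv_arith4 (m E nu a b c d : R) : b + c + d <= m * nu -> - a - d - b - c < - (m * (E + nu)) -> m * E <= a.
Proof. by rewrite mulrDr; lra. Qed.

Lemma conv_arith5 (m E M L ep : R) : L <= m * ep -> 0 <= m * ep -> m * M <= m * (E + 2 * ep) ->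
  L - m * (E + 8 * ep) <= - (m * (M + ep)).
Proof. by rewrite !mulrDr ![m * (_ * ep)]mulrCA; lra. Qed.

End converse_arith.

Section converse.
Context {R : realType}.

(** The slack eta below R1 pays for the constant factors lost by halving, so that the converse still
    applies at Rt = R1. *)
Definition many_close_pairs (b s R1 Rx : R) : Prop :=
  forall ep, 0 < ep -> exists2 eta, 0 < eta & exists n1 : nat, forall n, (n1 <= n)%N ->
  forall (T : finType) (x : T -> 'rV[R]_n) (A : {set T}),
  (forall c, norm2 (x c) = 1) -> expR (n%:R * (R1 - eta)) <= #|A|%:R ->
  #|A|%:R ^+ 2 * expR (- (n%:R * (b * (1 - s) + Rx + ep))) <=
  \sum_(c in A) \sum_(c' in A | c' != c) expR (- (n%:R * b * pd x c c')).

Lemma exists_subset_card (T : finType) (B : {set T}) k : (k <= #|B|)%N ->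
  exists2 A : {set T}, A \subset B & #|A| = k.
Proof.
move=> kB; exists [set c in take k (enum B)].
  by apply/fintype.subsetP => c; rewrite inE => /mem_take; rewrite mem_enum.
rewrite cardsE (card_uniqP _) ?take_uniq ?enum_uniq// size_take -cardE.
by case: ltnP => // h; apply/eqP; rewrite eqn_leq h kB.
Qed.

Lemma pigeonhole (I : finType) (f : I -> R) (t : R) : (0 < #|I|)%N -> t <= \sum_i f i ->
  exists i, t / #|I|%:R <= f i.
Proof.
move=> I0 ht; apply: contrapT => /forallNP no.
have : \sum_i f i < \sum_(i : I) t / #|I|%:R.
  have [i _] : exists i : I, i \in I by apply/card_gt0P.
  rewrite (bigD1 i)//= [ltRHS](bigD1 i)//=; apply: ltr_leD.
    by rewrite ltNge; apply/negP; exact: no.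
  by apply: ler_sum => k _; rewrite leNgt; apply/negP => h; apply: (no k); exact: ltW.
rewrite sumr_const -[_ *+ _]mulr_natr divfK; last by rewrite pnatr_eq0 -lt0n.
by rewrite ltNge ht.
Qed.

(** Pigeonhole over cells of width d that cover the possible distances; p0 is the left end of a cell
    that carries at least the average share. *)
Lemma window (n : nat) (T : finType) (x : T -> 'rV[R]_n) (b d tot : R) (A : {set T}) :
  0 < b -> 0 < d <= 1 -> (forall c, norm2 (x c) = 1) -> 0 < tot ->
  tot <= \sum_(c in A) \sum_(c' in A | c' != c) expR (- (n%:R * b * pd x c c')) ->
  exists (e : rel T) (p0 : R), [/\ symmetric e, (forall c c', e c c' -> [/\ c \in A, c' \in A & c' != c]),
    (forall c c', e c c' -> `|pd x c c' - p0| <= d), 0 <= p0 <= 2 &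
    tot / (Num.truncn (2 / d)).+1%:R <= @nedges R T e * expR (- (n%:R * b * p0))].
Proof.
move=> b0 /andP[d0 d1] x1 tot0 htot.
pose K := (Num.truncn (2 / d)).+1.
pose ix c c' := Num.truncn (pd x c c' / d).
pose e (k : 'I_K) c c' := [&& c \in A, c' \in A, c' != c & ix c c' == k].
have pb c c' := pd_bound x1 c c'.
have ixK c c' : (ix c c' < K)%N.
  rewrite ltnS /ix; apply: le_truncn; rewrite ler_pM2r ?invr_gt0//; by have /andP[] := pb c c'.
have ixb c c' : (ix c c')%:R * d <= pd x c c' < (ix c c').+1%:R * d.
  rewrite -ler_pdivlMr// -ltr_pdivrMr//; apply: truncn_itv.
  by apply: divr_ge0; [have /andP[] := pb c c'|exact: ltW].
have sumE : \sum_(c in A) \sum_(c' in A | c' != c) expR (- (n%:R * b * pd x c c')) =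
  \sum_(k < K) \sum_c \sum_(c' | e k c c') expR (- (n%:R * b * pd x c c')).
  rewrite [LHS]big_mkcond exchange_big; apply: eq_bigr => c _ /=.
  case: ifPn => cA; last first.
    by rewrite big1// => k _; rewrite big_pred0// => c'; rewrite /e (negbTE cA).
  rewrite [LHS](partition_big (fun c' => Ordinal (ixK c c')) xpredT)//=.
  apply: eq_bigr => k _; apply: eq_bigl => c'; rewrite /e cA/= -andbA; congr [&& _, _ & _].
have K0 : (0 < #|'I_K|)%N by rewrite card_ord.
rewrite sumE in htot; have [k] := pigeonhole K0 htot; rewrite card_ord => hk.
have ne : exists c c', e k c c'.
  apply: contrapT => /forallNP no; move: hk; rewrite big1 => [|c _].
    by apply/negP; rewrite -ltNge divr_gt0// ltr0n.
  by rewrite big_pred0// => c'; apply/negP => h; apply: (no c); exists c'.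
exists (e k), (k%:R * d); split.
- move=> c c'; rewrite /e /ix pdC eq_sym.
  by case: (c \in A); case: (c' \in A) => //=.
- by move=> c c' /and4P[].
- move=> c c' /and4P[_ _ _ /eqP ek]; have := ixb c c'; rewrite ek -natr1 mulrDl mul1r => /andP[h1 h2].
  by rewrite ler_norml; lra.
- have [c [c' /and4P[_ _ _ /eqP ek]]] := ne; have := ixb c c'; rewrite ek => /andP[h1 _].
  by rewrite mulr_ge0 ?(ltW d0)//=; have /andP[_] := pb c c'; lra.
apply: (le_trans hk); rewrite /nedges mulr_suml; apply: ler_sum => c _.
rewrite mulr_suml; apply: ler_sum => c' /and4P[_ _ _ /eqP ek]; rewrite mul1r ler_expR lerN2.
have := ixb c c'; rewrite ek => /andP[h1 _]; apply: ler_wpM2l => //; apply: mulr_ge0 => //; exact: ltW.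
Qed.

Lemma converse (b s R1 Rx Rt nu : R) : 0 < b -> 0 < s -> s < 1 -> s = b * (1 - s ^+ 2) ->
  many_close_pairs b s R1 Rx -> R1 <= Rt -> 0 < nu <= 1 ->
  b * (1 - s) + ln (1 - b * (1 - s)) / 2 <= b * (1 - s) + Rx - Rt ->
  0 < b * (1 - s) + Rx - Rt ->
  exists n1 : nat, forall n, (n1 <= n)%N ->
  forall (T : finType) (x : T -> 'rV[R]_n) (Phi : T -> 'rV[R]_n -> R),
  (forall c, norm2 (x c) = 1) -> (forall c c', c' != c -> dot (x c) (x c') < 1) ->
  expR (n%:R * Rt) <= #|T|%:R ->
  (forall c, good (Phi c)) -> (forall c z, 0 <= Phi c z) ->
  (forall c c' z, c' != c -> 0 <= dot (x c' - x c) z -> 1 <= Phi c z) ->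
  expR (- (n%:R * (b * (1 - s) + Rx - Rt + nu))) <=
  #|T|%:R^-1 * \sum_c Ex (fun w => Phi c (w + (2 * Num.sqrt (n%:R * b)) *: x c)).
Proof.
move=> b0 s0 s1 sE hLP R1Rt /andP[nu0 nu1].
set E0 := b * (1 - s) + Rx - Rt => FE E00.
pose ep := nu / 8; have ep0 : 0 < ep by rewrite divr_gt0.
pose Q := b * (1 - s) + Rx.
have QE : Q = E0 + Rt by rewrite /Q /E0; ring.
clearbody E0.
pose Eb := `|E0| + `|Rt| + 2 * `|Q| + 10.
have Eb0 : 0 <= Eb by rewrite !addr_ge0// mulr_ge0.
(* An edge at distance p forces an error of exponent about b p, while the error is going to be
   assumed below about e^{-n (E0 + nu)}; hence p >= E0 / b. *)
pose pm := E0 / b; have pm0 : 0 < pm by rewrite divr_gt0.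
have [d d01 [n1 Hg]] := graph_theorem b0 s0 s1 sE Eb0 pm0 ep0.
have /andP[d0 d1] := d01.
pose ep' := d / 2; have ep'0 : 0 < ep' by rewrite divr_gt0.
have ep'1 : ep' <= 1 by rewrite /ep'; lra.
have [eta eta0 [n2 HLP]] := hLP ep ep0.
(* Enough factors g = e^{n ep'} to descend from the trivial bound 1 on each summand to the level w0.
   J does not depend on n, so the loss 2^J is harmless. *)
pose J := (Num.truncn ((`|Q| + ep + 1) / ep')).+1.
have J1 : `|Q| + ep + 1 <= ep' * J%:R.
  by rewrite mulrC -ler_pdivrMr// ltW// truncnS_gt.
have J2 : ep' * J%:R <= `|Q| + ep + 1 + ep'.
  have x0 : 0 <= (`|Q| + ep + 1) / ep' by rewrite divr_ge0 ?(ltW ep'0)// !addr_ge0// ltW.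
  have := truncn_le ((`|Q| + ep + 1) / ep'); rewrite x0 ler_pdivlMr//.
  by rewrite /J -natr1 mulrDr mulr1 mulrC; clear; lra.
pose K := (Num.truncn (2 / d)).+1.
have [n3 H3] := @small_lin R (J.+2%:R * ln 2) eta eta0.
have [n4 H4] := @small_lin R (J.+1%:R * ln 2) 1 ltr01.
have [n5 H5] := @small_lin R (J.+1%:R * ln 2) ep ep0.
have [n6 H6] := @small_lin R (ln (2 * K%:R)) ep' ep'0.
have [n7 H7] := @small_lin R (ln 2) ep ep0.
have [n8 H8] := @sqrt_small R b 8 (3 + ln 4) nu (ltW b0) (ler0n _ 8) nu0.
exists (maxn (maxn (maxn n1 n2) (maxn n3 n4)) (maxn (maxn n5 n6) (maxn (maxn n7 n8) 1))) => n.
rewrite !geq_max => /andP[/andP[/andP[/Hg hg /HLP hlp] /andP[/H3 h3 /H4 h4]] /andP[/andP[/H5 h5 /H6 h6] /andP[/andP[/H7 h7 /H8 h8] n0]]] {Hg HLP H3 H4 H5 H6 H7 H8 hLP}.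
move=> T x Phi x1 xd hT PhiG Phi0 PhiP.
set mu := Num.sqrt _ in h8 *.
pose F c := Ex (fun w => Phi c (w + (2 * mu) *: x c)).
have F0 c : 0 <= F c by apply: Ex_ge0.
have nn0 : 0 < n%:R :> R by rewrite ltr0n.
have T0 : 0 < #|T|%:R :> R by apply: lt_le_trans hT; exact: expR_gt0.
rewrite leNgt; apply/negP => hlt.
set e0 := expR (- (n%:R * (E0 + nu))) in hlt; have e00 : 0 < e0 by exact: expR_gt0.
(* Expurgation: at least half of the codewords have an error below twice the assumed bound on the
   mean. *)
pose B : {set T} := finset.finset (fun c => (F c < 2 * e0)%R).
have cardB : #|T|%:R / 2 <= #|B|%:R :> R.
  have : #|~: B|%:R * (2 * e0) <= #|T|%:R * e0.
    apply: (@le_trans _ _ (\sum_c F c)); last by rewrite ltW// -ltr_pdivrMl.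
    rewrite (bigID (mem B))/= -sum1_card natr_sum mulr_suml -[leLHS]add0r; apply: lerD.
      by apply: sumr_ge0.
    rewrite [leLHS](eq_bigl (fun c => c \notin B)); last by move=> c; rewrite inE.
    by apply: ler_sum => c; rewrite inE -leNgt mul1r.
  rewrite mulrA ler_pM2r// => h; have := cardsC B; move=> /(congr1 (fun k => k%:R : R)).
  by rewrite natrD; move: h; clear; lra.
set ee := expR (n%:R * Rt) in hT.
(* Only about e^{n Rt} codewords are kept: the lower bound on E requires an upper bound on their
   number, and [hT] bounds it only from below. *)
pose k := minn #|B| (Num.truncn ee).+1.
have ee0 : 0 < ee by exact: expR_gt0.
have [A0 A0B cardA0] := exists_subset_card (geq_minl #|B| (Num.truncn ee).+1 : (k <= #|B|)%N).
set a : R := #|A0|%:R.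
have a1 : ee / 2 <= a.
  rewrite /a cardA0 /k; case: (leqP #|B| (Num.truncn ee).+1) => _; first by move: cardB hT; clear; lra.
  by have := truncnS_gt ee; move: ee0; clear; lra.
have e1n : 2 <= expR n%:R :> R.
  have n1' : 1 <= n%:R :> R by rewrite ler1n.
  by have := expR_ge1Dx (n%:R : R); move: n1'; clear; lra.
have a2 : a <= expR (n%:R * (`|Rt| + 1)).
  apply: (@le_trans _ _ (ee + 1)).
    apply: (@le_trans _ _ (Num.truncn ee).+1%:R); first by rewrite /a cardA0 ler_nat geq_minr.
    by rewrite -natr1 lerD2r; have := truncn_le ee; rewrite (ltW ee0).
  have r1 : ee <= expR (n%:R * `|Rt|) by rewrite ler_expR ler_wpM2l// ler_norm.
  have r2 : 1 <= expR (n%:R * `|Rt|) by rewrite -[leLHS]expR0 ler_expR mulr_ge0.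
  by rewrite mulrDr mulr1 expRD; move: r1 r2 e1n; clear; nra.
have a0 : 0 < a by move: a1 ee0; clear; lra.
have p2 m : 2 ^+ m = expR (m%:R * ln 2) :> R by rewrite expRM_natl lnK ?posrE.
pose X := a / 2 ^+ J.+1.
have pw0 : 0 < 2 ^+ J.+1 :> R by rewrite exprn_gt0.
have X0 : 0 < X by rewrite divr_gt0.
pose w0 := X * expR (- (n%:R * (Q + ep))).
have w00 : 0 < w0 by rewrite mulr_gt0 ?expR_gt0.
pose g := expR (n%:R * ep').
have g1 : 1 <= g by rewrite -[leLHS]expR0 ler_expR mulr_ge0 ?ltW.
pose f c c' := expR (- (n%:R * b * pd x c c')).
have f0 c c' : 0 <= f c c' by exact: expR_ge0.
have X1 : expR (n%:R * (R1 - eta)) <= X.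
  apply: (@le_trans _ _ (ee / 2 / 2 ^+ J.+1)); last by rewrite ler_pM2r ?invr_gt0.
  have -> : ee / 2 / 2 ^+ J.+1 = ee / 2 ^+ J.+2 by rewrite (exprS _ J.+1); field.
  rewrite p2 -expRN -expRD ler_expR mulrBr.
  have : n%:R * R1 <= n%:R * Rt by rewrite ler_wpM2l.
  by move: h3; clear; lra.
have hreg (A : {set T}) : X <= #|A|%:R -> #|A|%:R * w0 <= \sum_(c in A) \sum_(c' in A | c' != c) f c c'.
  move=> XA; apply: le_trans (hlp T x A x1 (le_trans X1 XA)).
  by rewrite /w0 mulrA expr2; apply: ler_wpM2r; [exact: expR_ge0|rewrite ler_wpM2l].
have big0 : 2 ^+ J.+1 <= expR (- (n%:R * (Q + ep))) * g ^+ J.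
  rewrite p2 /g -expRM_natl -expRD ler_expR.
  have := ler_norm Q; have := ler_wpM2l (ltW nn0) J1.
  have -> : J%:R * (n%:R * ep') = n%:R * (ep' * J%:R) by ring.
  move=> u1 u2; have := ler_wpM2l (ltW nn0) u2; move: u1 u2; rewrite !mulrDr mulr1 in h4 *; move: h4; clear; lra.
have tot0 : \sum_(c in A0) \sum_(c' in A0 | c' != c) f c c' <= #|A0|%:R * w0 * g ^+ J.
  apply: (@le_trans _ _ (a * a)).
    rewrite {2}/a -sum1_card natr_sum mulr_sumr; apply: ler_sum => c _; rewrite mulr1.
    rewrite /a -sum1_card natr_sum big_mkcondr; apply: ler_sum => c' _.
    case: ifP => // _; rewrite -[leRHS]expR0 ler_expR oppr_le0 !mulr_ge0//; first exact: ltW.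
    by have /andP[] := pd_bound x1 c c'.
  rewrite -/a -mulrA ler_pM2l// /w0 -mulrA /X mulrAC ler_pdivlMr// ler_pM2l//.
have hA0 : 2 ^+ J.+1 * X <= #|A0|%:R by rewrite -/a /X mulrC divfK// gt_eqF.
have [A' [W [A'A0 XA' /andP[w0W Wg] omA' totA']]] := regularize f0 X0 w00 g1 hreg hA0 tot0.
have W0 : 0 < W by exact: lt_le_trans w0W.
pose E := - ln (2 * W) / n%:R.
have nE : n%:R * E = - ln (2 * W) by rewrite /E mulrC divfK// gt_eqF.
have WE : expR (- (n%:R * E)) = 2 * W by rewrite nE opprK lnK// posrE mulr_gt0.
have E1 : E <= E0 + 2 * ep.
  rewrite -(ler_pM2l nn0) nE.
  have w1 : expR (- (n%:R * (E0 + ep)) - J.+2%:R * ln 2) <= w0.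
    apply: (@le_trans _ _ (ee / 2 / 2 ^+ J.+1 * expR (- (n%:R * (Q + ep))))); last first.
      by apply: ler_wpM2r; [exact: expR_ge0|rewrite ler_pM2r// invr_gt0].
    have -> : ee / 2 / 2 ^+ J.+1 = ee / 2 ^+ J.+2 by rewrite (exprS _ J.+1); field.
    rewrite p2 -expRN /ee -!expRD ler_expR QE.
    by rewrite le_eqVlt; apply/orP; left; apply/eqP; ring.
  have : ln (expR (- (n%:R * (E0 + ep)) - J.+2%:R * ln 2)) <= ln W.
    by rewrite ler_ln ?posrE ?expR_gt0//; exact: le_trans w0W.
  rewrite expRK lnM ?posrE//.
  have -> : J.+2%:R = J.+1%:R + 1 :> R by rewrite -natr1.
  move=> u; exact: (conv_arith1 h5 u).
have E2 : - (`|Rt| + 2 * `|Q| + 3) <= E.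
  rewrite -(ler_pM2l nn0) nE mulrN lerN2.
  have : ln (2 * W) <= ln (expR (n%:R * (`|Rt| + 1)) * (expR (- (n%:R * (Q + ep))) * g ^+ J)).
    rewrite ler_ln ?posrE ?mulr_gt0 ?expR_gt0 ?exprn_gt0//; last by rewrite (lt_le_trans _ g1).
    apply: (@le_trans _ _ (2 * (w0 * g ^+ J))); first by rewrite ler_pM2l.
    have -> : 2 * (w0 * g ^+ J) = 2 * X * (expR (- (n%:R * (Q + ep))) * g ^+ J) by rewrite /w0; ring.
    apply: ler_wpM2r.
      by rewrite mulr_ge0 ?expR_ge0// exprn_ge0// expR_ge0.
    apply: le_trans a2; rewrite /X mulrA ler_pdivrMr// exprS mulrC ler_wpM2l ?(ltW a0)//.
    by rewrite ler_peMr// exprn_ege1// ler1n.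
  rewrite /g -expRM_natl -!expRD expRK.
  have -> : J%:R * (n%:R * ep') = n%:R * (ep' * J%:R) by ring.
  have := ler_wpM2l (ltW nn0) J2.
  have : - Q <= `|Q| by rewrite -normrN ler_norm.
  move=> u1 u2 u3; apply: (le_trans u3); exact: (conv_arith2 `|Rt| nn0 u2 u1 ep'1).
have EEb : `|E| <= Eb.
  exact: (conv_arith3 nu1 E1 E2).
have A'0 : 0 < #|A'|%:R :> R by exact: lt_le_trans XA'.
have tot'0 : 0 < #|A'|%:R * W / g by rewrite divr_gt0 ?expR_gt0// mulr_gt0.
have [e [p0 [esym eA' pe p002 hN]]] := window b0 d01 x1 tot'0 totA'.
have A'B c : c \in A' -> F c < 2 * e0.
  by move=> /(fintype.subsetP A'A0)/(fintype.subsetP A0B); rewrite inE.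
have K0 : 0 < K%:R :> R by rewrite ltr0n.
(* Near equality on average: halving loses g = e^{n d / 2} and a factor 2, the pigeonhole loses K,
   together at most e^{n d}. *)
have NA : #|A'|%:R * expR (n%:R * (b * p0 - E - d)) <= @nedges R T e.
  have -> : n%:R * (b * p0 - E - d) = n%:R * b * p0 + (- (n%:R * E)) + (- (n%:R * d)) by ring.
  rewrite !expRD WE.
  have h : expR (- (n%:R * d)) <= (2 * K%:R * g)^-1.
    rewrite expRN lef_pV2 ?posrE ?mulr_gt0 ?expR_gt0//.
    rewrite -[2 * K%:R]lnK ?posrE ?mulr_gt0// /g -expRD ler_expR.
    have -> : n%:R * d = n%:R * ep' + n%:R * ep' by rewrite /ep'; field.
    by rewrite lerD2r.
  have := ler_wpM2r (expR_ge0 (n%:R * b * p0)) hN.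
  have -> : @nedges R T e * expR (- (n%:R * b * p0)) * expR (n%:R * b * p0) = @nedges R T e.
    by rewrite -mulrA -expRD addNr expR0 mulr1.
  rewrite -/K; apply: le_trans.
  apply: (@le_trans _ _ (#|A'|%:R * (expR (n%:R * b * p0) * (2 * W) * (2 * K%:R * g)^-1))).
    apply: ler_wpM2l; first exact: ler0n.
    apply: ler_wpM2l; last exact: h.
    by apply: mulr_ge0; [exact: expR_ge0|apply: mulr_ge0; [exact: ler0n|exact: ltW]].
  rewrite le_eqVlt; apply/orP; left; apply/eqP; field.
  by rewrite !gt_eqF// (lt_le_trans _ g1).
have pem c c' : e c c' -> pm <= pd x c c'.
  move=> ecc; have [cA' _ cc] := eA' _ _ ecc.
  have := pair_err n0 b0 (x1 c) (x1 c') (xd _ _ cc) (PhiG c) (Phi0 c) (fun z => PhiP c c' z cc).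
  rewrite -/mu -/(pd x c c') -/(F c) => h.
  have := le_lt_trans h (A'B _ cA').
  have -> : 2^-1 * expR (- (n%:R * b * pd x c c') - 8 * mu - 3) = 2 * expR (- (n%:R * b * pd x c c') - 8 * mu - 3 - ln 4).
    by rewrite !expRD [expR (- ln 4)]expRN lnK ?posrE//; field.
  rewrite ltr_pM2l// /e0 ltr_expR => h9.
  rewrite /pm ler_pdivrMr// -(ler_pM2l nn0).
  have -> : n%:R * (pd x c c' * b) = n%:R * b * pd x c c' by ring.
  exact: (conv_arith4 h8 h9).
have A'n : (0 < #|A'|)%N by rewrite -(ltr0n R).
have om c : c \in A' -> \sum_(c' in A' | c' != c) expR (- (n%:R * b * pd x c c')) <= expR (- (n%:R * E)).
  by move=> /omA'; rewrite WE.
have eA c c' : e c c' -> c \in A' by move=> /eA'[].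
have PhiP' c c' z : e c c' -> 0 <= dot (x c' - x c) z -> 1 <= Phi c z.
  by move=> /eA'[_ _ cc]; exact: PhiP.
have := hg T x e A' E p0 Phi x1 esym eA pe pem om A'n NA p002 EEb PhiG Phi0 PhiP'.
rewrite -/mu; apply/negP; rewrite -ltNge.
apply: (@lt_le_trans _ _ (\sum_(c in A') 2 * e0)).
  have [c0 c0A'] : exists c, c \in A' by apply/card_gt0P.
  rewrite (bigD1 c0)//= [ltRHS](bigD1 c0)//=; apply: ltr_leD; first exact: A'B.
  by apply: ler_sum => c /andP[/A'B/ltW].
rewrite sumr_const -[_ *+ _]mulr_natl ler_pM2l//.
have M1 : Num.max E (b * (1 - s) + ln (1 - b * (1 - s)) / 2) <= E0 + 2 * ep.
  by rewrite ge_max E1/= (le_trans FE)// lerDl mulr_ge0// ltW.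
have -> : 2 * e0 = expR (ln 2 - n%:R * (E0 + nu)) by rewrite expRD lnK ?posrE.
rewrite ler_expR; have := ler_wpM2l (ltW nn0) M1.
have nuE : nu = 8 * ep by rewrite /ep; field.
have nep : 0 <= n%:R * ep by rewrite mulr_ge0 ?ltW.
move=> u; rewrite nuE; exact: (conv_arith5 h7 nep u).
Qed.

End converse.

Import Zonal.

(** * Differential equation and growth of Gegenbauer polynomials *)

Section gegenbauer.
Context {R : realType}.
Variable N : nat.
Hypothesis N5 : (4 < N)%N.
Implicit Types (x y s t k d : R) (i j : nat).
Local Notation c := (gegc R N).
Local Notation P := (geg R N).
Local Notation lam := (N%:R / 2 - 1 : R).
Local Notation M i := (i%:R + lam).

(** The squared norm of the monic polynomial of degree i for the normalized ultraspherical weight,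
    as a product of recurrence coefficients. *)
Fixpoint nu i : R := if i is i'.+1 then c i * nu i' else 1.

Lemma lam_gt1 : 1 < lam.
Proof.
have : (5 : R) <= N%:R by rewrite (ler_nat R 5).
by lra.
Qed.

Lemma M_ge i : lam <= M i.
Proof. by have : (0 : R) <= i%:R; [rewrite ler0n|lra]. Qed.

Lemma gegcE i : c i = (1 - lam * (lam - 1) / (M i * (M i - 1))) / 4.
Proof.
have := lam_gt1; have := M_ge i; rewrite /gegc => h1 h2.
by field; lra.
Qed.

Lemma frac_mono (l m m' : R) : 1 < l -> l <= m -> m <= m' ->
  l * (l - 1) / (m' * (m' - 1)) <= l * (l - 1) / (m * (m - 1)).
Proof.
move=> l1 lm mm; apply: ler_wpM2l; first by apply: mulr_ge0; lra.
have h : 0 < m * (m - 1) by apply: mulr_gt0; lra.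
have h' : m * (m - 1) <= m' * (m' - 1) by apply: ler_pM; lra.
by rewrite lef_pV2 ?posrE//; lra.
Qed.

Lemma gegc_le i j : (i <= j)%N -> c i <= c j.
Proof.
move=> ij; have mm : M i <= M j by rewrite lerD2r ler_nat.
have := frac_mono lam_gt1 (M_ge i) mm; rewrite !gegcE; lra.
Qed.

Lemma gegc0 : c 0 = 0.
Proof. by rewrite /gegc !mul0r. Qed.

Lemma gegc_gt0 i : 0 < c i.+1.
Proof.
have := lam_gt1; have := M_ge i => h1 h2.
have i0 : (0 : R) <= i%:R by rewrite ler0n.
rewrite /gegc -natr1; apply: divr_gt0; apply: mulr_gt0; lra.
Qed.

Lemma gegc_ge0 i : 0 <= c i.
Proof. by case: i => [|i]; [rewrite gegc0|exact: ltW (gegc_gt0 i)]. Qed.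

Lemma gegc_le14 i : 4 * c i <= 1.
Proof.
have l1 := lam_gt1; have m1 := M_ge i; rewrite gegcE.
have : 0 <= lam * (lam - 1) / (M i * (M i - 1)).
  by apply: divr_ge0; apply: mulr_ge0; lra.
lra.
Qed.

Lemma frac_lo (l m t : R) : 1 < l -> l <= m -> 0 <= t -> l <= t * m ->
  l * (l - 1) / (m * (m - 1)) <= t ^+ 2.
Proof.
move=> l1 lm t0 lt; rewrite ler_pdivrMr; last by apply: mulr_gt0; lra.
case: (lerP 1 t) => t1.
  have h : 1 <= t ^+ 2 by rewrite expr2; nra.
  have h2 : l * (l - 1) <= m * (m - 1) by nra.
  have h3 : 0 <= l * (l - 1) by nra.
  by apply: le_trans h2 _; rewrite ler_peMl//; nra.
have h1 : l - 1 <= t * (m - 1) by lra.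
have -> : t ^+ 2 * (m * (m - 1)) = (t * m) * (t * (m - 1)) by ring.
by apply: ler_pM => //; lra.
Qed.

Lemma frac_hi (l m t : R) : 1 < l -> l <= m -> 0 <= t -> t * (m - 1) <= l - 1 ->
  t ^+ 2 <= l * (l - 1) / (m * (m - 1)).
Proof.
move=> l1 lm t0 lt; rewrite ler_pdivlMr; last by apply: mulr_gt0; lra.
have t1 : t <= 1 by rewrite leNgt; apply/negP => t1; nra.
have h1 : t * m <= l by lra.
have -> : t ^+ 2 * (m * (m - 1)) = (t * m) * (t * (m - 1)) by ring.
by apply: ler_pM => //; apply: mulr_ge0; lra.
Qed.

Lemma nu_gt0 i : 0 < nu i.
Proof. by elim: i => [|i ih] //=; apply: mulr_gt0 => //; exact: gegc_gt0. Qed.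

Lemma P_rec i x : (P i.+2).[x] = x * (P i.+1).[x] - c i.+1 * (P i).[x].
Proof. by rewrite gegS !hornerE. Qed.

Lemma dP_rec i x : (P i.+2)^`().[x] = (P i.+1).[x] + x * (P i.+1)^`().[x] - c i.+1 * (P i)^`().[x].
Proof. by rewrite gegS derivB derivM derivX derivZ mul1r !hornerE. Qed.

Lemma dP0 : (P 0)^`() = 0.
Proof. by rewrite geg0 -polyC1 derivC. Qed.

Lemma P_at0 i : (P i).[0] ^+ 2 <= nu i.
Proof.
elim/two_step_ind: i => [||i ih _].
- by rewrite geg0 hornerE expr1n.
- by rewrite geg1 hornerE expr0n /= mulr1 gegc_ge0.
rewrite P_rec mul0r sub0r sqrrN exprMn /=.
have h := gegc_le (leqnSn i.+1); have h0 := gegc_gt0 i; have n0 := nu_gt0 i.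
rewrite mulrA; apply: ler_pM => //; rewrite ?sqr_ge0// expr2; apply: ler_wpM2r => //; exact: ltW.
Qed.

Lemma geggE i : gegg R N i = 2 * M i * c i.
Proof. by rewrite /gegg; field. Qed.

Lemma geg_dstep (x k p1 p2 p3 c2 c1 g3 g2 g1 q2 q1 : R) :
  g3 = 1 + g2 - 2 * c2 -> (g2 - 2 * c2) * c1 = c2 * g1 ->
  p3 = x * p2 - c1 * p1 ->
  (1 - x ^+ 2) * q2 = - (k + 1) * x * p3 + g2 * p2 ->
  (1 - x ^+ 2) * q1 = - k * x * p2 + g1 * p1 ->
  (1 - x ^+ 2) * (p3 + x * q2 - c2 * q1) = - (k + 2) * x * (x * p3 - c2 * p2) + g3 * p3.
Proof.
move=> -> h2 h3 h4 h5.
rewrite [LHS](_ : _ = (1 - x ^+ 2) * p3 + x * ((1 - x ^+ 2) * q2) - c2 * ((1 - x ^+ 2) * q1)); last by ring.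
rewrite h4 h5.
apply: subr0_eq; rewrite [LHS](_ : _ = (g2 - 2 * c2) * (x * p2 - p3) - c2 * g1 * p1); last by ring.
by rewrite h3 -h2; ring.
Qed.

Lemma geg_deriv i x : (1 - x ^+ 2) * (P i.+1)^`().[x] =
  - i.+1%:R * x * (P i.+1).[x] + gegg R N i.+1 * (P i).[x].
Proof.
have N3 : (2 < N)%N by apply: leq_trans N5.
elim/two_step_ind: i => [||i ih1 ih2].
- by rewrite geg1 geg0 (gegg1 R N3) derivX !hornerE; ring.
- rewrite dP_rec P_rec dP0 geg1 geg0 derivX (geggS R N3) (gegg1 R N3) -polyC1 !hornerC hornerX.
  by ring.
- rewrite (dP_rec i.+1) (P_rec i.+1).
  have := geg_dstep (geggS R N3 i.+1) (gegg_comm R N3 i) (P_rec i x) _ ih1.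
  have e2 : i.+1%:R + 1 = i.+2%:R :> R by rewrite natr1.
  have e3 : i.+1%:R + 2 = i.+3%:R :> R by rewrite -!natr1; ring.
  by rewrite e3 e2 => /(_ _ ih2).
Qed.

Lemma geg_deriv2 i x : (1 - x ^+ 2) * (P i)^`().[x] = 
  (i%:R + 2 * lam) * x * (P i).[x] - 2 * M i * (P i.+1).[x].
Proof.
case: i => [|i].
  by rewrite dP0 geg0 geg1 !hornerE; ring.
rewrite geg_deriv P_rec geggE; ring.
Qed.

Lemma der_uniq (f : R -> R) x a b : der f x a -> der f x b -> a = b.
Proof. by move=> ha hb; rewrite -(@derive_val _ _ _ _ _ _ _ ha) (@derive_val _ _ _ _ _ _ _ hb). Qed.

(** The first-order relation [geg_deriv] is differentiated; [geg_deriv2], and then [geg_deriv] once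
    more, eliminate the polynomial of lower degree. *)
Lemma geg_ode i x : x ^+ 2 < 1 ->
  (1 - x ^+ 2) * (P i)^`()^`().[x] =
  (2 * lam + 1) * x * (P i)^`().[x] - i%:R * (i%:R + 2 * lam) * (P i).[x].
Proof.
move=> x1; case: i => [|i].
  by rewrite dP0 linear0 !hornerE; ring.
have h1 : der (fun x => (1 - x ^+ 2) * (P i.+1)^`().[x]) x
   (- (2 * x) * (P i.+1)^`().[x] + (1 - x ^+ 2) * (P i.+1)^`()^`().[x]).
  apply: der_eq.
    by apply: derM; [apply: derB; [exact: der_cst|apply: derX; exact: der_id]|exact: der_horner].
  by rewrite /=; ring.
have h2 : der (fun x => (1 - x ^+ 2) * (P i.+1)^`().[x]) x
   (- i.+1%:R * ((P i.+1).[x] + x * (P i.+1)^`().[x]) + gegg R N i.+1 * (P i)^`().[x]).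
  rewrite (funext (geg_deriv i)).
  apply: der_eq.
    apply: derD; last by apply: derM; [exact: der_cst|exact: der_horner].
    by apply: derM; [apply: derM; [exact: der_cst|exact: der_id]|exact: der_horner].
  by rewrite /=; ring.
have e := der_uniq h1 h2.
have hi := geg_deriv2 i x.
have hp := geg_deriv i x.
have hc : 2 * M i * gegg R N i.+1 = i.+1%:R * (i.+1%:R + 2 * lam - 1).
  rewrite geggE gegcE -natr1; have := lam_gt1; have := M_ge i => H1 H2; by field; lra.
have x0 : 1 - x ^+ 2 != 0 by lra.
have e1 : i.+1%:R = i%:R + 1 :> R by rewrite natr1.
apply: (mulfI x0); move: e hi hp hc.
move: ((P i.+1)^`()^`().[x]) ((P i.+1)^`().[x]) ((P i.+1).[x]) ((P i)^`().[x]) ((P i).[x]) (gegg R N i.+1).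
rewrite e1; move: (i%:R : R) (lam) => k l p2 p1 p q1 q g e hi hp hc.
have e' : (1 - x ^+ 2) * p2 = 2 * x * p1 - (k + 1) * (p + x * p1) + g * q1 by lra.
rewrite [X in _ * X]e'.
rewrite [LHS](_ : _ = (1 - x ^+ 2) * (2 * x * p1 - (k + 1) * (p + x * p1)) + g * ((1 - x ^+ 2) * q1)); last by ring.
rewrite hi.
rewrite [LHS](_ : _ = (1 - x ^+ 2) * (2 * x * p1 - (k + 1) * (p + x * p1)) + (k + 2 * l) * x * (g * q) - 2 * (k + l) * g * p); last by ring.
have -> : g * q = (1 - x ^+ 2) * p1 + (k + 1) * x * p by lra.
by rewrite hc; ring.
Qed.


Definition wgt x : R := expR (lam * ln (1 - x ^+ 2)).
Definition phi i x : R := M i ^+ 2 - lam * (lam - 1) / (1 - x ^+ 2).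
Definition qt i x : R := (1 - x ^+ 2) * (P i)^`().[x] - lam * x * (P i).[x].
(* With v = (1 - x^2)^{lam / 2} P this is phi v^2 + (1 - x^2) v'^2. *)
Definition sonin i x : R := wgt x * (phi i x * (P i).[x] ^+ 2 + qt i x ^+ 2 / (1 - x ^+ 2)).

Lemma der_1Bsqr x : der (fun y => 1 - y ^+ 2) x (- (2 * x)).
Proof.
apply: der_eq; first by apply: derB; [exact: der_cst|apply: derX; exact: der_id].
by rewrite /=; ring.
Qed.

Lemma der_wgt (l x : R) : x ^+ 2 < 1 -> 
  der (fun y => expR (l * ln (1 - y ^+ 2))) x (expR (l * ln (1 - x ^+ 2)) * (l * (- (2 * x) / (1 - x ^+ 2)))).
Proof.
move=> x1; apply: der_exp; apply: derZ; apply: der_ln; first by lra.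
exact: der_1Bsqr.
Qed.

Lemma sonin_field (W x p p1 p2 l k : R) : x ^+ 2 < 1 ->
  (1 - x ^+ 2) * p2 = (2 * l + 1) * x * p1 - k * (k + 2 * l) * p ->
  let f := (k + l) ^+ 2 - l * (l - 1) / (1 - x ^+ 2) in
  let f' := - (l * (l - 1) * (- - (2 * x) / (1 - x ^+ 2) ^+ 2)) in
  let q := (1 - x ^+ 2) * p1 - l * x * p in
  let q' := - (2 * x) * p1 + (1 - x ^+ 2) * p2 - (l * p + l * x * p1) in
  W * (l * (- (2 * x) / (1 - x ^+ 2))) * (f * p ^+ 2 + q ^+ 2 / (1 - x ^+ 2)) +
  W * ((f' * p ^+ 2 + f * (2 * p * p1)) + ((2 * q * q') / (1 - x ^+ 2) + q ^+ 2 * (- - (2 * x) / (1 - x ^+ 2) ^+ 2)))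
  = W * p ^+ 2 * f'.
Proof.
move=> x1 h /=; rewrite h.
have x0 : 1 - x ^+ 2 != 0 by lra.
by field.
Qed.

(** By the differential equation everything cancels except the derivative of [phi], which is
    negative on (0, 1); hence [sonin] decreases there. *)
Lemma der_sonin i x : x ^+ 2 < 1 ->
  der (sonin i) x (wgt x * (P i).[x] ^+ 2 * - (lam * (lam - 1) * (- - (2 * x) / (1 - x ^+ 2) ^+ 2))).
Proof.
move=> x1; have x0 : 1 - x ^+ 2 != 0 by lra.
apply: der_eq; last exact: (sonin_field (wgt x) x1 (geg_ode i x1)).
have dV : der (fun y => (1 - y ^+ 2)^-1) x (- - (2 * x) / (1 - x ^+ 2) ^+ 2).
  by apply: derV => //; exact: der_1Bsqr.
have dphi : der (phi i) x (- (lam * (lam - 1) * (- - (2 * x) / (1 - x ^+ 2) ^+ 2))).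
  apply: der_eq; first by apply: derB; [exact: der_cst|apply: derZ; exact: dV].
  by rewrite sub0r.
have dq : der (qt i) x (- (2 * x) * (P i)^`().[x] + (1 - x ^+ 2) * (P i)^`()^`().[x] - (lam * (P i).[x] + lam * x * (P i)^`().[x])).
  apply: derB; first by apply: derM; [exact: der_1Bsqr|exact: der_horner].
  apply: derM; last exact: der_horner.
  by apply: der_eq; [apply: derZ; exact: der_id|rewrite mulr1].
apply: derM; first exact: der_wgt.
apply: derD.
  apply: derM => //; apply: der_eq; first by apply: derX; exact: der_horner.
  by rewrite expr1.
apply: derM => //; apply: der_eq; first by apply: derX; exact: dq.
by rewrite expr1.
Qed.

Lemma sqr_lt1 x : 0 <= x -> x < 1 -> x ^+ 2 < 1.
Proof. by move=> x0 x1; rewrite expr_lt1. Qed.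

Lemma sonin_decr i x : 0 <= x -> x < 1 -> sonin i x <= sonin i 0.
Proof.
move=> x0 x1; apply: der_decr x0 _ _ => t /andP[t0 tx].
  by apply: der_sonin; apply: sqr_lt1 => //; lra.
have l1 := lam_gt1; have t1 : t ^+ 2 < 1 by apply: sqr_lt1 => //; lra.
rewrite mulrN oppr_le0; apply: mulr_ge0; first by apply: mulr_ge0; [exact: expR_ge0|exact: sqr_ge0].
apply: mulr_ge0; first by apply: mulr_ge0; lra.
by apply: divr_ge0; [lra|exact: sqr_ge0].
Qed.

Lemma sonin0_arith (k l p q nu' nu'' c' : R) : 1 < l -> 1 <= k -> 0 <= nu' -> 0 <= c' -> 4 * c' <= 1 ->
  p ^+ 2 <= nu' -> nu' = c' * nu'' -> q ^+ 2 <= nu'' ->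
  ((k + l) ^+ 2 - l * (l - 1)) * p ^+ 2 + (2 * (k + l) * c' * q) ^+ 2 <= 3 * (k + l) ^+ 2 * nu'.
Proof.
move=> l1 k1 n0 c0 c1 hp hn hq.
have h1 : ((k + l) ^+ 2 - l * (l - 1)) * p ^+ 2 <= (k + l) ^+ 2 * nu'.
  apply: ler_pM => //; rewrite ?sqr_ge0//; first by nra.
  by have : 0 <= l * (l - 1); [nra|lra].
have h2 : (2 * (k + l) * c' * q) ^+ 2 <= (k + l) ^+ 2 * nu'.
  rewrite [leLHS](_ : _ = (k + l) ^+ 2 * ((4 * c') * (c' * q ^+ 2))); last by ring.
  apply: ler_wpM2l; first exact: sqr_ge0.
  have cq : 0 <= c' * q ^+ 2 by apply: mulr_ge0 => //; exact: sqr_ge0.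
  apply: le_trans (_ : c' * q ^+ 2 <= _); first by apply: ler_piMl.
  by rewrite hn; apply: ler_wpM2l.
have : 0 <= (k + l) ^+ 2 * nu' by apply: mulr_ge0 => //; exact: sqr_ge0.
lra.
Qed.

Lemma sonin_le i x : 0 <= x -> x < 1 -> sonin i.+1 x <= 3 * M i.+1 ^+ 2 * nu i.+1.
Proof.
move=> x0 x1; apply: le_trans (sonin_decr i.+1 x0 x1) _.
have e : (P i.+1)^`().[0] = 2 * M i.+1 * c i.+1 * (P i).[0].
  by have := geg_deriv i 0; rewrite geggE expr0n /= subr0 mul1r mulr0 mul0r add0r.
have z : (0 : R) ^+ 2 = 0 by rewrite expr2 mulr0.
rewrite /sonin /wgt /phi /qt z subr0 ln1 !mulr0 expR0 !mul1r mul0r subr0 !divr1 e.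
apply: (@sonin0_arith _ _ _ _ (nu i.+1) (nu i) (c i.+1)); rewrite ?gegc_le14 ?gegc_ge0 ?P_at0 ?lam_gt1//.
- by rewrite -natr1; have : (0 : R) <= i%:R; [rewrite ler0n|lra].
- exact: ltW (nu_gt0 _).
Qed.

Definition wp2 i x : R := wgt x * (P i).[x] ^+ 2.

Lemma wp2_ge0 i x : 0 <= wp2 i x.
Proof. by apply: mulr_ge0; [exact: expR_ge0|exact: sqr_ge0]. Qed.

Lemma der_wp2 i x : x ^+ 2 < 1 -> der (wp2 i) x (2 * (wgt x * (P i).[x] * qt i x / (1 - x ^+ 2))).
Proof.
move=> x1; have x0 : 1 - x ^+ 2 != 0 by lra.
apply: der_eq; first by apply: derM; [exact: der_wgt|apply: derX; exact: der_horner].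
rewrite -/(wgt x) /qt /=; move: (wgt x) ((P i).[x]) ((P i)^`().[x]) => W p p1.
by move: lam => l; field.
Qed.

Lemma wp2_start_arith (m l d y2 v nu' t : R) : 1 < l -> 0 < m -> 0 < d -> 0 <= y2 -> 0 <= t -> l <= t * m ->
  y2 < 1 -> t ^+ 2 + d <= 1 - y2 -> 0 <= v -> v * (m ^+ 2 - l * (l - 1) / (1 - y2)) <= 3 * m ^+ 2 * nu' ->
  v <= 3 / d * nu'.
Proof.
move=> l1 m0 d0 y0 t0 lt y1 td v0 h.
have m2 : 0 < m ^+ 2 by apply: exprn_gt0.
have h1 : m ^+ 2 * d <= m ^+ 2 - l * (l - 1) / (1 - y2).
  rewrite lerBrDr -lerBrDl ler_pdivrMr; last by lra.
  have hl : l * (l - 1) <= t ^+ 2 * m ^+ 2.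
    by rewrite -exprMn; apply: le_trans (_ : l ^+ 2 <= _); [nra|rewrite lerXn2r ?nnegrE//; lra].
  apply: le_trans hl _.
  have -> : (m ^+ 2 - m ^+ 2 * d) * (1 - y2) = m ^+ 2 * ((1 - y2) - d * (1 - y2)) by ring.
  rewrite mulrC; apply: ler_wpM2l; first exact: ltW.
  have : d * (1 - y2) <= d by rewrite ler_piMr//; lra.
  lra.
have h2 : v * (m ^+ 2 * d) <= 3 * m ^+ 2 * nu' by apply: le_trans (ler_wpM2l v0 h1) h.
rewrite -(ler_pM2r m2) -(ler_pM2r d0); apply: le_trans (_ : v * (m ^+ 2 * d) <= _); first by lra.
apply: le_trans h2 _; rewrite [leRHS](_ : _ = 3 * m ^+ 2 * nu')//; field; lra.
Qed.

(** On the oscillatory side of the turning point [phi] is at least d times the square of [M i.+1],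
    so the bound on [sonin] controls the weighted square itself. *)
Lemma wp2_start i y t d : 0 <= y -> y < 1 -> 0 < d -> 0 <= t -> lam <= t * M i.+1 ->
  t ^+ 2 + d <= 1 - y ^+ 2 -> wp2 i.+1 y <= 3 / d * nu i.+1.
Proof.
move=> y0 y1 d0 t0 lt td; have l1 := lam_gt1; have ml := M_ge i.+1.
have yy := sqr_lt1 y0 y1.
have m0 : 0 < M i.+1 by lra.
apply: (wp2_start_arith l1 m0 d0 (sqr_ge0 y) t0 lt yy td (wp2_ge0 i.+1 y)).
have hs := sonin_le i y0 y1.
apply: le_trans hs; rewrite -/(phi i.+1 y) /wp2 /sonin [leRHS]mulrDr.
have : 0 <= wgt y * (qt i.+1 y ^+ 2 / (1 - y ^+ 2)).
  by apply: mulr_ge0; [exact: expR_ge0|apply: divr_ge0; [exact: sqr_ge0|lra]].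
have -> : wgt y * (P i.+1).[y] ^+ 2 * phi i.+1 y = wgt y * (phi i.+1 y * (P i.+1).[y] ^+ 2) by ring.
lra.
Qed.

Lemma wp2_growth_arith (m l s2 x2 W p q nu' : R) : 1 < l -> l <= m -> 0 <= x2 -> x2 <= s2 -> s2 < 1 -> 0 <= W -> 0 <= nu' ->
  W * ((m ^+ 2 - l * (l - 1) / (1 - x2)) * p ^+ 2 + q ^+ 2 / (1 - x2)) <= 3 * m ^+ 2 * nu' ->
  2 * (W * p * q / (1 - x2)) <= 2 / (1 - s2) * m * (W * p ^+ 2 + 3 * nu').
Proof.
move=> l1 lm x0 xs s1 W0 n0 h.
have m0 : 0 < m by lra.
set k := (1 - x2)^-1; set ks := (1 - s2)^-1.
have k1 : 1 <= ks by rewrite /ks invf_ge1 ?lerBlDr ?lerDl; lra.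
have k0 : 0 <= k by rewrite /k invr_ge0; lra.
have kk : k <= ks by rewrite /k /ks lef_pV2 ?posrE; lra.
move: h; rewrite -/k -/ks => h.
have v0 : 0 <= W * p ^+ 2 by apply: mulr_ge0 => //; exact: sqr_ge0.
(* AM-GM: 2 p q <= m p^2 + q^2 / m *)
have h1 : 2 * (p * q) <= m * p ^+ 2 + q ^+ 2 / m.
  rewrite -subr_ge0 [leRHS](_ : _ = (m * p - q) ^+ 2 / m); last by field; lra.
  by apply: divr_ge0; [exact: sqr_ge0|lra].
have h2 : W * (q ^+ 2 * k) <= 3 * m ^+ 2 * nu' + m ^+ 2 * ks * (W * p ^+ 2).
  have e : W * (q ^+ 2 * k) = W * ((m ^+ 2 - l * (l - 1) * k) * p ^+ 2 + q ^+ 2 * k) - m ^+ 2 * (W * p ^+ 2) + l * (l - 1) * k * (W * p ^+ 2) by ring.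
  have h3 : l * (l - 1) * k * (W * p ^+ 2) <= m ^+ 2 * ks * (W * p ^+ 2).
    apply: ler_wpM2r => //; apply: ler_pM => //; first by apply: mulr_ge0; lra.
    by rewrite expr2; apply: ler_pM; lra.
  have h4 : 0 <= m ^+ 2 * (W * p ^+ 2) by apply: mulr_ge0 => //; exact: sqr_ge0.
  by rewrite e; lra.
have h5 : 2 * (W * p * q * k) <= m * (k * (W * p ^+ 2)) + (W * (q ^+ 2 * k)) / m.
  have -> : 2 * (W * p * q * k) = (W * k) * (2 * (p * q)) by ring.
  have -> : m * (k * (W * p ^+ 2)) + (W * (q ^+ 2 * k)) / m = (W * k) * (m * p ^+ 2 + q ^+ 2 / m) by field; lra.
  by apply: ler_wpM2l => //; apply: mulr_ge0.
apply: le_trans h5 _.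
have h6 : (W * (q ^+ 2 * k)) / m <= 3 * m * nu' + m * ks * (W * p ^+ 2).
  rewrite ler_pdivrMr//; apply: le_trans h2 _; rewrite le_eqVlt; apply/orP; left; apply/eqP; ring.
have h7 : m * (k * (W * p ^+ 2)) <= m * (ks * (W * p ^+ 2)).
  by apply: ler_wpM2l; [lra|apply: ler_wpM2r].
have h8 : 3 * m * nu' <= 2 * ks * m * (3 * nu').
  have : 0 <= m * nu' by apply: mulr_ge0 => //; lra.
  have : m * nu' <= ks * (m * nu') by apply: ler_peMl => //; apply: mulr_ge0 => //; lra.
  have -> : 2 * ks * m * (3 * nu') = 6 * (ks * (m * nu')) by ring.
  have -> : 3 * m * nu' = 3 * (m * nu') by ring.
  lra.
have -> : 2 * ks * m * (W * p ^+ 2 + 3 * nu') = 2 * (m * (ks * (W * p ^+ 2))) + 2 * ks * m * (3 * nu') by ring.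
have e6 : m * ks * (W * p ^+ 2) = m * (ks * (W * p ^+ 2)) by ring.
lra.
Qed.

(** A Gronwall estimate across the turning point, where [phi] may vanish: the rate is of the order
    of the degree plus the dimension, so the cost is exponential only in the gap x - y, which can be
    made small. *)
Lemma wp2_growth i y x s : 0 <= y -> y <= x -> x <= s -> s < 1 ->
  wp2 i.+1 x <= (wp2 i.+1 y + 3 * nu i.+1) * expR (2 / (1 - s ^+ 2) * M i.+1 * (x - y)).
Proof.
move=> y0 yx xs s1.
set k := 2 / (1 - s ^+ 2) * M i.+1.
have n0 := ltW (nu_gt0 i.+1).
pose G t := (wp2 i.+1 t + 3 * nu i.+1) * expR (- (k * t)).
have h : G x <= G y.
  apply: (@der_decr _ G (fun t => 2 * (wgt t * (P i.+1).[t] * qt i.+1 t / (1 - t ^+ 2)) * expR (- (k * t)) + (wp2 i.+1 t + 3 * nu i.+1) * (expR (- (k * t)) * - k)) _ _ yx _ _) => t /andP[ty tx].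
    apply: derM.
      apply: der_eq; first by apply: derD; [apply: der_wp2; apply: sqr_lt1; lra|exact: der_cst].
      by rewrite addr0.
    apply: der_exp; apply: derN; apply: der_eq; first by apply: derZ; exact: der_id.
    by rewrite mulr1.
  have -> (a b e : R) : a * e + b * (e * - k) = (a - k * b) * e by ring.
  rewrite pmulr_lle0 ?expR_gt0// subr_le0.
  have t0 : 0 <= t by lra.
  have t1 : t < 1 by lra.
  apply: (wp2_growth_arith lam_gt1 (M_ge i.+1) (sqr_ge0 t) _ _ (expR_ge0 _) n0 (sonin_le i t0 t1)).
    by rewrite lerXn2r ?nnegrE//; lra.
  by apply: sqr_lt1; lra.
move: h; rewrite /G !expRN ler_pdivrMr ?expR_gt0// => h.
apply: le_trans (_ : wp2 i.+1 x + 3 * nu i.+1 <= _); first by lra.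
apply: le_trans h _; rewrite -mulrA mulrBr expRB mulrC [X in _ <= _ * X]mulrC.
by rewrite mulrC.
Qed.

(** Beyond the turning point the ratio of consecutive polynomials stays above x / 2, the fixed point
    of r = x - x^2 / (4 r). *)
Lemma geg_pos i x : 0 < x -> 4 * c i <= x ^+ 2 -> forall j, (j <= i)%N ->
  0 < (P j).[x] /\ x / 2 * (P j).[x] <= (P j.+1).[x].
Proof.
move=> x0 ci; elim=> [|j ih] ji.
  by rewrite geg0 geg1 !hornerE; split=> //; lra.
have [p0 pj] := ih (ltnW ji); have p1 : 0 < (P j.+1).[x].
  by apply: lt_le_trans pj; apply: mulr_gt0 => //; lra.
split=> //; rewrite P_rec.
have h : 4 * c j.+1 <= x ^+ 2 by apply: le_trans ci; rewrite ler_pM2l//; exact: gegc_le.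
have h1 : c j.+1 * (P j).[x] <= x ^+ 2 / 4 * (P j).[x] by apply: ler_wpM2r; lra.
have h2 : x ^+ 2 / 4 * (P j).[x] <= x / 2 * (P j.+1).[x].
  have -> : x ^+ 2 / 4 * (P j).[x] = x / 2 * (x / 2 * (P j).[x]) by field.
  by apply: ler_wpM2l => //; lra.
lra.
Qed.

Lemma P1_rec i : (P i.+1).[1] = (i%:R + 2 * lam) / (2 * M i) * (P i).[1].
Proof.
have := geg_deriv2 i 1; have := lam_gt1; have := M_ge i => h1 h2.
rewrite expr1n subrr mul0r mulr1 => /esym/eqP; rewrite subr_eq0 => /eqP h.
by rewrite mulrAC h; field; lra.
Qed.

Lemma P1_gt0 i : 0 < (P i).[1].
Proof.
elim: i => [|i ih]; first by rewrite geg0 hornerE.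
have := lam_gt1; have := M_ge i => h1 h2; have i0 : (0 : R) <= i%:R by rewrite ler0n.
by rewrite P1_rec; apply: mulr_gt0 => //; apply: divr_gt0; lra.
Qed.

Lemma dP1 i : (2 * lam + 1) * (P i)^`().[1] = i%:R * (i%:R + 2 * lam) * (P i).[1].
Proof.
elim/two_step_ind: i => [||i ih1 ih2].
- by rewrite dP0 !hornerE; ring.
- by rewrite geg1 derivX !hornerE; ring.
have l1 := lam_gt1.
have l2 : 2 * lam + 1 != 0 by lra.
have e (a b : R) : (2 * lam + 1) * a = b -> a = b / (2 * lam + 1) by move=> <-; rewrite mulrAC mulfV// mul1r.
rewrite dP_rec (e _ _ ih1) (e _ _ ih2) !P1_rec gegcE.
move: l1; have := M_ge i; have i0 : (0 : R) <= i%:R by rewrite ler0n.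
have e1 : i.+1%:R = i%:R + 1 :> R by rewrite natr1.
have e2 : i.+2%:R = i%:R + 1 + 1 :> R by rewrite !natr1.
rewrite e2 e1; move: (P i).[1] i0 => p; move: (i%:R : R) (lam) => k l h1 h2 h3.
by field; lra.
Qed.

(* A positive value of P' - k P at some t in [s, 1) would, F below being increasing, exclude a
   zero of P' - k P in [t, 1), although P'(1) < k P(1). *)
Lemma geg_decay i s x k : 0 < s -> s <= x -> x <= 1 -> s < 1 -> 0 < k -> 4 * c i <= s ^+ 2 ->
  i%:R * (i%:R + 2 * lam) + k ^+ 2 * (1 - s ^+ 2) <= (2 * lam + 1) * s * k ->
  0 < (P i).[x] <= (P i).[s] * expR (k * (x - s)).
Proof.
move=> s0 sx x1 s1 k0 ci hk; have l1 := lam_gt1.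
set L := i%:R * (i%:R + 2 * lam) in hk *.
have Ppos t : s <= t -> 0 < (P i).[t].
  move=> st; have [] := @geg_pos i t _ _ i (leqnn i) => //; first by lra.
  by apply: le_trans ci _; rewrite lerXn2r ?nnegrE//; lra.
pose D := (P i)^`() - k *: P i.
have DE t : D.[t] = (P i)^`().[t] - k * (P i).[t] by rewrite !hornerE.
have kk : 0 < k ^+ 2 * (1 - s ^+ 2).
  by apply: mulr_gt0; [exact: exprn_gt0|have := sqr_lt1 (ltW s0) s1; lra].
have D1 : D.[1] < 0.
  have l2 : 0 < 2 * lam + 1 by lra.
  rewrite DE -(pmulr_rlt0 _ l2) mulrBr dP1 -/L mulrA -mulrBl.
  rewrite pmulr_llt0 ?P1_gt0// subr_lt0.
  have : (2 * lam + 1) * s * k <= (2 * lam + 1) * k.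
    by rewrite -mulrA; apply: ler_wpM2l; [lra|rewrite ler_piMl//; lra].
  lra.
pose F t := expR ((lam + 2^-1) * ln (1 - t ^+ 2)) * (expR (k * t) * D.[t]).
have dF t : t ^+ 2 < 1 -> der F t (expR ((lam + 2^-1) * ln (1 - t ^+ 2)) * expR (k * t) * (P i).[t] *
    (((2 * lam + 1) * t * k - k ^+ 2 * (1 - t ^+ 2) - L) / (1 - t ^+ 2))).
  move=> t1; have t0 : 1 - t ^+ 2 != 0 by lra.
  apply: der_eq.
    apply: derM; first exact: der_wgt.
    apply: derM; last exact: der_horner.
    by apply: der_exp; apply: derZ; exact: der_id.
  have -> : D^`().[t] = (P i)^`()^`().[t] - k * (P i)^`().[t] by rewrite derivB derivZ !hornerE.
  rewrite DE; have := geg_ode i t1; rewrite -/L.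
  move: (expR _) (expR _) (P i)^`()^`().[t] (P i)^`().[t] (P i).[t] => W E p2 p1 p e.
  have -> : p2 = ((2 * lam + 1) * t * p1 - L * p) / (1 - t ^+ 2) by rewrite -e mulrAC mulfV// mul1r.
  by move: (lam) (L) => l K; field.
have Dle t : s <= t -> t <= 1 -> D.[t] <= 0.
  move=> st t1; rewrite leNgt; apply/negP => Dt.
  have [r] : exists2 r, t <= r <= 1 & root D r.
    have [|r r1 rr] := @poly_ivt _ (- D) t 1 t1; last by exists r => //; rewrite rootN in rr.
    by rewrite !hornerN; apply/andP; split; lra.
  move=> /andP[tr r1] rr.
  have r1' : r < 1.
    rewrite lt_neqAle r1 andbT; apply/eqP => re; move: rr; rewrite re => /rootP h.
    by rewrite h ltxx in D1.
  have : F t <= F r.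
    apply: der_incr tr (fun z hz => dF z _) _ => [z /andP[tz zr]|z /andP[tz zr]].
      by apply: sqr_lt1; lra.
    have z1 : z ^+ 2 < 1 by apply: sqr_lt1; lra.
    apply: mulr_ge0.
      by apply: mulr_ge0; [apply: mulr_ge0; exact: expR_ge0|apply: ltW; apply: Ppos; lra].
    apply: divr_ge0; last by lra.
    have sz : s <= z by exact: le_trans tz.
    have hz : s ^+ 2 <= z ^+ 2 by apply: lerXn2r => //; rewrite nnegrE; [exact: ltW|apply: le_trans sz; exact: ltW].
    have h1 : k ^+ 2 * (1 - z ^+ 2) <= k ^+ 2 * (1 - s ^+ 2) by apply: ler_wpM2l; [exact: sqr_ge0|lra].
    have h2 : (2 * lam + 1) * s * k <= (2 * lam + 1) * z * k.
      apply: ler_wpM2r; first exact: ltW.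
      by apply: ler_wpM2l; [move: l1; clear; lra|exact: le_trans tz].
    by move: h1 h2 hk; clear; lra.
  move: rr => /rootP rr; rewrite /F rr !mulr0 leNgt => /negP; apply.
  by apply: mulr_gt0; [exact: expR_gt0|apply: mulr_gt0 => //; exact: expR_gt0].
apply/andP; split; first exact: Ppos.
have h : (P i).[x] * expR (- (k * x)) <= (P i).[s] * expR (- (k * s)).
  apply: (@der_decr _ (fun t => (P i).[t] * expR (- (k * t))) (fun t => (P i)^`().[t] * expR (- (k * t)) + (P i).[t] * (expR (- (k * t)) * - k)) _ _ sx _ _) => t /andP[st tx].
    apply: derM; first exact: der_horner.
    apply: der_exp; apply: derN; apply: der_eq; first by apply: derZ; exact: der_id.
    by rewrite mulr1.
  have -> (a b e : R) : a * e + b * (e * - k) = (a - k * b) * e by ring.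
  by rewrite pmulr_lle0 ?expR_gt0// -DE; apply: Dle => //; lra.
move: h; rewrite !expRN ler_pdivrMr ?expR_gt0// => h; apply: le_trans h _.
by rewrite mulrBr expRB mulrA mulrAC.
Qed.

End gegenbauer.

(** * The linear programming bound *)

Lemma cauchy_schwarz_sum (R : realType) (I : Type) (r : seq I) (f g : I -> R) :
  (\sum_(i <- r) f i * g i) ^+ 2 <= (\sum_(i <- r) f i ^+ 2) * (\sum_(i <- r) g i ^+ 2).
Proof.
elim: r => [|i r ih]; first by rewrite !big_nil expr0n mulr0.
rewrite !big_cons; set S := \sum_(j <- r) f j * g j in ih *.
set F := \sum_(j <- r) f j ^+ 2 in ih *; set G := \sum_(j <- r) g j ^+ 2 in ih *.
have F0 : 0 <= F by apply: sumr_ge0 => *; exact: sqr_ge0.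
have G0 : 0 <= G by apply: sumr_ge0 => *; exact: sqr_ge0.
move: (f i) (g i) S F G ih F0 G0 => a b S F G ih F0 G0.
have h : (2 * (a * b * S)) <= a ^+ 2 * G + b ^+ 2 * F.
  have y0 : 0 <= a ^+ 2 * G + b ^+ 2 * F by apply: addr_ge0; apply: mulr_ge0 => //; exact: sqr_ge0.
  apply: le_trans (ler_norm _) _; rewrite -(ler_pXn2r (n := 2))// ?nnegrE// real_normK ?num_real//.
  have h1 : (a * b) ^+ 2 * S ^+ 2 <= (a * b) ^+ 2 * (F * G) by apply: ler_wpM2l => //; exact: sqr_ge0.
  have h2 : 0 <= (a ^+ 2 * G - b ^+ 2 * F) ^+ 2 by exact: sqr_ge0.
  have -> : (2 * (a * b * S)) ^+ 2 = 4 * ((a * b) ^+ 2 * S ^+ 2) by ring.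
  have -> : (a ^+ 2 * G + b ^+ 2 * F) ^+ 2 = (a ^+ 2 * G - b ^+ 2 * F) ^+ 2 + 4 * ((a * b) ^+ 2 * (F * G)) by ring.
  lra.
have -> : (a * b + S) ^+ 2 = (a * b) ^+ 2 + 2 * (a * b * S) + S ^+ 2 by ring.
have -> : (a ^+ 2 + F) * (b ^+ 2 + G) = (a * b) ^+ 2 + (a ^+ 2 * G + b ^+ 2 * F) + F * G by ring.
lra.
Qed.

Section lp.
Context {R : realType}.
Variable N : nat.
Hypothesis N5 : (4 < N)%N.
Implicit Types (i j m k : nat) (p q : {poly R}).
Local Notation c := (gegc R N).
Local Notation P := (geg R N).
Local Notation nu := (@nu R N).

(** Stands for the sum of a polynomial over the inner products of all pairs of a code; positive
    definiteness enters as [LP]. *)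
Variable L : {poly R} -> R.
Hypothesis LD : forall p q, L (p + q) = L p + L q.
Hypothesis LZ : forall (a : R) p, L (a *: p) = a * L p.
Hypothesis LP : forall i, 0 <= L (P i).

(** A determinant of Turan type. Its recurrence [turanS] has nonnegative coefficients for m <= n
    because the [gegc] increase. *)
Definition turan m n : {poly R} :=
  if m is m'.+1 then P m * P n - P m' * P n.+1 else P n.

Lemma turanS_ring (A : comNzRingType) (X p0 p1 q0 q1 a b : A) :
  (X * p1 - a * p0) * q1 - p1 * (X * q1 - b * q0) = (b - a) * (p1 * q0) + a * (p1 * q0 - p0 * q1).
Proof. by ring. Qed.

Lemma turanS0_ring (A : comNzRingType) (X q0 q1 b : A) :
  X * q1 - 1 * (X * q1 - b * q0) = b * (1 * q0).
Proof. by ring. Qed.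

Lemma turanS m n : turan m.+1 n.+1 = (c n.+1 - c m) *: (P m * P n) + c m *: turan m n.
Proof.
rewrite /turan gegS; case: m => [|m].
  rewrite geg0 geg1 gegc0 subr0 scale0r addr0 -!mul_polyC.
  exact: turanS0_ring.
rewrite [in LHS]gegS -!mul_polyC polyCB; exact: turanS_ring.
Qed.

(* Askey's induction for the nonnegativity of the linearization coefficients of P_m P_n, carried
   out under a functional that is nonnegative on the basis. *)
Lemma L_prod m n : (m <= n)%N ->
  (m == n)%:R * nu m * L 1 <= L (P m * P n) /\ (m == n)%:R * nu m * L 1 <= L (turan m n).
Proof.
elim: m n => [|m ih] n mn.
  rewrite /turan geg0 mul1r /= mulr1; case: n mn => [|n] _.
    by rewrite geg0 eqxx mul1r.
  by rewrite /= !mul0r.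
case: n mn => [//|n]; rewrite ltnS => mn; have [h1 h2] := ih n mn.
have ht : (m.+1 == n.+1)%:R * nu m.+1 * L 1 <= L (turan m.+1 n.+1).
  rewrite turanS LD !LZ eqSS.
  have c1 : 0 <= c n.+1 - c m by rewrite subr_ge0; apply: gegc_le => //; exact: leqW.
  have := ler_wpM2l c1 h1; have := ler_wpM2l (gegc_ge0 N5 m) h2.
  case: eqP => [->|_]; rewrite ?mul1r ?mul0r ?mulr0 /=; last by lra.
  have -> : c n.+1 * nu n * L 1 = (c n.+1 - c n) * (nu n * L 1) + c n * (nu n * L 1) by ring.
  lra.
split=> //; have [h3 _] := ih n.+2 (leqW (leqW mn)).
have -> : P m.+1 * P n.+1 = turan m.+1 n.+1 + P m * P n.+2 by rewrite /turan subrK.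
rewrite LD; move: h3; rewrite (_ : (m == n.+2) = false) ?mul0r; first by lra.
by apply/negbTE; rewrite neq_ltn ltnS (leqW mn).
Qed.

Definition gegn i : {poly R} := (Num.sqrt (nu i))^-1 *: P i.
Local Notation Q := gegn.

Lemma sqrt_nu_gt0 i : 0 < Num.sqrt (nu i).
Proof. by rewrite sqrtr_gt0 nu_gt0. Qed.

Lemma L_prodn i j : (i == j)%:R * L 1 <= L (Q i * Q j).
Proof.
wlog ij : i j / (i <= j)%N.
  by move=> h; case: (leqP i j) => [|/ltnW] /h//; rewrite eq_sym [Q j * _]mulrC.
have [h _] := L_prod ij; have n0 := sqrt_nu_gt0 i; have n0' := sqrt_nu_gt0 j.
rewrite /gegn -scalerAl -scalerAr scalerA LZ.
have r0 : 0 <= (Num.sqrt (nu i))^-1 / Num.sqrt (nu j) by apply: divr_ge0; rewrite ?invr_ge0; exact: ltW.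
apply: le_trans (ler_wpM2l r0 h); case: eqP => [e|_]; rewrite ?mul0r ?mulr0// !mul1r.
rewrite -e -invfM -expr2 sqr_sqrtr; last exact: ltW (nu_gt0 N5 i).
by rewrite mulKf// gt_eqF// nu_gt0.
Qed.

Lemma L1_ge0 : 0 <= L 1.
Proof. by have := LP 0; rewrite geg0. Qed.

Lemma L_prodn_ge0 i j : 0 <= L (Q i * Q j).
Proof. by apply: le_trans (L_prodn i j); apply: mulr_ge0; [exact: ler0n|exact: L1_ge0]. Qed.

Lemma mulX_gegn i : 'X * Q i.+1 = Num.sqrt (c i.+2) *: Q i.+2 + Num.sqrt (c i.+1) *: Q i.
Proof.
have s0 := sqrt_nu_gt0 i; have s1 := sqrt_nu_gt0 i.+1.
have c1 : 0 < Num.sqrt (c i.+1) by rewrite sqrtr_gt0 gegc_gt0.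
have c2 : 0 < Num.sqrt (c i.+2) by rewrite sqrtr_gt0 gegc_gt0.
have e1 : Num.sqrt (nu i.+1) = Num.sqrt (c i.+1) * Num.sqrt (nu i) by rewrite /= sqrtrM// gegc_ge0.
have e2 : Num.sqrt (nu i.+2) = Num.sqrt (c i.+2) * Num.sqrt (nu i.+1) by rewrite /= [in LHS]sqrtrM// gegc_ge0.
rewrite /gegn (gegS R N i) !scalerA e2 invfM mulVKf ?gt_eqF// -scalerAr scalerBr scalerA.
suff -> : (Num.sqrt (nu i.+1))^-1 * c i.+1 = Num.sqrt (c i.+1) / Num.sqrt (nu i) by rewrite subrK.
rewrite e1 -{2}[c i.+1]sqr_sqrtr ?gegc_ge0//; field.
by rewrite !gt_eqF.
Qed.

Lemma LB p q : L (p - q) = L p - L q.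
Proof. by rewrite LD -scaleN1r LZ mulN1r. Qed.
Lemma LZl (a : R) p q : L ((a *: p) * q) = a * L (p * q).
Proof. by rewrite -scalerAl LZ. Qed.
Lemma LZr (a : R) p q : L (p * (a *: q)) = a * L (p * q).
Proof. by rewrite -scalerAr LZ. Qed.
Lemma L0 : L 0 = 0.
Proof. by rewrite -(scale0r 0) LZ mul0r. Qed.
Lemma L_sum n (F : 'I_n -> {poly R}) : L (\sum_(i < n) F i) = \sum_(i < n) L (F i).
Proof. by apply: (big_morph L) => [p q|]; [exact: LD|exact: L0]. Qed.

Variables (i0 K : nat).
Hypothesis K0 : (0 < K)%N.
(* The second differences of [wt] are -2 and [wt] >= K on 1..K, so that ('X - lp_s) lp_h has
   nonnegative coefficients. *)
Definition wt j : R := j%:R * (K%:R + 1 - j%:R).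

Lemma wt_sum_parts (G : nat -> R) n :
  \sum_(j < n) wt j.+1 * (G j.+2 + G j - 2 * G j.+1) =
  wt 1 * G 0 + wt n * G n.+1 - wt n.+1 * G n - 2 * \sum_(j < n) G j.+1.
Proof.
elim: n => [|n ih]; first by rewrite !big_ord0 /wt; ring.
rewrite !big_ord_recr /= ih /wt -!natr1; ring.
Qed.

Lemma wt_ge j : (j < K)%N -> K%:R <= wt j.+1.
Proof.
move=> jK; rewrite /wt -natr1 -subr_ge0.
have -> : (j%:R + 1) * (K%:R + 1 - (j%:R + 1)) - K%:R = j%:R * (K%:R - (j%:R + 1)) :> R by ring.
by apply: mulr_ge0; rewrite ?ler0n// subr_ge0 natr1 ler_nat.
Qed.

Lemma wt_ge0 j : (j < K)%N -> 0 <= wt j.+1.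
Proof. by move=> /wt_ge; apply: le_trans; rewrite ler0n. Qed.

Lemma wt_diff_ge (G : nat -> R) : (forall j, 0 <= G j) ->
  0 <= \sum_(j < K) wt j.+1 * (G j.+2 + G j - 2 * (1 - K%:R^-1) * G j.+1).
Proof.
move=> G0; have k0 : (0 : R) < K%:R by rewrite ltr0n.
have -> : \sum_(j < K) wt j.+1 * (G j.+2 + G j - 2 * (1 - K%:R^-1) * G j.+1) =
   \sum_(j < K) wt j.+1 * (G j.+2 + G j - 2 * G j.+1) + 2 * \sum_(j < K) (wt j.+1 / K%:R * G j.+1).
  by rewrite mulr_sumr -big_split; apply: eq_bigr => j _ /=; ring.
rewrite wt_sum_parts.
have w1 : 0 <= wt 1 * G 0 by apply: mulr_ge0 => //; exact: wt_ge0.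
have w2 : 0 <= wt K * G K.+1.
  by apply: mulr_ge0 => //; have := @wt_ge0 K.-1; rewrite prednK//; apply.
have w3 : wt K.+1 = 0 by rewrite /wt -natr1 subrr mulr0.
have : \sum_(j < K) G j.+1 <= \sum_(j < K) (wt j.+1 / K%:R * G j.+1).
  apply: ler_sum => j _; rewrite ler_peMl// ler_pdivlMr// mul1r; exact: wt_ge.
rewrite w3 mul0r; lra.
Qed.

Lemma alg_distr (a b l : R) (u v w z : {poly R}) :
  (a *: u + b *: v - l *: w) * z = a *: (u * z) + b *: (v * z) - l *: (w * z).
Proof. by rewrite mulrBl mulrDl -!scalerAl. Qed.

Definition lp_h : {poly R} := \sum_(j < K) wt j.+1 *: Q (i0 + j.+1).
(** Multiplication by X is a Jacobi matrix in the basis [gegn]; twice its off-diagonal entry is the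
    edge of its spectrum, and 1 / K is the loss for a window of K degrees. *)
Definition lp_s : R := 2 * Num.sqrt (c i0.+1) * (1 - K%:R^-1).

(** The Jacobi entries in the window are at least [be]; replacing them by [be] leaves the second
    differences of [wt] up to the correction 1 / K. *)
Lemma L_shift_h k : 0 <= L (('X - lp_s%:P) * lp_h * Q k).
Proof.
pose G j := L (Q (i0 + j) * Q k).
have G0 j : 0 <= G j by exact: L_prodn_ge0.
set be := Num.sqrt (c i0.+1).
have b0 : 0 <= be by exact: sqrtr_ge0.
have bj j : be <= Num.sqrt (c (i0 + j.+1)).
  by apply: ler_wsqrtr; apply: gegc_le => //; rewrite addnS ltnS leq_addr.
have -> : ('X - lp_s%:P) * lp_h * Q k = \sum_(j < K) wt j.+1 *:
   (Num.sqrt (c (i0 + j.+2)) *: (Q (i0 + j.+2) * Q k) + Num.sqrt (c (i0 + j.+1)) *: (Q (i0 + j) * Q k) - lp_s *: (Q (i0 + j.+1) * Q k)).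
  rewrite /lp_h mulr_sumr mulr_suml; apply: eq_bigr => j _.
  rewrite -[_ * (wt _ *: _)]scalerAr -[(wt _ *: _) * _]scalerAl; congr (_ *: _).
  by rewrite mulrBl addnS mulX_gegn mul_polyC !addnS; exact: alg_distr.
rewrite L_sum.
apply: le_trans (_ : be * \sum_(j < K) wt j.+1 * (G j.+2 + G j - 2 * (1 - K%:R^-1) * G j.+1) <= _).
  by apply: mulr_ge0 => //; exact: wt_diff_ge.
rewrite mulr_sumr; apply: ler_sum => j _; rewrite LZ LB LD !LZ mulrCA; apply: ler_wpM2l; first exact: wt_ge0.
have h1 := ler_wpM2r (G0 j.+2) (bj j.+1); have h2 := ler_wpM2r (G0 j) (bj j).
rewrite /lp_s -/be -!/(G _).
have -> : be * (G j.+2 + G j - 2 * (1 - K%:R^-1) * G j.+1) = be * G j.+2 + be * G j - 2 * be * (1 - K%:R^-1) * G j.+1 by ring.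
by apply: lerB => //; apply: lerD.
Qed.

Lemma L_shift_hh : 0 <= L (('X - lp_s%:P) * lp_h * lp_h).
Proof.
rewrite {2}/lp_h mulr_sumr L_sum; apply: sumr_ge0 => j _.
by rewrite LZr; apply: mulr_ge0; [exact: wt_ge0|exact: L_shift_h].
Qed.

Lemma L_hh : (\sum_(j < K) wt j.+1 ^+ 2) * L 1 <= L (lp_h * lp_h).
Proof.
rewrite {1}/lp_h [X in _ <= L X]mulr_suml L_sum mulr_suml; apply: ler_sum => j _.
rewrite LZl /lp_h mulr_sumr L_sum expr2 -mulrA; apply: ler_wpM2l; first exact: wt_ge0.
rewrite (bigD1 j)//= LZr.
have h : wt j.+1 * L 1 <= wt j.+1 * L (Q (i0 + j.+1) * Q (i0 + j.+1)).
  by apply: ler_wpM2l; [exact: wt_ge0|have := L_prodn (i0 + j.+1) (i0 + j.+1); rewrite eqxx mul1r].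
apply: le_trans h _; rewrite lerDl; apply: sumr_ge0 => k _.
by rewrite LZr; apply: mulr_ge0; [exact: wt_ge0|exact: L_prodn_ge0].
Qed.

(** The margin [lp_s] - s' multiplies the square of [lp_h], whose degree-zero part is at least the
    squared length of [wt]; the rest is nonnegative by [L_shift_hh]. *)
Lemma L_lower (s' : R) : s' <= lp_s ->
  (lp_s - s') * (\sum_(j < K) wt j.+1 ^+ 2) * L 1 <= L (('X - s'%:P) * (lp_h * lp_h)).
Proof.
move=> ss.
have -> : ('X - s'%:P) * (lp_h * lp_h) = ('X - lp_s%:P) * lp_h * lp_h + (lp_s - s') *: (lp_h * lp_h).
  by rewrite -mul_polyC polyCB -mulrA -mulrDl addrA subrK.
rewrite LD LZ -mulrA; have h0 : 0 <= lp_s - s' by lra.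
have := ler_wpM2l h0 L_hh; have := L_shift_hh; lra.
Qed.

Lemma lp_h_sqr (t : R) : lp_h.[t] ^+ 2 <= (\sum_(j < K) wt j.+1 ^+ 2) * \sum_(j < K) (P (i0 + j.+1)).[t] ^+ 2 / nu (i0 + j.+1).
Proof.
have -> : lp_h.[t] = \sum_(j < K) wt j.+1 * (Q (i0 + j.+1)).[t].
  by rewrite /lp_h horner_sum; apply: eq_bigr => j _; rewrite hornerZ.
apply: le_trans (cauchy_schwarz_sum _ _ _) _; rewrite le_eqVlt; apply/orP; left; apply/eqP; congr (_ * _).
apply: eq_bigr => j _; rewrite /gegn hornerZ exprMn exprVn sqr_sqrtr 1?mulrC//.
exact: ltW (nu_gt0 N5 _).
Qed.

End lp.

Section lp_code.
Context {R : realType}.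
Variable N : nat.
Hypothesis N5 : (4 < N)%N.
Variables (T : finType) (x : T -> 'rV[R]_N) (A : {set T}).
Hypothesis x1 : forall c, ip (x c) (x c) = 1.
Hypothesis ip_le1 : forall c c', ip (x c) (x c') <= 1.
Variables (i0 K : nat) (s' D B k : R).
Hypothesis K0 : (0 < K)%N.
Hypothesis s1 : 0 <= s' < 1.
Hypothesis ss : s' < lp_s N i0 K.
Hypothesis B0 : 0 <= B.
Hypothesis hD : forall j, (i0 < j <= i0 + K)%N -> (geg R N j).[1] ^+ 2 <= D * nu N j.
Hypothesis hB : forall j t, (i0 < j <= i0 + K)%N -> s' <= t -> t <= 1 ->
  (geg R N j).[t] ^+ 2 <= B * expR (k * (t - 1)) * nu N j.

(** The functional is estimated in two ways at (X - s') h^2: from below by [L_lower], from above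
    pointwise, where the pairs with inner product below s' contribute nothing positive. *)
Lemma lp_code_bound : (lp_s N i0 K - s') * #|A|%:R ^+ 2 <= K%:R *
  (#|A|%:R * D + B * \sum_(c in A) \sum_(c' in A | c' != c) expR (- (k * (1 - ip (x c) (x c'))))).
Proof.
pose L (p : {poly R}) := \sum_(c in A) \sum_(c' in A) p.[ip (x c) (x c')].
have LD p q : L (p + q) = L p + L q.
  by rewrite /L -big_split; apply: eq_bigr => c _; rewrite -big_split; apply: eq_bigr => c' _; rewrite hornerD.
have LZ (a : R) p : L (a *: p) = a * L p.
  by rewrite /L mulr_sumr; apply: eq_bigr => c _; rewrite mulr_sumr; apply: eq_bigr => c' _; rewrite hornerZ.
have LP i : 0 <= L (geg R N i) by apply: geg_posdef => //; apply: leq_trans N5.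
have L1 : L 1 = #|A|%:R ^+ 2.
  rewrite /L -polyC1; under eq_bigr do under eq_bigr do rewrite hornerC.
  by rewrite !sumr_const expr2 mulr_natr.
have := L_lower N5 LD LZ LP K0 (ltW ss); rewrite L1.
set W := \sum_(j < K) _; set h := lp_h N i0 K.
have W0 : 0 < W.
  rewrite /W; case: (K) K0 => [//|K' _]; rewrite big_ord_recl /=; apply: ltr_pwDl.
    apply: exprn_gt0; rewrite /wt -natr1; have : (0 : R) <= K'%:R by rewrite ler0n.
    by move=> ?; apply: mulr_gt0; lra.
  by apply: sumr_ge0 => j _; exact: sqr_ge0.
have nj j : 0 < nu N j :> R by exact: nu_gt0.
have jK (j : 'I_K) : (i0 < i0 + j.+1 <= i0 + K)%N by rewrite addnS ltnS leq_addr /= -addnS leq_add2l.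
have up (t e : R) : t <= 1 -> (s' <= t -> forall j, (i0 < j <= i0 + K)%N -> (geg R N j).[t] ^+ 2 <= e * nu N j) -> 0 <= e ->
    (('X - s'%:P) * (h * h)).[t] <= W * (K%:R * e).
  move=> t1 ht e0; rewrite !hornerM hornerXsubC -expr2.
  have We : 0 <= W * (K%:R * e) by rewrite !mulr_ge0 ?ler0n// ltW.
  case: (lerP s' t) => st; last first.
    apply: le_trans We; apply: mulr_le0_ge0; [lra|exact: sqr_ge0].
  apply: le_trans (_ : h.[t] ^+ 2 <= _).
    by rewrite ler_piMl ?sqr_ge0//; move: s1 => /andP[? ?]; lra.
  apply: le_trans (lp_h_sqr N5 _ _ _) _; apply: ler_wpM2l; first exact: ltW.
  rewrite mulr_natl -[X in _ *+ X](card_ord K) -sumr_const; apply: ler_sum => j _.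
  by rewrite ler_pdivrMr//; apply: ht.
move=> low; rewrite -(ler_pM2l W0).
apply: le_trans (_ : L (('X - s'%:P) * (h * h)) <= _); first by apply: le_trans low; rewrite mulrA (mulrC W).
have D0 : 0 <= D.
  have hj : (i0 < i0.+1 <= i0 + K)%N by rewrite leqnn /= -addn1 leq_add2l.
  by rewrite -(pmulr_lge0 _ (nj i0.+1)); apply: le_trans (hD hj); exact: sqr_ge0.
rewrite /L [X in _ <= W * (K%:R * (X + _))](_ : _ = \sum_(c in A) D); last first.
  by rewrite sumr_const mulr_natl.
rewrite [B * _]mulr_sumr -big_split /= [K%:R * _]mulr_sumr [W * _]mulr_sumr; apply: ler_sum => c cA.
rewrite (bigD1 c)//= x1 !mulrDr; apply: lerD.
  by apply: up => // _ j hj; exact: hD.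
rewrite [B * _]mulr_sumr [K%:R * _]mulr_sumr [W * _]mulr_sumr; apply: ler_sum => c' _.
apply: up => //; last by apply: mulr_ge0 => //; exact: expR_ge0.
by move=> st j hj; rewrite -mulrN opprB; apply: hB.
Qed.

End lp_code.

(** * Exponents of the linear programming bound *)

Section lp_exponent.
Context {R : realType}.

Lemma bin_prob_le1 (p : R) m i : 0 <= p <= 1 -> (i <= m)%N ->
  'C(m, i)%:R * (1 - p) ^+ (m - i) * p ^+ i <= 1.
Proof.
move=> /andP[p0 p1] im; have := exprDn (1 - p) p m; rewrite subrK expr1n => e; rewrite [leRHS]e.
have im' : (i < m.+1)%N by rewrite ltnS.
rewrite (bigD1 (Ordinal im'))//= -mulrA mulr_natl lerDl; apply: sumr_ge0 => j _.
by apply: mulrn_wge0; apply: mulr_ge0; apply: exprn_ge0; lra.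
Qed.

Lemma bin_expR_le (p : R) m i : 0 < p < 1 ->
  'C(m + i, i)%:R <= expR (- (i%:R * ln p) - m%:R * ln (1 - p)).
Proof.
move=> /andP[p0 p1]; have h := @bin_prob_le1 p (m + i) i; rewrite addnK in h.
have q0 : 0 < 1 - p by lra.
rewrite -opprD expRN -div1r ler_pdivlMr ?expR_gt0// expRD !expRM_natl !lnK ?posrE//.
rewrite [p ^+ i * _]mulrC mulrA; apply: h; last exact: leq_addl.
by apply/andP; split; lra.
Qed.

(** The ratio of P_i(1)^2 to [nu n i] is the dimension of the space of spherical harmonics of degree
    i. *)
Lemma geg1_sqr n i : (4 < n)%N ->
  (geg R n i).[1] ^+ 2 * (n%:R / 2 - 1) = (i%:R + (n%:R / 2 - 1)) * 'C(n - 3 + i, i)%:R * nu n i.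
Proof.
move=> n5; have l1 := @lam_gt1 R n n5.
elim: i => [|i ih]; first by rewrite geg0 addn0 bin0 hornerE expr1n /=; ring.
have i0 : (0 : R) <= i%:R by rewrite ler0n.
have e : (n - 3 + i).+1%:R = i%:R + n%:R - 2 :> R.
  by rewrite -natr1 natrD natrB ?(ltnW (ltnW n5))//; ring.
have hb : 'C(n - 3 + i.+1, i.+1)%:R = (i%:R + n%:R - 2) * 'C(n - 3 + i, i)%:R / (i%:R + 1) :> R.
  have := mul_bin_diag (n - 3 + i).+1 i; rewrite /= -addnS => h.
  have := congr1 (fun k => k%:R : R) h; rewrite /= !natrM addnS e => ->.
  by rewrite -natr1 mulrAC mulfV ?mul1r//; lra.
rewrite P1_rec// exprMn -[_ * _ * (n%:R / 2 - 1)]mulrA ih hb /= gegcE// -(natr1 i).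
move: l1 ('C(_, _)%:R) (nu n i) i0 => l1 C v i0.
move: (i%:R) (n%:R) l1 i0 => k N l1 i0.
by field; lra.
Qed.

Lemma geg1_le n i (p : R) : (4 < n)%N -> 0 < p < 1 -> 
  (geg R n i).[1] ^+ 2 <= (1 + 4 * (i%:R / n%:R)) * expR (- (i%:R * ln p) - n%:R * ln (1 - p)) * nu n i.
Proof.
move=> n5 p01; have l1 := @lam_gt1 R n n5; have l0 : 0 < n%:R / 2 - 1 :> R by lra.
have n5' : (5 : R) <= n%:R by rewrite (ler_nat R 5).
rewrite -(ler_pM2r l0) geg1_sqr// [leRHS]mulrAC; apply: ler_wpM2r; first exact: ltW (nu_gt0 _ _).
rewrite mulrAC; apply: ler_pM; rewrite ?ler0n//.
- by have : (0 : R) <= i%:R; [rewrite ler0n|lra].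
- rewrite mulrDl mul1r addrC lerD2l.
  have -> : 4 * (i%:R / n%:R) * (n%:R / 2 - 1) = i%:R * (2 - 4 / n%:R) :> R by field; lra.
  have i0 : (0 : R) <= i%:R by rewrite ler0n.
  rewrite ler_peMr// lerBrDr -lerBrDl ler_pdivrMr; lra.
apply: le_trans (bin_expR_le _ _ p01) _; rewrite ler_expR lerD2l lerN2.
move: p01 => /andP[p0 p1]; apply: ler_wnM2r; first by rewrite ln_le0//; lra.
by rewrite ler_nat leq_subr.
Qed.

Lemma gegc_hi n i (r s : R) : (4 < n)%N -> 0 < r -> s ^+ 2 = 1 - (2 * r + 1)^-1 ^+ 2 ->
  i%:R <= r * (n%:R - 4) -> 4 * gegc R n i <= s ^+ 2.
Proof.
move=> n5 r0 -> ir; rewrite gegcE//; have l1 := @lam_gt1 R n n5; have ml := @M_ge R n i.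
have : (2 * r + 1)^-1 ^+ 2 <= (n%:R / 2 - 1) * (n%:R / 2 - 1 - 1) / ((i%:R + (n%:R / 2 - 1)) * (i%:R + (n%:R / 2 - 1) - 1)).
  apply: frac_hi => //; first by rewrite invr_ge0; lra.
  rewrite mulrC ler_pdivrMr; lra.
lra.
Qed.

Lemma gegc_lo n i (r s : R) : (4 < n)%N -> 0 < r -> s ^+ 2 = 1 - (2 * r + 1)^-1 ^+ 2 ->
  r * n%:R <= i%:R -> s ^+ 2 <= 4 * gegc R n i.
Proof.
move=> n5 r0 -> ir; rewrite gegcE//; have l1 := @lam_gt1 R n n5; have ml := @M_ge R n i.
have : (n%:R / 2 - 1) * (n%:R / 2 - 1 - 1) / ((i%:R + (n%:R / 2 - 1)) * (i%:R + (n%:R / 2 - 1) - 1)) <= (2 * r + 1)^-1 ^+ 2.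
  apply: frac_lo => //; first by rewrite invr_ge0; lra.
  rewrite ler_pdivlMl; lra.
lra.
Qed.

(** The condition of [geg_decay] for k = n b / 2, which lets the square grow at the rate n b of
    e^{-n b p}. At i = r n the terms of order n^2 balance by the saddle equation, so lower-order
    terms decide. *)
Lemma decay_cond (r s b i n : R) : 0 < r -> 0 <= i -> 4 < n -> b * s = 4 * (r ^+ 2 + r) -> s = b * (1 - s ^+ 2) ->
  i <= r * (n - 4) ->
  i * (i + 2 * (n / 2 - 1)) + (n * b / 2) ^+ 2 * (1 - s ^+ 2) <= (2 * (n / 2 - 1) + 1) * s * (n * b / 2).
Proof.
move=> r0 i0 n4 bs sb ir.
have -> : (n * b / 2) ^+ 2 * (1 - s ^+ 2) = n ^+ 2 / 4 * (b * (b * (1 - s ^+ 2))) by field.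
rewrite -sb bs.
have -> : (2 * (n / 2 - 1) + 1) * s * (n * b / 2) = (n - 1) * n / 2 * (b * s) by field.
rewrite bs.
have h : i * (i + 2 * (n / 2 - 1)) <= (r * (n - 2)) * (r * n + n).
  by apply: ler_pM => //; nra.
nra.
Qed.

(** The bound at y, in the oscillatory region, is carried across the turning point to s by
    [wp2_growth] and from s to 1 by [geg_decay]; dividing by the weight at s produces the term in ln
    (1 - s^2). *)
Lemma geg_sqr_le n i (r r' s b y d x : R) : (4 < n)%N -> 0 < r' -> 0 < r -> 0 < s -> s < 1 -> 0 < b ->
  s = b * (1 - s ^+ 2) -> 1 - s ^+ 2 = (2 * r + 1)^-1 ^+ 2 ->
  r' * n%:R <= i.+1%:R -> i.+1%:R <= r * (n%:R - 4) ->
  0 < y -> y < s -> 0 < d -> (2 * r' + 1)^-1 ^+ 2 + d <= 1 - y ^+ 2 -> y <= x -> x <= 1 ->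
  (geg R n i.+1).[x] ^+ 2 <= (3 / d + 3) * 
   expR (n%:R * ((s - y) * (b + (2 * r + 1) / (1 - s ^+ 2)) - ln (1 - s ^+ 2) / 2 + b * (1 - s))) * expR (n%:R * b * (x - 1)) * nu n i.+1.
Proof.
move=> n5 r'0 r0 s0 s1 b0 sb sr ir' ir y0 ys d0 yd yx x1.
have l1 := @lam_gt1 R n n5; have n4 : (4 : R) < n%:R by rewrite (ltr_nat R 4).
have s21 : s ^+ 2 < 1 by rewrite expr_lt1//; lra.
have v0 := ltW (@nu_gt0 R n n5 i.+1).
have K0 : 0 < 3 / d + 3 by apply: addr_gt0 => //; apply: divr_gt0.
pose z := Num.min x s.
have zs : z <= s by rewrite /z ge_min lexx orbT.
have yz : y <= z by rewrite /z le_min yx ltW.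
have hz : (geg R n i.+1).[z] ^+ 2 <= (3 / d + 3) * expR (n%:R * ((s - y) * ((2 * r + 1) / (1 - s ^+ 2)) - ln (1 - s ^+ 2) / 2)) * nu n i.+1.
  have w1 : wp2 n i.+1 y <= 3 / d * nu n i.+1.
    apply: (wp2_start n5 (ltW y0) _ d0 _ _ yd); first exact: lt_trans s1.
      by rewrite invr_ge0; move: r'0; clear; lra.
    by rewrite ler_pdivlMl; move: r'0 ir' l1; clear; lra.
  have w2 := wp2_growth n5 i (ltW y0) yz zs s1.
  have w3 : wp2 n i.+1 z <= (3 / d + 3) * nu n i.+1 * expR (n%:R * ((s - y) * ((2 * r + 1) / (1 - s ^+ 2)))).
    apply: le_trans w2 _; apply: ler_pM; rewrite ?expR_ge0//.
    - by apply: addr_ge0; [exact: wp2_ge0|exact: mulr_ge0].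
    - by rewrite [leRHS]mulrDl lerD2r.
    rewrite ler_expR.
    have hM : i.+1%:R + (n%:R / 2 - 1) <= n%:R * (2 * r + 1) / 2 :> R by move: ir r0; clear; lra.
    have q0 : 0 < (1 - s ^+ 2)^-1 by rewrite invr_gt0 subr_gt0.
    have -> : n%:R * ((s - y) * ((2 * r + 1) / (1 - s ^+ 2))) = 2 / (1 - s ^+ 2) * (n%:R * (2 * r + 1) / 2) * (s - y).
      by field; move: s21; clear; lra.
    have q20 : 0 <= 2 / (1 - s ^+ 2) by apply: mulr_ge0 => //; exact: ltW.
    apply: ler_pM; [|by rewrite subr_ge0| |by rewrite lerD2r].
      by apply: mulr_ge0 => //; have := @M_ge R n i.+1; move: l1; clear; lra.
    exact: ler_wpM2l.
  have w4 : expR (n%:R * (ln (1 - s ^+ 2) / 2)) <= wgt n z.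
    rewrite /wgt ler_expR.
    have z0 : 0 <= z by apply: le_trans yz; exact: ltW.
    have zz : z ^+ 2 <= s ^+ 2 by apply: lerXn2r => //; rewrite nnegrE ltW.
    have h1 : ln (1 - s ^+ 2) <= ln (1 - z ^+ 2) by rewrite ler_ln ?posrE; move: zz s21; clear; lra.
    have h2 : ln (1 - s ^+ 2) <= 0 by apply: ln_le0; have := sqr_ge0 s; clear; lra.
    by move: h1 h2 l1; clear; nra.
  have w5 : wgt n z * (geg R n i.+1).[z] ^+ 2 <= (3 / d + 3) * nu n i.+1 * expR (n%:R * ((s - y) * ((2 * r + 1) / (1 - s ^+ 2)))) by exact: w3.
  have w6 := le_trans (ler_wpM2r (sqr_ge0 _) w4) w5.
  rewrite mulrBr expRB -(ler_pM2l (expR_gt0 (n%:R * (ln (1 - s ^+ 2) / 2)))).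
  apply: le_trans w6 _; rewrite le_eqVlt; apply/orP; left; apply/eqP.
  have E0 := expR_gt0 (n%:R * (ln (1 - s ^+ 2) / 2)).
  move: (expR _) (expR _) (nu _ _) E0 d0; clear => u v w u0 d0.
  by field; lra.
have e0 : n%:R * ((s - y) * (b + (2 * r + 1) / (1 - s ^+ 2)) - ln (1 - s ^+ 2) / 2 + b * (1 - s)) + n%:R * b * (x - 1) =
  n%:R * ((s - y) * ((2 * r + 1) / (1 - s ^+ 2)) - ln (1 - s ^+ 2) / 2) + n%:R * b * (x - y) by ring.
rewrite [leRHS](_ : _ = (3 / d + 3) * expR (n%:R * ((s - y) * ((2 * r + 1) / (1 - s ^+ 2)) - ln (1 - s ^+ 2) / 2)) * nu n i.+1 * expR (n%:R * b * (x - y))); last first.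
  rewrite -[(3 / d + 3) * _ * _]mulrA -expRD e0 expRD.
  by move: (expR _) (expR _) (3 / d + 3) => u v w; ring.
case: (lerP x s) => xs.
  have zx : z = x by rewrite /z; apply/min_idPl.
  rewrite zx in hz; apply: le_trans hz _; rewrite ler_peMr//.
    by apply: mulr_ge0 => //; apply: mulr_ge0; [exact: ltW|exact: expR_ge0].
  by rewrite -[leLHS]expR0 ler_expR; apply: mulr_ge0; [apply: mulr_ge0; [exact: ler0n|exact: ltW]|rewrite subr_ge0].
have zx : z = s by rewrite /z; apply/min_idPr; exact: ltW.
rewrite zx in hz.
have cs : 4 * gegc R n i.+1 <= s ^+ 2 by apply: gegc_hi ir => //; rewrite -sr opprB addrC subrK.
have bs : b * s = 4 * (r ^+ 2 + r).
  have e1 : (2 * r + 1) ^+ 2 * (1 - s ^+ 2) = 1.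
    by rewrite sr exprVn mulfV// expf_neq0//; move: r0; clear; lra.
  have e2 : b = (2 * r + 1) ^+ 2 * s by rewrite sb mulrCA e1 mulr1.
  have e3 : b * s = (2 * r + 1) ^+ 2 - (2 * r + 1) ^+ 2 * (1 - s ^+ 2) by rewrite e2; ring.
  by rewrite e3 e1; ring.
have k0 : 0 < n%:R * b / 2 by apply: divr_gt0 => //; apply: mulr_gt0 => //; exact: lt_trans n4.
have cond := decay_cond r0 (ler0n R i.+1) n4 bs sb ir.
have /andP[p0 p1] := geg_decay n5 s0 (ltW xs) x1 s1 k0 cs cond.
have h2 : (geg R n i.+1).[x] ^+ 2 <= ((geg R n i.+1).[s] * expR (n%:R * b / 2 * (x - s))) ^+ 2.
  by rewrite lerXn2r ?nnegrE//; [exact: ltW|apply: le_trans p1; exact: ltW].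
apply: le_trans h2 _; rewrite exprMn; apply: ler_pM => //; rewrite ?sqr_ge0//.
rewrite -expRM_natl ler_expR.
have -> : 2 * (n%:R * b / 2 * (x - s)) = n%:R * b * (x - s) by field.
by apply: ler_wpM2l; [apply: mulr_ge0; [exact: ler0n|exact: ltW]|rewrite lerD2l lerN2 ltW].
Qed.


Lemma lp_final_arith (a D B S g K E : R) : 0 <= a -> 0 < K -> 0 < B -> 0 <= E ->
  g * a ^+ 2 <= K * (a * D + B * S) -> K * D <= g / 2 * a -> E * (K * B) <= g / 2 -> a ^+ 2 * E <= S.
Proof.
move=> a0 K0 B0 E0 h hD hE.
have KB : 0 < K * B by apply: mulr_gt0.
have h1 : g / 2 * a ^+ 2 <= K * B * S.
  have : a * (K * D) <= a * (g / 2 * a) by apply: ler_wpM2l.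
  have -> : a * (g / 2 * a) = g / 2 * a ^+ 2 by ring.
  have -> : a * (K * D) = K * (a * D) by ring.
  have e : g * a ^+ 2 = g / 2 * a ^+ 2 + g / 2 * a ^+ 2 by field.
  move: h; rewrite e mulrDr mulrA; lra.
rewrite -(ler_pM2l KB); apply: le_trans h1.
have -> : K * B * (a ^+ 2 * E) = a ^+ 2 * (E * (K * B)) by ring.
by rewrite [leRHS]mulrC; apply: ler_wpM2l => //; exact: sqr_ge0.
Qed.

Lemma le_2sqrt (u v : R) : 0 <= u -> 0 <= v -> u ^+ 2 <= 4 * v -> u <= 2 * Num.sqrt v.
Proof.
move=> u0 v0 h; have := sqr_sqrtr v0; have := sqrtr_ge0 v; move: (Num.sqrt v) => w w0 e.
by rewrite leNgt; apply/negP => ww; nra.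
Qed.

(** Degree over dimension at which the turning point is asymptotically sqrt (1 - t^2). *)
Definition ratio (t : R) : R := (1 - t) / (2 * t).

Lemma ratioK (t : R) : 0 < t -> (2 * ratio t + 1)^-1 = t.
Proof. by move=> t0; rewrite /ratio; field; lra. Qed.

Lemma ratio_gt0 (t : R) : 0 < t -> t < 1 -> 0 < ratio t.
Proof. by move=> t0 t1; apply: divr_gt0; lra. Qed.

Lemma ratio_lt (t u : R) : 0 < t -> t < u -> ratio u < ratio t.
Proof.
move=> t0 tu.
have e (v : R) : 0 < v -> ratio v = (v^-1 - 1) / 2 by move=> v0; rewrite /ratio; field; lra.
rewrite !e//; last by lra.
have : u^-1 < t^-1 by rewrite ltf_pV2 ?posrE//; lra.
lra.
Qed.

Lemma lp_s_ge (st y g k c : R) : 0 <= st -> 0 <= c -> st ^+ 2 <= 4 * c -> 0 < k -> 1 <= k -> y + g <= st * (1 - k^-1) ->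
  y + g <= 2 * Num.sqrt c * (1 - k^-1).
Proof.
move=> st0 c0 h k0 k1 hy; apply: le_trans hy _; apply: ler_wpM2r; last exact: le_2sqrt.
by rewrite subr_ge0 invf_le1.
Qed.

Lemma index_hi (r r' i K n : R) : i <= r' * n + K -> K + 4 * r <= n * (r - r') -> i <= r * (n - 4).
Proof. by lra. Qed.

Lemma index_div (r i n : R) : 4 < n -> 0 < r -> i <= r * (n - 4) -> i / n <= r.
Proof. by move=> n4 r0 h; rewrite ler_pdivrMr; lra. Qed.

Definition lp_D (n p r r' K : R) := (1 + 4 * r) * expR (- ((r' * n + K) * ln p) - n * ln (1 - p)).
Definition lp_B (n b s r y d : R) := (3 / d + 3) *
  expR (n * ((s - y) * (b + (2 * r + 1) / (1 - s ^+ 2)) - ln (1 - s ^+ 2) / 2 + b * (1 - s))).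

Lemma lp_instance n (T : finType) (x : T -> 'rV[R]_n) (A : {set T}) (b s r r' p y d st g : R) K :
  (4 < n)%N -> (0 < K)%N -> (forall c, norm2 (x c) = 1) ->
  0 < r' -> r' < r -> 0 < r -> 0 < p -> p < 1 -> 0 < s -> s < 1 -> 0 < b ->
  s = b * (1 - s ^+ 2) -> 1 - s ^+ 2 = (2 * r + 1)^-1 ^+ 2 ->
  st ^+ 2 = 1 - (2 * r' + 1)^-1 ^+ 2 -> 0 <= st -> 0 < y -> y < s -> 0 < d -> (2 * r' + 1)^-1 ^+ 2 + d <= 1 - y ^+ 2 ->
  0 < g -> y + g <= st * (1 - K%:R^-1) -> K%:R + 4 * r <= n%:R * (r - r') ->
  g * #|A|%:R ^+ 2 <= K%:R * (#|A|%:R * lp_D n%:R p r r' K%:R + lp_B n%:R b s r y d *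
     \sum_(c in A) \sum_(c' in A | c' != c) expR (- (n%:R * b * (1 - ip (x c) (x c'))))).
Proof.
move=> n5 K0 x1 r'0 r'r r0 p0 p1 s0 s1 b0 sb sr str st0 y0 ys d0 dy g0 hg hn.
have n4 : (4 : R) < n%:R by rewrite (ltr_nat R 4).
(* The degrees i0 + 1, ..., i0 + K lie between r' n and r (n - 4): large enough for the spectral
   edge, small enough for the growth bounds. *)
pose i0 := Num.truncn (r' * n%:R).
have rn0 : 0 <= r' * n%:R by apply: mulr_ge0; [exact: ltW|exact: ler0n].
have /andP[i0le i0gt] : i0%:R <= r' * n%:R < i0.+1%:R by exact: truncn_itv.
have jlo j : (i0 < j)%N -> r' * n%:R <= j%:R.
  by move=> ij; apply: le_trans (ltW i0gt) _; rewrite ler_nat.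
have jhi j : (j <= i0 + K)%N -> j%:R <= r' * n%:R + K%:R.
  by move=> ij; apply: le_trans (_ : (i0 + K)%:R <= _); [rewrite ler_nat|rewrite natrD lerD2r].
have jhi2 j : (j <= i0 + K)%N -> j%:R <= r * (n%:R - 4) by move=> /jhi h; exact: index_hi h hn.
have lps : y + g <= lp_s n i0 K.
  apply: (lp_s_ge st0 (gegc_ge0 n5 _) _ _ _ hg).
  - exact: (gegc_lo n5 r'0 str (jlo _ (leqnn _))).
  - by rewrite ltr0n.
  - by rewrite ler1n.
have lps' : g <= lp_s n i0 K - y by rewrite lerBrDl.
have dd : 0 < 3 / d + 3 by apply: addr_gt0 => //; apply: divr_gt0.
have B0 : 0 <= lp_B n%:R b s r y d by apply: mulr_ge0; [exact: ltW|exact: expR_ge0].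
have p01 : 0 < p < 1 by apply/andP.
have y01 : 0 <= y < 1 by rewrite (ltW y0) (lt_trans ys s1).
have yl : y < lp_s n i0 K by rewrite -subr_gt0; exact: lt_le_trans lps'.
apply: le_trans (ler_wpM2r (sqr_ge0 _) lps') _.
apply: (lp_code_bound n5) => //.
- by move=> c c'; have := dot_unit (x1 c) (x1 c'); rewrite ler_norml => /andP[].
- move=> j /andP[j0 jK]; apply: le_trans (geg1_le j n5 p01) _.
  apply: ler_wpM2r; first exact: ltW (nu_gt0 n5 j).
  have jn := index_div n4 r0 (jhi2 _ jK).
  apply: ler_pM; [|exact: expR_ge0| |].
  + by apply: addr_ge0 => //; apply: mulr_ge0 => //; apply: divr_ge0; rewrite ler0n.
  + by rewrite lerD2l; apply: ler_wpM2l.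
  rewrite ler_expR lerD2r lerN2; apply: ler_wnM2r; [by apply: ln_le0; exact: ltW|exact: jhi].
- move=> [//|j] t /andP[j0 jK] yt t1.
  exact: (geg_sqr_le n5 r'0 r0 s0 s1 b0 sb sr (jlo _ j0) (jhi2 _ jK) y0 ys d0 dy yt t1).
Qed.

Lemma lp_D_le (n p r r' K g a u v w : R) : 0 < K -> 0 < r -> 0 < g -> u = ln p -> v = ln (1 - p) ->
  w = ln (2 * K * (1 + 4 * r) / g) -> w + K * - u <= n * ((r - r') * - u / 2) ->
  expR (n * (- r * u - v - (r - r') * - u / 2)) <= a -> K * lp_D n p r r' K <= g / 2 * a.
Proof.
move=> K0 r0 g0 -> -> wE hn ha; have g2 : 0 < 2 / g by apply: divr_gt0.
rewrite -(ler_pM2l g2).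
have -> : 2 / g * (g / 2 * a) = a by field; lra.
apply: le_trans ha.
have -> : 2 / g * (K * lp_D n p r r' K) = (2 * K * (1 + 4 * r) / g) * expR (- ((r' * n + K) * ln p) - n * ln (1 - p)).
  by rewrite /lp_D; ring.
have c0 : 0 < 2 * K * (1 + 4 * r) / g by apply: divr_gt0 => //; apply: mulr_gt0; [apply: mulr_gt0|lra].
rewrite -[X in X * _]lnK ?posrE// -wE -expRD ler_expR.
move: (ln (1 - p)) (ln p) hn => v' u' hn; nra.
Qed.

Lemma lp_B_le (n b s r y d K g ep : R) : 0 < n -> 0 < K -> 0 < g -> 0 < d ->
  (s - y) * (b + (2 * r + 1) / (1 - s ^+ 2)) <= ep / 2 ->
  ln (2 * K * (3 / d + 3) / g) <= n * (ep / 2) ->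
  expR (- (n * (b * (1 - s) + - (ln (1 - s ^+ 2) / 2) + ep))) * (K * lp_B n b s r y d) <= g / 2.
Proof.
move=> n0 K0 g0 d0 he hn.
have dd : 0 < 3 / d + 3 by apply: addr_gt0 => //; apply: divr_gt0.
have c0 : 0 < 2 * K * (3 / d + 3) / g by apply: divr_gt0 => //; apply: mulr_gt0 => //; apply: mulr_gt0.
have g2 : 0 < 2 / g by apply: divr_gt0.
rewrite -(ler_pM2l g2).
have -> : 2 / g * (g / 2) = 1 by field; lra.
rewrite /lp_B; move: he hn; set C := (s - y) * _; set v := ln (1 - s ^+ 2) => he hn.
rewrite [leLHS](_ : _ = (2 * K * (3 / d + 3) / g) * (expR (- (n * (b * (1 - s) + - (v / 2) + ep))) * expR (n * (C - v / 2 + b * (1 - s))))); last by ring.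
rewrite -[X in X * _]lnK ?posrE// -!expRD -[leRHS]expR0 ler_expR.
have hw : n * C <= n * (ep / 2) by apply: ler_wpM2l => //; exact: ltW.
move: hn; move: (ln (_ / g)) => u hn.
have -> : u + (- (n * (b * (1 - s) + - (v / 2) + ep)) + n * (C - v / 2 + b * (1 - s))) = u + n * C - n * (ep / 2) - n * (ep / 2) by field.
lra.
Qed.

(** The sign change y = s - e and the spectral edge st = s - e / 2 both lie below s; e is so small
    that the growth from y to s costs at most ep / 2. *)
Lemma lp_params (s C ep : R) : 0 < s -> s < 1 -> 0 < C -> 0 < ep ->
  exists y st ta d : R, [/\ 0 < y, y < s, (s - y) * C <= ep / 2, 0 <= st & [/\ st ^+ 2 = 1 - ta ^+ 2, 0 < ta, ta < 1, 0 < d & 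
    [/\ 1 - s ^+ 2 < ta ^+ 2, ta ^+ 2 + d <= 1 - y ^+ 2 & y + (s - y) / 4 <= st * (1 - (s - y) / 4)]]].
Proof.
move=> s0 s1 C0 ep0.
pose e := Num.min (ep / (2 * C)) (s / 2).
have e0 : 0 < e by rewrite /e lt_min; apply/andP; split; apply: divr_gt0 => //; lra.
have e1 : e * C <= ep / 2.
  apply: le_trans (_ : ep / (2 * C) * C <= _); last by rewrite le_eqVlt; apply/orP; left; apply/eqP; field; lra.
  by apply: ler_wpM2r; [lra|rewrite /e ge_min lexx].
have e2 : e <= s / 2 by rewrite /e ge_min lexx orbT.
clearbody e.
have st0 : 0 < s - e / 2 by lra.
have st1 : s - e / 2 < 1 by lra.
exists (s - e), (s - e / 2), (Num.sqrt (1 - (s - e / 2) ^+ 2)), ((s - e / 2) ^+ 2 - (s - e) ^+ 2).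
have sq : 0 < 1 - (s - e / 2) ^+ 2 by rewrite subr_gt0 expr_lt1//; lra.
have sqs : (s - e / 2) ^+ 2 < s ^+ 2 by rewrite ltrXn2r// ?nnegrE; lra.
have sqy : (s - e) ^+ 2 < (s - e / 2) ^+ 2 by rewrite ltrXn2r// ?nnegrE; lra.
have st2 : 0 < (s - e / 2) ^+ 2 by exact: exprn_gt0.
rewrite sqr_sqrtr; last exact: ltW.
have -> : s - (s - e) = e by ring.
split; [lra|lra|lra|lra|split; [by ring| by rewrite sqrtr_gt0| |lra|split; [lra|lra|]]].
  by rewrite -[ltRHS]sqrtr1 ltr_sqrt; lra.
have : (s - e / 2) * (e / 4) <= e / 4 by rewrite ler_piMl//; lra.
lra.
Qed.

Lemma lp_many_close_pairs (b s sg : R) : 0 < b -> 0 < s -> s < 1 -> s = b * (1 - s ^+ 2) ->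
  0 < sg -> sg ^+ 2 = 1 - s ^+ 2 ->
  many_close_pairs b s (- ratio sg * ln ((1 - sg) / (1 + sg)) - ln (2 * sg / (1 + sg))) (- (ln (1 - s ^+ 2) / 2)).
Proof.
move=> b0 s0 s1 sb g0 gs ep ep0.
have s20 : 0 < s ^+ 2 by apply: exprn_gt0.
have sg20 : 0 < sg ^+ 2 by apply: exprn_gt0.
have sg1 : sg < 1.
  by rewrite -(ltr_pXn2r (n := 2))// ?nnegrE ?expr1n; lra.
have p0 : 0 < (1 - sg) / (1 + sg) by apply: divr_gt0; lra.
(* The parameter p = (1 - sg) / (1 + sg) is r / (1 + r), the optimal tilt for the binomial
   coefficient at degree r n; this gives R_1 its form. *)
have qE : 2 * sg / (1 + sg) = 1 - (1 - sg) / (1 + sg) by field; lra.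
have p1 : (1 - sg) / (1 + sg) < 1 by rewrite -subr_gt0 -qE; apply: divr_gt0; lra.
rewrite qE; move: ((1 - sg) / (1 + sg)) p0 p1 {qE} => p p0 p1.
have lnp : 0 < - ln p by rewrite oppr_gt0 ln_lt0// p0.
have r0 := ratio_gt0 g0 sg1; have rK := ratioK g0.
have C0 : 0 < b + (2 * ratio sg + 1) / (1 - s ^+ 2) by apply: addr_gt0 => //; apply: divr_gt0; lra.
have [y [st [ta [d [y0 ys hC st0 [st2 ta0 ta1 d0 [sta dy hg]]]]]]] := lp_params s0 s1 C0 ep0.
have sgta : sg < ta.
  by rewrite -(ltr_pXn2r (n := 2))// ?nnegrE; [rewrite gs|exact: ltW|exact: ltW].
have r'0 := ratio_gt0 ta0 ta1; have r'r := ratio_lt g0 sgta; have r'K := ratioK ta0.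
move: (ratio sg) (ratio ta) r0 rK r'0 r'r r'K C0 hC => r r' r0 rK r'0 r'r r'K C0 hC.
have sy : 0 < s - y by rewrite subr_gt0.
have gg0 : 0 < (s - y) / 4 by exact: divr_gt0.
move: ((s - y) / 4) gg0 hg => g gg0 hg.
have [K1 hK1] := archi_nat g^-1; pose K := maxn K1 1.
have K0 : (0 < K)%N by rewrite leq_max orbT.
have KR : (0 : R) < K%:R by rewrite ltr0n.
have hKi : K%:R^-1 <= g.
  by rewrite -[g]invrK lef_pV2 ?posrE ?invr_gt0//; apply: hK1; rewrite leq_max leqnn.
have hg' : y + g <= st * (1 - K%:R^-1).
  by apply: le_trans hg _; apply: ler_wpM2l => //; rewrite lerD2l lerN2.
have rr : 0 < r - r' by rewrite subr_gt0.
have eta0 : 0 < (r - r') * - ln p / 2 by apply: divr_gt0 => //; exact: mulr_gt0.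
(* Using degrees near r' n instead of r n shrinks the diagonal terms by e^{n (r - r') ln p}; half of
   this gain is the slack eta, the other half absorbs the constants. *)
exists ((r - r') * - ln p / 2) => //.
have ep2 : 0 < ep / 2 by exact: divr_gt0.
have [n1 h1] := small_lin (K%:R + 4 * r) rr.
have [n2 h2] := small_lin (ln (2 * K%:R * (3 / d + 3) / g)) ep2.
have [n3 h3] := small_lin (ln (2 * K%:R * (1 + 4 * r) / g) + K%:R * - ln p) eta0.
exists (maxn 5 (maxn n1 (maxn n2 n3))) => n; rewrite !geq_max => /and4P[n5 /h1 hn1 /h2 hn2 /h3 hn3].
move=> T x A x1 hA.
have n0 : (0 : R) < n%:R by rewrite ltr0n; apply: leq_trans n5.
have srE : 1 - s ^+ 2 = (2 * r + 1)^-1 ^+ 2 by rewrite rK gs.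
have st2' : st ^+ 2 = 1 - (2 * r' + 1)^-1 ^+ 2 by rewrite r'K.
have dy' : (2 * r' + 1)^-1 ^+ 2 + d <= 1 - y ^+ 2 by rewrite r'K.
have hLP := @lp_instance n T x A b s r r' p y d st g K n5 K0 x1 r'0 r'r r0 p0 p1 s0 s1 b0 sb srE st2' st0 y0 ys d0 dy' gg0 hg' hn1.
apply: (lp_final_arith _ KR _ (expR_ge0 _) hLP).
- exact: ler0n.
- by apply: mulr_gt0; [apply: addr_gt0 => //; exact: divr_gt0|exact: expR_gt0].
- exact: (lp_D_le KR r0 gg0 erefl erefl erefl hn3 hA).
- exact: (lp_B_le n0 KR gg0 d0 hC hn2).
Qed.

End lp_exponent.

(** * Achievability *)

Section achievability.
Context {R : realType}.

Lemma good_quad n (h : 'rV[R]_n) (l : R) : 0 <= l -> good (fun w => expR (dot h w - l * norm2 w)).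
Proof.
move=> l0; apply: (good_le _ (good_expdot h)) => [|w].
  apply: measurableT_comp => //; apply: measurable_funB; first exact: meas_dot.
  by apply: measurable_funM => //; apply: measurable_norm2; exact: measurable_rv.
rewrite !ger0_norm ?expR_ge0// ler_expR gerBl; apply: mulr_ge0 => //.
by apply: sumr_ge0 => i _; exact: sqr_ge0.
Qed.

Lemma Ex_quad n (h : 'rV[R]_n) (l : R) : 0 <= l ->
  Ex (fun w => expR (dot h w - l * norm2 w)) = expR (norm2 h / (2 * (1 + 2 * l)) - n%:R * (ln (1 + 2 * l) / 2)).
Proof.
move=> l0; have l1 : 0 < 1 + 2 * l by lra.
rewrite /Ex.
have v1 : - (2 * l) < 1 by lra.
have -> : (fun w : n.-tuple R => (expR (dot h (rv w) - l * norm2 (rv w)))%:E) =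
  (fun w => (expR (dot h (rv w) + - (2 * l) * norm2 (rv w) / 2))%:E).
  by apply/funext => w; congr (expR _)%:E; field.
rewrite gauss_quad//= opprK expRD; congr (_ * _).
rewrite -mulrN expRM_natl; congr (_ ^+ _); rewrite expRN; congr (_^-1).
rewrite -[in RHS](@sqr_sqrtr _ (1 + 2 * l)) ?ltW// lnXn ?sqrtr_gt0//.
have -> (y : R) : y *+ 2 / 2 = y by rewrite mulr2n; field.
by rewrite lnK// posrE sqrtr_gt0.
Qed.

(* The left-hand side is, up to the term in ln, the exponent of e^{l n} E e^{b sqrt n <c, W> - l |W|^2};
   1 + 2 l = 1 / (1 - s^2) is its minimizer in l. *)
Lemma saddle_exponent (b s l n : R) : 0 < s -> s < 1 -> s = b * (1 - s ^+ 2) -> 1 + 2 * l = (1 - s ^+ 2)^-1 ->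
  l * n + n * b ^+ 2 / (2 * (1 + 2 * l)) = n * (b * s).
Proof.
move=> s0 s1 sb lE; have s2 : s ^+ 2 < 1 by rewrite expr_lt1//; lra.
have -> : l = ((1 - s ^+ 2)^-1 - 1) / 2 by rewrite -lE; field.
have -> : b = s / (1 - s ^+ 2) by rewrite [X in _ = X / _]sb mulfK//; lra.
by field; lra.
Qed.

Lemma direction_exponent_le (n b d r t : R) : 0 < n -> 0 < b -> 0 < r ->
  n * (1 - d) <= r ^+ 2 -> r ^+ 2 <= n * (1 + d) -> `|t| <= r ->
  n * b * (t / r) <= b * Num.sqrt n * t + n * b * d.
Proof.
move=> n0 b0 r0 lo hi tr.
have [q0 qE] : 0 < Num.sqrt n /\ Num.sqrt n ^+ 2 = n by split; [rewrite sqrtr_gt0|rewrite sqr_sqrtr// ltW].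
move: (Num.sqrt n) q0 qE => q q0 qE.
rewrite -lerBlDl -[X in X * b * _]qE.
have -> : q ^+ 2 * b * (t / r) - b * q * t = b * q * (q - r) * (t / r) by field; lra.
have t1 : `|t / r| <= 1 by rewrite normrM normfV (gtr0_norm r0) ler_pdivrMr// mul1r.
have h : b * q * (q - r) * (t / r) <= b * q * `|q - r|.
  apply: le_trans (ler_norm _) _; rewrite !normrM (gtr0_norm b0) (gtr0_norm q0) -normrM.
  by rewrite ler_piMr//; apply: mulr_ge0; [apply: mulr_ge0; exact: ltW|exact: normr_ge0].
apply: le_trans h _; rewrite mulrAC -!mulrA [n * _]mulrC -mulrA; apply: ler_wpM2l; first exact: ltW.
have h2 : `|q - r| * (q + r) <= d * n.
  rewrite -[X in _ * X]gtr0_norm; last by lra.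
  rewrite -normrM (_ : (q - r) * (q + r) = q ^+ 2 - r ^+ 2); last by ring.
  by rewrite qE ler_norml; apply/andP; split; lra.
by apply: le_trans h2; apply: ler_wpM2l; [exact: normr_ge0|lra].
Qed.

Lemma shell_bound n (b l d u K : R) (cs : seq 'rV[R]_n) : (0 < n)%N -> 0 < b -> 0 <= l -> 0 < d -> d < 1 -> 0 <= u -> 0 <= K ->
  all (fun c => norm2 c == 1) cs ->
  (forall x : 'rV[R]_n, norm2 x = 1 -> (size cs)%:R * K <= \sum_(c <- cs) expR (n%:R * b * dot c x)) ->
  (size cs)%:R * K * (1 - (1 + d)^-1 - expR (n%:R * (u * (1 - d) - ln (1 + u)) / 2)) <=
  (size cs)%:R * expR (n%:R * b * d + l * (n%:R * (1 + d)) + (n%:R * b ^+ 2 / (2 * (1 + 2 * l)) - n%:R * (ln (1 + 2 * l) / 2))).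
Proof.
move=> n0 b0 l0 d0 d1 u0 K0 /allP cs1 hx.
have nR : (0 : R) < n%:R by rewrite ltr0n.
set q := Num.sqrt n%:R : R.
have q2 : q ^+ 2 = n%:R by rewrite sqr_sqrtr// ler0n.
(* 1 - A - B is a lower bound of the indicator of the shell n(1 - d) <= |w|^2 <= n(1 + d). *)
pose A (w : 'rV[R]_n) := (n%:R * (1 + d))^-1 * norm2 w.
pose B (w : 'rV[R]_n) := expR (u * (n%:R * (1 - d)) / 2) * expR (dot 0 w - u / 2 * norm2 w).
pose G c (w : 'rV[R]_n) := expR (n%:R * b * d + l * (n%:R * (1 + d))) * expR (dot ((b * q) *: c) w - l * norm2 w).
have u2 : 0 <= u / 2 by lra.
have gA : good A by apply: goodZ; exact: good_norm2.
have gB : good B by apply: goodZ; exact: good_quad.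
have gG c : good (G c) by apply: goodZ; exact: good_quad.
have sK : 0 <= (size cs)%:R * K by apply: mulr_ge0 => //; exact: ler0n.
have pw w : (size cs)%:R * K * (1 - A w - B w) <= \sum_(c <- cs) G c w.
  have G0 : 0 <= \sum_(c <- cs) G c w by apply: sumr_ge0 => c _; apply: mulr_ge0; exact: expR_ge0.
  have w0 : 0 <= norm2 w by apply: sumr_ge0 => i _; exact: sqr_ge0.
  have nd : 0 < n%:R * (1 + d) by apply: mulr_gt0 => //; lra.
  have A0 : 0 <= A w by apply: mulr_ge0 => //; rewrite invr_ge0 ltW.
  have B0 : 0 <= B w by apply: mulr_ge0; exact: expR_ge0.
  case: (lerP (norm2 w) (n%:R * (1 + d))) => [hi|hi]; last first.
    apply: le_trans G0; apply: mulr_ge0_le0 => //.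
    have : 1 <= A w by rewrite /A mulrC ler_pdivlMr// mul1r ltW.
    lra.
  case: (lerP (n%:R * (1 - d)) (norm2 w)) => [lo|lo]; last first.
    apply: le_trans G0; apply: mulr_ge0_le0 => //.
    have : 1 <= B w.
      rewrite /B -expRD -[leLHS]expR0 ler_expR dot0l.
      have : u * norm2 w <= u * (n%:R * (1 - d)) by apply: ler_wpM2l => //; exact: ltW.
      lra.
    lra.
  have wp : 0 < norm2 w by apply: lt_le_trans lo; apply: mulr_gt0 => //; lra.
  set r := Num.sqrt (norm2 w).
  have r0 : 0 < r by rewrite sqrtr_gt0.
  have r2 : r ^+ 2 = norm2 w by rewrite sqr_sqrtr// ltW.
  have x1 : norm2 (r^-1 *: w) = 1.
    by rewrite norm2E dotZl dotZr -norm2E -r2; field; rewrite gt_eqF.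
  apply: le_trans (_ : (size cs)%:R * K <= _); first by rewrite ler_piMr//; lra.
  apply: le_trans (hx _ x1) _; rewrite big_seq [leRHS]big_seq; apply: ler_sum => c /cs1 /eqP c1.
  rewrite /G -expRD ler_expR dotZr dotZl [r^-1 * _]mulrC.
  have tr : `|dot c w| <= r.
    have := dot_unit c1 x1; rewrite dotZr normrM gtr0_norm ?invr_gt0// mulrC ler_pdivrMr// mul1r.
    by [].
  rewrite -r2 in lo hi.
  have h := direction_exponent_le nR b0 r0 lo hi tr.
  have hl : l * norm2 w <= l * (n%:R * (1 + d)) by apply: ler_wpM2l => //; rewrite -r2.
  rewrite -/q in h; lra.
have := le_Ex _ _ pw.
have gAB : good (fun w => 1 - A w - B w) by apply: goodB => //; apply: goodB => //; exact: good_cst.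
move=> /(_ (goodZ _ gAB) (good_sum _ (fun c _ => gG c))).
rewrite ExZ// ExB//; last by apply: goodB => //; exact: good_cst.
rewrite ExB//; last exact: good_cst.
rewrite Ex_cst Ex_sum//.
have eB : Ex B = expR (n%:R * (u * (1 - d) - ln (1 + u)) / 2).
  rewrite ExZ; last exact: good_quad.
  rewrite Ex_quad// -expRD; congr expR; rewrite norm2E dot0l mul0r (_ : 1 + 2 * (u / 2) = 1 + u); last by field.
  by field.
have eG c : c \in cs -> Ex (G c) = expR (n%:R * b * d + l * (n%:R * (1 + d)) + (n%:R * b ^+ 2 / (2 * (1 + 2 * l)) - n%:R * (ln (1 + 2 * l) / 2))).
  move=> /cs1 /eqP c1; rewrite ExZ; last exact: good_quad.
  rewrite Ex_quad// -expRD; congr expR; congr (_ + (_ / _ - _)).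
  by rewrite norm2E dotZl dotZr -norm2E c1 mulr1 -expr2 exprMn q2 mulrC.
rewrite eB (eq_big_seq _ eG) big_const_seq iter_addr_0 count_predT -[X in _ <= X -> _]mulr_natl => h.
apply: le_trans h; apply: ler_wpM2l => //; rewrite lerD2r lerD2l lerN2.
rewrite /A ExZ; last exact: good_norm2.
apply: le_trans (_ : (n%:R * (1 + d))^-1 * n%:R <= _); last by rewrite le_eqVlt; apply/orP; left; apply/eqP; field; lra.
apply: ler_wpM2l; last exact: Ex_norm2_le.
by rewrite invr_ge0; apply: mulr_ge0; lra.
Qed.


(** The Chernoff exponent of the lower tail of the squared norm is negative of order d^2; for the
    upper tail Markov's inequality suffices. *)
Lemma small_shell (d : R) : 0 < d -> d < 1 -> d * (1 - d) - ln (1 + d) <= - (d ^+ 2 / 4).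
Proof.
move=> d0 d1; pose f (y : R) : R := ln (1 + y) - y + (3 / 4) * y ^+ 2.
have h : f 0 <= f d.
  apply: (@der_incr _ f (fun y => (1 + y)^-1 - 1 + 3 / 4 * (2 * y)) 0 d (ltW d0)) => y /andP[y0 yd].
    apply: derD; last by apply: derZ; apply: der_eq; [apply: derX; exact: der_id|rewrite /=; ring].
    apply: derB; last exact: der_id.
    apply: der_eq; first by apply: der_ln; [lra|apply: derD; [exact: der_cst|exact: der_id]].
    by rewrite add0r div1r.
  rewrite [leRHS](_ : _ = y * (2^-1 + 3 / 2 * y) / (1 + y)); last by field; lra.
  by apply: divr_ge0; [apply: mulr_ge0; lra|lra].
move: h; rewrite /f addr0 ln1 expr0n /=; lra.
Qed.

Lemma greedy_dir (b s ep : R) : 0 < b -> 0 < s -> s < 1 -> s = b * (1 - s ^+ 2) -> 0 < ep ->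
  exists n1 : nat, forall n, (n1 <= n)%N -> forall cs : seq 'rV[R]_n,
  all (fun c => norm2 c == 1) cs ->
  exists2 x : 'rV[R]_n, norm2 x = 1 &
    \sum_(c <- cs) expR (n%:R * b * dot c x) <= (size cs)%:R * expR (n%:R * (b * s + ln (1 - s ^+ 2) / 2 + ep)).
Proof.
move=> b0 s0 s1 sb ep0.
have s2 : 0 < 1 - s ^+ 2 by rewrite subr_gt0 expr_lt1//; exact: ltW.
have s20 : 0 < s ^+ 2 by exact: exprn_gt0.
pose l := ((1 - s ^+ 2)^-1 - 1) / 2.
have lE : 1 + 2 * l = (1 - s ^+ 2)^-1 by rewrite /l; field; lra.
have l0 : 0 <= l.
  have : 1 <= (1 - s ^+ 2)^-1 by rewrite invf_ge1//; lra.
  by rewrite -lE; lra.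
clearbody l.
pose d := Num.min 2^-1 (ep / (2 * (b + l))).
have bl : 0 < b + l by lra.
have d0 : 0 < d by rewrite /d lt_min invr_gt0 ltr0n /=; apply: divr_gt0 => //; apply: mulr_gt0.
have d1 : d < 1.
  have : d <= 2^-1 by rewrite /d ge_min lexx.
  lra.
have dep : (b + l) * d <= ep / 2.
  apply: le_trans (_ : (b + l) * (ep / (2 * (b + l))) <= _).
    by apply: ler_wpM2l; [exact: ltW|rewrite /d ge_min lexx orbT].
  by rewrite le_eqVlt; apply/orP; left; apply/eqP; field; lra.
clearbody d.
(* The shell keeps at least the mass 1 - 1 / (1 + d) - q = 3 q, a constant that costs nothing in the
   exponent. *)
pose q := d / (4 * (1 + d)).
have q0 : 0 < q by apply: divr_gt0 => //; lra.
have ep2 : 0 < ep / 2 by exact: divr_gt0.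
have d8 : 0 < d ^+ 2 / 8 by apply: divr_gt0 => //; exact: exprn_gt0.
have [n1 h1] := small_lin (1 - ln q) ep2.
have [n2 h2] := small_lin (- ln q) d8.
exists (maxn 1 (maxn n1 n2)) => n; rewrite !geq_max => /and3P[n0 /h1 hn1 /h2 hn2] cs cs1.
have nR : (0 : R) < n%:R by rewrite ltr0n.
case: cs cs1 => [|c0 cs'] cs1.
  case: n n0 {hn1 hn2 nR cs1} => [//|n] _; exists (delta_mx 0 ord0); last by rewrite big_nil mul0r.
  rewrite /norm2 (bigD1 ord0)//= mxE !eqxx expr1n big1 ?addr0// => i /negbTE i0.
  by rewrite mxE i0 expr0n.
set cs := c0 :: cs' in cs1 *.
set K := expR (n%:R * (b * s + ln (1 - s ^+ 2) / 2 + ep)).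
apply: contrapT => hno.
have hx (x : 'rV[R]_n) : norm2 x = 1 -> (size cs)%:R * K <= \sum_(c <- cs) expR (n%:R * b * dot c x).
  by move=> x1; rewrite leNgt; apply/negP => /ltW h; apply: hno; exists x.
have K0 : 0 < K by exact: expR_gt0.
have := shell_bound n0 b0 l0 d0 d1 (ltW d0) (ltW K0) cs1 hx.
have sz : (0 : R) < (size cs)%:R by rewrite ltr0n.
rewrite -mulrA ler_pM2l// leNgt => /negP; apply.
have e1 : expR (n%:R * (d * (1 - d) - ln (1 + d)) / 2) <= q.
  rewrite -[q]lnK ?posrE// ler_expR.
  have := ler_wpM2l (ltW nR) (small_shell d0 d1); lra.
have e2 : 1 - (1 + d)^-1 = 4 * q by rewrite /q; field; lra.
apply: lt_le_trans (_ : K * q <= _); last first.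
  by apply: ler_wpM2l; [exact: ltW|rewrite e2; lra].
rewrite /K -[X in _ < _ * X]lnK ?posrE// -expRD ltr_expR.
have se := saddle_exponent n%:R s0 s1 sb lE.
have lnE : ln (1 + 2 * l) = - ln (1 - s ^+ 2) by rewrite lE lnV.
rewrite lnE.
have dn : n%:R * ((b + l) * d) <= n%:R * (ep / 2) by apply: ler_wpM2l => //; exact: ltW.
move: (ln q) (ln (1 - s ^+ 2)) (n%:R * b ^+ 2 / (2 * (1 + 2 * l))) hn1 se dn => Q L Z hn1 se dn.
have -> : n%:R * b * d + l * (n%:R * (1 + d)) + (Z - n%:R * (- L / 2)) = n%:R * ((b + l) * d) + (l * n%:R + Z) + n%:R * (L / 2) by field.
rewrite se; have -> : n%:R * (b * s + L / 2 + ep) + Q = n%:R * (b * s) + n%:R * (L / 2) + n%:R * (ep / 2) + n%:R * (ep / 2) + Q by field.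
lra.
Qed.

Lemma greedy_code n (b K : R) M : 0 <= b -> 0 <= K -> M%:R * K < expR (n%:R * b) ->
  (forall cs : seq 'rV[R]_n, all (fun c => norm2 c == 1) cs ->
    exists2 x : 'rV[R]_n, norm2 x = 1 & \sum_(c <- cs) expR (n%:R * b * dot c x) <= (size cs)%:R * K) ->
  exists cs : seq 'rV[R]_n, [/\ is_code cs, size cs = M &
    \sum_(c <- cs) \sum_(c' <- cs | c' != c) expR (n%:R * b * dot c c') <= M%:R ^+ 2 * K].
Proof.
move=> b0 K0 hM hdir; elim: M hM => [|M ih] hM.
  by exists [::]; split=> //; rewrite big_nil expr0n /= mul0r.
have [|cs [/andP[ucs cs1] szcs hcs]] := ih.
  by apply: le_lt_trans hM; apply: ler_wpM2r => //; rewrite ler_nat.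
have [x x1 hx] := hdir cs cs1; rewrite szcs in hx.
(* A repeated codeword would contribute e^{n b} by itself, which exceeds the allowed sum. *)
have xcs : x \notin cs.
  apply/negP => xin; move: hx; rewrite leNgt => /negP; apply.
  have MM : M%:R * K <= M.+1%:R * K by apply: ler_wpM2r => //; rewrite ler_nat.
  apply: le_lt_trans MM _; apply: lt_le_trans hM _.
  rewrite (big_rem x)//= -norm2E x1 mulr1 lerDl; apply: sumr_ge0 => c _; exact: expR_ge0.
exists (x :: cs); split; rewrite /= ?szcs//.
  by rewrite /is_code /= xcs ucs x1 eqxx cs1.
rewrite big_cons big_mkcond big_cons eqxx /= add0r -big_mkcond /=.
have h1 : \sum_(c' <- cs | c' != x) expR (n%:R * b * dot x c') <= \sum_(c <- cs) expR (n%:R * b * dot c x).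
  rewrite big_mkcond; apply: ler_sum => c _; case: ifP => _; last exact: expR_ge0.
  by rewrite dotC.
have h2 : \sum_(c <- cs) \sum_(c' <- x :: cs | c' != c) expR (n%:R * b * dot c c') <=
   \sum_(c <- cs) expR (n%:R * b * dot c x) + \sum_(c <- cs) \sum_(c' <- cs | c' != c) expR (n%:R * b * dot c c').
  rewrite -big_split /=; apply: ler_sum => c _; rewrite big_cons; case: ifP => _ //.
  by rewrite lerDr expR_ge0.
have -> : M.+1%:R ^+ 2 * K = M%:R * K + (M%:R * K + M%:R ^+ 2 * K) + K by rewrite -natr1; ring.
lra.
Qed.

Lemma norm2_code_err n (a : R) (c c' z : 'rV[R]_n) : 0 < n%:R * a -> norm2 c = 1 -> norm2 c' = 1 ->
  (norm2 (Num.sqrt (n%:R * a) *: c + z - Num.sqrt (n%:R * a) *: c') <= norm2 z) =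
  (0 <= dot (c' - c) (z + Num.sqrt (n%:R * a) *: c)).
Proof.
move=> na c1 c'1; set t := Num.sqrt _; have t0 : 0 < t by rewrite sqrtr_gt0.
have -> : t *: c + z - t *: c' = z - t *: (c' - c).
  by rewrite scalerBr opprB addrCA addrA.
rewrite norm2B [norm2 (t *: _)]norm2E dotZl !dotZr [dot (c' - c) (z + _)]dotDr dotZr -[dot (c' - c) (c' - c)]norm2E norm2B c1 c'1.
rewrite [dot (c' - c) c]dotBl -[dot c c]norm2E c1 [dot z _]dotC.
move: (norm2 z) (dot c' c) (dot (c' - c) z) => Z p w.
have -> : Z + t * (t * (1 + 1 - 2 * p)) - 2 * (t * w) = Z - (2 * t) * (w + t * (p - 1)) by ring.
by rewrite lerBlDr lerDl pmulr_rge0//; lra.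
Qed.

Definition code_err n (C : seq 'rV[R]_n) (c z : 'rV[R]_n) : R :=
  (has (fun c' => (c' != c) && (0 <= dot (c' - c) z)) C)%:R.

Lemma good_code_err n (C : seq 'rV[R]_n) c : good (code_err C c).
Proof.
apply: good_ind; elim: C => [|c' C ih] /=; first exact: measurable_cst.
apply: measurable_or => //; apply: measurable_and; first exact: measurable_cst.
by apply: measurable_fun_ler => //; exact: meas_dot.
Qed.

Lemma err_prob_cwE n (a : R) (C : seq 'rV[R]_n) c : 0 < n%:R * a -> is_code C -> c \in C ->
  err_prob_cw a C c = Ex (fun w => code_err C c (w + Num.sqrt (n%:R * a) *: c)).
Proof.
move=> na /andP[_ /allP C1] cC; have /eqP c1 := C1 _ cC; rewrite /err_prob_cw /Ex.
have -> : (fun z : 'rV[R]_n => ((has (fun c' => (c' != c) && (norm2 (Num.sqrt (n%:R * a) *: c + z - Num.sqrt (n%:R * a) *: c') <= norm2 z)) C)%:R : R)%:E) =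
  (fun z => (code_err C c (z + Num.sqrt (n%:R * a) *: c))%:E).
  apply/funext => z; rewrite /code_err; congr (nat_of_bool _)%:R%:E; apply: eq_in_has => c' /C1 /eqP c'1.
  by rewrite norm2_code_err.
rewrite gauss_expectE//; last by move=> v; rewrite lee_fin ler0n.
by apply: good_mfun; apply: good_shift; exact: good_code_err.
Qed.

(** The union bound over competitors, with each half-space indicator dominated by an exponential of
    the optimal parameter t / 2. *)
Lemma err_prob_cw_le n (a b : R) (C : seq 'rV[R]_n) c : 0 < n%:R * a -> a = 4 * b -> is_code C -> c \in C ->
  err_prob_cw a C c <= \sum_(c' <- C | c' != c) expR (- (n%:R * b * (1 - dot c c'))).
Proof.
move=> na ab codeC cC; rewrite err_prob_cwE//; have /andP[_ /allP C1] := codeC.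
have /eqP c1 := C1 _ cC; set t := Num.sqrt (n%:R * a).
have t0 : 0 < t by rewrite sqrtr_gt0.
have t2 : t ^+ 2 = n%:R * a by rewrite sqr_sqrtr// ltW.
pose G c' (w : 'rV[R]_n) := expR (- (t ^+ 2 / 2 * (1 - dot c c'))) * expR (dot ((t / 2) *: (c' - c)) w).
have gG c' : good (G c') by apply: goodZ; exact: good_expdot.
apply: le_trans (_ : Ex (fun w => \sum_(c' <- C | c' != c) G c' w) <= _).
  apply: le_Ex.
  - by apply: good_shift; exact: good_code_err.
  - by apply: good_sum => c' _; exact: gG.
  move=> w; have G0 c' : 0 <= G c' w by apply: mulr_ge0; exact: expR_ge0.
  rewrite /code_err; case: hasP => [[c' c'C /andP[cc' h]]|_] /=; last by apply: sumr_ge0 => c' _.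
  rewrite (big_rem c')//= cc' ler_wpDr//; first by apply: sumr_ge0 => *; exact: G0.
  rewrite /G -expRD -[leLHS]expR0 ler_expR dotZl.
  move: h; rewrite dotDr dotZr dotBl [dot (c' - c) c]dotBl -[dot c c]norm2E c1 [dot c c']dotC.
  move: (dot c' w - dot c w) (dot c' c) => u p h.
  rewrite -(pmulr_rge0 _ (_ : 0 < t / 2)) in h; last by apply: divr_gt0.
  have -> : - (t ^+ 2 / 2 * (1 - p)) + t / 2 * u = t / 2 * (u + t * (p - 1)) by ring.
  exact: h.
rewrite Ex_sum; last by move=> c' _; exact: gG.
rewrite le_eqVlt; apply/orP; left; apply/eqP; rewrite big_seq_cond [RHS]big_seq_cond; apply: eq_bigr => c' /andP[/C1/eqP c'1 _].
rewrite ExZ; last exact: good_expdot.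
rewrite Ex_expdot -expRD; congr expR; rewrite norm2E dotZl dotZr -norm2E norm2B c1 c'1 [dot c' c]dotC.
rewrite (_ : n%:R * b = t ^+ 2 / 4); last by rewrite t2 ab; field.
by field.
Qed.

Lemma achievable (b s Rt ep : R) : 0 < b -> 0 < s -> s < 1 -> s = b * (1 - s ^+ 2) -> 0 < ep -> 0 <= Rt ->
  0 < b * (1 - s) - ln (1 - s ^+ 2) / 2 - Rt ->
  exists n1 : nat, forall n, (n1 <= n)%N -> exists C : seq 'rV[R]_n,
  [/\ is_code C, expR (n%:R * Rt) <= (size C)%:R &
   Pe (4 * b) C <= expR (- (n%:R * (b * (1 - s) - ln (1 - s ^+ 2) / 2 - Rt - ep)))].
Proof.
move=> b0 s0 s1 sb ep0 Rt0; set E := b * (1 - s) - _ - Rt => E0.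
(* Besides 2 e <= ep, the greedy construction requires E - 2 e >= 0, which keeps M K below e^{n
   b}. *)
pose e := Num.min ep E / 2.
have e0 : 0 < e by apply: divr_gt0 => //; rewrite lt_min ep0.
have eep : 2 * e <= ep by rewrite /e mulrC divfK// ge_min lexx.
have eE : 2 * e <= E by rewrite /e mulrC divfK// ge_min lexx orbT.
clearbody e.
have [n1 h1] := greedy_dir b0 s0 s1 sb e0.
have [n2 h2] := small_lin (ln 2 + 1) e0.
exists (maxn 1 (maxn n1 n2)) => n; rewrite !geq_max => /and3P[n0 /h1 hn1 /h2 hn2].
have nR : (0 : R) < n%:R by rewrite ltr0n.
set K := expR (n%:R * (b * s + ln (1 - s ^+ 2) / 2 + e)) in hn1.
pose M := (Num.truncn (expR (n%:R * Rt))).+1.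
have M1 : expR (n%:R * Rt) <= M%:R by apply: ltW; exact: truncnS_gt.
have M2 : M%:R <= 2 * expR (n%:R * Rt).
  have t1 : (Num.truncn (expR (n%:R * Rt)))%:R <= expR (n%:R * Rt) by rewrite truncn_le// expR_ge0.
  have t2 : 1 <= expR (n%:R * Rt) by rewrite -[leLHS]expR0 ler_expR; apply: mulr_ge0 => //; exact: ltW.
  have -> : M%:R = (Num.truncn (expR (n%:R * Rt)))%:R + 1 :> R by rewrite natr1.
  by move: (expR _) t1 t2 => y t1 t2; lra.
have KE : expR (- (n%:R * b)) * K = expR (- (n%:R * (E + Rt - e))).
  by rewrite /K -expRD; congr expR; rewrite /E; field.
have MK : M%:R * (expR (- (n%:R * b)) * K) <= expR (- (n%:R * (E - 2 * e) + 1)).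
  apply: le_trans (ler_wpM2r (_ : 0 <= _) M2) _; first by rewrite KE expR_ge0.
  rewrite KE -[X in X * _ * _]lnK ?posrE// -!expRD ler_expR.
  lra.
have MK1 : M%:R * K < expR (n%:R * b).
  have hk : M%:R * K = M%:R * (expR (- (n%:R * b)) * K) * expR (n%:R * b).
    by rewrite expRN; field; rewrite gt_eqF// expR_gt0.
  rewrite hk -[ltRHS]mul1r ltr_pM2r ?expR_gt0//; apply: le_lt_trans MK _.
  rewrite -[ltRHS]expR0 ltr_expR oppr_lt0; apply: ltr_wpDl => //; apply: mulr_ge0; [exact: ltW|lra].
have [C [codeC szC hC]] := greedy_code (ltW b0) (expR_ge0 _) MK1 hn1.
exists C; split=> //; first by rewrite szC.
have na : 0 < n%:R * (4 * b) by apply: mulr_gt0 => //; apply: mulr_gt0.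
have M0 : (0 : R) < M%:R by rewrite ltr0n.
rewrite /Pe szC mulrC ler_pdivrMr//.
apply: le_trans (_ : \sum_(c <- C) \sum_(c' <- C | c' != c) expR (- (n%:R * b)) * expR (n%:R * b * dot c c') <= _).
  rewrite big_seq [leRHS]big_seq; apply: ler_sum => c cC.
  apply: le_trans (err_prob_cw_le na erefl codeC cC) _; apply: ler_sum => c' _.
  by rewrite -expRD ler_expR; lra.
under eq_bigr do rewrite -mulr_sumr.
rewrite -mulr_sumr; apply: le_trans (ler_wpM2l (expR_ge0 _) hC) _.
have -> : expR (- (n%:R * b)) * (M%:R ^+ 2 * K) = M%:R * (expR (- (n%:R * b)) * K) * M%:R by ring.
apply: ler_wpM2r; first exact: ltW.
apply: le_trans MK _; rewrite ler_expR.
have : n%:R * (2 * e) <= n%:R * ep by apply: ler_wpM2l => //; exact: ltW.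
lra.
Qed.

End achievability.

(** * The reliability function *)

Section assembly.
Context {R : realType}.
Implicit Types (a b s Rt : R).

Lemma norm2_eq0 n (u : 'rV[R]_n) : norm2 u = 0 -> u = 0.
Proof.
move=> /eqP; rewrite /norm2 psumr_eq0 => [/allP h|i _]; last exact: sqr_ge0.
apply/rowP => i; rewrite mxE; apply/eqP; rewrite -sqrf_eq0; apply: h.
by rewrite mem_index_enum.
Qed.

Lemma dot_lt1 n (u v : 'rV[R]_n) : norm2 u = 1 -> norm2 v = 1 -> u != v -> dot u v < 1.
Proof.
move=> u1 v1 uv; have : norm2 (u - v) != 0.
  by apply: contraNneq uv => /norm2_eq0/eqP; rewrite subr_eq0.
have : 0 <= norm2 (u - v) by apply: sumr_ge0 => i _; exact: sqr_ge0.
rewrite norm2B u1 v1; lra.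
Qed.

Lemma Pe_ge0 n a (C : seq 'rV[R]_n) : 0 < n%:R * a -> is_code C -> 0 <= Pe a C.
Proof.
move=> na codeC; apply: mulr_ge0; first by rewrite invr_ge0 ler0n.
rewrite big_seq; apply: sumr_ge0 => c cC; rewrite err_prob_cwE//.
by apply: Ex_ge0 => w; rewrite ler0n.
Qed.

(** The converse concerns families indexed by a finite type and functions [Phi] that dominate the
    error events; positions in the sequence C serve as indices, and [code_err] as [Phi]. *)
Lemma Pe_lower n b (C : seq 'rV[R]_n) (p : R) : 0 < n%:R * (4 * b) -> is_code C ->
  (forall (T : finType) (x : T -> 'rV[R]_n) (Phi : T -> 'rV[R]_n -> R),
    (forall c, norm2 (x c) = 1) -> (forall c c', c' != c -> dot (x c) (x c') < 1) ->
    #|T| = size C ->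
    (forall c, good (Phi c)) -> (forall c z, 0 <= Phi c z) ->
    (forall c c' z, c' != c -> 0 <= dot (x c' - x c) z -> 1 <= Phi c z) ->
    p <= #|T|%:R^-1 * \sum_c Ex (fun w => Phi c (w + (2 * Num.sqrt (n%:R * b)) *: x c))) ->
  p <= Pe (4 * b) C.
Proof.
move=> na codeC h; have /andP[uC /allP C1] := codeC.
pose x (i : 'I_(size C)) := nth 0 C i.
have xC i : x i \in C by exact: mem_nth.
have x1 i : norm2 (x i) = 1 by exact/eqP/C1.
have xx i j : j != i -> x i != x j.
  by apply: contraNneq => /eqP; rewrite nth_uniq// => /eqP ij; apply/eqP/val_inj.
have e2 : 2 * Num.sqrt (n%:R * b) = Num.sqrt (n%:R * (4 * b)).
  rewrite [n%:R * (4 * b)]mulrCA [RHS]sqrtrM//; congr (_ * _).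
  by rewrite (_ : 4 = 2 ^+ 2) ?sqrtr_sqr ?ger0_norm//; ring.
have -> : Pe (4 * b) C = #|'I_(size C)|%:R^-1 * \sum_i Ex (fun w => code_err C (x i) (w + (2 * Num.sqrt (n%:R * b)) *: x i)).
  rewrite /Pe (big_nth 0) big_mkord card_ord; congr (_ * _); apply: eq_bigr => i _.
  by rewrite e2; exact: (err_prob_cwE na codeC (xC i)).
apply: (h _ x (fun i => code_err C (x i)) x1 _ (card_ord _)).
- by move=> i j ij; apply: dot_lt1 => //; exact: xx.
- by move=> i; exact: good_code_err.
- by move=> i z; exact: ler0n.
- move=> i j z ij hz; rewrite /code_err; case: hasP => // -[]; exists (x j) => //.
  by rewrite hz andbT eq_sym; exact: xx.
Qed.

Lemma best_exponent_near (b s sg Rt nu : R) : 0 < b -> 0 < s -> s < 1 -> s = b * (1 - s ^+ 2) ->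
  0 < sg -> sg ^+ 2 = 1 - s ^+ 2 ->
  - ratio sg * ln ((1 - sg) / (1 + sg)) - ln (2 * sg / (1 + sg)) <= Rt ->
  Rt <= - (ln (1 - s ^+ 2) / 2) + ln (1 + s) / 2 -> 0 < nu <= 1 ->
  exists n1 : nat, forall n, (n1 <= n)%N ->
  ((b * (1 - s) - ln (1 - s ^+ 2) / 2 - Rt - nu)%:E <= best_exponent Rt (4 * b) n <=
   (b * (1 - s) - ln (1 - s ^+ 2) / 2 - Rt + nu)%:E)%E.
Proof.
move=> b0 s0 s1 sb g0 gs R1 Rc /andP[nu0 nu1].
have s2 : 0 < 1 - s ^+ 2 by rewrite subr_gt0 expr_lt1//; exact: ltW.
have sg1 : sg < 1.
  have s20 : 0 < s ^+ 2 by exact: exprn_gt0.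
  by rewrite -(ltr_pXn2r (n := 2))// ?nnegrE ?expr1n; lra.
have Rt0 : 0 <= Rt.
  apply: le_trans R1; rewrite mulNr -opprD oppr_ge0.
  have l1 : ln ((1 - sg) / (1 + sg)) <= 0 by apply: ln_le0; rewrite ler_pdivrMr; lra.
  have l2 : ln (2 * sg / (1 + sg)) <= 0 by apply: ln_le0; rewrite ler_pdivrMr; lra.
  have := ratio_gt0 g0 sg1; move: (ratio sg) => r r0; nra.
have bE : b = s / (1 - s ^+ 2) by rewrite [X in _ = X / _]sb mulfK//; lra.
have bs : b * (1 - s) = s / (1 + s).
  by rewrite bE; field; apply/andP; split; [lra|rewrite gt_eqF//; nra].
(* Since 1 - b (1 - s) = 1 / (1 + s), this is the upper bound on the rate. *)
have FE : b * (1 - s) + ln (1 - b * (1 - s)) / 2 <= b * (1 - s) + - (ln (1 - s ^+ 2) / 2) - Rt.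
  have -> : 1 - b * (1 - s) = (1 + s)^-1 by rewrite bs; field; lra.
  rewrite lnV ?posrE; lra.
have E00 : 0 < b * (1 - s) + - (ln (1 - s ^+ 2) / 2) - Rt.
  have h1 : ln (1 + s) <= s by apply: le_trans (le_ln1Dx _) _ => //; lra.
  have h2 : s / 2 < b * (1 - s) by rewrite bs ltr_pM2l// ltf_pV2 ?posrE; lra.
  lra.
have hLP := lp_many_close_pairs b0 s0 s1 sb g0 gs.
have nu01 : 0 < nu <= 1 by apply/andP.
have [n1 h1] := converse b0 s0 s1 sb hLP R1 nu01 FE E00.
have [n2 h2] := achievable b0 s0 s1 sb nu0 Rt0 E00.
exists (maxn 1 (maxn n1 n2)) => n; rewrite !geq_max => /and3P[n0 /h1 hn1 /h2 hn2].
have nR : (0 : R) < n%:R by rewrite ltr0n.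
have na : 0 < n%:R * (4 * b) by apply: mulr_gt0 => //; apply: mulr_gt0.
apply/andP; split.
  have [C [codeC szC PeC]] := hn2.
  apply: le_ereal_sup_tmp; exists (exponent_of (4 * b) C); first by exists C.
  rewrite /exponent_of; case: ifPn => [_|Pe0]; first by rewrite leey.
  have Pep : 0 < Pe (4 * b) C by rewrite lt0r Pe0 Pe_ge0.
  rewrite lee_fin ler_pdivlMr// lerNr.
  have := PeC; rewrite -ler_ln ?posrE ?expR_gt0// expRK => h; rewrite [_ * n%:R]mulrC; exact: h.
apply: ge_ereal_sup => _ [C [codeC szC] <-].
have hPe : expR (- (n%:R * (b * (1 - s) + - (ln (1 - s ^+ 2) / 2) - Rt + nu))) <= Pe (4 * b) C.
  apply: (Pe_lower na codeC) => T x Phi x1 xx sT gP P0 P1.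
  by apply: hn1 => //; rewrite sT.
have Pep : 0 < Pe (4 * b) C by exact: lt_le_trans (expR_gt0 _) hPe.
rewrite /exponent_of gt_eqF// lee_fin ler_pdivrMr// lerNl.
by move: hPe; rewrite -ler_ln ?posrE ?expR_gt0// expRK [_ * n%:R]mulrC.
Qed.

Lemma reliability_lim (u : (\bar R)^nat) (E : R) :
  (forall nu : R, 0 < nu <= 1 -> exists n1 : nat, forall n, (n1 <= n)%N -> ((E - nu)%:E <= u n <= (E + nu)%:E)%E) ->
  limn_esup u = E%:E.
Proof.
move=> h; suff cu : u @ \oo --> E%:E by rewrite is_cvg_limn_esupE ?(cvg_lim _ cu)//; apply/cvg_ex; exists E%:E.
apply/fine_cvgP; split.
  have [|n1 hn] := h 1; first by rewrite ltr01 lexx.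
  exists n1 => // n /= /hn /andP[lo hi].
  by rewrite fin_numElt (lt_le_trans _ lo) ?ltNyr// (le_lt_trans hi) ?ltry.
apply/cvgrPdist_le => e e0; pose nu := Num.min e 1.
have nu01 : 0 < nu <= 1 by rewrite /nu lt_min e0 ltr01 ge_min lexx orbT.
have [n1 hn] := h nu nu01; exists n1 => // n /= /hn /andP[lo hi].
have nue : nu <= e by rewrite /nu ge_min lexx.
case: (u n) lo hi => [r| |] //=; rewrite !lee_fin => lo hi.
by rewrite ler_norml; apply/andP; split; lra.
Qed.

Lemma snr_params a : 0 < a -> exists s sg : R,
  [/\ [/\ 0 < s, s < 1 & s = a / 4 * (1 - s ^+ 2)], 0 < sg, sg ^+ 2 = 1 - s ^+ 2,
   cos (theta_x a) = s & [/\ sin (theta_x a) = sg, R_x a = - (ln (1 - s ^+ 2) / 2) &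
   R_crit a = - (ln (1 - s ^+ 2) / 2) + ln (1 + s) / 2]].
Proof.
(* D = e^{2 R_x} is the root above 1 of D^2 - D = (a / 4)^2; with s^2 = 1 - 1 / D this becomes s D =
   a / 4, the saddle equation. *)
move=> a0; pose w := Num.sqrt (1 + a ^+ 2 / 4); pose D := 2^-1 + 2^-1 * w.
have a2 : 0 < a ^+ 2 by exact: exprn_gt0.
have w2 : w ^+ 2 = 1 + a ^+ 2 / 4 by rewrite sqr_sqrtr//; lra.
have w0 : 0 <= w by exact: sqrtr_ge0.
have w1 : 1 < w by rewrite ltNge; apply/negP => h; nra.
have D1 : 1 < D by rewrite /D; lra.
have D2 : D ^+ 2 - D = (a / 4) ^+ 2 by rewrite /D; nra.
have eR : expR (- (2 * R_x a)) = D^-1.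
  by rewrite expRN /R_x mulrA mulfV// mul1r lnK// posrE -/w -/D; lra.
have Di : 0 < D^-1 by rewrite invr_gt0; lra.
have Di1 : D^-1 < 1 by rewrite invf_lt1; lra.
pose s := Num.sqrt (1 - D^-1).
have s2 : s ^+ 2 = 1 - D^-1 by rewrite sqr_sqrtr//; lra.
have s0 : 0 < s by rewrite sqrtr_gt0; lra.
have s1 : s < 1 by rewrite -[ltRHS]sqrtr1 ltr_sqrt; lra.
have s11 : -1 <= s <= 1 by apply/andP; split; lra.
have sD : s * D = a / 4.
  apply/eqP; rewrite -(eqrXn2 (n := 2))//; [|by apply: mulr_ge0; lra|by lra].
  by rewrite exprMn s2 -D2; apply/eqP; field; lra.
have e1 : 1 - s ^+ 2 = D^-1 by rewrite s2; ring.
have RxE : R_x a = - (ln (1 - s ^+ 2) / 2).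
  by rewrite e1 lnV ?posrE; [rewrite /R_x -/w -/D; field|lra].
exists s, (Num.sqrt (1 - s ^+ 2)); split; [split=> //| | | |split=> //].
- by rewrite e1 -sD mulfK//; lra.
- by rewrite sqrtr_gt0 e1.
- by rewrite sqr_sqrtr// e1 ltW.
- by rewrite /theta_x eR acosK// in_itv.
- by rewrite /theta_x eR sin_acos.
rewrite /R_crit -/w (_ : 2^-1 + a / 4 + 2^-1 * w = D * (1 + s)); last by rewrite mulrDr mulr1 [D * s]mulrC sD /D; ring.
by rewrite lnM ?posrE; [rewrite e1 lnV ?posrE; [field|]|lra|]; lra.
Qed.

End assembly.

Theorem theorem19 (R : realType) (a Rt : R) :
  0 < a -> a <= 57 / 10 ->
  R_1 a <= Rt -> Rt <= R_crit a ->
  reliability Rt a = (E0 Rt a)%:E.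
Proof.
move=> a0 _; have [s [sg [[s0 s1 sb] g0 gs cE [sE RxE RcE]]]] := snr_params a0.
rewrite /R_1 /psi sE RcE /E0 cE RxE => R1 Rc.
apply: reliability_lim => nu nu01.
have b0 : 0 < a / 4 by exact: divr_gt0.
have := best_exponent_near b0 s0 s1 sb g0 gs R1 Rc nu01.
by rewrite (_ : 4 * (a / 4) = a)//; field.
Qed.
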